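(* There exists a non-empty $C^1$-open set of (pointwise) partially hyperbolic diffeomorphisms $f:\mathbb{T}^3\to\mathbb{T}^3$ (an open subset of $\operatorname{Diff}^1(\mathbb{T}^3)$) such that, for every $f$ in this set, the center bundle $E^c$ of $f$ is not locally uniquely integrable.
   Context: A diffeomorphism $f$ of a closed manifold $M$ is (pointwise) partially hyperbolic if $TM$ splits into three nontrivial $Tf$-invariant sub-bundles $TM=E^s\oplus E^c\oplus E^u$ such that, for some suitable Riemannian metric, for every $x\in M$ all unit vectors $v^\sigma\in E^\sigma_x$ ($\sigma=s,c,u$) satisfy $\|T_xf v^s\|<\|T_xf v^c\|<\|T_xf v^u\|$, and moreover $\|Tf|_{E^s}\|<1$ and $\|Tf^{-1}|_{E^u}\|<1$. The bundle $E^c$ is the center bundle; on $\mathbb{T}^3$ each of the three bundles is one-dimensional. Local unique integrability: let $E$ be a distribution, $\mathcal{W}$ a foliation tangent to $E$ and $W(x)$ the leaf of $\mathcal{W}$ through $x$. $E$ is locally uniquely integrable at $x$ if any embedded arc through $x$ and tangent to $E$ is contained in $W(x)$. Accordingly, ''$E$ is not locally uniquely integrable'' means: there is a foliation $\mathcal{W}$ tangent to $E$, a point $x$, and an embedded $C^1$ arc through $x$, tangent to $E$, that is not contained in $W(x)$. Foliations are topological foliations with $C^1$ leaves; a foliation is tangent to a bundle $E$ if the tangent space to its leaf at each point $x$ is $E_x$. *)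

(* Defs.v *)
From Stdlib Require Import Relation_Operators.
From HB Require Import structures.
From mathcomp Require Import all_boot all_order all_algebra.
From mathcomp Require Import all_classical all_reals all_analysis.
Set Implicit Arguments.
Unset Strict Implicit.
Unset Printing Implicit Defensive.
Import Order.TTheory GRing.Theory Num.Theory.
Import numFieldNormedType.Exports.
Local Open Scope classical_set_scope.
Local Open Scope ring_scope.

Section Torus.
Variable R : realType.

Definition lattice_eq (p q : 'rV[R]_3) : bool :=
  [forall i, (p ord0 i - q ord0 i) \is a Num.int].

Lemma lattice_eq_refl : reflexive lattice_eq.
Proof. by move=> p; apply/forallP => i; rewrite subrr rpred0. Qed.

Lemma lattice_eq_sym : symmetric lattice_eq.
Proof. by move=> p q; apply: eq_forallb => i; rewrite -opprB rpredN. Qed.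

Lemma lattice_eq_trans : transitive lattice_eq.
Proof.
move=> q p r /forallP pq /forallP qr; apply/forallP => i.
by rewrite -(subrKA (q ord0 i)) rpredD.
Qed.

Canonical lattice_equiv :=
  EquivRel lattice_eq lattice_eq_refl lattice_eq_sym lattice_eq_trans.

Definition torus : Type :=
  quotient_topology {eq_quot lattice_equiv}%qT.

HB.instance Definition _ := Topological.on torus.
HB.instance Definition _ := Quotient.on torus.

Definition tpi (p : 'rV[R]_3) : torus := (\pi_torus p)%qT.

End Torus.

Section PartialHyperbolicity.
Variable R : realType.
Local Notation T3 := (torus R).
Local Notation V3 := 'rV[R]_3.
Local Notation tpi := (@tpi R).

Definition C1_map (F : V3 -> V3) : Prop :=
  (forall p, differentiable F p) /\ continuous (jacobian F).

(* Since R^3 is simply connected, the C^1 self-maps of T^3 are exactly the maps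
   induced by C^1 self-maps of R^3. *)
Definition C1_lift (f : T3 -> T3) (F : V3 -> V3) : Prop :=
  C1_map F /\ forall p, tpi (F p) = f (tpi p).

Definition C1_torus_map (f : T3 -> T3) : Prop := exists F, C1_lift f F.

(* Two lifts of f differ by a constant in Z^3, and F (p + n) - F p is constant
   in p for n in Z^3, so the derivative of f at x depends neither on the lift
   nor on the representative of x.  It acts on row vectors on the right, in the
   trivialization T(T^3) = T^3 x R^3 induced by the projection from R^3. *)
Definition tangent_map (f : T3 -> T3) (x : T3) : 'M[R]_3 :=
  jacobian (xget (fun=> 0) [set F | C1_lift f F]) (repr x).

Definition inverse_maps (f g : T3 -> T3) : Prop := cancel f g /\ cancel g f.

Definition Diff1 : set (T3 -> T3) :=
  [set f | C1_torus_map f /\ exists2 g, inverse_maps f g & C1_torus_map g].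

Definition torus_close (e : R) (x y : T3) : Prop :=
  exists p q, [/\ tpi p = x, tpi q = y & `|p - q| < e].

Definition C1_close (e : R) (f g : T3 -> T3) : Prop :=
  forall x, torus_close e (f x) (g x) /\
            `|tangent_map f x - tangent_map g x| < e.

Definition C1_open (U : set (T3 -> T3)) : Prop :=
  U `<=` Diff1 /\
  forall f, U f -> exists2 e : R, 0 < e &
    forall g, Diff1 g -> C1_close e f g -> U g.

Definition smooth (h : V3 -> R) : Prop :=
  forall (s : seq V3) p,
    differentiable (foldr (fun v k => 'D_v k) h s : V3 -> R) p.

Definition riemannian_metric (G : T3 -> 'M[R]_3) : Prop :=
  [/\ forall i j, smooth (fun p => G (tpi p) i j),
      forall x, (G x)^T = G x
    & forall x (v : V3), v != 0 -> 0 < (v *m G x *m v^T) ord0 ord0].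

Definition metric_norm (G : T3 -> 'M[R]_3) (x : T3) (v : V3) : R :=
  Num.sqrt ((v *m G x *m v^T) ord0 ord0).

(* In a splitting of the tangent bundle of T^3 into three nontrivial
   sub-bundles, each of them is a continuous line field. *)
Definition line_bundle (E : T3 -> {vspace V3}) : Prop :=
  forall x : T3, exists v : T3 -> V3, \forall y \near x,
    [/\ {for y, continuous v}, v y != 0 & E y = <[v y]>%VS].

Definition invariant_bundle (f : T3 -> T3) (E : T3 -> {vspace V3}) : Prop :=
  forall x, (linfun (mulmxr (tangent_map f x)) @: E x)%VS = E (f x).

Definition restricted_norm (G : T3 -> 'M[R]_3) (f : T3 -> T3)
    (E : T3 -> {vspace V3}) : \bar R :=
  ereal_sup [set r | exists x v, [/\ v \in E x, metric_norm G x v = 1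
    & r = (metric_norm G (f x) (v *m tangent_map f x))%:E]].

Definition ph_splitting (f : T3 -> T3) (Es Ec Eu : T3 -> {vspace V3}) : Prop :=
  [/\ [/\ line_bundle Es, line_bundle Ec & line_bundle Eu],
      forall x, (Es x + Ec x + Eu x)%VS = fullv /\
                directv (Es x + Ec x + Eu x)%VS,
      [/\ invariant_bundle f Es, invariant_bundle f Ec & invariant_bundle f Eu]
    & exists2 G, riemannian_metric G &
      [/\ forall x vs vc vu, vs \in Es x -> vc \in Ec x -> vu \in Eu x ->
            metric_norm G x vs = 1 -> metric_norm G x vc = 1 ->
            metric_norm G x vu = 1 ->
            metric_norm G (f x) (vs *m tangent_map f x) <
              metric_norm G (f x) (vc *m tangent_map f x) /\
            metric_norm G (f x) (vc *m tangent_map f x) <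
              metric_norm G (f x) (vu *m tangent_map f x),
          (restricted_norm G f Es < 1)%E
        & exists2 g, inverse_maps f g & (restricted_norm G g Eu < 1)%E]].

Definition partially_hyperbolic (f : T3 -> T3) : Prop :=
  Diff1 f /\ exists Es Ec Eu, ph_splitting f Es Ec Eu.

Definition center_bundle (f : T3 -> T3) (Ec : T3 -> {vspace V3}) : Prop :=
  exists Es Eu, ph_splitting f Es Ec Eu.

Definition C1_curve (c : R -> V3) : Prop :=
  (forall t, derivable c t 1) /\ continuous (derive1 c).

(* A foliated chart is given by its inverse, a homeomorphism from R x R^2 onto
   an open subset of T^3. *)
Definition foliated_chart (phi : R * 'rV[R]_2 -> T3) : Prop :=
  [/\ injective phi, continuous phi & forall A, open A -> open (phi @` A)].

Definition plaque (phi : R * 'rV[R]_2 -> T3) (y : 'rV[R]_2) : set T3 :=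
  [set phi (s, y) | s in [set: R]].

(* The last clause says that the coordinate changes psi^-1 o phi are locally of
   the form (s, y) |-> (h1 s y, h2 y). *)
Definition foliation (W : set (R * 'rV[R]_2 -> T3)) : Prop :=
  [/\ W `<=` foliated_chart,
      forall x, exists2 phi, W phi & range phi x
    & forall phi psi a b, W phi -> W psi -> phi a = psi b ->
        exists2 N, nbhs a N & forall a1 a2, N a1 -> N a2 -> a1.2 = a2.2 ->
          exists b1 b2, [/\ psi b1 = phi a1, psi b2 = phi a2 & b1.2 = b2.2]].

Definition same_plaque (W : set (R * 'rV[R]_2 -> T3)) (x y : T3) : Prop :=
  exists phi z, [/\ W phi, plaque phi z x & plaque phi z y].

Definition leaf (W : set (R * 'rV[R]_2 -> T3)) (x : T3) : set T3 :=
  [set y | clos_refl_trans T3 (same_plaque W) x y].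

(* The leaves are C^1 and tangent to E: every plaque, being homeomorphic to a
   line, has a global regular C^1 parametrization, and its velocity spans E. *)
Definition tangent_foliation (E : T3 -> {vspace V3})
    (W : set (R * 'rV[R]_2 -> T3)) : Prop :=
  foliation W /\
  forall phi y, W phi -> exists c : R -> V3,
    [/\ C1_curve c, injective (tpi \o c), range (tpi \o c) = plaque phi y
      & forall t, derive1 c t != 0 /\ <[derive1 c t]>%VS = E (tpi (c t))].

(* An arc is the image of [0, 1] under tpi o c; any C^1 curve on [0, 1] extends
   to a C^1 curve on the whole line and lifts to R^3. *)
Definition embedded_arc (c : R -> V3) : Prop :=
  [/\ C1_curve c, {in `[0, 1] &, injective (tpi \o c)}
    & {in `[0, 1], forall t, derive1 c t != 0}].

Definition arc_image (c : R -> V3) : set T3 := (tpi \o c) @` `[0, 1].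

Definition tangent_arc (E : T3 -> {vspace V3}) (c : R -> V3) : Prop :=
  {in `[0, 1], forall t, derive1 c t \in E (tpi (c t))}.

Definition not_locally_uniquely_integrable (E : T3 -> {vspace V3}) : Prop :=
  exists2 W, tangent_foliation E W &
    exists x c, [/\ embedded_arc c, tangent_arc E c, arc_image c x
      & ~ (arc_image c `<=` leaf W x)].

End PartialHyperbolicity.

(* Main.v *)
Require Import Defs.
From Stdlib Require Import Relation_Operators.
From HB Require Import structures.
From mathcomp Require Import all_boot all_order all_algebra.
From mathcomp Require Import all_classical all_reals all_analysis.
From mathcomp Require Import ring lra zify.
Set Implicit Arguments.
Unset Strict Implicit.
Unset Printing Implicit Defensive.
Import Order.TTheory GRing.Theory Num.Theory.
Import numFieldNormedType.Exports.
Local Open Scope classical_set_scope.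
Local Open Scope ring_scope.

(** Take the linear coordinates [cS], [cT], [cU] of the space, written [S], [T], [U] here,
in which the lift of the model diffeomorphism ([torus_model]) is
<<
    (S, T, U) |-> (lam S + T / 4, psi T, lam^-1 U).
>>
It is the product of a hyperbolic automorphism of the two-torus, with eigenvalues [lam] and
[lam^-1], by the identity of a circle, composed with a shear that moves the circle
coordinate [T] by a diffeomorphism [psi]. The fixed point [T = 0] of [psi] attracts at the
rate [1/10], stronger than [lam]; the fixed point [T = 1/2] repels. Hence the stable
direction is transverse to the torus [T = 0] and the center is the direction of [S] inside
that torus, while at [T = 1/2] the two exchange their roles. At every height, the derivative on
the planes of [S] and [T] preserves a cone: in the basis formed by the edges of the cone its
entries are positive, uniformly ([off_ge], [positive_entries_cone]).

If [al (psi T) = lam (al T) + T / 4], then the function [S - al T] is multiplied by [lam],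
and the map permutes the curves on which both this function and [U] are constant. These
curves are tangent to the center and foliate the space. Since [al] is an increasing
homeomorphism, they all cross the torus [T = 0], tangentially. But this torus is also filled
by the lines in the direction of [S], which are tangent to the center as well: a piece of
such a line is an arc that leaves the leaf through its origin.

All this survives a small perturbation [g] of the model, with lift [G].

The functions [U] and [S - al T] are corrected, by solving a cohomological equation with
bounded unknown ([twisted_equation]), to functions [hu] and [hs] that [G] multiplies by
[lam^-1] and [lam] exactly ([leaf_coords_exist]). Two nearby points of a common level of
[(hu, hs)] differ by a vector of the center cone ([fibre_quadrant]): otherwise their
distance would grow under backward iteration up to a size at which the values of [hs]
differ. It follows that the levels are graphs over the [S]-axis ([fibre_inj],
[fibre_surj]), which depend continuously on the level ([leaf_chart_exists]); they are the
leaves. The role of the torus [T = 0] is played by the set of the points whose backward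
orbit stays near it ([torus_set]): this set meets each level of [hu] in a Lipschitz graph
over the [S]-axis ([torus_cone], [torus_set_meets]). Both kinds of curves consist of points
whose differences stay in the center cone along the entire orbit, and the dynamics makes
that cone arbitrarily thin, so these curves are of class C^1 and tangent to the center
([center_directions], [center_curve]). Finally [hs] is constant on the leaves, but on the
curves of [torus_set] it moves with [S] ([torus_hs]): these curves are not contained in
leaves ([arc_outside_leaf]).

The invariant directions of [g] are fixed points of graph transforms ([unstable_slopes],
[cs_slopes]) and of a projective contraction on the center cone ([positive_section],
[frame_exists]); a constant metric shows that [g] is partially hyperbolic ([fd_splitting]).
The theorem speaks of the center bundle of any splitting, adapted to any metric. That there
is only one is a comparison of the growth rates of the two splittings ([center_unique]),
where the second splitting is dominated only pointwise; what replaces uniform rates is that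
its angles are bounded below, by compactness ([global_tame]). *)

(** * The circle diffeomorphism and the center cone *)

Section MeanValue.
Variable R : realType.
Implicit Types (f df : R -> R) (a b x y : R).

Lemma is_derive_continuous f df : (forall x, is_derive x 1 f (df x)) -> continuous f.
Proof.
move=> fd x; apply: differentiable_continuous.
by apply/derivable1_diffP; have := fd x; case.
Qed.

Lemma mean_value f df : (forall x, is_derive x 1 f (df x)) ->
  forall a b, a < b -> exists2 c, a < c < b & f b - f a = df c * (b - a).
Proof.
move=> fd a b ab.
have fc : {within `[a, b], continuous f}.
  by apply: continuous_subspaceT; exact: is_derive_continuous fd.
have [c cab ->] := MVT ab (fun x _ => fd x) fc.
by exists c => //; move: cab; rewrite in_itv.
Qed.

Lemma derive_bounds f df l u : (forall x, is_derive x 1 f (df x)) ->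
  (forall x, l <= df x <= u) ->
  forall a b, a <= b -> l * (b - a) <= f b - f a <= u * (b - a).
Proof.
move=> fd lu a b; rewrite le_eqVlt => /predU1P[->|ab].
  by rewrite !subrr !mulr0 lexx.
have [c _ ->] := mean_value fd ab; have /andP[lc cu] := lu c.
by rewrite !ler_pM2r ?subr_gt0 // lc.
Qed.

Lemma derive_lipschitz f df K : (forall x, is_derive x 1 f (df x)) ->
  (forall x, `|df x| <= K) -> forall a b, `|f b - f a| <= K * `|b - a|.
Proof.
move=> fd dK a b.
have lu x : - K <= df x <= K by rewrite -ler_norml.
wlog ab : a b / a <= b => [hw|].
  by have [/hw//|/ltW/hw] := leP a b; rewrite distrC (distrC a).
have /andP[h1 h2] := derive_bounds fd lu ab.
by rewrite (ger0_norm (_ : 0 <= b - a)) ?subr_ge0// ler_norml -mulNr h1.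
Qed.

End MeanValue.

Section TrigonometricBounds.
Variable R : realType.
Implicit Types x y : R.

Lemma norm_sin_le x : `|sin x| <= `|x|.
Proof.
have := @derive_lipschitz R sin cos 1 (@is_derive_sin R) _ 0 x.
rewrite sin0 !subr0 mul1r; apply=> z.
by rewrite ler_norml cos_geN1 cos_le1.
Qed.

Lemma cos_ge_quadratic x : 1 - x ^+ 2 / 2 <= cos x.
Proof.
have -> : cos x = 1 - 2 * sin (x / 2) ^+ 2.
  have {1}-> : x = x / 2 + x / 2 by field.
  rewrite cosD -!expr2; have := cos2Dsin2 (x / 2); lra.
have : sin (x / 2) ^+ 2 <= (x / 2) ^+ 2.
  by rewrite -[leLHS]real_normK ?num_real// -[leRHS]real_normK ?num_real//
     ler_pXn2r ?nnegrE ?norm_sin_le.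
lra.
Qed.

Lemma sin_ge_cubic x : 0 <= x -> x - x ^+ 3 / 6 <= sin x.
Proof.
move=> x0; pose f y : R := sin y - y + y ^+ 3 / 6.
have fd y : is_derive y 1 f (cos y - 1 + y ^+ 2 / 2).
  rewrite /f; apply: is_derive_eq.
  by rewrite /GRing.scale /=; lra.
move: x0; rewrite le_eqVlt => /predU1P[<-|x0]; first by rewrite sin0; lra.
have [c _] := mean_value fd x0.
rewrite /f sin0 => E.
have : 0 <= (cos c - 1 + c ^+ 2 / 2) * (x - 0).
  by rewrite mulr_ge0 ?subr_ge0 ?(ltW x0)//; have := cos_ge_quadratic c; lra.
rewrite -E; lra.
Qed.

End TrigonometricBounds.

Section Constants.
Variable R : realType.

Definition lam : R := 2 - Num.sqrt 3.

Lemma lam_sqr : lam ^+ 2 = 4 * lam - 1.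
Proof.
have : Num.sqrt 3 ^+ 2 = 3 :> R by rewrite sqr_sqrtr.
rewrite /lam; lra.
Qed.

Lemma lam_gt : 26 / 100 < lam.
Proof.
have h : Num.sqrt 3 ^+ 2 = 3 :> R by rewrite sqr_sqrtr.
have h0 : 0 <= Num.sqrt 3 :> R by exact: sqrtr_ge0.
by rewrite /lam; nra.
Qed.

Lemma lam_lt : lam < 27 / 100.
Proof.
have h : Num.sqrt 3 ^+ 2 = 3 :> R by rewrite sqr_sqrtr.
have h0 : 0 <= Num.sqrt 3 :> R by exact: sqrtr_ge0.
by rewrite /lam; nra.
Qed.

(** On the circle: 0 attracts with multiplier 1/10, smaller than [lam], and 1/2 repels. *)
Definition psi (t : R) : R := t - 9 / 10 * (sin (2 * pi * t) / (2 * pi)).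
Definition dpsi (t : R) : R := 1 - 9 / 10 * cos (2 * pi * t).
(** In the plane of [S] and [T], the derivative of the model at height [t] is triangular with
eigenlines of slopes 0 and [4 * bar t]. If [bar t] is not 0, it separates these slopes, and
the center is the eigenline of larger slope: hence the choice of [bar t] as the slope
of one edge of the center cone, the other one being vertical. *)
Definition bar (t : R) : R := dpsi t - lam.

Lemma is_derive_psi (t : R) : is_derive t 1 psi (dpsi t).
Proof.
have pi0 : pi != 0 :> R by rewrite gt_eqF ?pi_gt0.
have h : is_derive t 1 ( *%R (2 * pi)) (2 * pi : R).
  by apply: is_derive_eq; rewrite /GRing.scale /= mulr1.
rewrite /psi.
have := is_derive1_comp (is_derive_sin (2 * pi * t)) h.
move=> h2.
have -> : (fun t : R => t - 9 / 10 * (sin (2 * pi * t) / (2 * pi))) =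
  id - (9 / 10 : R) *: ((2 * pi)^-1 *: (sin \o *%R (2 * pi))).
  by apply/funext => x; rewrite !fctE /GRing.scale /= [_^-1 * _]mulrC.
apply: is_derive_eq; rewrite /dpsi /GRing.scale /=.
by move: (pi : R) pi0 => P P0; field.
Qed.

Lemma dpsi_bound t : 1 / 10 <= dpsi t <= 19 / 10.
Proof.
by rewrite /dpsi; have := cos_geN1 (2 * pi * t); have := cos_le1 (2 * pi * t); lra.
Qed.

Lemma dpsi_gt0 t : 0 < dpsi t.
Proof. by have := dpsi_bound t; lra. Qed.

Lemma is_derive_dpsi (t : R) : is_derive t 1 dpsi (9 / 10 * (2 * pi * sin (2 * pi * t))).
Proof.
have h : is_derive t 1 ( *%R (2 * pi)) (2 * pi : R).
  by apply: is_derive_eq; rewrite /GRing.scale /= mulr1.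
have := is_derive1_comp (is_derive_cos (2 * pi * t)) h => h2.
have -> : dpsi = cst 1 - (9 / 10 : R) *: (cos \o *%R (2 * pi)).
  by apply/funext => x; rewrite !fctE /GRing.scale /=.
by apply: is_derive_eq; rewrite /GRing.scale /=; lra.
Qed.

Lemma dpsi_lipschitz x y : `|dpsi x - dpsi y| <= 8 * `|x - y|.
Proof.
apply: (derive_lipschitz is_derive_dpsi) => z.
have p4 : pi <= 4 :> R by have := pihalf_lt2 R; lra.
have p0 := pi_ge0 R.
have s1 : `|sin (2 * pi * z)| <= 1 by rewrite ler_norml sin_geN1 sin_le1.
rewrite mulrA normrM ger0_norm; last by lra.
apply: le_trans (_ : 9 / 10 * (2 * pi) * 1 <= _); last by lra.
by apply: ler_wpM2l => //; lra.
Qed.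

Lemma bar_lipschitz x y : `|bar x - bar y| <= 8 * `|x - y|.
Proof. by rewrite /bar (_ : _ - _ = dpsi x - dpsi y) ?dpsi_lipschitz//; lra. Qed.

Lemma psi_bounds x y : x <= y ->
  1 / 10 * (y - x) <= psi y - psi x <= 19 / 10 * (y - x).
Proof. exact: (derive_bounds is_derive_psi dpsi_bound). Qed.

Lemma psi_linearization t h : `|psi (t + h) - psi t - dpsi t * h| <= 8 * h ^+ 2.
Proof.
pose f (z : R) := psi z - dpsi t * z.
have fd (z : R) : is_derive z 1 f (dpsi z - dpsi t).
  have h1 := is_derive_psi z.
  by rewrite /f; apply: is_derive_eq; rewrite /GRing.scale /=; lra.
have key a b : a <= b -> (t = a) \/ (t = b) ->
    `|f b - f a| <= 8 * (b - a) ^+ 2.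
  rewrite le_eqVlt => /predU1P[->|ab] tab.
    by rewrite !subrr normr0 expr0n /= mulr0.
  have [c /andP[ac cb] ->] := mean_value fd ab.
  rewrite normrM (gtr0_norm (_ : 0 < b - a)) ?subr_gt0//.
  apply: (@le_trans _ _ (8 * (b - a) * (b - a))); last by rewrite expr2 mulrA.
  rewrite ler_pM2r ?subr_gt0// (le_trans (dpsi_lipschitz _ _))//.
  by rewrite ler_pM2l // ler_norml; case: tab => ->; lra.
have -> : psi (t + h) - psi t - dpsi t * h = f (t + h) - f t by rewrite /f; lra.
have [h0|/ltW h0] := leP 0 h.
  have := key t (t + h) _ (or_introl erefl).
  by rewrite (_ : t + h - t = h); [apply; lra | lra].
have := key (t + h) t _ (or_intror erefl); rewrite distrC.
by rewrite (_ : (t - (t + h)) ^+ 2 = h ^+ 2); [apply; lra | ring].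
Qed.

Lemma psi_lt x y : x < y -> psi x < psi y.
Proof. by move=> xy; have := psi_bounds (ltW xy); lra. Qed.

Lemma psi_le x y : x <= y -> psi x <= psi y.
Proof. by move=> xy; have := psi_bounds xy; lra. Qed.

Lemma psi_inj : injective psi.
Proof.
by move=> x y e; have [/psi_lt|/psi_lt|//] := ltgtP x y; rewrite e ltxx.
Qed.

Lemma psi_continuous : continuous psi.
Proof. exact: is_derive_continuous is_derive_psi. Qed.

Lemma dpsi_continuous : continuous dpsi.
Proof. exact: is_derive_continuous is_derive_dpsi. Qed.

Lemma bar_continuous : continuous bar.
Proof. by move=> x; apply: cvgB; [exact: dpsi_continuous | exact: cvg_cst]. Qed.

Lemma psiE t : psi t = t - 9 / 10 * (sin (2 * pi * t) / (2 * pi)).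
Proof. by []. Qed.

Lemma dpsiE t : dpsi t = 1 - 9 / 10 * cos (2 * pi * t).
Proof. by []. Qed.

Lemma barE t : bar t = dpsi t - lam.
Proof. by []. Qed.

Opaque lam psi dpsi bar.

Lemma psiD1 t : psi (t + 1) = psi t + 1.
Proof.
rewrite !psiE mulrDr mulr1 sinD (mulr_natl pi 2) cos2pi sin2pi mulr0 addr0 mulr1; lra.
Qed.

Lemma dpsiD1 t : dpsi (t + 1) = dpsi t.
Proof. by rewrite !dpsiE mulrDr mulr1 cosD (mulr_natl pi 2) cos2pi sin2pi mulr0 subr0 mulr1. Qed.

Lemma psi_near_id t : `|psi t - t| <= 1 / 4.
Proof.
have p2 := pi_ge2 R.
have s1 : `|sin (2 * pi * t)| <= 1 by rewrite ler_norml sin_geN1 sin_le1.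
rewrite psiE addrAC subrr add0r normrN mulrA normrM normfV.
rewrite (gtr0_norm (_ : 0 < 2 * pi)); last by lra.
rewrite ler_pdivrMr; last by lra.
by rewrite normrM ger0_norm; lra.
Qed.

(** Along an orbit the circle coordinate moves towards the attracting point, where the
derivative is smallest. The quantitative form is needed near the points where [bar]
vanishes, since there nothing else keeps [off] positive. *)
Lemma dpsi_psi_le t : 1 / 3 * sin (2 * pi * t) ^+ 2 <= dpsi t - dpsi (psi t).
Proof.
set s := sin (2 * pi * t); set c := cos (2 * pi * t).
have E : 2 * pi * psi t = 2 * pi * t - 9 / 10 * s.
  have pi0 : pi != 0 :> R by rewrite gt_eqF ?pi_gt0.
  by rewrite psiE -/s; move: (pi : R) pi0 => P P0; field.
rewrite !dpsiE E cosB -/s -/c.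
have sc : c ^+ 2 + s ^+ 2 = 1 := cos2Dsin2 _.
have h1 := cos_ge_quadratic (9 / 10 * s).
have h2 : s ^+ 2 * (9 / 10 - (9 / 10) ^+ 3 * s ^+ 2 / 6) <= s * sin (9 / 10 * s).
  have [s0|s0] := leP 0 s.
    have := @sin_ge_cubic R (9 / 10 * s); rewrite mulr_ge0 // => /(_ isT) h.
    apply: le_trans (ler_wpM2l s0 h).
    by rewrite le_eqVlt; apply/orP; left; apply/eqP; field.
  have := @sin_ge_cubic R (9 / 10 * - s); rewrite mulr_ge0 //; last by lra.
  move=> /(_ isT) h; have s0' : 0 <= - s by lra.
  have -> : s * sin (9 / 10 * s) = - s * sin (9 / 10 * - s).
    by rewrite mulrN sinN mulrNN.
  apply: le_trans (ler_wpM2l s0' h).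
  by rewrite le_eqVlt; apply/orP; left; apply/eqP; field.
have c1 : c * (1 - cos (9 / 10 * s)) <= (9 / 10 * s) ^+ 2 / 2.
  have g0 : 0 <= 1 - cos (9 / 10 * s) by have := cos_le1 (9 / 10 * s); lra.
  have gc : c <= 1 by exact: cos_le1.
  by have := ler_wpM2r g0 gc; lra.
have s2 : s ^+ 2 <= 1 by have := sqr_ge0 c; lra.
have s20 := sqr_ge0 s.
nra.
Qed.

Lemma bar_psi_le t : bar (psi t) <= bar t.
Proof.
rewrite !barE; have := dpsi_psi_le t.
by have := sqr_ge0 (sin (2 * pi * t)); lra.
Qed.

Lemma bar_bound t : - (17 / 100) <= bar t <= 164 / 100.
Proof.
by have := dpsi_bound t; have := lam_gt; have := lam_lt; rewrite !barE; lra.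
Qed.

(** The lower left entry of the matrix of the derivative in the basis of the edges of the
cone; the edges at [psi t] differ from those at [t]. *)
Definition off (t : R) : R :=
  3 / 4 * bar t ^+ 2 + (bar t - bar (psi t)) * (lam + bar t / 4).

(** The cone condition of the model. As a function of the cosine, the lower bound is a
quadratic polynomial without real roots. *)
Lemma off_ge t : 1 / 64 <= off t.
Proof.
rewrite /off.
have h1 : 1 / 3 * sin (2 * pi * t) ^+ 2 <= bar t - bar (psi t).
  by have := dpsi_psi_le t; rewrite !barE; lra.
set s := sin _ in h1; set c := cos (2 * pi * t).
have sc : c ^+ 2 + s ^+ 2 = 1 := cos2Dsin2 _.
have l1 := lam_gt; have l2 := lam_lt.
have Xc : bar t = 1 - 9 / 10 * c - lam by rewrite barE dpsiE.
have c1 : c <= 1 := cos_le1 _.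
have c2 : -1 <= c := cos_geN1 _.
clearbody s c; move: (bar t) (bar (psi t)) (bar_bound t) h1 Xc => X Y hb h1 Xc.
have h2 : 1 / 3 * s ^+ 2 * (21 / 100) <= (X - Y) * (lam + X / 4).
  have := sqr_ge0 s => s2.
  by apply: ler_pM => //; lra.
apply: le_trans (lerD (lexx _) h2).
have -> : s ^+ 2 = 1 - c ^+ 2 by lra.
rewrite Xc; set a := 1 - lam.
(* [54 / 43 * a] is the vertex of the polynomial in [c] *)
have h3 := sqr_ge0 (c - 54 / 43 * a).
have h4 : a ^+ 2 <= (74 / 100) ^+ 2.
  by rewrite ler_pXn2r ?nnegrE //; rewrite /a; lra.
have -> : 1 - 9 / 10 * c - lam = a - 9 / 10 * c by rewrite /a; lra.
clearbody a; clear -h3 h4; lra.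
Qed.

Lemma off_le t : off t <= 4.
Proof.
rewrite /off; have := bar_bound t; have := bar_bound (psi t).
have := bar_psi_le t; have := lam_gt; have := lam_lt.
move: (bar t) (bar (psi t)) lam => X Y l l1 l2 h h1 h2.
have : 0 <= (164 / 100 - X) * (164 / 100 + X) by rewrite mulr_ge0 //; lra.
have : (X - Y) * (l + X / 4) <= 181 / 100 * (68 / 100).
  by apply: ler_pM => //; lra.
lra.
Qed.

Lemma psi_surj y : exists x, psi x = y.
Proof.
have h x : x - 1 <= psi x <= x + 1.
  by have := psi_near_id x; rewrite ler_norml; lra.
have [|||c _ <-] := @IVT R psi (y - 1) (y + 1) y; last by exists c.
- lra.
- exact: continuous_subspaceT psi_continuous.
- have h1 := h (y - 1); have h2 := h (y + 1).
  rewrite min_l ?max_r; try (apply: psi_le; lra).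
  lra.
Qed.

End Constants.

Arguments lam {R}.
Arguments lam_gt {R}.
Arguments lam_lt {R}.
Arguments lam_sqr {R}.

(** * Invariant sections of contracting bundle maps *)

Section GeometricLimits.
Variable R : realType.
Implicit Types (u : nat -> R) (A k e : R).

Lemma geometric_small A k e : 0 <= k -> k < 1 -> 0 < e ->
  exists n, A * k ^+ n < e.
Proof.
move=> k0 k1 e0.
have h : (fun n => A * k ^+ n) @ \oo --> (0 : R).
  rewrite -[X in _ --> X](mulr0 A); apply: cvgM; first exact: cvg_cst.
  by apply: cvg_expr; rewrite ger0_norm.
have /cvgrPdist_lt /(_ e e0) [N _ hN] := h.
exists N; have := hN N (leqnn N).
by rewrite /= sub0r normrN; apply: le_lt_trans; exact: ler_norm.
Qed.

Lemma le0_geometric x A k : 0 <= k -> k < 1 ->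
  (forall n, x <= A * k ^+ n) -> x <= 0.
Proof.
move=> k0 k1 h; rewrite leNgt; apply/negP => x0.
by have [n] := geometric_small A k0 k1 x0; rewrite ltNge h.
Qed.

(** The sequences [u n] plus and minus the tail of the geometric series are monotone. *)
Lemma geometric_cvg u A k : 0 <= k -> k < 1 ->
  (forall n, `|u n.+1 - u n| <= A * k ^+ n) ->
  exists2 l, u @ \oo --> l & forall n, `|l - u n| <= A * k ^+ n / (1 - k).
Proof.
move=> k0 k1 hu; pose c n := A * k ^+ n / (1 - k).
have c0 : c @ \oo --> (0 : R).
  rewrite -[X in _ --> X](mul0r (1 - k)^-1) -(mulr0 A).
  apply: cvgM; last exact: cvg_cst.
  apply: cvgM; first exact: cvg_cst.
  by apply: cvg_expr; rewrite ger0_norm.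
have cS n : c n - c n.+1 = A * k ^+ n.
  by rewrite /c exprS; field; rewrite subr_eq0 eq_sym lt_eqF.
have up n : u n.+1 + c n.+1 <= u n + c n.
  by have := hu n; have := cS n; rewrite ler_norml; lra.
have dn n : u n - c n <= u n.+1 - c n.+1.
  by have := hu n; have := cS n; rewrite ler_norml; lra.
have cge n : 0 <= c n.
  by rewrite mulr_ge0 ?invr_ge0 ?subr_ge0 ?(ltW k1)// (le_trans _ (hu n)).
have ndv : nondecreasing_seq (fun n => u n - c n) by apply/nondecreasing_seqP.
have niv : nonincreasing_seq (fun n => u n + c n) by apply/nonincreasing_seqP.
have bd n m : u n - c n <= u m + c m.
  apply: le_trans (ndv _ _ (leq_maxl n m)) _.
  by apply: le_trans (niv _ _ (leq_maxr n m)); have := cge (maxn n m); lra.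
have cv : cvgn (fun n => u n - c n).
  by apply: nondecreasing_is_cvgn => //; exists (u 0 + c 0) => _ [n _ <-]; exact: bd.
have lb := nondecreasing_cvgn_le ndv cv.
exists (limn (fun n => u n - c n)) => [|n].
  rewrite -[X in _ --> X]addr0.
  have E : (fun n => (u n - c n) + c n) = u by apply/funext => n; rewrite subrK.
  rewrite -{1}E.
  exact: cvgD.
rewrite ler_norml; apply/andP; split.
  by have := lb n; rewrite -/(c n); lra.
suff : limn (fun n => u n - c n) <= u n + c n by rewrite -/(c n); lra.
by apply: limr_le => //; apply: nearW => m; exact: bd.
Qed.

Lemma continuous_uniform_limit (X : topologicalType) (w_ : nat -> X -> R) w A k :
  0 <= k -> k < 1 -> (forall n, continuous (w_ n)) ->
  (forall n x, `|w x - w_ n x| <= A * k ^+ n) -> continuous w.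
Proof.
move=> k0 k1 wc ww x; apply/cvgrPdist_lt => e e0.
have e3 : 0 < e / 3 by lra.
have [n hn] := geometric_small A k0 k1 e3.
have /cvgrPdist_lt /(_ _ e3) := wc n x.
apply: filterS => y hy.
have h1 := ww n x; have h2 := ww n y.
have -> : w x - w y = (w x - w_ n x) + (w_ n x - w_ n y) + - (w y - w_ n y) by lra.
apply: le_lt_trans (ler_normD _ _) _.
rewrite normrN; apply: le_lt_trans (lerD (ler_normD _ _) h2) _.
lra.
Qed.

End GeometricLimits.

(** The invariant section of a bundle map over [T], acting on fibres [I -> R] by [G]. The
contraction is with respect to a distance [d] on the set [K] that need only dominate the
sup distance: this covers the projective distance on positive slopes. *)
Section InvariantSection.
Variables (R : realType) (X : topologicalType) (I : Type).
Variables (T : X -> X) (G : X -> (I -> R) -> I -> R).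
Variables (K : (I -> R) -> Prop) (d : (I -> R) -> (I -> R) -> R).
Variables (C k B : R) (y0 : I -> R).

Hypothesis T_cont : continuous T.
Hypothesis G_K : forall x y, K y -> K (G x y).
Hypothesis G_cvg : forall (Y : Type) (F : set_system Y) (FF : Filter F)
    (x : Y -> X) x0 (y : Y -> I -> R) y1,
  x @ F --> x0 -> (forall i, y ^~ i @ F --> y1 i) ->
  (forall t, K (y t)) -> K y1 ->
  forall i, (fun t => G (x t) (y t) i) @ F --> G x0 y1 i.
Hypothesis K_closed : forall (y : nat -> I -> R) y1,
  (forall n, K (y n)) -> (forall i, y ^~ i @ \oo --> y1 i) -> K y1.
Hypothesis C_ge0 : 0 <= C.
Hypothesis d_ge : forall y y', K y -> K y' -> forall i, `|y i - y' i| <= C * d y y'.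
Hypothesis k_ge0 : 0 <= k.
Hypothesis k_lt1 : k < 1.
Hypothesis d_contract : forall x y y', K y -> K y' ->
  d (G x y) (G x y') <= k * d y y'.

(** Two related points have related orbits, so their difference contracts to 0. Applied to
the relation of differing by a lattice vector, it makes the section periodic. *)
Lemma invariant_section_respects (w : X -> I -> R) (r : X -> X -> Prop) :
  (forall x x', r x x' -> r (T x) (T x')) -> (forall x x', r x x' -> G x = G x') ->
  (forall x, K (w x)) -> (forall x, w x = G (T x) (w (T x))) ->
  (forall x x', d (w x) (w x') <= B) -> forall x x', r x x' -> w x = w x'.
Proof.
move=> rT rG wK wi dB x x' xx'; apply/funext => i.
have db n y y' : r y y' -> d (w y) (w y') <= B * k ^+ n.
  elim: n y y' => [|n IHn] y y' yy'; first by rewrite expr0 mulr1.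
  rewrite (wi y) (wi y') (rG _ _ (rT _ _ yy')) (le_trans (d_contract _ _ _))//.
  by rewrite exprS mulrCA ler_wpM2l// IHn//; exact: rT.
apply/eqP; rewrite -subr_eq0 -normr_le0.
apply: (@le0_geometric _ _ (C * B) k) => // n.
by apply: le_trans (d_ge _ _ _) _ => //; rewrite -mulrA ler_wpM2l// db.
Qed.

Hypothesis K_y0 : K y0.
Hypothesis d_y0 : forall x, d y0 (G x y0) <= B.

Lemma invariant_section : exists w : X -> I -> R,
  [/\ forall i, continuous (w ^~ i), forall x, K (w x),
      forall x, w x = G (T x) (w (T x))
    & forall x i, `|w x i - y0 i| <= C * B / (1 - k)].
Proof.
pose w_ := fix w_ n := if n is m.+1 then fun x => G (T x) (w_ m (T x)) else fun=> y0.
have wK n x : K (w_ n x) by elim: n x => //= n IHn x; exact/G_K/IHn.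
have wS n x : d (w_ n x) (w_ n.+1 x) <= B * k ^+ n.
  elim: n x => [|n IHn] x; first by rewrite expr0 mulr1 /=.
  rewrite [w_ n.+2 x]/= [w_ n.+1 x]/= (le_trans (d_contract _ _ _))//.
    exact: (wK n.+1).
  by rewrite exprS mulrCA ler_wpM2l// IHn.
have /choice[w hw] (x : X) : exists wx : I -> R, forall i, w_ ^~ x ^~ i @ \oo --> wx i /\
    forall n, `|wx i - w_ n x i| <= C * B * k ^+ n / (1 - k).
  have /choice[wx hwx] (i : I) : exists l : R, w_ ^~ x ^~ i @ \oo --> l /\
      forall n, `|l - w_ n x i| <= C * B * k ^+ n / (1 - k).
    have [|l h1 h2] := @geometric_cvg R (fun n => w_ n x i) (C * B) k k_ge0 k_lt1.
      move=> n; rewrite distrC; apply: le_trans (d_ge (wK n x) (wK n.+1 x) i) _.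
      by rewrite -mulrA ler_wpM2l.
    by exists l.
  by exists wx.
exists w; split=> [i|x|x|x i].
- apply: (@continuous_uniform_limit R X (fun n x => w_ n x i) _ (C * B / (1 - k)) k) => //.
    move=> n; elim: n i => [|n IHn] i x; first exact: cvg_cst.
    apply: (@G_cvg X (nbhs x) _ T (T x) (fun t => w_ n (T t)) (w_ n (T x))) => //.
    - exact: T_cont.
    - move=> j; apply: (@continuous_cvg _ _ _ (nbhs x) _ T (fun y => w_ n y j)).
        exact: IHn.
      exact: T_cont.
  by move=> n x; rewrite mulrAC; have [_] := hw x i; exact.
- apply: (@K_closed (w_ ^~ x)) => [n|i]; first exact: wK.
  by have [] := hw x i.
- apply/funext => i; have [h _] := hw x i.
  have h' : (fun n => w_ n.+1 x i) @ \oo --> G (T x) (w (T x)) i.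
    apply: (@G_cvg nat \oo _ (fun=> T x) (T x) (fun n => w_ n (T x)) (w (T x))).
    - exact: cvg_cst.
    - by move=> j; have [] := hw (T x) j.
    - by move=> n; exact: wK.
    - apply: (@K_closed (w_ ^~ (T x))) => [n|j]; first exact: wK.
      by have [] := hw (T x) j.
  apply: (cvg_unique _ _ h') => //.
  by move: h; rewrite -(cvg_shiftS (fun n => w_ n x i)).
- by have [_ /(_ 0%N)] := hw x i; rewrite expr0 mulr1.
Qed.

End InvariantSection.

(** The cohomological equation [D (T x) = l * D x + eps x]; its bounded solution is the
invariant section of a contraction over [T]. *)
Section TwistedEquation.
Variables (R : realType) (X : topologicalType).
Variables (T T' : X -> X) (eps : X -> R) (l b : R).
Hypothesis TK' : cancel T' T.
Hypothesis TK : cancel T T'.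
Hypothesis T'_cont : continuous T'.
Hypothesis eps_cont : continuous eps.
Hypothesis eps_le : forall x, `|eps x| <= b.
Hypothesis l_ge0 : 0 <= l.
Hypothesis l_lt1 : l < 1.

Lemma twisted_equation : exists D : X -> R,
  [/\ continuous D, forall x, `|D x| <= b / (1 - l)
    & forall x, D (T x) = l * D x + eps x].
Proof.
have [||||||||||w [wc _ wi wb]] :=
  @invariant_section R X unit T' (fun x y i => l * y i + eps x) (fun=> True)
   (fun y y' => `|y tt - y' tt|) 1 l b (fun=> 0) T'_cont => //.
- move=> Y F FF x x0 y y1 hx hy _ _ i.
  apply: cvgD; first by apply: cvgM => //; exact: cvg_cst.
  by apply: continuous_cvg => //; exact: eps_cont.
- by move=> y y' _ _ []; rewrite mul1r.
- by move=> x y y' _ _; rewrite opprD addrACA subrr addr0 -mulrBr normrM ger0_norm.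
- by move=> x; rewrite (_ : _ - _ = - eps x) ?normrN//; ring.
exists (w ^~ tt); split=> [//|x|x]; last by rewrite wi TK.
by have := wb x tt; rewrite subr0 mul1r.
Qed.

Lemma twisted_equation_unique (D D' : X -> R) M :
  (forall x, `|D x| <= M) -> (forall x, `|D' x| <= M) ->
  (forall x, D (T x) = l * D x + eps x) -> (forall x, D' (T x) = l * D' x + eps x) ->
  D = D'.
Proof.
move=> DM DM' De De'; apply/funext => x; apply/eqP; rewrite -subr_eq0 -normr_le0.
apply: (@le0_geometric _ _ (M + M) l) => // n.
elim: n x => [|n IHn] x.
  by rewrite expr0 mulr1 (le_trans (ler_normB _ _))// lerD.
rewrite -(TK' x) De De' opprD addrACA subrr addr0 -mulrBr normrM ger0_norm//.
by rewrite exprS mulrCA ler_wpM2l.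
Qed.

End TwistedEquation.

(** * The center function of the model *)

Section CenterFunction.
Variable R : realType.
Implicit Types (s t x y d : R).
Local Notation psi := (@psi R).
Local Notation dpsi := (@dpsi R).
Local Notation bar := (@bar R).
Local Notation lam := (@lam R).

Definition phi y : R := sval (cid (psi_surj y)).

Lemma phiK : cancel phi psi.
Proof. by move=> y; rewrite /phi; case: cid. Qed.

Lemma psiK : cancel psi phi.
Proof. by move=> x; apply: psi_inj; rewrite phiK. Qed.

Lemma phi_le x y : x <= y -> phi x <= phi y.
Proof.
move=> xy; rewrite leNgt; apply/negP => /psi_lt.
by rewrite !phiK ltNge xy.
Qed.

Lemma phi_lipschitz x y : `|phi x - phi y| <= 10 * `|x - y|.
Proof.
wlog xy : x y / x <= y => [hw|].
  by have [/hw//|/ltW/hw] := leP x y; rewrite distrC (distrC y).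
have h := phi_le xy; have := psi_bounds h; rewrite !phiK.
by rewrite !ler0_norm ?subr_le0//; lra.
Qed.

Lemma phi_continuous : continuous phi.
Proof.
move=> x; apply/cvgrPdist_lt => e e0; near=> y.
apply: le_lt_trans (phi_lipschitz _ _) _.
rewrite mulrC -ltr_pdivlMr//; near: y.
by apply: (@cvgr_dist_lt _ _ _ _ _ id) => //; rewrite divr_gt0.
Unshelve. all: by end_near. Qed.

Lemma is_derive_phi y : is_derive y (1 : R) phi (dpsi (phi y))^-1.
Proof.
rewrite -{1}(phiK y); apply: is_derive_inverse.
- by near=> x; exact: psiK.
- by near=> x; exact: psi_continuous.
- exact: is_derive_psi.
- by rewrite gt_eqF ?dpsi_gt0.
Unshelve. all: by end_near. Qed.

(** The drift of the center function: [al (t + 1) = al t + c2]. *)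
Definition c2 : R := (4 * (1 - lam))^-1.

Lemma c2E : c2 * (1 - lam) = 1 / 4.
Proof. by rewrite /c2; field; have := @lam_lt R; lra. Qed.

Lemma c2_gt : 33 / 100 < c2.
Proof. have := c2E; have := @lam_lt R; have := @lam_gt R; move: c2 lam => c l; nra. Qed.

Lemma c2_lt : c2 < 35 / 100.
Proof. have := c2E; have := @lam_lt R; have := @lam_gt R; move: c2 lam => c l; nra. Qed.

Lemma periodic_part_exists : exists D : R -> R,
  [/\ continuous D, forall t, `|D t| <= 1
    & forall t, D (psi t) = lam * D t + c2 * (t - psi t)].
Proof.
have l1 := @lam_lt R; have l2 := @lam_gt R; have k1 := c2_lt; have k2 := c2_gt.
have epsC : continuous (fun t => c2 * (t - psi t)).
  move=> t; apply: cvgM; first exact: cvg_cst.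
  by apply: cvgB; [exact: cvg_id|exact: psi_continuous].
have epsB t : `|c2 * (t - psi t)| <= 1 / 4.
  rewrite normrM gtr0_norm; last by lra.
  apply: (@le_trans _ _ (1 * (1 / 4))); last by lra.
  by apply: ler_pM => //; [lra | lra | rewrite distrC; exact: psi_near_id].
have [||D [Dc Db De]] := twisted_equation psiK phi_continuous epsC epsB _ (_ : lam < 1).
- by lra.
- by lra.
exists D; split=> // t; apply: le_trans (Db t) _.
by rewrite ler_pdivrMr; lra.
Qed.

Definition perD : R -> R := sval (cid periodic_part_exists).

(** The curve [S = al T] is a center leaf of the model. *)
Definition al t : R := c2 * t + perD t.

Let perD_spec : [/\ continuous perD, forall t, `|perD t| <= 1
    & forall t, perD (psi t) = lam * perD t + c2 * (t - psi t)].
Proof. by rewrite /perD; case: cid. Qed.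

Lemma al_continuous : continuous al.
Proof.
have [c _ _] := perD_spec.
move=> t; apply: cvgD; last exact: c.
by apply: cvgM; [exact: cvg_cst | exact: cvg_id].
Qed.

Lemma al_psi t : al (psi t) = lam * al t + t / 4.
Proof.
have [_ _ e] := perD_spec; rewrite /al e.
have := c2E; move: lam c2 (perD t) (psi t) => l k D p E.
have -> : l * (k * t + D) + t / 4 = l * (k * t + D) + t * (k * (1 - l)) by rewrite E; lra.
ring.
Qed.

Lemma al_phi t : al t = lam * al (phi t) + phi t / 4.
Proof. by rewrite -al_psi phiK. Qed.

Lemma alD1 t : al (t + 1) = al t + c2.
Proof.
have l1 := @lam_lt R; have l2 := @lam_gt R.
have [_ b e] := perD_spec.
rewrite /al mulrDr mulr1 -!addrA; congr (_ + _).
rewrite addrC; congr (_ + _).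
have /funeqP/(_ t)// : (fun t => perD (t + 1)) = perD.
apply: (@twisted_equation_unique R R psi phi (fun t => c2 * (t - psi t)) lam phiK) => //.
- by lra.
- by lra.
- by move=> x; rewrite /= -psiD1 e psiD1; congr (_ + _ * _); lra.
Qed.

Lemma al_near x : `|al x - c2 * x| <= 1.
Proof. by rewrite /al addrAC subrr add0r; have [_ b _] := perD_spec. Qed.

(** Iterating the functional equation backwards writes [al] as a series of the increasing
functions [phi^n]; the first term already has the slope claimed here. *)
Lemma al_ge x y : x <= y -> (y - x) / 8 <= al y - al x.
Proof.
have l1 := @lam_lt R; have l2 := @lam_gt R.
have k1 := c2_gt.
have mono u v : u <= v -> 0 <= al v - al u.
  move=> uv; rewrite -oppr_le0; apply: (@le0_geometric R _ 2 lam); try lra.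
  move=> n; elim: n u v uv => [|n IHn] u v uv.
    have := al_near u; have := al_near v; rewrite expr0 !ler_norml mulr1.
    have : 0 <= c2 * (v - u) by rewrite mulr_ge0//; lra.
    clear; lra.
  rewrite (al_phi u) (al_phi v) exprS.
  have h := phi_le uv; have := IHn _ _ h.
  have -> : 2 * (lam * lam ^+ n) = lam * (2 * lam ^+ n) by ring.
  move=> h1; have l0 : 0 <= lam by lra.
  have := ler_wpM2l l0 h1.
  move: h; clear; lra.
move=> xy; rewrite (al_phi x) (al_phi y).
have h := phi_le xy; have h2 := mono _ _ h.
have := psi_bounds h; rewrite !phiK => h3.
have : 0 <= lam * (al (phi y) - al (phi x)) by rewrite mulr_ge0//; lra.
move: h3; clear; lra.
Qed.

Lemma al_le x y : x <= y -> al x <= al y.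
Proof. by move=> xy; have := al_ge xy; lra. Qed.

(** Iterating the functional equation [n] times leaves an error [lam ^ n] and a Lipschitz
function. Lipschitz bounds themselves fail, as the leaves of the model are tangent to
the torus [t = 0]. *)
Lemma al_unif (b : R) : 0 < b ->
  exists2 e, 0 < e & forall x y, `|x - y| <= e -> `|al x - al y| <= b.
Proof.
have l1 := @lam_lt R; have l2 := @lam_gt R; have k1 := c2_lt; have k2 := c2_gt.
move=> b0; have l0 : 0 <= lam by lra.
have h n : exists2 e, 0 < e &
    forall x y, `|x - y| <= e -> `|al x - al y| <= 3 * lam ^+ n + b / 2.
  elim: n => [|n [e e0 he]].
    exists 1 => // x y xy; rewrite expr0 mulr1.
    have := al_near x; have := al_near y.
    have : `|c2 * (x - y)| <= 1.
      rewrite normrM gtr0_norm; last by lra.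
      by apply: mulr_ile1 => //; lra.
    by rewrite !ler_norml; move: b0; clear; lra.
  exists (Num.min (e / 10) (b / 10)); first by rewrite lt_min !divr_gt0.
  move=> x y; rewrite le_min => /andP[h1 h2].
  have h3 := phi_lipschitz x y.
  rewrite (al_phi x) (al_phi y).
  have h4 : `|al (phi x) - al (phi y)| <= 3 * lam ^+ n + b / 2 by apply: he; lra.
  have h5 := ler_wpM2l l0 h4.
  have -> : lam * al (phi x) + phi x / 4 - (lam * al (phi y) + phi y / 4) =
    lam * (al (phi x) - al (phi y)) + (phi x - phi y) / 4 by ring.
  apply: le_trans (ler_normD _ _) _; rewrite !normrM (ger0_norm l0) (@ger0_norm _ 4^-1)//.
  have h6 : lam * b <= 27 / 100 * b by rewrite ler_wpM2r //; lra.
  rewrite exprS; move: h2 h3 h5 h6 b0; clear; lra.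
have b4 : 0 < b / 2 by lra.
have [|n hn] := @geometric_small R 3 lam (b / 2) l0 _ b4; first by lra.
have [e e0 he] := h n; exists e => // x y /he; lra.
Qed.

(** Where [bar] is at least [d], the slope of [psi] is at least [d + lam], which beats the
factor [lam] of the functional equation; the region is preserved by [phi] since [bar]
increases in backward time. *)
Lemma al_slope d x y : 0 < d -> x <= y ->
  (forall z, x <= z <= y -> d <= bar z) -> 3 / 2 * d * (al y - al x) <= y - x.
Proof.
have l1 := @lam_lt R; have l2 := @lam_gt R; have k1 := c2_lt; have k2 := c2_gt.
move=> d0 xy hd.
suff : 3 / 2 * d * (al y - al x) - (y - x) <= 0 by lra.
apply: (@le0_geometric R _ 8 lam); try lra.
move=> n; elim: n x y xy hd => [|n IHn] x y xy hd.
  have d1 : d <= 164 / 100.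
    by apply: le_trans (hd x _) _; [rewrite lexx | have := bar_bound x; lra].
  have h : al y - al x <= c2 * (y - x) + 2.
    by have := al_near x; have := al_near y; rewrite !ler_norml; clear; lra.
  have h2 : c2 * (y - x) <= 35 / 100 * (y - x) by apply: ler_wpM2r; lra.
  have h3 : d * (al y - al x) <= 164 / 100 * (35 / 100 * (y - x) + 2).
    apply: ler_pM => //; [lra | by have := al_le xy; lra | lra].
  by rewrite expr0; move: h3 xy; clear; lra.
set x' := phi x; set y' := phi y.
have xy' : x' <= y' := phi_le xy.
have hd' z : x' <= z <= y' -> d <= bar z.
  move=> /andP[h1 h2]; apply: le_trans (bar_psi_le z); apply: hd.
  by rewrite -[x]phiK -[y]phiK !psi_le.
have h1 := IHn _ _ xy' hd'.
have h2 : (d + lam) * (y' - x') <= y - x.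
  rewrite -[y]phiK -[x]phiK -/x' -/y'.
  move: xy'; rewrite le_eqVlt => /predU1P[->|xy']; first by rewrite !subrr mulr0.
  have [z /andP[z1 z2] ->] := mean_value (@is_derive_psi R) xy'.
  rewrite ler_pM2r ?subr_gt0//.
  have := hd' z; rewrite barE (ltW z1) (ltW z2) => /(_ isT).
  by move: (dpsi z) => D; clear; lra.
have l0 : 0 <= lam by lra.
have h3 := ler_wpM2l l0 h1.
rewrite (al_phi x) (al_phi y) -/x' -/y' exprS.
have h4 : 0 <= d * (y' - x') by rewrite mulr_ge0 ?subr_ge0 ?(ltW d0).
move: h2 h3 h4; clear; lra.
Qed.

(** A point displaced from the graph of [al] along the complement of the center cone gets
off the graph, by a definite fraction of the displacement. *)
Lemma al_gap s t x : 0 < s -> s <= 1 / 100 -> t <= bar x * s ->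
  s / 4 <= s - (al (x + t) - al x).
Proof.
move=> s0 s1 ts; have [t0|t0] := leP t 0.
  have : al (x + t) <= al x by apply: al_le; lra.
  by move: s0; clear; lra.
have b0 : 0 < bar x by rewrite -(pmulr_lgt0 _ s0) (lt_le_trans t0).
have d0 : 0 < 92 / 100 * bar x by lra.
have bs : bar x * s <= bar x * (1 / 100) by rewrite ler_wpM2l// ltW.
have := @al_slope (92 / 100 * bar x) x (x + t) d0; rewrite lerDl (ltW t0) => /(_ isT).
have hz z : x <= z <= x + t -> 92 / 100 * bar x <= bar z.
  move=> hz; have := bar_lipschitz x z; rewrite (ler0_norm (_ : x - z <= 0)); last by lra.
  by rewrite ler_norml; move: hz bs ts b0; clear; lra.
move=> /(_ hz) h.
have : bar x * (al (x + t) - al x) <= bar x * (3 / 4 * s).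
  by move: h ts bs t0; clear; lra.
by rewrite ler_pM2l//; clear; lra.
Qed.

Lemma al_gapN s t x : 0 < s -> s <= 1 / 100 -> t <= bar x * s ->
  s / 4 <= s - (al x - al (x - t)).
Proof.
move=> s0 s1 ts; have [t0|t0] := leP t 0.
  have : al x <= al (x - t) by apply: al_le; lra.
  by move: s0; clear; lra.
have b0 : 0 < bar x by rewrite -(pmulr_lgt0 _ s0) (lt_le_trans t0).
have d0 : 0 < 92 / 100 * bar x by lra.
have bs : bar x * s <= bar x * (1 / 100) by rewrite ler_wpM2l// ltW.
have := @al_slope (92 / 100 * bar x) (x - t) x d0; rewrite gerBl (ltW t0) => /(_ isT).
have hz z : x - t <= z <= x -> 92 / 100 * bar x <= bar z.
  move=> hz; have := bar_lipschitz x z; rewrite (ger0_norm (_ : 0 <= x - z)); last by lra.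
  by rewrite ler_norml; move: hz bs ts b0; clear; lra.
move=> /(_ hz) h.
have : bar x * (al x - al (x - t)) <= bar x * (3 / 4 * s).
  by move: h ts bs t0; clear; lra.
by rewrite ler_pM2l//; clear; lra.
Qed.

End CenterFunction.

(** * Linear coordinates *)

Section ContinuityCriteria.
Variable R : realType.

Lemma continuous_eps (X : topologicalType) (f : X -> R) x :
  (forall e, 0 < e -> \forall y \near x, `|f x - f y| < e) -> {for x, continuous f}.
Proof. by move=> h; apply/cvgrPdist_lt => e e0; exact: h. Qed.

Lemma near_norm_lt (V : normedModType R) (x : V) e : 0 < e ->
  \forall y \near x, `|x - y| < e.
Proof. by move=> e0; apply: (@cvgr_dist_lt _ _ _ _ _ id). Qed.

Lemma cont_cst (X : topologicalType) (c : R) : continuous (fun _ : X => c).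
Proof. by move=> x; exact: cvg_cst. Qed.

Lemma contD (X : topologicalType) (f g : X -> R) :
  continuous f -> continuous g -> continuous (fun x => f x + g x).
Proof. by move=> hf hg x; apply: cvgD; [exact: hf|exact: hg]. Qed.

Lemma contB (X : topologicalType) (f g : X -> R) :
  continuous f -> continuous g -> continuous (fun x => f x - g x).
Proof. by move=> hf hg x; apply: cvgB; [exact: hf|exact: hg]. Qed.

Lemma contN (X : topologicalType) (f : X -> R) :
  continuous f -> continuous (fun x => - f x).
Proof. by move=> hf x; apply: cvgN; exact: hf. Qed.

Lemma contM (X : topologicalType) (f g : X -> R) :
  continuous f -> continuous g -> continuous (fun x => f x * g x).
Proof. by move=> hf hg x; apply: cvgM; [exact: hf|exact: hg]. Qed.

Lemma contV (X : topologicalType) (f : X -> R) :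
  continuous f -> (forall x, f x != 0) -> continuous (fun x => (f x)^-1).
Proof. by move=> hf f0 x; apply: cvgV; [exact: f0|exact: hf]. Qed.

Lemma cont_comp (X Y Z : topologicalType) (f : X -> Y) (g : Y -> Z) :
  continuous f -> continuous g -> continuous (fun x => g (f x)).
Proof. by move=> hf hg x; apply: (@continuous_cvg _ _ _ (nbhs x) _ f g); [exact: hg|exact: hf]. Qed.

End ContinuityCriteria.

Section Coordinates.
Variable R : realType.
Local Notation V3 := 'rV[R]_3.
Local Notation lam := (@lam R).
Local Notation c2 := (@c2 R).
Implicit Types (p q v w : V3) (s t u : R).

Definition j0 : 'I_3 := ord0.
Definition j1 : 'I_3 := lift ord0 ord0.
Definition j2 : 'I_3 := lift ord0 (lift ord0 ord0).

Lemma forall_I3 (P : 'I_3 -> Prop) : P j0 -> P j1 -> P j2 -> forall i, P i.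
Proof.
move=> h0 h1 h2 [[|[|[|//]]] hi].
- by rewrite (_ : Ordinal hi = j0) //; exact: val_inj.
- by rewrite (_ : Ordinal hi = j1) //; exact: val_inj.
- by rewrite (_ : Ordinal hi = j2) //; exact: val_inj.
Qed.

Definition row3 (a b c : R) : V3 := \row_(j < 3) [:: a; b; c]`_j.

Lemma row3E a b c : (row3 a b c ord0 j0 = a) * (row3 a b c ord0 j1 = b) *
  (row3 a b c ord0 j2 = c).
Proof. by rewrite /row3 !mxE. Qed.

Lemma row3_inj v w : v ord0 j0 = w ord0 j0 -> v ord0 j1 = w ord0 j1 ->
  v ord0 j2 = w ord0 j2 -> v = w.
Proof. by move=> h0 h1 h2; apply/rowP; exact: forall_I3. Qed.

(** [cU] and [cS - c2 * cT] are eigenfunctionals of the hyperbolic automorphism. The tilt by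
[c2] is chosen so that the shear of the model, which moves [cS - c2 * cT] together with [cT],
leaves [cS] alone. *)
Definition cT v : R := v ord0 j2.
Definition cU v : R := v ord0 j0 + (1 - lam) * v ord0 j1.
Definition cS v : R := v ord0 j0 + (lam - 3) * v ord0 j1 + c2 * v ord0 j2.

Lemma cS_is_linear : linear cS.
Proof. by move=> a v w; rewrite /cS !mxE /GRing.scale /=; ring. Qed.
Lemma cT_is_linear : linear cT.
Proof. by move=> a v w; rewrite /cT !mxE. Qed.
Lemma cU_is_linear : linear cU.
Proof. by move=> a v w; rewrite /cU !mxE /GRing.scale /=; ring. Qed.

HB.instance Definition _ := GRing.isLinear.Build R V3 R _ cS cS_is_linear.
HB.instance Definition _ := GRing.isLinear.Build R V3 R _ cT cT_is_linear.
HB.instance Definition _ := GRing.isLinear.Build R V3 R _ cU cU_is_linear.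

Lemma cSD v w : cS (v + w) = cS v + cS w. Proof. exact: raddfD. Qed.
Lemma cTD v w : cT (v + w) = cT v + cT w. Proof. exact: raddfD. Qed.
Lemma cUD v w : cU (v + w) = cU v + cU w. Proof. exact: raddfD. Qed.
Lemma cSB v w : cS (v - w) = cS v - cS w. Proof. exact: raddfB. Qed.
Lemma cTB v w : cT (v - w) = cT v - cT w. Proof. exact: raddfB. Qed.
Lemma cUB v w : cU (v - w) = cU v - cU w. Proof. exact: raddfB. Qed.
Lemma cSZ a v : cS (a *: v) = a * cS v. Proof. exact: linearZ. Qed.
Lemma cTZ a v : cT (a *: v) = a * cT v. Proof. exact: linearZ. Qed.
Lemma cUZ a v : cU (a *: v) = a * cU v. Proof. exact: linearZ. Qed.
Definition coordE := (cSD, cTD, cUD, cSB, cTB, cUB, cSZ, cTZ, cUZ).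

(** The inverse of the change of coordinates. *)
Definition mk s t u : V3 :=
  let b := (u - (s - c2 * t)) / (4 - 2 * lam) in row3 (u - (1 - lam) * b) b t.

Lemma lam_den : 4 - 2 * lam != 0.
Proof. by rewrite gt_eqF//; have := @lam_lt R; lra. Qed.

Lemma cS_mk s t u : cS (mk s t u) = s.
Proof.
rewrite /cS /mk !row3E; have := lam_den; move: lam c2 => l c h; field.
exact: h.
Qed.
Lemma cT_mk s t u : cT (mk s t u) = t.
Proof. by rewrite /cT /mk row3E. Qed.
Lemma cU_mk s t u : cU (mk s t u) = u.
Proof. by rewrite /cU /mk !row3E; ring. Qed.

Lemma mk_eta v : mk (cS v) (cT v) (cU v) = v.
Proof.
have e : (cU v - (cS v - c2 * cT v)) / (4 - 2 * lam) = v ord0 j1.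
  by rewrite /cU /cS /cT; have := lam_den; move: lam c2 => l c h; field; exact: h.
by apply: row3_inj; rewrite /mk row3E ?e// /cU; ring.
Qed.

Lemma coords_inj v w : cS v = cS w -> cT v = cT w -> cU v = cU w -> v = w.
Proof. by move=> h1 h2 h3; rewrite -(mk_eta v) h1 h2 h3 mk_eta. Qed.

Lemma mkD s t u s' t' u' : mk (s + s') (t + t') (u + u') = mk s t u + mk s' t' u'.
Proof. by apply: coords_inj; rewrite !coordE ?cS_mk ?cT_mk ?cU_mk. Qed.

Lemma mkZ a s t u : mk (a * s) (a * t) (a * u) = a *: mk s t u.
Proof. by apply: coords_inj; rewrite !coordE ?cS_mk ?cT_mk ?cU_mk. Qed.

(** All estimates are in this norm, because the model is explicit in these coordinates. *)
Definition N v : R := Num.max `|cS v| (Num.max `|cT v| `|cU v|).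

Lemma cS_le_N v : `|cS v| <= N v. Proof. by rewrite /N le_max lexx. Qed.
Lemma cT_le_N v : `|cT v| <= N v. Proof. by rewrite /N !le_max lexx orbT. Qed.
Lemma cU_le_N v : `|cU v| <= N v. Proof. by rewrite /N !le_max lexx !orbT. Qed.
Lemma N_ge0 v : 0 <= N v. Proof. exact: le_trans (cS_le_N v). Qed.
Lemma N_le v (b : R) : `|cS v| <= b -> `|cT v| <= b -> `|cU v| <= b -> N v <= b.
Proof. by move=> h1 h2 h3; rewrite /N !ge_max h1 h2 h3. Qed.

Lemma ND v w : N (v + w) <= N v + N w.
Proof.
by apply: N_le; rewrite raddfD (le_trans (ler_normD _ _))// lerD// ?cS_le_N ?cT_le_N ?cU_le_N.
Qed.

Lemma NN v : N (- v) = N v.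
Proof. by rewrite /N !raddfN /= !normrN. Qed.

Lemma NZ a v : N (a *: v) = `|a| * N v.
Proof.
by rewrite /N !linearZ /= !normrM maxr_pMr ?normr_ge0// maxr_pMr ?normr_ge0.
Qed.

Lemma N_eq0 v : N v = 0 -> v = 0.
Proof.
move=> h; apply: coords_inj; rewrite raddf0; apply/eqP; rewrite -normr_le0 -h.
- exact: cS_le_N.
- exact: cT_le_N.
- exact: cU_le_N.
Qed.

Lemma coord_le_norm v i : `|v ord0 i| <= `|v|.
Proof.
rewrite [leRHS]mx_normrE.
exact: (le_bigmax_cond 0 (fun ij : 'I_1 * 'I_3 => `|v ij.1 ij.2|) (j := (ord0, i)) isT).
Qed.

Lemma norm_le_coord v (b : R) : 0 <= b -> (forall i, `|v ord0 i| <= b) -> `|v| <= b.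
Proof.
move=> b0 h; rewrite [leLHS]mx_normrE; apply: bigmax_le => // -[i j] _ /=.
by rewrite (ord1 i).
Qed.

Lemma N_le_norm v : N v <= 5 * `|v|.
Proof.
have l1 := @lam_lt R; have l2 := @lam_gt R; have k1 := @c2_lt R; have k2 := @c2_gt R.
have h0 := coord_le_norm v j0; have h1 := coord_le_norm v j1.
have h2 := coord_le_norm v j2; have n0 := normr_ge0 v.
have a1 : `|(lam - 3) * v ord0 j1| <= 3 * `|v|.
  by rewrite normrM; apply: ler_pM => //; rewrite ler_norml; lra.
have a2 : `|c2 * v ord0 j2| <= 1 * `|v|.
  by rewrite normrM; apply: ler_pM => //; rewrite ler_norml; lra.
have a3 : `|(1 - lam) * v ord0 j1| <= 1 * `|v|.
  by rewrite normrM; apply: ler_pM => //; rewrite ler_norml; lra.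
apply: N_le.
- rewrite /cS (le_trans (ler_normD _ _))//.
  apply: le_trans (lerD (ler_normD _ _) (lexx _)) _.
  move: h0 a1 a2; clear; lra.
- by rewrite /cT; move: h2 n0; clear; lra.
- rewrite /cU (le_trans (ler_normD _ _))//.
  move: h0 n0 a3; clear; lra.
Qed.

Lemma norm_le_N v : `|v| <= 3 * N v.
Proof.
have l1 := @lam_lt R; have l2 := @lam_gt R; have k1 := @c2_lt R; have k2 := @c2_gt R.
have h0 := cS_le_N v; have h1 := cT_le_N v.
have h2 := cU_le_N v; have n0 := N_ge0 v.
have a2 : `|c2 * cT v| <= 35 / 100 * N v.
  by rewrite normrM; apply: ler_pM => //; rewrite ler_norml; lra.
have e : v ord0 j1 = (cU v - (cS v - c2 * cT v)) / (4 - 2 * lam).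
  by rewrite -{1}(mk_eta v) /mk row3E.
have b1 : `|v ord0 j1| <= N v.
  rewrite e normrM normfV (@ger0_norm _ (4 - 2 * lam)); last by lra.
  rewrite ler_pdivrMr; last by lra.
  have : N v * (34 / 10) <= N v * (4 - 2 * lam) by apply: ler_wpM2l => //; lra.
  by move: h0 h2 a2 n0; rewrite !ler_norml; clear; lra.
apply: norm_le_coord; first by lra.
apply: forall_I3.
- have -> : v ord0 j0 = cU v - (1 - lam) * v ord0 j1 by rewrite /cU; ring.
  have a3 : `|(1 - lam) * v ord0 j1| <= 1 * N v.
    by rewrite normrM; apply: ler_pM => //; rewrite ler_norml; lra.
  by move: a3 h2 n0; rewrite !ler_norml; clear; lra.
- by move: b1 n0; clear; lra.
- by rewrite -/(cT v); move: h1 n0; clear; lra.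
Qed.

Lemma lipschitz_continuous (f : V3 -> R) (K : R) :
  (forall p q, `|f p - f q| <= K * N (p - q)) -> continuous f.
Proof.
move=> h p; have K0 : 0 < `|K| + 1 by have := normr_ge0 K; lra.
apply: continuous_eps => e e0.
have e1 : 0 < e / ((`|K| + 1) * 5) by rewrite divr_gt0//; lra.
apply: filterS (near_norm_lt p e1) => q hq.
apply: le_lt_trans (h p q) _.
apply: (@le_lt_trans _ _ ((`|K| + 1) * (5 * `|p - q|))).
  apply: le_trans (_ : (`|K| + 1) * N (p - q) <= _); last first.
    by apply: ler_wpM2l; [exact: ltW | exact: N_le_norm].
  by apply: ler_wpM2r; [exact: N_ge0|have := ler_norm K; lra].
by rewrite mulrA mulrC -ltr_pdivlMr; last by lra.
Qed.

Lemma cS_continuous : continuous cS.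
Proof.
by apply: (@lipschitz_continuous _ 1) => p q; rewrite mul1r -raddfB cS_le_N.
Qed.

Lemma cT_continuous : continuous cT.
Proof.
by apply: (@lipschitz_continuous _ 1) => p q; rewrite mul1r -raddfB cT_le_N.
Qed.

Lemma cU_continuous : continuous cU.
Proof.
by apply: (@lipschitz_continuous _ 1) => p q; rewrite mul1r -raddfB cU_le_N.
Qed.

Lemma cvg_N (Y : Type) (F : set_system Y) (FF : Filter F) (f : Y -> V3) p :
  (forall e : R, 0 < e -> \forall y \near F, N (f y - p) < e) -> f @ F --> p.
Proof.
move=> h; apply/cvgrPdist_lt => e e0.
have e3 : 0 < e / 3 by lra.
apply: filterS (h _ e3) => y hy; rewrite distrC.
by apply: le_lt_trans (norm_le_N _) _; lra.
Qed.

Lemma cvg_coords (Y : Type) (F : set_system Y) (FF : Filter F) (f : Y -> V3) p :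
  cS (f y) @[y --> F] --> cS p -> cT (f y) @[y --> F] --> cT p ->
  cU (f y) @[y --> F] --> cU p -> f @ F --> p.
Proof.
move=> hS hT hU; apply: cvg_N => e e0.
move/cvgrPdist_lt : hS => /(_ e e0) hS.
move/cvgrPdist_lt : hT => /(_ e e0) hT.
move/cvgrPdist_lt : hU => /(_ e e0) hU.
near=> y; rewrite /N !gt_max !raddfB /=.
by apply/and3P; split; rewrite distrC; near: y.
Unshelve. all: by end_near. Qed.

Lemma mk_cvg (Y : Type) (F : set_system Y) (FF : Filter F) (a b c : Y -> R) a0 b0 c0 :
  a @ F --> a0 -> b @ F --> b0 -> c @ F --> c0 ->
  mk (a y) (b y) (c y) @[y --> F] --> mk a0 b0 c0.
Proof.
move=> ha hb hc; apply: cvg_coords; rewrite ?cS_mk ?cT_mk ?cU_mk.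
- by under eq_fun do rewrite cS_mk.
- by under eq_fun do rewrite cT_mk.
- by under eq_fun do rewrite cU_mk.
Qed.

End Coordinates.

Arguments cS {R} v : simpl never.
Arguments cT {R} v : simpl never.
Arguments cU {R} v : simpl never.
Arguments mk {R} s t u : simpl never.
Arguments N {R} v : simpl never.

(** * Positive matrices on the center cone *)

Section ConeArithmetic.
Variable R : realType.
Local Notation psi := (@psi R).
Local Notation dpsi := (@dpsi R).
Local Notation bar := (@bar R).
Local Notation lam := (@lam R).
Local Notation off := (@off R).
Implicit Types (th S T : R).

(** The diagonal entries of the cone matrix, [off] and [1 / 4] being the other two. *)
Definition diagS th : R := lam + bar th / 4.
Definition diagT th : R := dpsi th - bar (psi th) / 4.

Lemma diagS_bound th : 21 / 100 <= diagS th <= 68 / 100.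
Proof. by rewrite /diagS; have := bar_bound th; have := @lam_lt R; have := @lam_gt R; lra. Qed.

Lemma diagT_bound th : 13 / 100 <= diagT th <= 2.
Proof.
rewrite /diagT; have := bar_bound (psi th); have := bar_psi_le th.
have := dpsi_bound th; rewrite (barE th); have := @lam_lt R; have := @lam_gt R.
move: (bar _) (dpsi th) lam => a b c; lra.
Qed.

Lemma cone_det th : diagS th * diagT th - off th / 4 = lam * dpsi th.
Proof.
rewrite /diagS /diagT /off; have -> : dpsi th = bar th + lam by rewrite barE; lra.
by move: (bar th) (bar (psi th)) lam => a b l; field.
Qed.

(** Why [off] is the remaining entry of the matrix. *)
Lemma diagT_dpsi th : dpsi th * bar th - bar (psi th) * diagS th = off th.
Proof.
rewrite /diagS /off; have -> : dpsi th = bar th + lam by rewrite barE; lra.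
by move: (bar th) (bar (psi th)) lam => a b l; field.
Qed.

(** In the coordinates [S] and [T - bar th * S] the model acts by a matrix with
positive entries; a perturbation of it does so up to a small error. *)
Definition cone_image (l k m q x1 x2 y1 y2 : R) :=
  `|y1 - (l * x1 + x2 / 4)| <= k * (`|x1| + `|x2|) /\
  `|y2 - (m * x1 + q * x2)| <= k * (`|x1| + `|x2|).

Lemma cone_matrix th th' S T S' T' (x1 := S) (x2 := T - bar th * S)
    (y1 := S') (y2 := T' - bar th' * S') :
  `|T| <= (1 / 10) ^+ 6 ->
  `|S' - (lam * S + T / 4)| <= (1 / 10) ^+ 6 * (`|S| + `|T|) ->
  `|T' - dpsi th * T| <= (1 / 10) ^+ 6 * (`|S| + `|T|) + 8 * T ^+ 2 ->
  `|th' - psi th| <= (1 / 10) ^+ 6 ->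
  cone_image (diagS th) ((1 / 10) ^+ 4) (off th) (diagT th) x1 x2 y1 y2.
Proof.
move=> hT hS hT' hth.
set e := (1 / 10) ^+ 6 in hT hS hT' hth.
have e0 : 0 < e by rewrite exprn_gt0.
have eE : 100 * e = (1 / 10) ^+ 4 by rewrite /e; field.
have bb := bar_bound th; have bp := bar_bound (psi th).
have bl := bar_lipschitz th' (psi th).
have hS0 := normr_ge0 S; have hx2 := normr_ge0 x2.
have nT : `|T| <= `|x2| + 164 / 100 * `|S|.
  have -> : T = x2 + bar th * S by rewrite /x2; ring.
  apply: le_trans (ler_normD _ _) _; rewrite lerD2l normrM ler_wpM2r//.
  by rewrite ler_norml; lra.
have T2 : 8 * T ^+ 2 <= 8 * e * `|T|.
  rewrite -mulrA ler_pM2l// -real_normK ?num_real// expr2.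
  by rewrite ler_wpM2r.
have l1E : lam * S + T / 4 = diagS th * x1 + x2 / 4.
  by rewrite /diagS /x1 /x2; field.
rewrite l1E in hS.
set L := diagS th * x1 + x2 / 4 in hS *.
have nL : `|L| <= `|S| + `|x2|.
  rewrite /L; apply: le_trans (ler_normD _ _) _; rewrite lerD//.
    rewrite normrM -[leRHS]mul1r ler_wpM2r// ler_norml.
    by have := diagS_bound th; lra.
  by rewrite normrM (@ger0_norm _ 4^-1)//; move: hx2; clear; lra.
split.
  rewrite /y1 -eE (le_trans hS)//.
  rewrite /x1 [100 * e]mulrC -[leRHS]mulrA ler_wpM2l ?(ltW e0)//.
  by move: nT hS0 hx2; clear; lra.
have -> : y2 - (off th * x1 + diagT th * x2) =
    (T' - dpsi th * T) - bar th' * (S' - L) - (bar th' - bar (psi th)) * L.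
  rewrite -(diagT_dpsi th) /y2 /x1 /x2 /L /diagT /x1 /x2.
  by move: (bar th') (bar (psi th)) (bar th) (dpsi th) (diagS th) => a b c d f; field.
have nb : `|bar th'| <= 2 by have := bar_bound th'; rewrite ler_norml; lra.
have h1 : `|bar th' * (S' - L)| <= 2 * (e * (`|S| + `|T|)).
  by rewrite normrM; apply: ler_pM.
have h2 : `|(bar th' - bar (psi th)) * L| <= 8 * e * (`|S| + `|x2|).
  rewrite normrM; apply: ler_pM => //; apply: le_trans bl _.
  by rewrite ler_wpM2l.
apply: le_trans (ler_normB _ _) _; apply: le_trans (lerD (ler_normB _ _) (lexx _)) _.
apply: le_trans (lerD (lerD hT' h1) h2) _.
rewrite -eE /x1.
have m1 := ler_wpM2l (ltW e0) nT.
have m2 := mulr_ge0 (ltW e0) hS0; have m3 := mulr_ge0 (ltW e0) hx2.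
move: m1 m2 m3 T2; clear; lra.
Qed.

Lemma cone_imageN l k m q x1 x2 y1 y2 : cone_image l k m q x1 x2 y1 y2 ->
  cone_image l k m q (- x1) (- x2) (- y1) (- y2).
Proof.
rewrite /cone_image !normrN => -[h1 h2]; split.
  by rewrite (_ : _ - _ = - (y1 - (l * x1 + x2 / 4))) ?normrN//; field.
by rewrite (_ : _ - _ = - (y2 - (m * x1 + q * x2))) ?normrN//; ring.
Qed.

Definition positive_entries (l k m q : R) :=
  [/\ 21 / 100 <= l <= 68 / 100, 13 / 100 <= q <= 2, 1 / 64 <= m <= 4,
      0 <= k <= (1 / 10) ^+ 4 & 26 / 1000 <= l * q - m / 4].

Lemma cone_image_ge0 l k m q x1 x2 y1 y2 : positive_entries l k m q ->
  cone_image l k m q x1 x2 y1 y2 ->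
  0 <= x1 -> 0 <= x2 -> 0 <= y1 /\ 0 <= y2.
Proof.
move=> [/andP[lb _] /andP[qb _] /andP[mb _] /andP[_ kb] _] [h1 h2] x10 x20; move: h1 h2; rewrite (ger0_norm x10) (ger0_norm x20).
have k1 : k <= 1 / 100 by move: kb; clear; lra.
have a1 : 21 / 100 * x1 <= l * x1 by rewrite ler_wpM2r.
have a2 : 13 / 100 * x2 <= q * x2 by rewrite ler_wpM2r.
have a3 : 1 / 64 * x1 <= m * x1 by rewrite ler_wpM2r.
have a4 : k * (x1 + x2) <= 1 / 100 * (x1 + x2) by rewrite ler_wpM2r// addr_ge0.
rewrite !ler_norml; move: a1 a2 a3 a4 x10 x20; clear; lra.
Qed.

(** A vector of the complementary cone has a preimage there, which is longer: the inverse of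
a positive matrix of positive determinant has that sign pattern. *)
Lemma cone_image_back l k m q x1 x2 y1 y2 : positive_entries l k m q ->
  cone_image l k m q x1 x2 y1 y2 ->
  0 < y1 -> y2 < 0 ->
  [/\ 0 < x1, x2 < 0, y1 <= 7 / 10 * x1 & - y2 <= 7 * x1].
Proof.
move=> pe h y10 y20.
have [/andP[lb lb'] /andP[qb qb'] /andP[mb mb'] /andP[kb0 kb] det] := pe.
have [x10|x10] := leP x1 0.
  have [x20|x20] := leP x2 0.
    have [] := cone_image_ge0 pe (cone_imageN h); rewrite ?oppr_ge0//; lra.
  case: h; rewrite (ler0_norm x10) (gtr0_norm x20) => h1 h2; exfalso.
  have [a xE] : {a | x1 = - a} by exists (- x1); rewrite opprK.
  have a0 : 0 <= a by move: x10; rewrite xE oppr_le0.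
  rewrite xE opprK in h1 h2; clear x10 xE.
  have mu : m * a <= 4 * a by rewrite ler_wpM2r.
  have qu : 13 / 100 * x2 <= q * x2 by rewrite ler_pM2r.
  have ku : k * (a + x2) <= (1 / 10) ^+ 4 * (a + x2) by rewrite ler_wpM2r// addr_ge0// ltW.
  have x2a : x2 <= 32 * a.
    by move: h2; rewrite ler_norml; move: mu qu ku y20 x20 a0; clear; lra.
  have ka : k * (a + x2) <= (33 / 10 ^+ 4) * a.
    by move: ku x2a; clear; lra.
  have e1 : y1 <= - l * a + x2 / 4 + (33 / 10 ^+ 4) * a.
    by move: h1; rewrite ler_norml; move: ka; clear; lra.
  have e2 : - m * a + q * x2 - (33 / 10 ^+ 4) * a <= y2.
    by move: h2; rewrite ler_norml; move: ka; clear; lra.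
  have q0 : 0 <= q by move: qb; clear; lra.
  have e3 : 0 <= q * y1 by rewrite mulr_ge0// ltW.
  have e4 := ler_wpM2l q0 e1.
  have e5 : 26 / 1000 * a <= (l * q - m / 4) * a by rewrite ler_wpM2r.
  have e6 : q * (33 / 10 ^+ 4 * a) <= 2 * (33 / 10 ^+ 4 * a).
    by rewrite ler_wpM2r// mulr_ge0.
  have a00 : a <= 0 by move: e2 e3 e4 e5 e6 y20; clear; lra.
  by move: x2a x20 a00; clear; lra.
have [x20|x20] := leP 0 x2.
  have [] := cone_image_ge0 pe h (ltW x10) x20; lra.
case: h; rewrite (gtr0_norm x10) (ltr0_norm x20) => h1 h2.
have ku : k * (x1 - x2) <= (1 / 10) ^+ 4 * (x1 - x2) by rewrite ler_wpM2r// addr_ge0 ?oppr_ge0// ltW.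
have lu : l * x1 <= 68 / 100 * x1 by rewrite ler_pM2r.
have mu : 0 <= m * x1 by rewrite mulr_ge0 ?(ltW x10)//; move: mb; clear; lra.
have qu : q * (- x2) <= 2 * (- x2) by rewrite ler_pM2r ?oppr_gt0.
have e1 : y1 <= 7 / 10 * x1.
  by move: h1; rewrite ler_norml; move: ku lu x10 x20; clear; lra.
have e2 : - x2 <= 28 / 10 * x1.
  by move: h1; rewrite ler_norml; move: ku lu x10 x20 y10; clear; lra.
split=> //.
by move: h2; rewrite ler_norml; move: ku e2 mu qu x10; clear; lra.
Qed.

Lemma positive_entries_cone th :
  positive_entries (diagS th) ((1 / 10) ^+ 4) (off th) (diagT th).
Proof.
split; [exact: diagS_bound | exact: diagT_bound | by rewrite off_ge off_le | |].
  by rewrite lexx exprn_ge0.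
rewrite cone_det; have := @lam_gt R => h; have := dpsi_bound th => /andP[h1 _].
have -> : 26 / 1000 = 26 / 100 * (1 / 10) :> R by lra.
by apply: ler_pM => //; exact: ltW.
Qed.

End ConeArithmetic.

(** * Coordinates of the leaves *)

Section NearModel.
Variable R : realType.
Local Notation V3 := 'rV[R]_3.
Local Notation psi := (@psi R).
Local Notation lam := (@lam R).
Implicit Types (e : R) (G H : V3 -> V3) (hu hs : V3 -> R) (p q n : V3).

(** One size of perturbation that serves all estimates. *)
Definition om : R := (1 / 10) ^+ 13.

Definition A3 : 'M[R]_3 :=
  \matrix_(i < 3, j < 3) nth 0 (nth [::] [:: [:: 3; 1; 0]; [:: 2; 1; 0]; [:: 0; 0; 1]] i) j.

Lemma mulA3 p : p *m A3 =
  row3 (3 * p ord0 (j0) + 2 * p ord0 (j1)) (p ord0 (j0) + p ord0 (j1)) (p ord0 (j2)).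
Proof.
apply: row3_inj; rewrite !row3E !mxE !big_ord_recl big_ord0 !mxE /=; rewrite /j0 /j1 /j2; ring.
Qed.

Lemma cS_mulA3 p : cS (p *m A3) = lam * cS p + cT p / 4.
Proof.
rewrite mulA3 /cS /cT !row3E.
have h := @lam_sqr R.
have -> : p ord0 j2 / 4 = p ord0 j2 * (c2 R * (1 - lam)) by rewrite c2E; ring.
have : (lam ^+ 2 - 4 * lam + 1) * p ord0 j1 = 0 by rewrite h; ring.
by move: lam (c2 R) => l c E; nra.
Qed.

Lemma cT_mulA3 p : cT (p *m A3) = cT p.
Proof. by rewrite mulA3 /cT !row3E. Qed.

Lemma cU_mulA3 p : cU (p *m A3) = (4 - lam) * cU p.
Proof.
rewrite mulA3 /cU !row3E.
have h := @lam_sqr R.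
have : (lam ^+ 2 - 4 * lam + 1) * p ord0 j1 = 0 by rewrite h; ring.
by move: lam => l E; nra.
Qed.

Lemma lam_inv : lam * (4 - lam) = 1.
Proof. by have := @lam_sqr R; move: lam => l h; lra. Qed.

Definition intv n : Prop := forall i, n ord0 i \is a Num.int.

Lemma intv_mulA3 n : intv n -> intv (n *m A3).
Proof.
by move=> hn; rewrite mulA3; apply: forall_I3; rewrite row3E ?rpredD ?rpredM ?natr_int.
Qed.

Lemma intv_mulA3_surj n : intv n -> exists2 m, intv m & n = m *m A3.
Proof.
move=> hn.
exists (row3 (n ord0 j0 - 2 * n ord0 j1) (3 * n ord0 j1 - n ord0 j0) (n ord0 j2)).
  by apply: forall_I3; rewrite row3E ?rpredB ?rpredM ?natr_int.
by rewrite mulA3 !row3E; apply: row3_inj; rewrite !row3E //; ring.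
Qed.

(** Perturbations of the lift of the model: [G] with inverse [H] is within [e] of it, in the
sup distance and in the Lipschitz constant of the difference. The condition [nm_al] says
that [e] is small with respect to the modulus of continuity of [al]. *)
Record near_model e G H : Prop := NearModel {
  nm_e : 0 < e <= om;
  nm_al : forall x y, `|x - y| <= e -> `|al x - al y| <= om;
  nm_GH : cancel G H;
  nm_HG : cancel H G;
  nm_Gc : continuous G;
  nm_Hc : continuous H;
  nm_per : forall p n, intv n -> G (p + n) = G p + n *m A3;
  nm_S0 : forall p, `|cS (G p) - (lam * cS p + cT p / 4)| <= e;
  nm_T0 : forall p, `|cT (G p) - psi (cT p)| <= e;
  nm_U0 : forall p, `|cU (G p) - (4 - lam) * cU p| <= e;
  nm_S : forall p q, `|cS (G q) - cS (G p) - (lam * (cS q - cS p) + (cT q - cT p) / 4)|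
    <= e * N (q - p);
  nm_T : forall p q, `|cT (G q) - cT (G p) - (psi (cT q) - psi (cT p))| <= e * N (q - p);
  nm_U : forall p q, `|cU (G q) - cU (G p) - (4 - lam) * (cU q - cU p)| <= e * N (q - p)
}.

(** [hu] and [hs] semiconjugate [G] to multiplications and are close to the functions that
do so for the model. *)
Record leaf_coords G hu hs : Prop := LeafCoords {
  lc_huc : continuous hu;
  lc_hsc : continuous hs;
  lc_huG : forall p, hu (G p) = (4 - lam) * hu p;
  lc_hsG : forall p, hs (G p) = lam * hs p;
  lc_hu : forall p, `|hu p - cU p| <= om;
  lc_hs : forall p, `|hs p - (cS p - al (cT p))| <= 3 * om;
  lc_huP : forall p n, intv n -> hu (p + n) = hu p + cU n;
  lc_hsP : forall p n, intv n -> hs (p + n) = hs p + (cS n - c2 R * cT n)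
}.

Lemma alD_int (t z : R) : z \is a Num.int -> al (t + z) = al t + c2 R * z.
Proof.
move=> /intrP[k ->].
have h (n : nat) x : al (x + n%:R) = al x + c2 R * n%:R.
  elim: n x => [|n IHn] x; first by rewrite !addr0 mulr0 addr0.
  by rewrite -natr1 addrA alD1 IHn mulrDr mulr1 addrA.
case: k => n; first by rewrite h.
rewrite NegzE mulrNz; apply/eqP; rewrite -subr_eq; apply/eqP.
by rewrite -[in RHS](subrK (n.+1%:~R : R) t) h -mulrN opprK.
Qed.

Lemma al_cT_continuous : continuous (fun p => cS p - al (cT p) : R).
Proof.
apply: contB; first exact: cS_continuous.
by apply: cont_comp; [exact: cT_continuous | exact: al_continuous].
Qed.

Lemma om_gt0 : 0 < om. Proof. by rewrite exprn_gt0. Qed.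

(** The defects of [cU] and of [cS - al (cT)] are small, so bounded corrections solve the
twisted equation, over [H] for the expanded one and over [G] for the contracted one. The
corrections are periodic because the bounded solution is unique. *)
Lemma leaf_coords_exist e G H : near_model e G H -> exists hu hs, leaf_coords G hu hs.
Proof.
move=> M.
have l1 := @lam_lt R; have l2 := @lam_gt R; have [e0 eo] := andP (nm_e M).
have l0 : 0 <= lam by lra. have l11 : lam < 1 by lra.
have o0 := om_gt0.
have cGc : continuous (fun q => lam * cU q - cU (H q)).
  apply: contB; first by apply: contM; [exact: cont_cst|exact: cU_continuous].
  by apply: cont_comp; [exact: (nm_Hc M) | exact: cU_continuous].
have cGb q : `|lam * cU q - cU (H q)| <= lam * e.
  have -> : lam * cU q - cU (H q) = lam * (cU (G (H q)) - (4 - lam) * cU (H q)).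
    by rewrite (nm_HG M) mulrBr mulrA lam_inv mul1r.
  by rewrite normrM (ger0_norm l0) ler_wpM2l// (nm_U0 M).
have [Du [Duc Dub Due]] := twisted_equation (nm_HG M) (nm_Gc M) cGc cGb l0 l11.
have sc : continuous (fun p => lam * (cS p - al (cT p)) - (cS (G p) - al (cT (G p)))).
  apply: contB; first by apply: contM; [exact: cont_cst|exact: al_cT_continuous].
  exact: (cont_comp (nm_Gc M) al_cT_continuous).
have sb p : `|lam * (cS p - al (cT p)) - (cS (G p) - al (cT (G p)))| <= e + om.
  have -> : lam * (cS p - al (cT p)) - (cS (G p) - al (cT (G p))) =
    - (cS (G p) - (lam * cS p + cT p / 4)) + (al (cT (G p)) - al (psi (cT p))).
    by rewrite al_psi; ring.
  by rewrite (le_trans (ler_normD _ _))// lerD// ?normrN ?(nm_S0 M)// (nm_al M)// (nm_T0 M).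
have [Ds [Dsc Dsb Dse]] := twisted_equation (nm_GH M) (nm_Hc M) sc sb l0 l11.
have Hper p n : intv n -> H (p + n *m A3) = H p + n.
  by move=> hn; rewrite -{1}(nm_HG M p) -(nm_per M)// (nm_GH M).
have DuP p n : intv n -> Du (p + n) = Du p.
  move=> hn; apply/eqP; rewrite -subr_eq0 -normr_le0.
  apply: (@le0_geometric R _ (2 * (lam * e / (1 - lam))) lam) => // k.
  elim: k p n hn => [|k IHk] p n hn.
    have := Dub p; have := Dub (p + n); rewrite expr0 !ler_norml; move: (_ / _) => b; lra.
  rewrite -(nm_GH M p) -Hper// !Due.
  have -> : lam * Du (G p + n *m A3) + (lam * cU (G p + n *m A3) - cU (H (G p + n *m A3)))
     - (lam * Du (G p) + (lam * cU (G p) - cU (H (G p)))) =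
     lam * (Du (G p + n *m A3) - Du (G p)).
    rewrite Hper// !coordE cU_mulA3.
    have := lam_inv; move: (cU n) (cU (G p)) (cU (H (G p))) (Du _) (Du _) lam => a b c d f l E.
    have : (l * (4 - l) - 1) * a = 0 by rewrite E; ring.
    lra.
  by rewrite normrM (ger0_norm l0) exprS mulrCA ler_wpM2l// IHk//; exact: intv_mulA3.
have DsP p n : intv n -> Ds (p + n) = Ds p.
  move=> hn; apply/eqP; rewrite -subr_eq0 -normr_le0.
  apply: (@le0_geometric R _ (2 * ((e + om) / (1 - lam))) lam) => // k.
  elim: k p n hn => [|k IHk] p n hn.
    have := Dsb p; have := Dsb (p + n); rewrite expr0 !ler_norml; move: (_ / _) => b; lra.
  have [n' hn' ->] := intv_mulA3_surj hn.
  rewrite -(nm_HG M p); set p' := H p; rewrite -(nm_per M)// !Dse.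
  have hT : cT n' \is a Num.int := hn' j2.
  rewrite (nm_per M)// !coordE cS_mulA3 cT_mulA3 !(alD_int _ hT).
  set a := Ds (p' + n'); set b := Ds p'.
  have -> : forall X Y, lam * a + X - (lam * b + Y) = lam * (a - b) + (X - Y) by move=> *; ring.
  rewrite (_ : _ - _ - _ = 0); last first.
    have := c2E R; move: (c2 R) lam => c l E.
    have -> : cT n' / 4 = cT n' * (c * (1 - l)) by rewrite E; ring.
    ring.
  by rewrite addr0 normrM (ger0_norm l0) exprS mulrCA ler_wpM2l// IHk.
have Duo p : `|Du p| <= om.
  apply: le_trans (Dub p) _; rewrite ler_pdivrMr; last by lra.
  have : lam * e <= 27 / 100 * om by apply: ler_pM => //; exact: ltW.
  have : om * (73 / 100) <= om * (1 - lam) by rewrite ler_wpM2l//; lra.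
  by move: o0; clear; lra.
have Dso p : `|Ds p| <= 3 * om.
  apply: le_trans (Dsb p) _; rewrite ler_pdivrMr; last by lra.
  have : om * (73 / 100) <= om * (1 - lam) by rewrite ler_wpM2l//; lra.
  by move: o0 eo; clear; lra.
exists (fun p => cU p + Du p), (fun p => cS p - al (cT p) + Ds p); split.
- exact: contD (@cU_continuous R) Duc.
- exact: contD al_cT_continuous Dsc.
- move=> p; have := Due (G p); rewrite (nm_GH M) => ->.
  have := lam_inv; move: (Du _) (cU p) (cU (G p)) lam => a b c l E.
  have : (l * (4 - l) - 1) * a = 0 by rewrite E; ring.
  have : (l * (4 - l) - 1) * c = 0 by rewrite E; ring.
  lra.
- by move=> p; rewrite Dse; ring.
- by move=> p; rewrite addrAC subrr add0r.
- by move=> p; rewrite addrAC subrr add0r.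
- by move=> p n hn; rewrite DuP// cUD; ring.
- by move=> p n hn; rewrite DsP// cSD cTD alD_int//; [ring | exact: hn].
Qed.

End NearModel.

(** * The levels of the leaf coordinates as graphs *)

Section Fibres.
Variable R : realType.
Local Notation V3 := 'rV[R]_3.
Local Notation psi := (@psi R).
Local Notation dpsi := (@dpsi R).
Local Notation bar := (@bar R).
Local Notation lam := (@lam R).
Local Notation om := (@om R).
Implicit Types (e : R) (G H : V3 -> V3) (hu hs : V3 -> R) (p q n v : V3).

Definition Mx v : R := Num.max `|cS v| `|cT v|.

Lemma cS_le_Mx v : `|cS v| <= Mx v. Proof. by rewrite /Mx le_max lexx. Qed.
Lemma cT_le_Mx v : `|cT v| <= Mx v. Proof. by rewrite /Mx le_max lexx orbT. Qed.
Lemma Mx_ge0 v : 0 <= Mx v. Proof. exact: le_trans (cS_le_Mx v). Qed.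
Lemma Mx_le_add v : Mx v <= `|cS v| + `|cT v|.
Proof. by rewrite /Mx ge_max lerDl lerDr !normr_ge0. Qed.

Lemma psi_lipschitz (x y : R) : `|psi x - psi y| <= 19 / 10 * `|x - y|.
Proof.
wlog xy : x y / y <= x => [hw|].
  by have [/hw//|/ltW/hw] := leP y x; rewrite distrC (distrC y).
have := psi_bounds xy; rewrite (ger0_norm (_ : 0 <= x - y)) ?subr_ge0// => h.
by rewrite ger0_norm; lra.
Qed.

Lemma psi_expand (x y : R) : `|x - y| <= 10 * `|psi x - psi y|.
Proof.
wlog xy : x y / y <= x => [hw|].
  by have [/hw//|/ltW/hw] := leP y x; rewrite distrC (distrC (psi y)).
have := psi_bounds xy; rewrite (ger0_norm (_ : 0 <= x - y)) ?subr_ge0// => h.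
by rewrite ger0_norm; lra.
Qed.

(** The cone around the unstable direction is so wide that the complementary
vectors form a thin neighbourhood of the plane of [cS] and [cT]. *)
Definition flat v := `|cU v| <= (1 / 10) ^+ 4 * Mx v.

Lemma om_le : om <= (1 / 10) ^+ 6.
Proof. by rewrite /om -[13%N]/((6 + 7)%N) exprD ler_piMr ?exprn_ge0// exprn_ile1//; lra. Qed.

Lemma e_le e G H : near_model e G H -> 0 <= e <= (1 / 10) ^+ 6.
Proof. by move/nm_e => /andP[/ltW-> h]; rewrite (le_trans h)// om_le. Qed.

Lemma u_cone_step e G H p q (d := q - p) (d' := G q - G p) : near_model e G H ->
  ~ flat d -> ~ flat d' /\ 3 * `|cU d| <= `|cU d'|.
Proof.
move=> M /negP; rewrite -ltNge => h.
have /andP[e0 e6] := e_le M.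
have l1 := @lam_lt R; have l2 := @lam_gt R.
have hS := nm_S M p q; have hT := nm_T M p q; have hU := nm_U M p q.
have hp := psi_lipschitz (cT q) (cT p).
rewrite -?cSB -?cTB -?cUB -/d -/d' in hS hT hU hp.
have m1 := cS_le_Mx d; have m2 := cT_le_Mx d; have m0 := Mx_ge0 d.
set u := `|cU d| in h *; set m := Mx d in h m1 m2 m0.
have c0 : 0 < (1 / 10) ^+ 4 :> R by rewrite exprn_gt0.
have hN : N d <= 10 ^+ 4 * u.
  have u0 : 0 <= u by exact: normr_ge0.
  by apply: N_le; move: m1 m2 h u0; rewrite -/u; clear; lra.
have heN : e * N d <= 1 / 100 * u.
  apply: le_trans (ler_pM e0 (N_ge0 d) e6 hN) _.
  have : 0 <= u by exact: normr_ge0.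
  by clear; lra.
have U' : 37 / 10 * u <= `|cU d'| + 1 / 100 * u.
  have : `|(4 - lam) * cU d| <= `|cU d'| + 1 / 100 * u.
    have -> : (4 - lam) * cU d = cU d' - (cU d' - (4 - lam) * cU d) by ring.
    by apply: le_trans (ler_normB _ _) _; rewrite lerD2l (le_trans hU).
  rewrite normrM (@ger0_norm _ (4 - lam)) -/u; last by lra.
  apply: le_trans; apply: ler_wpM2r; [exact: normr_ge0 | lra].
have u0 : 0 <= u by exact: normr_ge0.
split; last by move: U' u0; clear; lra.
apply/negP; rewrite -ltNge.
have S' : `|cS d'| <= m + 1 / 100 * u.
  have -> : cS d' = (cS d' - (lam * cS d + cT d / 4)) + (lam * cS d + cT d / 4) by ring.
  apply: le_trans (ler_normD _ _) _; rewrite addrC; apply: lerD; last exact: le_trans heN.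
  apply: le_trans (ler_normD _ _) _; rewrite !normrM (@ger0_norm _ lam); last by lra.
  rewrite (@ger0_norm _ 4^-1)//.
  have : lam * `|cS d| <= 27 / 100 * m by apply: ler_pM => //; lra.
  by move: m2 m0; clear; lra.
have T' : `|cT d'| <= 19 / 10 * m + 1 / 100 * u.
  have -> : cT d' = (cT d' - (psi (cT q) - psi (cT p))) + (psi (cT q) - psi (cT p)) by ring.
  apply: le_trans (ler_normD _ _) _; rewrite addrC; apply: lerD; last exact: le_trans heN.
  by apply: le_trans hp _; rewrite ler_wpM2l.
have : Mx d' <= 19 / 10 * m + 1 / 100 * u.
  by rewrite /Mx ge_max T' (le_trans S')//; move: m0; clear; lra.
move: h U' u0; clear; lra.
Qed.

Lemma lc_iterG G hu hs p k : leaf_coords G hu hs ->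
  hu (iter k G p) = (4 - lam) ^+ k * hu p.
Proof.
move=> C; elim: k => [|k IHk] /=; first by rewrite expr0 mul1r.
by rewrite (lc_huG C) IHk exprS mulrA.
Qed.

(** Outside the thin neighbourhood, [cU (q - p)] would triple at each step, while on a level
of [hu] it stays bounded. *)
Lemma hu_flat e G H hu hs p q : near_model e G H -> leaf_coords G hu hs ->
  hu p = hu q -> flat (q - p).
Proof.
move=> M C hpq; apply: contrapT => nf.
have h k : ~ flat (iter k G q - iter k G p) /\
    3 ^+ k * `|cU (q - p)| <= `|cU (iter k G q - iter k G p)|.
  elim: k => [|k [IH1 IH2]] /=; first by rewrite expr0 mul1r.
  have [h1 h2] := u_cone_step M IH1; split=> //.
  by rewrite exprS -mulrA (le_trans _ h2)// ler_pM2l.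
have b k : `|cU (iter k G q - iter k G p)| <= 2 * om.
  rewrite cUB; have := lc_hu C (iter k G q); have := lc_hu C (iter k G p).
  by rewrite !(lc_iterG _ _ C) hpq !ler_norml; lra.
suff u0 : `|cU (q - p)| <= 0.
  apply: nf; rewrite /flat (le_trans u0)// mulr_ge0 ?Mx_ge0// exprn_ge0//.
apply: (@le0_geometric R _ (2 * om) (1 / 3)); try lra.
move=> k; have [_ h2] := h k; have := le_trans h2 (b k).
by rewrite div1r exprVn ler_pdivlMr ?exprn_gt0// mulrC.
Qed.

Definition same hu hs p q := hu p = hu q /\ hs p = hs q.

Lemma sameH e G H hu hs p q : near_model e G H -> leaf_coords G hu hs ->
  same hu hs p q -> same hu hs (H p) (H q).
Proof.
move=> M C [h1 h2]; have l1 := @lam_lt R; have l2 := @lam_gt R; split.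
  move: h1; rewrite -{1}(nm_HG M p) -{1}(nm_HG M q) !(lc_huG C).
  by apply: mulfI; rewrite gt_eqF//; lra.
move: h2; rewrite -{1}(nm_HG M p) -{1}(nm_HG M q) !(lc_hsG C).
by apply: mulfI; rewrite gt_eqF//; lra.
Qed.

Lemma sameG G hu hs p q : leaf_coords G hu hs ->
  same hu hs p q -> same hu hs (G p) (G q).
Proof. by move=> C [h1 h2]; rewrite /same !(lc_huG C) !(lc_hsG C) h1 h2. Qed.

Lemma flat_N v : flat v -> N v <= `|cS v| + `|cT v|.
Proof.
move=> h; have m0 := Mx_ge0 v; have h1 := normr_ge0 (cS v); have h2 := normr_ge0 (cT v).
apply: N_le; [lra | lra |].
apply: le_trans (Mx_le_add v); apply: le_trans h _.
by rewrite ler_piMl// exprn_ile1//; lra.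
Qed.

Lemma expand_back e G H p q (r : R) (d := q - p) (d' := G q - G p) :
  near_model e G H -> flat d ->
  `|cS d'| <= r -> `|cT d'| <= r -> `|cS d| <= 20 * r /\ `|cT d| <= 20 * r.
Proof.
move=> M /flat_N fN S' T'.
have /andP[e0 e6] := e_le M.
have l1 := @lam_lt R; have l2 := @lam_gt R.
have hS := nm_S M p q; have hT := nm_T M p q.
have hp := psi_expand (cT q) (cT p).
rewrite -?cSB -?cTB -?cUB -/d -/d' in hS hT hp.
have heN : e * N d <= 1 / 1000 * (`|cS d| + `|cT d|).
  by apply: ler_pM => //; [exact: N_ge0 | rewrite (le_trans e6)//; lra].
have s0 := normr_ge0 (cS d); have t0 := normr_ge0 (cT d).
have b1 : `|psi (cT q) - psi (cT p)| <= r + 1 / 1000 * (`|cS d| + `|cT d|).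
  have -> : psi (cT q) - psi (cT p) = cT d' - (cT d' - (psi (cT q) - psi (cT p))) by ring.
  by apply: le_trans (ler_normB _ _) _; apply: lerD => //; exact: le_trans heN.
have b2 : lam * `|cS d| <= r + `|cT d| / 4 + 1 / 1000 * (`|cS d| + `|cT d|).
  have -> : lam * `|cS d| = `|lam * cS d| by rewrite normrM ger0_norm//; lra.
  have -> : lam * cS d = cS d' - cT d / 4 - (cS d' - (lam * cS d + cT d / 4)) by ring.
  apply: le_trans (ler_normB _ _) _; apply: lerD; last exact: le_trans heN.
  apply: le_trans (ler_normB _ _) _; apply: lerD => //.
  by rewrite normrM (@ger0_norm _ 4^-1).
have b3 : 26 / 100 * `|cS d| <= lam * `|cS d| by rewrite ler_wpM2r// ltW.
move: b1 b2 b3 hp s0 t0; clear; lra.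
Qed.

Lemma cone_pair e G H p q (d := q - p) (d' := G q - G p) : near_model e G H ->
  flat d -> `|cT d| <= (1 / 10) ^+ 6 ->
  cone_image (diagS (cT p)) ((1 / 10) ^+ 4) (off (cT p)) (diagT (cT p))
    (cS d) (cT d - bar (cT p) * cS d) (cS d') (cT d' - bar (cT (G p)) * cS d').
Proof.
move=> M /flat_N fN hT6.
have /andP[e0 e6] := e_le M.
have hS := nm_S M p q; have hT := nm_T M p q.
have hp := psi_linearization (cT p) (cT d).
rewrite -?cSB -?cTB -?cUB -/d -/d' in hS hT.
have heN : e * N d <= (1 / 10) ^+ 6 * (`|cS d| + `|cT d|).
  by apply: ler_pM => //; exact: N_ge0.
apply: cone_matrix => //.
- exact: le_trans heN.
- have e2 : cT p + cT d = cT q by rewrite -cTD /d addrC subrK.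
  rewrite e2 in hp.
  have -> : cT d' - dpsi (cT p) * cT d = (cT d' - (psi (cT q) - psi (cT p)))
    + (psi (cT q) - psi (cT p) - dpsi (cT p) * cT d) by ring.
  apply: le_trans (ler_normD _ _) _; apply: lerD => //; exact: le_trans heN.
- exact: le_trans (nm_T0 M p) e6.
Qed.

(** The two points are displaced along the complement of the center cone;
[sg] is the sign of the [cS]-displacement. *)
Definition wide sg p q (d := q - p) : Prop :=
  0 < sg * cS d /\ sg * (cT d - bar (cT p) * cS d) < 0.

(** Through [cone_pair] this is [cone_image_back]. *)
Lemma wide_back e G H (sg : R) p q (d := q - p) (d' := G q - G p) :
  near_model e G H -> sg = 1 \/ sg = -1 ->
  flat d -> `|cT d| <= (1 / 10) ^+ 6 -> wide sg (G p) (G q) ->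
  [/\ wide sg p q, sg * cS d' <= 7 / 10 * (sg * cS d),
      `|cS d'| <= 10 * (sg * cS d) & `|cT d'| <= 10 * (sg * cS d)].
Proof.
move=> M hsg f h6 [w1 w2].
have ci := cone_pair M f h6; rewrite -/d -/d' in ci w1 w2 *.
have bb := bar_bound (cT (G p)); move: (bar (cT (G p))) bb ci w2 => b' bb ci w2.
have ci2 : cone_image (diagS (cT p)) ((1 / 10) ^+ 4) (off (cT p)) (diagT (cT p))
    (sg * cS d) (sg * (cT d - bar (cT p) * cS d)) (sg * cS d')
    (sg * (cT d' - b' * cS d')).
  have [->|->] := hsg.
    by rewrite (mul1r (cS d)) (mul1r (cS d')) (mul1r (cT d - _)) (mul1r (cT d' - _)).
  by rewrite !mulN1r; exact: cone_imageN.
have [c1 c2 c3 c4] := cone_image_back (positive_entries_cone _) ci2 w1 w2.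
have n' : `|cS d'| = sg * cS d'.
  rewrite -(gtr0_norm w1) normrM.
  by case: hsg => ->; rewrite ?normrN normr1 mul1r.
split=> //; first by rewrite n'; move: c1 c3; clear; lra.
have -> : `|cT d'| = `|sg * (cT d' - b' * cS d') + b' * (sg * cS d')|.
  have -> : sg * (cT d' - b' * cS d') + b' * (sg * cS d') = sg * cT d' by ring.
  by rewrite normrM; case: hsg => ->; rewrite ?normrN normr1 mul1r.
apply: le_trans (ler_normD _ _) _; rewrite (ltr0_norm w2) normrM (gtr0_norm w1).
have : `|b'| * (sg * cS d') <= 2 * (7 / 10 * (sg * cS d)).
  by apply: ler_pM => //; [exact: ltW | rewrite ler_norml; lra].
by move: c4 c1; clear; lra.
Qed.

(** [hs] is close to the function [S - al T] of the model, which varies by a definite amount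
along a wide displacement. *)
Lemma wide_gap G hu hs (sg : R) p q (d := q - p) : leaf_coords G hu hs ->
  sg = 1 \/ sg = -1 -> hs p = hs q -> `|cS d| <= 1 / 100 -> wide sg p q ->
  sg * cS d <= 24 * om.
Proof.
move=> C hsg hpq s1 [w1 w2]; rewrite -/d in w1 w2.
have hp := lc_hs C p; have hq := lc_hs C q; rewrite hpq in hp.
have eS : cS q = cS p + cS d by rewrite cSB; ring.
have eT : cT q = cT p + cT d by rewrite cTB; ring.
rewrite eS eT in hq.
case: hsg => sgE; rewrite sgE in w1 w2 *.
  rewrite !mul1r in w1 w2 *.
  have := @al_gap R (cS d) (cT d) (cT p) w1; rewrite (le_trans (ler_norm _) s1) => /(_ isT).
  rewrite -subr_le0 (ltW w2) => /(_ isT).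
  by move: hp hq; rewrite !ler_norml; clear; lra.
rewrite !mulN1r in w1 w2 *.
have c : - cT d <= bar (cT p) * - cS d by rewrite mulrN; move: w2; clear; lra.
have := @al_gapN R (- cS d) (- cT d) (cT p) w1; rewrite opprK.
rewrite (le_trans (ler_norm _)) ?normrN// => /(_ isT c).
by move: hp hq; rewrite !ler_norml; clear; lra.
Qed.

(** Going back, a wide displacement of two points of a common level grows at a definite rate,
whereas [wide_gap] keeps it below a multiple of [om]. This is where an error [om] far below
the scale of the displacements is essential: at each step the bound on the size of the
displacement is restored, which makes the induction run. *)
Lemma not_wide e G H hu hs (sg : R) p q : near_model e G H -> leaf_coords G hu hs ->
  sg = 1 \/ sg = -1 -> same hu hs p q ->
  `|cS (q - p)| <= (1 / 10) ^+ 9 -> `|cT (q - p)| <= (1 / 10) ^+ 9 -> ~ wide sg p q.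
Proof.
move=> M C hsg.
have step p' q' : same hu hs p' q' -> `|cS (q' - p')| <= (1 / 10) ^+ 9 ->
    `|cT (q' - p')| <= (1 / 10) ^+ 9 -> wide sg p' q' ->
    [/\ same hu hs (H p') (H q'), `|cS (H q' - H p')| <= (1 / 10) ^+ 9,
     `|cT (H q' - H p')| <= (1 / 10) ^+ 9, wide sg (H p') (H q') &
     sg * cS (q' - p') <= 7 / 10 * (sg * cS (H q' - H p'))].
  move=> s0 a b w.
  have s1 := sameH M C s0; have s2 := sameH M C s1.
  have f1 := hu_flat M C s1.1; have f2 := hu_flat M C s2.1.
  have := expand_back M f1; rewrite !(nm_HG M) => /(_ _ a b) [a1 b1].
  have := expand_back M f2; rewrite !(nm_HG M) => /(_ _ a1 b1) [a2 b2].
  have r1 : 20 * (1 / 10) ^+ 9 <= (1 / 10) ^+ 6 :> R by lra.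
  have r2 : 20 * (20 * (1 / 10) ^+ 9) <= (1 / 10) ^+ 6 :> R by lra.
  have r3 : (1 / 10) ^+ 6 <= 1 / 100 :> R by lra.
  have := @wide_back _ _ _ sg (H p') (H q') M hsg f1 (le_trans b1 r1).
  rewrite !(nm_HG M) => /(_ w) [w1 g1 _ _].
  have := @wide_back _ _ _ sg (H (H p')) (H (H q')) M hsg f2 (le_trans b2 r2).
  rewrite !(nm_HG M) => /(_ w1) [w2 g2 c2 d2].
  have g := wide_gap C hsg s2.2 (le_trans (le_trans a2 r2) r3) w2.
  (* By [wide_gap] the [S]-displacement of the second preimages is at most [24 * om]; one step
  forward multiplies displacements by at most 10. *)
  have r4 : 10 * (24 * om) <= (1 / 10) ^+ 9 by rewrite /om; lra.
  by split=> //; apply: le_trans r4; [apply: le_trans c2 _|apply: le_trans d2 _];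
     rewrite ler_pM2l.
move=> s0 a b w.
have h k : exists p' q', [/\ same hu hs p' q', `|cS (q' - p')| <= (1 / 10) ^+ 9,
     `|cT (q' - p')| <= (1 / 10) ^+ 9, wide sg p' q' &
     sg * cS (q - p) <= (7 / 10) ^+ k * (sg * cS (q' - p'))].
  elim: k => [|k [p' [q' [s1 a1 b1 w1 g1]]]].
    by exists p, q; split=> //; rewrite expr0 mul1r.
  have [s2 a2 b2 w2 g2] := step _ _ s1 a1 b1 w1.
  exists (H p'), (H q'); split=> //; apply: le_trans g1 _.
  by rewrite exprSr -mulrA ler_wpM2l// exprn_ge0//; lra.
case: w => w1 _; move: w1; rewrite ltNge => /negP; apply.
apply: (@le0_geometric R _ ((1 / 10) ^+ 9) (7 / 10)); try lra.
move=> k; have [p' [q' [_ a1 _ [w1 _] g]]] := h k.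
apply: le_trans g _; rewrite [leRHS]mulrC; apply: ler_wpM2l; first by rewrite exprn_ge0.
apply: le_trans a1; rewrite -(gtr0_norm w1) normrM.
by case: hsg => ->; rewrite ?normrN normr1 mul1r.
Qed.

Lemma fibre_quadrant e G H hu hs p q (d := q - p) : near_model e G H -> leaf_coords G hu hs ->
  same hu hs p q -> `|cS d| <= (1 / 10) ^+ 9 -> `|cT d| <= (1 / 10) ^+ 9 ->
  0 <= cS d * (cT d - bar (cT p) * cS d).
Proof.
move=> M C s a b.
have n1 := not_wide M C (or_introl erefl) s a b.
have n2 := not_wide M C (or_intror erefl) s a b.
rewrite leNgt; apply/negP => h.
have [s0|s0|s0] := ltgtP (cS d) 0.
- apply: n2; rewrite /wide -/d !mulN1r oppr_gt0 oppr_lt0; split=> //.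
  by move: h; rewrite nmulr_rlt0.
- apply: n1; rewrite /wide -/d !mul1r; split=> //.
  by move: h; rewrite pmulr_rlt0.
- by move: h; rewrite s0 mul0r ltxx.
Qed.

(** The image of the center cone avoids the vertical direction, since its second edge has
been turned by the entry [1 / 4]. *)
Lemma image_slope (b dp S T S' T' : R) :
  - (17 / 100) <= b <= 164 / 100 -> 1 / 10 <= dp <= 19 / 10 ->
  0 <= S * (T - b * S) ->
  `|S' - (lam * S + T / 4)| <= (1 / 10) ^+ 4 * (`|S| + `|T|) ->
  `|T' - dp * T| <= (1 / 10) ^+ 4 * (`|S| + `|T|) -> `|T'| <= 10 * `|S'|.
Proof.
move=> hb hdp; have l1 := @lam_lt R; have l2 := @lam_gt R.
have key (s t s' t' : R) : 0 <= s -> - (17 / 100) * s <= t ->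
  `|s' - (lam * s + t / 4)| <= (1 / 10) ^+ 4 * (`|s| + `|t|) ->
  `|t' - dp * t| <= (1 / 10) ^+ 4 * (`|s| + `|t|) -> `|t'| <= 10 * `|s'|.
  move=> s0 ts; rewrite (ger0_norm s0).
  have ls : 26 / 100 * s <= lam * s by rewrite ler_wpM2r// ltW.
  have [t0|/ltW t0] := leP 0 t.
    rewrite (ger0_norm t0) => h1 h2.
    have p1 : 1 / 10 * t <= dp * t by rewrite ler_wpM2r//; move: hdp; clear; lra.
    have p2 : dp * t <= 19 / 10 * t by rewrite ler_wpM2r//; move: hdp; clear; lra.
    have s'0 : 25 / 100 * s + 24 / 100 * t <= s'.
      by move: h1; rewrite ler_norml; move: ls s0 t0; clear; lra.
    rewrite (@ger0_norm _ s'); last by move: s'0 s0 t0; clear; lra.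
    by move: h2; rewrite !ler_norml; move: p1 p2 s'0 s0 t0; clear; lra.
  rewrite (ler0_norm t0) => h1 h2.
  have p1 : 19 / 10 * t <= dp * t.
    by rewrite -!(mulrC t); apply: ler_wnM2l => //; move: hdp; clear; lra.
  have p2 : dp * t <= 0 by rewrite mulr_ge0_le0//; move: hdp; clear; lra.
  have s'0 : 20 / 100 * s <= s'.
    by move: h1; rewrite ler_norml; move: ls s0 t0 ts; clear; lra.
  rewrite (@ger0_norm _ s'); last by move: s'0 s0 t0; clear; lra.
  by move: h2; rewrite !ler_norml; move: p1 p2 s'0 s0 t0 ts; clear; lra.
move=> q h1 h2.
have key2 : 0 <= S -> - (17 / 100) * S <= T -> `|T'| <= 10 * `|S'| by move=> a c; exact: (key S T).
have key3 : 0 <= - S -> - (17 / 100) * - S <= - T -> `|T'| <= 10 * `|S'|.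
  move=> a c; rewrite -(normrN T') -(normrN S'); apply: (key (- S) (- T)) => //; rewrite !normrN.
    by rewrite (_ : _ - _ = - (S' - (lam * S + T / 4))) ?normrN//; field.
  by rewrite (_ : _ - _ = - (T' - dp * T)) ?normrN//; ring.
have [s0|s0|s0] := ltgtP S 0.
- apply: key3; first by rewrite oppr_ge0 ltW.
  have : T - b * S <= 0 by move: q; rewrite nmulr_rge0.
  have : - S * b <= - S * (164 / 100) by apply: ler_wpM2l; [rewrite oppr_ge0 ltW | lra].
  have : - S * (- (17 / 100)) <= - S * b by apply: ler_wpM2l; [rewrite oppr_ge0 ltW | lra].
  by clear; lra.
- apply: key2; first exact: ltW.
  have : 0 <= T - b * S by move: q; rewrite pmulr_rge0.
  have : S * (- (17 / 100)) <= S * b by apply: ler_wpM2l; [exact: ltW | lra].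
  by clear; lra.
- have [t0|/ltW t0] := leP 0 T; [apply: key2|apply: key3]; rewrite s0 ?oppr0 ?mulr0//.
  by rewrite oppr_ge0.
Qed.

Lemma image_pair_slope e G H p q (d := q - p) (d' := G q - G p) : near_model e G H ->
  flat d -> `|cT d| <= (1 / 10) ^+ 6 -> 0 <= cS d * (cT d - bar (cT p) * cS d) ->
  `|cT d'| <= 10 * `|cS d'|.
Proof.
move=> M /flat_N fN hT6 hq.
have /andP[e0 e6] := e_le M.
have hS := nm_S M p q; have hT := nm_T M p q.
have hp := psi_linearization (cT p) (cT d).
rewrite -?cSB -?cTB -?cUB -/d -/d' in hS hT.
have heN : e * N d <= (1 / 10) ^+ 6 * (`|cS d| + `|cT d|).
  by apply: ler_pM => //; exact: N_ge0.
have n0 : 0 <= `|cS d| + `|cT d| by rewrite addr_ge0.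
apply: (@image_slope (bar (cT p)) (dpsi (cT p)) (cS d) (cT d)) => //.
- exact: bar_bound.
- exact: dpsi_bound.
- by apply: le_trans hS _; apply: le_trans heN _; move: n0; clear; lra.
- have e2 : cT p + cT d = cT q by rewrite -cTD /d addrC subrK.
  rewrite e2 in hp.
  have -> : cT d' - dpsi (cT p) * cT d = (cT d' - (psi (cT q) - psi (cT p)))
    + (psi (cT q) - psi (cT p) - dpsi (cT p) * cT d) by ring.
  apply: le_trans (ler_normD _ _) _.
  have T2 : 8 * cT d ^+ 2 <= 8 * (1 / 10) ^+ 6 * `|cT d|.
    rewrite -mulrA ler_pM2l// -real_normK ?num_real// expr2.
    by rewrite ler_wpM2r.
  have := normr_ge0 (cS d); have := normr_ge0 (cT d).
  by move: hT heN hp T2; clear; lra.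
Qed.

(** The center cone contains the vertical; its image does not. So the two points are replaced
by their preimages, whose difference lies in the cone by [fibre_quadrant]. *)
Lemma fibre_slope e G H hu hs p q : near_model e G H -> leaf_coords G hu hs ->
  same hu hs p q -> `|cS (q - p)| <= (1 / 10) ^+ 11 -> `|cT (q - p)| <= (1 / 10) ^+ 11 ->
  `|cT (q - p)| <= 10 * `|cS (q - p)|.
Proof.
move=> M C s a b.
have s1 := sameH M C s.
have f1 := hu_flat M C s1.1.
have := expand_back M f1; rewrite !(nm_HG M) => /(_ _ a b) [a1 b1].
have r1 : 20 * (1 / 10) ^+ 11 <= (1 / 10) ^+ 9 :> R by lra.
have r2 : 20 * (1 / 10) ^+ 11 <= (1 / 10) ^+ 6 :> R by lra.
have := fibre_quadrant M C s1 (le_trans a1 r1) (le_trans b1 r1).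
by move=> /(image_pair_slope M f1 (le_trans b1 r2)); rewrite !(nm_HG M).
Qed.

Lemma al_expand (x y : R) : `|x - y| <= 8 * `|al x - al y|.
Proof.
wlog xy : x y / y <= x => [hw|].
  by have [/hw//|/ltW/hw] := leP y x; rewrite distrC (distrC (al y)).
have := al_ge xy; rewrite (ger0_norm (_ : 0 <= x - y)) ?subr_ge0// => h.
by rewrite ger0_norm; lra.
Qed.

(** Two points of a level over the same point of the [S]-axis are close, since [hs] is close to
[S - al T] and [al] expands distances up to a factor; then [fibre_slope] applies. *)
Lemma fibre_inj e G H hu hs p q : near_model e G H -> leaf_coords G hu hs ->
  same hu hs p q -> cS p = cS q -> p = q.
Proof.
move=> M C s pq.
have d0 : cS (q - p) = 0 by rewrite cSB pq subrr.
have hT : `|cT (q - p)| <= (1 / 10) ^+ 11.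
  rewrite cTB; apply: le_trans (al_expand _ _) _.
  have hal : `|al (cT q) - al (cT p)| <= 6 * om.
    by have := lc_hs C p; have := lc_hs C q; rewrite s.2 pq !ler_norml; clear; lra.
  by move: hal; rewrite /om; clear; lra.
have hS : `|cS (q - p)| <= (1 / 10) ^+ 11 by rewrite d0 normr0 exprn_ge0.
have := fibre_slope M C s hS hT; rewrite d0 normr0 mulr0 => T0.
have T0' : cT (q - p) = 0 by apply/eqP; rewrite -normr_le0.
have := hu_flat M C s.1; rewrite /flat /Mx d0 T0' normr0 maxxx mulr0 => U0.
apply/esym/eqP; rewrite -subr_eq0; apply/eqP; apply: coords_inj; rewrite ?d0 ?T0' ?raddf0//.
by apply/eqP; rewrite -normr_le0.
Qed.

Lemma mk_continuous (X : topologicalType) (a b c : X -> R) :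
  continuous a -> continuous b -> continuous c ->
  continuous (fun x => mk (a x) (b x) (c x)).
Proof. by move=> ha hb hc x; apply: mk_cvg; [exact: ha|exact: hb|exact: hc]. Qed.

Lemma hu_solve G hu hs (s t c : R) : leaf_coords G hu hs -> exists u, hu (mk s t u) = c.
Proof.
move=> C.
have cf : continuous (fun u : R => hu (mk s t u)).
  apply: cont_comp (lc_huc C); apply: mk_continuous; try exact: cont_cst.
  by move=> x.
have o1 : om <= 1 by rewrite /om; lra.
have h u := lc_hu C (mk s t u).
have [|||u _ <-] := @IVT R (fun u : R => hu (mk s t u)) (c - 1) (c + 1) c; last by exists u.
- lra.
- exact: continuous_subspaceT.
have := h (c - 1); have := h (c + 1); rewrite !cU_mk !ler_norml => h1 h2.
by rewrite min_l ?max_r; lra.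
Qed.

(** The height of the level over the point [(s, t)] is a continuous function of [t] because the
level is flat. *)
Lemma hu_level e G H hu hs (s c : R) : near_model e G H -> leaf_coords G hu hs ->
  exists2 f : R -> R, continuous f & forall t, hu (mk s t (f t)) = c.
Proof.
move=> M C; have /choice[f hf] := fun t => hu_solve s t c C.
exists f => // t; apply: continuous_eps => e0 e0p.
apply: filterS (near_norm_lt t e0p) => t' tt'.
have := hu_flat M C (etrans (hf t') (esym (hf t))).
rewrite /flat /Mx cSB cTB cUB !cS_mk !cT_mk !cU_mk subrr normr0 max_r// => h.
apply: le_lt_trans h _; apply: le_lt_trans tt'.
by rewrite ler_piMl// exprn_ile1//; lra.
Qed.

(** On the curve where [hu = c] and [cS = s], the function [hs] is close to [s - al (cT)] and
therefore takes all values. *)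
Lemma fibre_surj e G H hu hs (s c d : R) : near_model e G H -> leaf_coords G hu hs ->
  exists p, [/\ cS p = s, hu p = c & hs p = d].
Proof.
move=> M C; have [f fc hf] := hu_level s c M C.
have cg : continuous (fun t : R => hs (mk s t (f t))).
  apply: cont_comp (lc_hsc C); apply: mk_continuous => //; first exact: cont_cst.
  by move=> x.
have o1 : om <= 1 / 10 by rewrite /om; lra.
have k1 := @c2_gt R.
have h t := lc_hs C (mk s t (f t)).
(* The margin 3 exceeds the deviation 1 of [al] from its linear part, plus the error of [hs]. *)
pose a := (s - d - 3) / c2 R; pose b := (s - d + 3) / c2 R.
have ea : c2 R * a = s - d - 3 by rewrite /a mulrC divfK// gt_eqF//; lra.
have eb : c2 R * b = s - d + 3 by rewrite /b mulrC divfK// gt_eqF//; lra.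
have [|||t _ ht] := @IVT R (fun t : R => hs (mk s t (f t))) a b d; last first.
- by exists (mk s t (f t)); split=> //; rewrite cS_mk.
- have := h a; have := h b; rewrite !cS_mk !cT_mk.
  have := al_near a; have := al_near b; rewrite ea eb !ler_norml => h1 h2 h3 h4.
  by rewrite min_r ?max_l; lra.
- exact: continuous_subspaceT.
- have c0 : 0 < c2 R by move: k1; clear; lra.
  by rewrite -(ler_pM2l c0) ea eb; clear; lra.
Qed.

End Fibres.

(** * Leaves and curves in the attracting torus *)

Section CenterCurves.
Variable R : realType.

Lemma contNorm (X : topologicalType) (f : X -> R) :
  continuous f -> continuous (fun x => `|f x|).
Proof. by move=> hf x; apply: cvg_norm; exact: hf. Qed.

Lemma iter_continuous (X : topologicalType) (f : X -> X) k :
  continuous f -> continuous (iter k f).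
Proof.
move=> fc; elim: k => [|k IHk] /=; first by move=> x.
exact: (cont_comp IHk fc).
Qed.

Local Notation V3 := 'rV[R]_3.
Local Notation psi := (@psi R).
Local Notation dpsi := (@dpsi R).
Local Notation bar := (@bar R).
Local Notation lam := (@lam R).
Local Notation om := (@om R).
Implicit Types (e : R) (G H : V3 -> V3) (hu hs : V3 -> R) (p q n v : V3).

Lemma N_continuous p : continuous (fun q => N (q - p)).
Proof.
apply: (@lipschitz_continuous _ _ 1) => a b; rewrite mul1r ler_norml.
have := ND (a - b) (b - p); have := ND (b - a) (a - p).
by rewrite !addrA !subrK -(NN (a - b)) opprB; lra.
Qed.

Lemma closed_N_ge p (a : R) : closed [set q | a <= N (q - p)].
Proof.
rewrite (_ : [set _ | _] = (fun q => N (q - p)) @^-1` [set x | a <= x])//.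
by apply: preimage_closed; [move=> q _; exact: N_continuous | exact: closed_ge].
Qed.

Lemma closed_N_le p (a : R) : closed [set q | N (q - p) <= a].
Proof.
rewrite (_ : [set _ | _] = (fun q => N (q - p)) @^-1` [set x | x <= a])//.
by apply: preimage_closed; [move=> q _; exact: N_continuous | exact: closed_le].
Qed.

Lemma compact_shell p (a b : R) : compact [set q | a <= N (q - p) <= b].
Proof.
apply: bounded_closed_compact.
  exists (`|p| + 3 * b); split; first exact: num_real.
  move=> x bx q /= /andP[_ h]; apply: le_trans (ltW bx).
  rewrite -(subrK p q) addrC; apply: le_trans (ler_normD _ _) _; rewrite lerD2l.
  by apply: le_trans (norm_le_N _) _; rewrite ler_pM2l.
rewrite (_ : [set _ | _] = [set q | a <= N (q - p)] `&` [set q | N (q - p) <= b]).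
  by apply: closedI; [exact: closed_N_ge | exact: closed_N_le].
by apply/seteqP; split => q /=; [move/andP | move=> [-> ->]].
Qed.

(** On a compact shell around [p] the injective map [(cS, hu, hs)] stays away from its value at
[p]; outside of the shell, it differs by much, because [hu] and [hs] are close to those of
the model. *)
Lemma fibre_near e G H hu hs p (a : R) : near_model e G H -> leaf_coords G hu hs ->
  0 < a -> exists2 d : R, 0 < d & forall q, `|cS q - cS p| < d -> `|hu q - hu p| < d ->
   `|hs q - hs p| < d -> N (q - p) < a.
Proof.
move=> M C a0.
pose m q := `|cS q - cS p| + `|hu q - hu p| + `|hs q - hs p|.
have mc : continuous m.
  apply: contD; first apply: contD.
  - by apply: contNorm; apply: contB; [exact: cS_continuous|exact: cont_cst].
  - by apply: contNorm; apply: contB; [exact: (lc_huc C)|exact: cont_cst].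
  - by apply: contNorm; apply: contB; [exact: (lc_hsc C)|exact: cont_cst].
have coarse q : m q <= 1 / 100 -> N (q - p) <= 1.
  have o1 : om <= 1 / 100 by rewrite /om; lra.
  have := normr_ge0 (cS q - cS p); have := normr_ge0 (hu q - hu p).
  have := normr_ge0 (hs q - hs p); rewrite /m => n1 n2 n3 h.
  have hS : `|cS q - cS p| <= 1 / 100 by lra.
  have hU : `|hu q - hu p| <= 1 / 100 by lra.
  have hs' : `|hs q - hs p| <= 1 / 100 by lra.
  clear n1 n2 n3 h; apply: N_le; rewrite ?cSB ?cTB ?cUB.
  - by apply: le_trans hS _; lra.
  - apply: le_trans (al_expand _ _) _.
    have : `|al (cT q) - al (cT p)| <= 1 / 10.
      move: hS hs' (lc_hs C p) (lc_hs C q) o1; rewrite !ler_norml; clear; lra.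
    by clear; lra.
  - move: hU (lc_hu C p) (lc_hu C q) o1; rewrite !ler_norml; clear; lra.
have [K0|/existsNP[q0 /contrapT hq0]] := pselect (forall q, ~ (a <= N (q - p) <= 1)).
  exists (1 / 300); first by lra.
  move=> q h1 h2 h3; rewrite ltNge; apply/negP => h; apply: (K0 q); rewrite h /=.
  by apply: coarse; rewrite /m; lra.
have [q1 q1in q1min] : exists2 q, q \in [set q | a <= N (q - p) <= 1] &
    forall t, t \in [set q | a <= N (q - p) <= 1] -> m q <= m t.
  apply: compact_EVT_min; first by exists q0.
    exact: compact_shell.
  exact: continuous_subspaceT.
have m0 : 0 < m q1.
  rewrite lt0r; apply/andP; split; last by rewrite !addr_ge0.
  apply/negP => /eqP m0; move: q1in; rewrite inE /= => /andP[+ _].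
  have := normr_ge0 (cS q1 - cS p); have := normr_ge0 (hu q1 - hu p).
  have := normr_ge0 (hs q1 - hs p) => n1 n2 n3.
  have e1 : cS q1 = cS p.
    by apply/eqP; rewrite -subr_eq0 -normr_le0; move: m0; rewrite /m; lra.
  have e2 : hu q1 = hu p.
    by apply/eqP; rewrite -subr_eq0 -normr_le0; move: m0; rewrite /m; lra.
  have e3 : hs q1 = hs p.
    by apply/eqP; rewrite -subr_eq0 -normr_le0; move: m0; rewrite /m; lra.
  rewrite (fibre_inj M C (conj e2 e3) e1) subrr.
  have -> : N (0 : V3) = 0 by rewrite /N !raddf0 normr0 !maxxx.
  by rewrite leNgt a0.
exists (Num.min (1 / 300) (m q1 / 3)).
  by rewrite lt_min; apply/andP; split; apply: divr_gt0; rewrite ?ltr01 ?ltr0n.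
move=> q; rewrite !lt_min => /andP[h1 h1'] /andP[h2 h2'] /andP[h3 h3'].
rewrite ltNge; apply/negP => h.
have : m q1 <= m q.
  apply: q1min; rewrite inE /= h /=; apply: coarse; rewrite /m; move: h1 h2 h3; clear; lra.
by rewrite leNgt => /negP; apply; rewrite /m; move: h1' h2' h3'; rewrite /m; clear; lra.
Qed.

Definition vec2 (a b : R) : 'rV[R]_2 := \row_(j < 2) [:: a; b]`_j.

Lemma vec2E a b : (vec2 a b ord0 ord0 = a) * (vec2 a b ord0 (lift ord0 ord0) = b).
Proof. by rewrite /vec2 !mxE. Qed.

Lemma vec2_eta (y : 'rV[R]_2) : vec2 (y ord0 ord0) (y ord0 (lift ord0 ord0)) = y.
Proof.
apply/rowP => -[[|[|//]] hi].
- by rewrite (_ : Ordinal hi = ord0) ?vec2E//; exact: val_inj.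
- by rewrite (_ : Ordinal hi = lift ord0 ord0) ?vec2E//; exact: val_inj.
Qed.

Definition lev (hu hs : V3 -> R) p : 'rV[R]_2 := vec2 (hu p) (hs p).

Lemma lev_same hu hs p q : lev hu hs p = lev hu hs q <-> same hu hs p q.
Proof.
split=> [h|[h1 h2]]; last by rewrite /lev h1 h2.
have h1 := congr1 (fun y : 'rV_2 => y ord0 ord0) h.
have h2 := congr1 (fun y : 'rV_2 => y ord0 (lift ord0 ord0)) h.
by rewrite /= /lev !vec2E in h1 h2.
Qed.

(** The graphs [Psi (-, y)] over the [S]-axis are the lifted leaves; that they depend
continuously on [y] is [fibre_near]. *)
Lemma leaf_chart_exists e G H hu hs : near_model e G H -> leaf_coords G hu hs ->
  exists Psi : R * 'rV[R]_2 -> V3,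
    [/\ continuous Psi, forall s y, cS (Psi (s, y)) = s,
      forall s y, lev hu hs (Psi (s, y)) = y & forall p, Psi (cS p, lev hu hs p) = p].
Proof.
move=> M C.
have /choice[Psi hPsi] : forall z : R * 'rV[R]_2, exists p, cS p = z.1 /\ lev hu hs p = z.2.
  move=> [s y]; have [p [h1 h2 h3]] := fibre_surj s (y ord0 ord0) (y ord0 (lift ord0 ord0)) M C.
  by exists p; split=> //=; rewrite /lev h2 h3 vec2_eta.
have PsiS s y : cS (Psi (s, y)) = s by have [] := hPsi (s, y).
have PsiL s y : lev hu hs (Psi (s, y)) = y by have [] := hPsi (s, y).
exists Psi; split=> // [|p]; last first.
  by apply: (fibre_inj M C); rewrite ?PsiS//; apply/lev_same; rewrite PsiL.
move=> [s y]; apply: cvg_N => a a0.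
have [d d0 hd] := fibre_near (Psi (s, y)) M C a0.
have near_prod : nbhs ((s, y) : R * 'rV[R]_2)
    ([set s' | `|s - s'| < d] `*` [set y' | `|y - y'| < d]).
  exists ([set s' | `|s - s'| < d], [set y' | `|y - y'| < d]) => //=.
  split; first exact: (@near_norm_lt R R s d d0).
  exact: (@near_norm_lt R 'rV[R]_2 y d d0).
apply: filterS near_prod => -[s' y'] [/= h1 h2].
have co (i : 'I_2) : `|(y - y') ord0 i| < d.
  apply: le_lt_trans h2; rewrite [leRHS]mx_normrE.
  exact: (le_bigmax_cond 0 (fun ij : 'I_1 * 'I_2 => `|(y - y') ij.1 ij.2|) (j := (ord0, i)) isT).
have eu z w : hu (Psi (z, w)) = w ord0 ord0.
  by rewrite -[in RHS](PsiL z w) /lev vec2E.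
have es z w : hs (Psi (z, w)) = w ord0 (lift ord0 ord0).
  by rewrite -[in RHS](PsiL z w) /lev vec2E.
apply: hd; rewrite ?PsiS ?eu ?es distrC //.
- by have := co ord0; rewrite !mxE.
- by have := co (lift ord0 ord0); rewrite !mxE.
Qed.

(** Displacements between nearby points related by [Rel] stay in the center cone
along the whole orbit. *)
Record center_rel G H (Rel : V3 -> V3 -> Prop) : Prop := CenterRel {
  cr_G : forall p q, Rel p q -> Rel (G p) (G q);
  cr_H : forall p q, Rel p q -> Rel (H p) (H q);
  cr_cone : exists2 r : R, 0 < r & forall p q, Rel p q -> N (q - p) <= r ->
    [/\ flat (q - p), `|cT (q - p)| <= 10 * `|cS (q - p)| &
        0 <= cS (q - p) * (cT (q - p) - bar (cT p) * cS (q - p))]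
}.

Lemma center_rel_fibre e G H hu hs : near_model e G H -> leaf_coords G hu hs ->
  center_rel G H (same hu hs).
Proof.
move=> M C; split=> [p q|p q|]; [exact: sameG|exact: (sameH M C)|].
exists ((1 / 10) ^+ 11); first by rewrite exprn_gt0.
have r9 : (1 / 10) ^+ 11 <= (1 / 10) ^+ 9 :> R by lra.
move=> p q s h; have hS := le_trans (cS_le_N _) h; have hT := le_trans (cT_le_N _) h.
split; first exact: (hu_flat M C s.1).
- exact: (fibre_slope M C s).
- by apply: (fibre_quadrant M C s); exact: le_trans r9.
Qed.

(** The invariant set that replaces the attracting torus. Forward orbits that start near the
torus stay there, so only the backward ones impose a condition. *)
Definition torus_set H p := forall k, `|cT (iter k H p)| <= 1 / 20.

Lemma dpsi_trap (t : R) : `|t| <= 1 / 20 -> dpsi t <= 1 / 5.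
Proof.
move=> ht; rewrite dpsiE; have := cos_ge_quadratic (2 * pi * t).
have p4 : pi <= 4 :> R by have := pihalf_lt2 R; lra.
have p0 := pi_ge0 R.
have : (2 * pi * t) ^+ 2 <= (4 / 10) ^+ 2.
  rewrite -real_normK ?num_real// ler_pXn2r ?nnegrE// normrM ger0_norm; last by lra.
  apply: le_trans (_ : 8 * (1 / 20) <= _); last by lra.
  by apply: ler_pM => //; lra.
move: (cos _) ((2 * pi * t) ^+ 2) => a b; lra.
Qed.

Lemma psi_trap (x y : R) : `|x| <= 1 / 20 -> `|y| <= 1 / 20 ->
  `|psi x - psi y| <= 1 / 5 * `|x - y|.
Proof.
wlog xy : x y / y <= x => [hw|] hx hy.
  by have [h|/ltW h] := leP y x; [exact: hw|rewrite distrC (distrC x); exact: hw].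
move: xy; rewrite le_eqVlt => /predU1P[->|xy]; first by rewrite !subrr normr0 mulr0.
have [c /andP[c1 c2] ->] := mean_value (@is_derive_psi R) xy.
rewrite normrM ler_wpM2r// gtr0_norm ?dpsi_gt0// dpsi_trap//.
by move: hx hy; rewrite !ler_norml; lra.
Qed.

Lemma psi0 : psi 0 = 0.
Proof. by rewrite psiE mulr0 sin0 mul0r mulr0 subrr. Qed.

Lemma trap_le e G H p : near_model e G H -> cT p <= 1 / 20 -> cT (G p) < 1 / 20.
Proof.
move=> M h; have /andP[e0 e6] := e_le M; have := nm_T0 M p; have := psi_le h.
have a : `|1 / 20| <= 1 / 20 :> R by rewrite ger0_norm.
have b : `|0 : R| <= 1 / 20 by rewrite normr0.
have := psi_trap a b; rewrite psi0 !subr0 (@ger0_norm _ (1 / 20))// !ler_norml.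
by move: e6; clear; lra.
Qed.

Lemma trap_ge e G H p : near_model e G H -> - (1 / 20) <= cT p -> - (1 / 20) < cT (G p).
Proof.
move=> M h; have /andP[e0 e6] := e_le M; have := nm_T0 M p; have := psi_le h.
have a : `|- (1 / 20)| <= 1 / 20 :> R by rewrite normrN ger0_norm.
have b : `|0 : R| <= 1 / 20 by rewrite normr0.
have := psi_trap a b; rewrite psi0 !subr0 normrN (@ger0_norm _ (1 / 20))// !ler_norml.
by move: e6; clear; lra.
Qed.

Lemma torus_setH H p : torus_set H p -> torus_set H (H p).
Proof. by move=> h k; rewrite -iterSr; exact: h. Qed.

Lemma torus_setG e G H p : near_model e G H -> torus_set H p -> torus_set H (G p).
Proof.
move=> M h [|k]; last by rewrite iterSr (nm_GH M); exact: h.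
have := h 0%N; rewrite /= !ler_norml => /andP[h1 h2].
by rewrite (ltW (trap_ge M h1)) (ltW (trap_le M h2)).
Qed.

(** Near the torus the contraction of [T], by 1/5, beats that of [S]: a displacement whose image
is steep was steeper itself, and longer. *)
Lemma torus_cone_step e G H p q (d := q - p) (d' := G q - G p) : near_model e G H ->
  flat d -> `|cT p| <= 1 / 20 -> `|cT q| <= 1 / 20 -> 1 / 20 * `|cS d'| < `|cT d'| ->
  1 / 20 * `|cS d| < `|cT d| /\ `|cT d'| <= 1 / 4 * `|cT d|.
Proof.
move=> M /flat_N fN hp hq h.
have /andP[e0 e6] := e_le M.
have l1 := @lam_lt R; have l2 := @lam_gt R.
have hS := nm_S M p q; have hT := nm_T M p q.
have := psi_trap hq hp.
rewrite -?cSB -?cTB -?cUB -/d -/d' in hS hT * => ht.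
have heN : e * N d <= (1 / 10) ^+ 4 * (`|cS d| + `|cT d|).
  by apply: ler_pM => //; [exact: N_ge0 | apply: le_trans e6 _; lra].
have s0 := normr_ge0 (cS d); have t0 := normr_ge0 (cT d).
have T' : `|cT d'| <= 1 / 5 * `|cT d| + (1 / 10) ^+ 4 * (`|cS d| + `|cT d|).
  have -> : cT d' = (psi (cT q) - psi (cT p)) + (cT d' - (psi (cT q) - psi (cT p))) by ring.
  apply: le_trans (ler_normD _ _) _; apply: lerD => //; exact: le_trans heN.
have S' : 26 / 100 * `|cS d| <= `|cS d'| + `|cT d| / 4 + (1 / 10) ^+ 4 * (`|cS d| + `|cT d|).
  apply: (@le_trans _ _ (lam * `|cS d|)); first by rewrite ler_wpM2r// ltW.
  have -> : lam * `|cS d| = `|lam * cS d| by rewrite normrM ger0_norm//; lra.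
  have -> : lam * cS d = cS d' - cT d / 4 - (cS d' - (lam * cS d + cT d / 4)) by ring.
  apply: le_trans (ler_normB _ _) _; apply: lerD; last exact: le_trans heN.
  apply: le_trans (ler_normB _ _) _; apply: lerD => //.
  by rewrite normrM (@ger0_norm _ 4^-1).
have c : 1 / 20 * `|cS d| < `|cT d|.
  by rewrite ltNge; apply/negP => c; move: c h T' S' s0 t0; clear; lra.
by split=> //; move: c T' s0; clear; lra.
Qed.

(** A steep displacement would grow at the rate 4 in backward time, though the orbits remain
in a bounded strip. *)
Lemma torus_cone e G H hu hs p q : near_model e G H -> leaf_coords G hu hs ->
  torus_set H p -> torus_set H q -> hu p = hu q ->
  `|cT (q - p)| <= 1 / 20 * `|cS (q - p)|.
Proof.
move=> M C tp tq hpq; rewrite leNgt; apply/negP => h.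
have l1 := @lam_lt R.
have huH a b : hu a = hu b -> hu (H a) = hu (H b).
  rewrite -{1}(nm_HG M a) -{1}(nm_HG M b) !(lc_huG C).
  by apply: mulfI; rewrite gt_eqF//; lra.
have it k : [/\ torus_set H (iter k H p), torus_set H (iter k H q),
    hu (iter k H p) = hu (iter k H q),
    1 / 20 * `|cS (iter k H q - iter k H p)| < `|cT (iter k H q - iter k H p)| &
    `|cT (q - p)| <= (1 / 4) ^+ k * `|cT (iter k H q - iter k H p)|].
  elim: k => [|k [h1 h2 h3 h4 h5]]; first by split=> //; rewrite expr0 mul1r.
  rewrite !iterS; have h3' := huH _ _ h3.
  have := torus_cone_step M (hu_flat M C h3') (torus_setH h1 0%N) (torus_setH h2 0%N).
  rewrite !(nm_HG M) => /(_ h4) [c1 c2].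
  split=> //; try exact: torus_setH.
  by apply: le_trans h5 _; rewrite exprSr -mulrA ler_wpM2l// exprn_ge0.
suff : `|cT (q - p)| <= 0.
  by have := normr_ge0 (cS (q - p)); move: h; clear; lra.
apply: (@le0_geometric R _ (1 / 10) (1 / 4)); try lra.
move=> k; have [h1 h2 _ _ h5] := it k; apply: le_trans h5 _.
rewrite mulrC ler_wpM2r ?exprn_ge0// cTB.
by have := h1 0%N; have := h2 0%N; rewrite /= !ler_norml; lra.
Qed.

(** Near the torus [bar] is negative, so the center cone contains the directions that are
almost parallel to the [S]-axis. *)
Lemma center_rel_torus e G H hu hs : near_model e G H -> leaf_coords G hu hs ->
  center_rel G H (fun p q => [/\ torus_set H p, torus_set H q & hu p = hu q]).
Proof.
move=> M C; have l1 := @lam_lt R; split=> [p q [h1 h2 h3]|p q [h1 h2 h3]|].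
- by split; [exact: (torus_setG M)|exact: (torus_setG M)|rewrite !(lc_huG C) h3].
- split; [exact: torus_setH|exact: torus_setH|].
  move: h3; rewrite -{1}(nm_HG M p) -{1}(nm_HG M q) !(lc_huG C).
  by apply: mulfI; rewrite gt_eqF//; lra.
exists 1 => // p q [h1 h2 h3] _.
have c := torus_cone M C h1 h2 h3.
have s0 := normr_ge0 (cS (q - p)).
split; [exact: (hu_flat M C h3) | by move: c s0; clear; lra |].
have b : bar (cT p) <= - (6 / 100).
  by have := dpsi_trap (h1 0%N); have := @lam_gt R; rewrite barE; clear; lra.
rewrite mulrBr subr_ge0.
have -> : cS (q - p) * (bar (cT p) * cS (q - p)) = bar (cT p) * `|cS (q - p)| ^+ 2.
  by rewrite real_normK ?num_real//; ring.
apply: (@le_trans _ _ (- (6 / 100) * `|cS (q - p)| ^+ 2)).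
  by rewrite ler_wpM2r ?sqr_ge0.
have : `|cS (q - p) * cT (q - p)| <= `|cS (q - p)| * (1 / 20 * `|cS (q - p)|).
  by rewrite normrM ler_wpM2l.
rewrite ler_norml; have := sqr_ge0 `|cS (q - p)|; clear; lra.
Qed.

(** Points of the segment that leave upwards and points that leave downwards under
backward iteration form disjoint open sets, so some point never leaves. *)
Lemma torus_set_meets e G H hu hs (s c : R) : near_model e G H -> leaf_coords G hu hs ->
  exists p, [/\ cS p = s, hu p = c & torus_set H p].
Proof.
move=> M C; have [f fc hf] := hu_level s c M C.
pose z t := mk s t (f t).
have zc : continuous z.
  by apply: mk_continuous => //; [exact: cont_cst | move=> x].
have Fc k : continuous (fun t => cT (iter k H (z t))).
  have Hz : continuous (fun t => iter k H (z t)).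
    exact: (cont_comp zc (iter_continuous (k := k) (nm_Hc M))).
  exact: (cont_comp Hz (@cT_continuous R)).
pose up := [set t : R | exists k, 1 / 20 < cT (iter k H (z t))].
pose dn := [set t : R | exists k, cT (iter k H (z t)) < - (1 / 20)].
have oup : open up.
  rewrite (_ : up = \bigcup_k ((fun t => cT (iter k H (z t))) @^-1` [set x | 1 / 20 < x])).
    apply: bigcup_open => k _; apply: open_comp => [t _|]; [exact: Fc | exact: open_gt].
  by apply/seteqP; split=> t /= [k h]; exists k.
have odn : open dn.
  rewrite (_ : dn = \bigcup_k ((fun t => cT (iter k H (z t))) @^-1` [set x | x < - (1 / 20)])).
    apply: bigcup_open => k _; apply: open_comp => [t _|]; [exact: Fc | exact: open_lt].
  by apply/seteqP; split=> t /= [k h]; exists k.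
have upS p : 1 / 20 <= cT p -> 1 / 20 < cT (H p).
  move=> h; rewrite ltNge; apply/negP => /(trap_le M); rewrite (nm_HG M).
  by rewrite ltNge h.
have dnS p : cT p <= - (1 / 20) -> cT (H p) < - (1 / 20).
  move=> h; rewrite ltNge; apply/negP => /(trap_ge M); rewrite (nm_HG M).
  by rewrite ltNge h.
have upK p k j : 1 / 20 < cT (iter k H p) -> 1 / 20 < cT (iter (j + k) H p).
  by move=> h; elim: j => //= j /ltW /upS.
have dnK p k j : cT (iter k H p) < - (1 / 20) -> cT (iter (j + k) H p) < - (1 / 20).
  by move=> h; elim: j => //= j /ltW /dnS.
have dis t : up t -> dn t -> False.
  move=> [k hk] [j hj]; have := upK _ _ j hk; have := dnK _ _ k hj.
  by rewrite addnC; lra.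
have [t [t1 t2 t3]] : exists t, [/\ `[- (1 / 20), 1 / 20]%classic t, ~ up t & ~ dn t].
  apply: contrapT => /forallNP no.
  have cov t : `[- (1 / 20), 1 / 20]%classic t -> up t \/ dn t.
    by move=> ht; have := no t => /not_and3P [//|/contrapT h|/contrapT h]; [left|right].
  have sub : up `&` `[- (1 / 20), 1 / 20] = `[- (1 / 20), 1 / 20]%classic.
    apply: segment_connected.
    - exists (1 / 20); split; last by rewrite /= in_itv /=; lra.
      by exists 1%N; apply: upS; rewrite /z cT_mk.
    - by exists up => //; rewrite setIC.
    - exists (~` dn); first exact: open_closedC.
      apply/seteqP; split=> t /= [h1 h2]; split=> //.
        by move=> h3; exact: (dis t).
      by have [] := cov t h1.
  have : up (- (1 / 20)).
    suff : (up `&` `[- (1 / 20), 1 / 20]) (- (1 / 20)) by case.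
    by rewrite sub /= in_itv /=; lra.
  move=> /dis; apply; exists 1%N; apply: dnS; rewrite /z cT_mk //.
exists (z t); split; [by rewrite /z cS_mk | exact: hf | move=> k].
rewrite ler_norml; apply/andP; split; rewrite leNgt; apply/negP => h.
  by apply: t3; exists k.
by apply: t2; exists k.
Qed.

End CenterCurves.

(** * Graph transforms and positive cocycles *)

Section GraphTransform.
Variables (R : realType) (X : topologicalType).

(** Graph transform for a dominated one-dimensional direction with slopes [y0] and
[y1]: the linear part grows slower than the denominator, so the slopes contract. *)
Lemma graph_section (T : X -> X) (A00 A01 A10 A11 C0 C1 B0 B1 D : X -> R) (c e : R) :
  continuous T -> continuous A00 -> continuous A01 -> continuous A10 -> continuous A11 ->
  continuous C0 -> continuous C1 -> continuous B0 -> continuous B1 -> continuous D ->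
  0 < c -> c <= 1 -> 0 <= e -> e <= c / 10 ->
  (forall x, `|A00 x| + `|A01 x| <= 22 / 10) -> (forall x, `|A10 x| + `|A11 x| <= 22 / 10) ->
  (forall x, `|C0 x| <= e) -> (forall x, `|C1 x| <= e) ->
  (forall x, `|B0 x| <= e) -> (forall x, `|B1 x| <= e) -> (forall x, 36 / 10 <= D x) ->
  exists y0 y1 : X -> R,
    [/\ continuous y0 /\ continuous y1,
        forall x, `|y0 x| <= c /\ `|y1 x| <= c,
        forall x, y0 x = (A00 (T x) * y0 (T x) + A01 (T x) * y1 (T x) + C0 (T x)) /
          (D (T x) + B0 (T x) * y0 (T x) + B1 (T x) * y1 (T x)),
        forall x, y1 x = (A10 (T x) * y0 (T x) + A11 (T x) * y1 (T x) + C1 (T x)) /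
          (D (T x) + B0 (T x) * y0 (T x) + B1 (T x) * y1 (T x)) &
        forall rel : X -> X -> Prop, (forall x y, rel x y -> rel (T x) (T y)) ->
          (forall x y, rel x y -> [/\ A00 x = A00 y, A01 x = A01 y, A10 x = A10 y,
             A11 x = A11 y & [/\ C0 x = C0 y, C1 x = C1 y, B0 x = B0 y, B1 x = B1 y & D x = D y]]) ->
          forall x y, rel x y -> y0 x = y0 y /\ y1 x = y1 y].
Proof.
move=> Tc cA00 cA01 cA10 cA11 cC0 cC1 cB0 cB1 cD c0 c1 e0 ec hA0 hA1 hC0 hC1 hB0 hB1 hD.
pose den x (y : bool -> R) := D x + B0 x * y false + B1 x * y true.
pose num x (y : bool -> R) (i : bool) := if i then A10 x * y false + A11 x * y true + C1 x
  else A00 x * y false + A01 x * y true + C0 x.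
pose G x y i := num x y i / den x y.
pose K (y : bool -> R) := (`|y false| <= c) /\ (`|y true| <= c).
pose dist (y y' : bool -> R) := Num.max `|y false - y' false| `|y true - y' true|.
have dist_ge y y' i : `|y i - y' i| <= dist y y'.
  by case: i; rewrite /dist le_max lexx ?orbT.
have dist0 y y' : 0 <= dist y y' := le_trans (normr_ge0 _) (dist_ge y y' false).
have denG x y : K y -> 34 / 10 <= den x y.
  move=> [k0 k1]; rewrite /den.
  have h0 : `|B0 x * y false| <= e * c by rewrite normrM ler_pM.
  have h1 : `|B1 x * y true| <= e * c by rewrite normrM ler_pM.
  have ecc : e * c <= 1 / 10 * 1 by apply: ler_pM => //; lra.
  by have := hD x; move: h0 h1 ecc; rewrite !ler_norml; clear; lra.
have lin (a b u v d : R) : `|a| + `|b| <= 22 / 10 -> `|u| <= d -> `|v| <= d ->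
    `|a * u + b * v| <= 22 / 10 * d.
  move=> ab ud vd; apply: le_trans (ler_normD _ _) _; rewrite !normrM.
  have h0 : `|a| * `|u| <= `|a| * d by rewrite ler_wpM2l.
  have h1 : `|b| * `|v| <= `|b| * d by rewrite ler_wpM2l.
  have d0 : 0 <= d by exact: le_trans ud.
  have h2 : (`|a| + `|b|) * d <= 22 / 10 * d by rewrite ler_wpM2r.
  by move: h0 h1 h2; clear; lra.
have numK x y i : K y -> `|num x y i| <= 22 / 10 * c + e.
  by move=> [k0 k1]; case: i; apply: le_trans (ler_normD _ _) _; apply: lerD => //; exact: lin.
have GK x y : K y -> K (G x y).
  move=> ky; have dp := denG x y ky.
  suff h i : `|G x y i| <= c by split.
  rewrite /G normrM normfV (@ger0_norm _ (den x y)); last by lra.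
  rewrite ler_pdivrMr; last by lra.
  apply: le_trans (numK x y i ky) _.
  apply: (@le_trans _ _ (c * (34 / 10))); last by rewrite ler_pM2l.
  by move: c0 ec; clear; lra.
have contr x y y' : K y -> K y' -> dist (G x y) (G x y') <= 3 / 4 * dist y y'.
  move=> ky ky'; have dp := denG x y ky; have dp' := denG x y' ky'.
  set d := dist y y'.
  have nd i : `|num x y i - num x y' i| <= 22 / 10 * d.
    case: i; rewrite /num.
      have -> : A10 x * y false + A11 x * y true + C1 x - (A10 x * y' false + A11 x * y' true + C1 x)
        = A10 x * (y false - y' false) + A11 x * (y true - y' true) by ring.
      by apply: lin => //; exact: dist_ge.
    have -> : A00 x * y false + A01 x * y true + C0 x - (A00 x * y' false + A01 x * y' true + C0 x)
      = A00 x * (y false - y' false) + A01 x * (y true - y' true) by ring.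
    by apply: lin => //; exact: dist_ge.
  have dd : `|den x y - den x y'| <= 2 * e * d.
    have -> : den x y - den x y' = B0 x * (y false - y' false) + B1 x * (y true - y' true).
      by rewrite /den; ring.
    apply: le_trans (ler_normD _ _) _; rewrite !normrM.
    have h0 : `|B0 x| * `|y false - y' false| <= e * d by apply: ler_pM => //; exact: dist_ge.
    have h1 : `|B1 x| * `|y true - y' true| <= e * d by apply: ler_pM => //; exact: dist_ge.
    by move: h0 h1; clear; lra.
  have [gk0 gk1] := GK x y' ky'.
  suff h i : `|G x y i - G x y' i| <= 3 / 4 * d by rewrite /dist ge_max !h.
  have gi : `|G x y' i| <= c by case: i.
  have -> : G x y i - G x y' i =
    ((num x y i - num x y' i) - G x y' i * (den x y - den x y')) / den x y.
    rewrite /G; move: (num x y i) (num x y' i) (den x y) (den x y') dp dp' => u v a b a0 b0.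
    by field; apply/andP; split; rewrite gt_eqF//; lra.
  rewrite normrM normfV (@ger0_norm _ (den x y)); last by lra.
  rewrite ler_pdivrMr; last by lra.
  apply: (@le_trans _ _ (3 / 4 * d * (34 / 10))); last first.
    by apply: ler_wpM2l => //; rewrite mulr_ge0 ?dist0// divr_ge0.
  apply: le_trans (ler_normB _ _) _; rewrite normrM.
  have h : `|G x y' i| * `|den x y - den x y'| <= c * (2 * e * d) by apply: ler_pM.
  have h2 : c * (2 * e * d) <= 1 * (2 * (1 / 10) * d).
    apply: ler_pM => //; [exact: ltW | by rewrite !mulr_ge0// dist0 |].
    by rewrite ler_wpM2r ?dist0// ler_wpM2l//; lra.
  by move: (nd i) h h2 (dist0 y y'); rewrite -/d; clear; lra.
have K0 : K (fun=> 0) by rewrite /K normr0; split; exact: ltW.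
have distB y y' : K y -> K y' -> dist y y' <= 2 * c.
  move=> [k0 k1] [k0' k1']; rewrite /dist ge_max; apply/andP; split;
    by apply: le_trans (ler_normB _ _) _; lra.
have [|||||||||w [wc wK wi _]] :=
  @invariant_section R X bool T G K dist 1 (3 / 4) (2 * c) (fun=> 0) Tc GK => //.
- move=> Y F FF x x0 y y1 hx hy _ hK1 i; rewrite /G.
  have cc2 (f : X -> R) : continuous f -> f (x t) @[t --> F] --> f x0.
    by move=> fc; apply: continuous_cvg => //; exact: fc.
  apply: cvgM.
    by case: i; (apply: cvgD; last exact: cc2); apply: cvgD; apply: cvgM;
      (exact: cc2 || exact: hy).
  apply: cvgV; first by rewrite gt_eqF//; have := denG x0 y1 hK1; lra.
  by apply: cvgD; [apply: cvgD; [exact: cc2|]|]; apply: cvgM; (exact: cc2 || exact: hy).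
- move=> y y1 hK hy.
  have lim i : `|y1 i| <= c.
    have hn : (fun n => `|y n i|) @ \oo --> `|y1 i| by apply: cvg_norm; exact: hy.
    rewrite -(cvg_lim _ hn)//; apply: limr_le; first exact: cvgP hn.
    by apply: nearW => n; have [] := hK n; case: i {hn}.
  by split.
- by move=> y y' _ _ i; rewrite mul1r.
- by lra.
- by move=> x; apply: distB => //; exact: GK.
exists (w ^~ false), (w ^~ true); split=> [||x|x|rel relT relE x y xy].
- by split; exact: wc.
- by move=> x; have [] := wK x.
- by rewrite wi.
- by rewrite wi.
suff -> : w x = w y by [].
apply: (@invariant_section_respects R X bool T G K dist 1 (3 / 4) (2 * c)) xy => //.
- by move=> y' y'' _ _ i; rewrite mul1r.
- by lra.
- move=> x1 x2 /relE [e1 e2 e3 e4 [e5 e6 e7 e8 e9]].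
  by apply/funext => y'; apply/funext => i; rewrite /G /num /den e1 e2 e3 e4 e5 e6 e7 e8 e9.
- by move=> x1 x2; exact: distB.
Qed.

End GraphTransform.

Section PositiveCocycle.
Variables (R : realType) (X : topologicalType).
Implicit Types (a b c d : X -> R) (T : X -> X).

(** With [Q = a d + b c], the sum [r' + s'] has numerator at least [Q (r + s)], the difference
has numerator [(a d - b c) (r - s)], and the denominators agree. *)
Lemma projective_contraction (a b c d r s : R)
    (r' := (c + d * r) / (a + b * r)) (s' := (c + d * s) / (a + b * s)) : 0 < a -> 0 < b -> 0 < c -> 0 < d ->
  0 <= a * d - b * c -> 0 < r -> 0 < s ->
  `|r' - s'| / (r' + s') <= (a * d - b * c) / (a * d + b * c) * (`|r - s| / (r + s)).
Proof.
move=> a0 b0 c0 d0 D0 r0 s0.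
have ar : 0 < a + b * r by rewrite addr_gt0 ?mulr_gt0.
have as' : 0 < a + b * s by rewrite addr_gt0 ?mulr_gt0.
set P := (a + b * r) * (a + b * s); have P0 : 0 < P by rewrite mulr_gt0.
set Q := a * d + b * c; have Q0 : 0 < Q by rewrite addr_gt0 ?mulr_gt0.
have e1 : r' - s' = (a * d - b * c) * (r - s) / P.
  by rewrite /r' /s' /P; field; rewrite !gt_eqF.
set Z := 2 * a * c + Q * (r + s) + 2 * b * d * r * s.
have e2 : r' + s' = Z / P.
  by rewrite /r' /s' /P /Z /Q; field; rewrite !gt_eqF.
have rs0 : 0 < r + s by rewrite addr_gt0.
have ZQ : Q * (r + s) <= Z.
  have : 0 < 2 * a * c by rewrite !mulr_gt0.
  have : 0 < 2 * b * d * r * s by rewrite !mulr_gt0.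
  by rewrite /Z; move: (Q * _) (2 * a * c) (2 * b * d * r * s) => x y z; lra.
have Z0 : 0 < Z by apply: lt_le_trans ZQ; rewrite mulr_gt0.
rewrite e1 e2 normrM normrM (ger0_norm D0) normfV (gtr0_norm P0).
have -> : (a * d - b * c) * `|r - s| / P / (Z / P) = (a * d - b * c) * `|r - s| / Z.
  by field; rewrite !gt_eqF.
have -> : (a * d - b * c) / Q * (`|r - s| / (r + s)) = (a * d - b * c) * `|r - s| / (Q * (r + s)).
  by field; rewrite !gt_eqF.
by rewrite ler_wpM2l ?mulr_ge0// lef_pV2// posrE mulr_gt0.
Qed.

(** Projectively, a cocycle of uniformly positive matrices contracts the positive
quadrant (Birkhoff), so it has a continuous invariant direction there. *)
Lemma positive_section T a b c d (lo hi k : R) :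
  continuous T -> continuous a -> continuous b -> continuous c -> continuous d ->
  (forall x, 0 < a x) -> (forall x, 0 < b x) -> (forall x, 0 < c x) -> (forall x, 0 < d x) ->
  (forall x, 0 <= a x * d x - b x * c x) ->
  (forall x, a x * d x - b x * c x <= k * (a x * d x + b x * c x)) ->
  0 <= k -> k < 1 -> 0 < lo -> lo <= hi ->
  (forall x r, lo <= r <= hi -> lo * (a x + b x * r) <= c x + d x * r <= hi * (a x + b x * r)) ->
  exists r : X -> R, [/\ continuous r, forall x, lo <= r x <= hi,
    forall x, r x = (c (T x) + d (T x) * r (T x)) / (a (T x) + b (T x) * r (T x)) &
    forall rel : X -> X -> Prop, (forall x y, rel x y -> rel (T x) (T y)) ->
      (forall x y, rel x y -> [/\ a x = a y, b x = b y, c x = c y & d x = d y]) ->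
      forall x y, rel x y -> r x = r y].
Proof.
move=> Tc ac bc cc dc a0 b0 c0 d0 D0 Dk k0 k1 lo0 lohi inv.
have den x r : lo <= r -> 0 < a x + b x * r.
  by move=> h; rewrite addr_gt0// mulr_gt0// (lt_le_trans lo0).
pose G (x : X) (y : unit -> R) (i : unit) := (c x + d x * y tt) / (a x + b x * y tt).
pose K (y : unit -> R) := lo <= y tt <= hi.
pose dist (y y' : unit -> R) := `|y tt - y' tt| / (y tt + y' tt).
have dist1 y y' : K y -> K y' -> dist y y' <= 1.
  move=> /andP[h1 _] /andP[h2 _]; rewrite /dist ler_pdivrMr; last by lra.
  by rewrite ler_norml; lra.
have GK x y : K y -> K (G x y).
  move=> h; rewrite /K /G; have /andP[h1 _] := h.
  by rewrite ler_pdivlMr ?den// ler_pdivrMr ?den// inv.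
have dge (y y' : unit -> R) : K y -> K y' -> forall i, `|y i - y' i| <= (2 * hi) * dist y y'.
  move=> /andP[h1 h2] /andP[h3 h4] []; rewrite /dist mulrA ler_pdivlMr; last by lra.
  by rewrite mulrC ler_wpM2r//; lra.
have dc' x y y' : K y -> K y' -> dist (G x y) (G x y') <= k * dist y y'.
  move=> /andP[h1 h2] /andP[h3 h4].
  apply: le_trans (projective_contraction (a0 x) (b0 x) (c0 x) (d0 x) (D0 x) _ _) _.
  - by lra.
  - by lra.
  apply: ler_wpM2r; first by rewrite divr_ge0//; lra.
  by rewrite ler_pdivrMr ?addr_gt0 ?mulr_gt0// Dk.
have [|||||||||w [wc wK wi _]] :=
  @invariant_section R X unit T G K dist (2 * hi) k 1 (fun=> lo) Tc GK => //.
- move=> Y F FF x x0 y y1 hx hy _ hK1 i; rewrite /G.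
  have /andP[h1 _] := hK1.
  have cc2 (f : X -> R) : continuous f -> f (x t) @[t --> F] --> f x0.
    by move=> fc; apply: continuous_cvg => //; exact: fc.
  apply: cvgM; first by apply: cvgD; [exact: cc2|apply: cvgM; [exact: cc2|exact: hy]].
  apply: cvgV; first by rewrite gt_eqF// den.
  by apply: cvgD; [exact: cc2|apply: cvgM; [exact: cc2|exact: hy]].
- move=> y y1 hK hy; rewrite /K; apply/andP; split.
    rewrite -(cvg_lim _ (hy tt))//; apply: limr_ge; first exact: cvgP (hy tt).
    by apply: nearW => n; have /andP[] := hK n.
  rewrite -(cvg_lim _ (hy tt))//; apply: limr_le; first exact: cvgP (hy tt).
  by apply: nearW => n; have /andP[] := hK n.
- by rewrite mulr_ge0//; lra.
- by rewrite /K lexx.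
- by move=> x; apply: dist1; [rewrite /K lexx | apply: GK; rewrite /K lexx].
exists (w ^~ tt); split=> [||x|rel relT relE x y xy].
- exact: wc.
- exact: wK.
- by rewrite wi.
have : w x = w y; last by move=> ->.
apply: (@invariant_section_respects R X unit T G K dist (2 * hi) k 1) xy => //.
- by rewrite mulr_ge0//; lra.
- by move=> x1 x2 /relE [e1 e2 e3 e4]; rewrite /G e1 e2 e3 e4.
- by move=> x1 x2; exact: dist1.
Qed.

End PositiveCocycle.

(** * Slopes of the dominated directions *)

Section Frames.
Variable R : realType.
Local Notation V3 := 'rV[R]_3.
Local Notation psi := (@psi R).
Local Notation dpsi := (@dpsi R).
Local Notation bar := (@bar R).
Local Notation lam := (@lam R).
Implicit Types (e : R) (G H : V3 -> V3) (J : V3 -> 'M[R]_3) (p q n v : V3).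

(** Derivative cocycles close to that of the model. *)
Record near_jac e J : Prop := NearJac {
  nj_cS : forall v, continuous (fun p => cS (v *m J p));
  nj_cT : forall v, continuous (fun p => cT (v *m J p));
  nj_cU : forall v, continuous (fun p => cU (v *m J p));
  nj_per : forall p n, intv n -> J (p + n) = J p;
  nj_S : forall p v, `|cS (v *m J p) - (lam * cS v + cT v / 4)| <= e * N v;
  nj_T : forall p v, `|cT (v *m J p) - dpsi (cT p) * cT v| <= e * N v;
  nj_U : forall p v, `|cU (v *m J p) - (4 - lam) * cU v| <= e * N v
}.

Definition bS : V3 := mk 1 0 0.
Definition bT : V3 := mk 0 1 0.
Definition bU : V3 := mk 0 0 1.

Lemma basis_eta v : v = cS v *: bS + cT v *: bT + cU v *: bU.
Proof.
by apply: coords_inj; rewrite !(cSD, cTD, cUD, cSZ, cTZ, cUZ) ?cS_mk ?cT_mk ?cU_mk; ring.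
Qed.

Lemma basis_mul v (A : 'M[R]_3) :
  v *m A = cS v *: (bS *m A) + cT v *: (bT *m A) + cU v *: (bU *m A).
Proof. by rewrite {1}(basis_eta v) !mulmxDl -!scalemxAl. Qed.

Lemma N_mk (s t u b : R) : `|s| <= b -> `|t| <= b -> `|u| <= b -> N (mk s t u) <= b.
Proof. by move=> *; apply: N_le; rewrite ?cS_mk ?cT_mk ?cU_mk. Qed.

Lemma N_bS : N bS <= 1.
Proof. by apply: N_mk; rewrite ?normr1 ?normr0. Qed.
Lemma N_bT : N bT <= 1.
Proof. by apply: N_mk; rewrite ?normr1 ?normr0. Qed.
Lemma N_bU : N bU <= 1.
Proof. by apply: N_mk; rewrite ?normr1 ?normr0. Qed.

Lemma norm_close (a b d : R) : `|a - b| <= d -> `|a| <= `|b| + d.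
Proof. by move=> h; rewrite -[a](subrK b) addrC (le_trans (ler_normD _ _))// lerD2l. Qed.

Section Entries.
Variables (e : R) (J : V3 -> 'M[R]_3).

Lemma entry_bounds : near_jac e J -> 0 <= e -> forall p,
  [/\ `|cS (bS *m J p) - lam| <= e, `|cS (bT *m J p) - 1 / 4| <= e, `|cS (bU *m J p)| <= e &
  [/\ `|cT (bS *m J p)| <= e, `|cT (bT *m J p) - dpsi (cT p)| <= e & `|cT (bU *m J p)| <= e] /\
  [/\ `|cU (bS *m J p)| <= e, `|cU (bT *m J p)| <= e & `|cU (bU *m J p) - (4 - lam)| <= e]].
Proof.
move=> NJ e0 p.
have le1 (x : R) v : N v <= 1 -> x <= e * N v -> x <= e.
  by move=> n1 h; apply: le_trans h _; rewrite ler_piMr.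
have S1 := le1 _ _ N_bS (nj_S NJ p bS); have S2 := le1 _ _ N_bT (nj_S NJ p bT).
have S3 := le1 _ _ N_bU (nj_S NJ p bU).
have T1 := le1 _ _ N_bS (nj_T NJ p bS); have T2 := le1 _ _ N_bT (nj_T NJ p bT).
have T3 := le1 _ _ N_bU (nj_T NJ p bU).
have U1 := le1 _ _ N_bS (nj_U NJ p bS); have U2 := le1 _ _ N_bT (nj_U NJ p bT).
have U3 := le1 _ _ N_bU (nj_U NJ p bU).
rewrite /bS /bT /bU !cS_mk !cT_mk !cU_mk in S1 S2 S3 T1 T2 T3 U1 U2 U3.
rewrite ?mulr1 ?mulr0 ?mul0r ?addr0 ?add0r ?subr0 in S1 S2 S3 T1 T2 T3 U1 U2 U3.
by split=> //; split.
Qed.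

End Entries.

Lemma intv_H e G H p q : near_model e G H -> intv (q - p) -> intv (H q - H p).
Proof.
move=> M; rewrite -{1}(nm_HG M q) -{1}(nm_HG M p) => h.
have [n hn e1] := intv_mulA3_surj h.
have : G (H q) = G (H p + n) by rewrite (nm_per M)// -e1 addrC subrK.
by move/(can_inj (nm_GH M)) ->; rewrite addrC addKr.
Qed.

Lemma intv_G e G H p q : near_model e G H -> intv (q - p) -> intv (G q - G p).
Proof.
move=> M h; have {1}-> : q = p + (q - p) by rewrite addrC subrK.
by rewrite (nm_per M)// addrC addKr; exact: intv_mulA3.
Qed.

Lemma nj_rel e J p q : near_jac e J -> intv (q - p) -> J q = J p.
Proof. by move=> NJ h; rewrite -(nj_per NJ p h) addrC subrK. Qed.

Local Notation c := ((1 / 10) ^+ 4 : R).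

(** The unstable direction as a graph over the [U]-axis, fixed by the forward graph transform. *)
Lemma unstable_slopes e G H J : near_model e G H -> near_jac e J ->
  exists a b : V3 -> R, [/\ continuous a /\ continuous b,
    forall p, `|a p| <= c /\ `|b p| <= c,
    forall p n, intv n -> a (p + n) = a p /\ b (p + n) = b p &
    forall p, exists2 r, 36 / 10 <= r &
      mk (a p) (b p) 1 *m J p = r *: mk (a (G p)) (b (G p)) 1].
Proof.
move=> M NJ; have /andP[e0 e6] := e_le M.
have l1 := @lam_lt R; have l2 := @lam_gt R.
have jS v : continuous (fun p => cS (v *m J p)) := @nj_cS _ _ NJ v.
have jT v : continuous (fun p => cT (v *m J p)) := @nj_cT _ _ NJ v.
have jU v : continuous (fun p => cU (v *m J p)) := @nj_cU _ _ NJ v.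
have eb := entry_bounds NJ e0.
have ec : e <= c / 10 by apply: le_trans e6 _; lra.
have [|||||||||a [b [[ac bc] ab ea eb' per]]] := @graph_section R V3 H
  (fun p => cS (bS *m J p)) (fun p => cS (bT *m J p))
  (fun p => cT (bS *m J p)) (fun p => cT (bT *m J p))
  (fun p => cS (bU *m J p)) (fun p => cT (bU *m J p))
  (fun p => cU (bS *m J p)) (fun p => cU (bT *m J p)) (fun p => cU (bU *m J p)) c e
  (nm_Hc M) (jS _) (jS _) (jT _) (jT _) (jS _) (jT _) (jU _) (jU _) (jU _) _ _ e0 ec.
- by rewrite exprn_gt0.
- by rewrite exprn_ile1//; lra.
- move=> p; have [h1 h2 _ _] := eb p.
  have := norm_close h1; have := norm_close h2.
  rewrite (@ger0_norm _ (1 / 4))// (@ger0_norm _ lam); last by lra.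
  by move: e6 l1; clear; lra.
- move=> p; have [_ _ _ [[h1 h2 _] _]] := eb p.
  have := norm_close h2; have := dpsi_bound (cT p); rewrite (gtr0_norm (dpsi_gt0 _)).
  by move: h1 e6; clear; lra.
- by move=> p; have [] := eb p.
- by move=> p; have [_ _ _ [[]]] := eb p.
- by move=> p; have [_ _ _ [_ []]] := eb p.
- by move=> p; have [_ _ _ [_ []]] := eb p.
- by move=> p; have [_ _ _ [_ [_ _ h]]] := eb p; move: h; rewrite ler_norml; move: e6 l1; clear; lra.
exists a, b; split=> // [p n hn|p].
  apply: (per (fun x y => intv (y - x)) _ _ (p + n) p) => [x y|x y h|].
  - exact: (intv_H M).
  - by rewrite (nj_rel NJ h).
  - by rewrite opprD addNKr => i; rewrite mxE rpredN.
set D := cU (bU *m J p) + cU (bS *m J p) * a p + cU (bT *m J p) * b p.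
have D0 : 36 / 10 <= D.
  have [_ _ _ [_ [h1 h2 h3]]] := eb p; have [k1 k2] := ab p.
  have c1 : c <= 1 by rewrite exprn_ile1//; lra.
  have m1 : `|cU (bS *m J p) * a p| <= e * 1.
    by rewrite normrM; apply: ler_pM => //; exact: le_trans c1.
  have m2 : `|cU (bT *m J p) * b p| <= e * 1.
    by rewrite normrM; apply: ler_pM => //; exact: le_trans c1.
  by rewrite /D; move: h3 m1 m2 e6 l1; rewrite !ler_norml; clear; lra.
exists D => //; rewrite basis_mul !cS_mk !cT_mk !cU_mk.
have Dn : D != 0 by rewrite gt_eqF//; lra.
apply: coords_inj; rewrite !(cSD, cTD, cUD, cSZ, cTZ, cUZ) ?cS_mk ?cT_mk ?cU_mk.
- rewrite (ea (G p)) !(nm_GH M) -/D [RHS]mulrC divfK//; ring.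
- rewrite (eb' (G p)) !(nm_GH M) -/D [RHS]mulrC divfK//; ring.
- by rewrite /D; ring.
Qed.

(** The center-stable plane is the kernel of an invariant covector; it is found by the graph
transform of the transposed cocycle, which runs in backward time. *)
Lemma cs_slopes e G H J : near_model e G H -> near_jac e J ->
  exists a b : V3 -> R, [/\ continuous a /\ continuous b,
    forall p, `|a p| <= c /\ `|b p| <= c,
    forall p n, intv n -> a (p + n) = a p /\ b (p + n) = b p &
    forall p v, cU v = a p * cS v + b p * cT v ->
      cU (v *m J p) = a (G p) * cS (v *m J p) + b (G p) * cT (v *m J p)].
Proof.
move=> M NJ; have /andP[e0 e6] := e_le M.
have l1 := @lam_lt R; have l2 := @lam_gt R.
have jS v : continuous (fun p => cS (v *m J (H p))).
  exact: (cont_comp (nm_Hc M) (@nj_cS _ _ NJ v)).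
have jT v : continuous (fun p => cT (v *m J (H p))).
  exact: (cont_comp (nm_Hc M) (@nj_cT _ _ NJ v)).
have jU v : continuous (fun p => cU (v *m J (H p))).
  exact: (cont_comp (nm_Hc M) (@nj_cU _ _ NJ v)).
have eb := entry_bounds NJ e0.
have ec : e <= c / 10 by apply: le_trans e6 _; lra.
have [|||||||||a [b [[ac bc] ab ea eb' per]]] := @graph_section R V3 G
  (fun p => cS (bS *m J (H p))) (fun p => cT (bS *m J (H p)))
  (fun p => cS (bT *m J (H p))) (fun p => cT (bT *m J (H p)))
  (fun p => - cU (bS *m J (H p))) (fun p => - cU (bT *m J (H p)))
  (fun p => - cS (bU *m J (H p))) (fun p => - cT (bU *m J (H p)))
  (fun p => cU (bU *m J (H p))) c e
  (nm_Gc M) (jS _) (jT _) (jS _) (jT _) (contN (jU _)) (contN (jU _)) (contN (jS _))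
  (contN (jT _)) (jU _) _ _ e0 ec.
- by rewrite exprn_gt0.
- by rewrite exprn_ile1//; lra.
- move=> p; have [h1 _ _ [[h2 _ _] _]] := eb (H p).
  have := norm_close h1; rewrite (@ger0_norm _ lam); last by lra.
  by move: h2 e6 l1; clear; lra.
- move=> p; have [_ h1 _ [[_ h2 _] _]] := eb (H p).
  have := norm_close h1; rewrite (@ger0_norm _ (1 / 4))//.
  have := norm_close h2; have := dpsi_bound (cT (H p)); rewrite (gtr0_norm (dpsi_gt0 _)).
  by move: e6; clear; lra.
- by move=> p; rewrite normrN; have [_ _ _ [_ []]] := eb (H p).
- by move=> p; rewrite normrN; have [_ _ _ [_ []]] := eb (H p).
- by move=> p; rewrite normrN; have [] := eb (H p).
- by move=> p; rewrite normrN; have [_ _ _ [[]]] := eb (H p).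
- by move=> p; have [_ _ _ [_ [_ _ h]]] := eb (H p); move: h; rewrite ler_norml; move: e6 l1; clear; lra.
exists a, b; split=> // [p n hn|p v hv].
  apply: (per (fun x y => intv (y - x)) _ _ (p + n) p) => [x y|x y h|].
  - exact: (intv_G M).
  - by rewrite (nj_rel NJ (intv_H M h)).
  - by rewrite opprD addNKr => i; rewrite mxE rpredN.
have := ea p; have := eb' p; rewrite !(nm_GH M).
set D := cU (bU *m J p) + _ * a (G p) + _ * b (G p) => E2 E1.
have Dn : D != 0.
  have [_ _ h1 [[_ _ h2] [_ _ h3]]] := eb p; have [k1 k2] := ab (G p).
  have c1 : c <= 1 by rewrite exprn_ile1//; lra.
  have m1 : `|- cS (bU *m J p) * a (G p)| <= e * 1.
    by rewrite normrM normrN; apply: ler_pM => //; exact: le_trans c1.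
  have m2 : `|- cT (bU *m J p) * b (G p)| <= e * 1.
    by rewrite normrM normrN; apply: ler_pM => //; exact: le_trans c1.
  by rewrite gt_eqF// /D; move: h3 m1 m2 e6 l1; rewrite !ler_norml; clear; lra.
have {}E1 : D * a p = cS (bS *m J p) * a (G p) + cT (bS *m J p) * b (G p) - cU (bS *m J p).
  by rewrite E1 mulrC divfK.
have {}E2 : D * b p = cS (bT *m J p) * a (G p) + cT (bT *m J p) * b (G p) - cU (bT *m J p).
  by rewrite E2 mulrC divfK.
rewrite (basis_mul v) !(cSD, cTD, cUD, cSZ, cTZ, cUZ).
have : D * cU v = cS v * (D * a p) + cT v * (D * b p) by rewrite hv; ring.
rewrite E1 E2 /D; clear; lra.
Qed.

Lemma jac_cont e J (s t u : V3 -> R) : near_jac e J ->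
  continuous s -> continuous t -> continuous u ->
  [/\ continuous (fun p => cS (mk (s p) (t p) (u p) *m J p)),
      continuous (fun p => cT (mk (s p) (t p) (u p) *m J p)) &
      continuous (fun p => cU (mk (s p) (t p) (u p) *m J p))].
Proof.
move=> NJ sc tc uc.
have jS v : continuous (fun p => cS (v *m J p)) := @nj_cS _ _ NJ v.
have jT v : continuous (fun p => cT (v *m J p)) := @nj_cT _ _ NJ v.
have jU v : continuous (fun p => cU (v *m J p)) := @nj_cU _ _ NJ v.
split.
- under eq_fun do rewrite basis_mul !(cSD, cSZ) cS_mk cT_mk cU_mk.
  by apply: contD; [apply: contD|]; apply: contM.
- under eq_fun do rewrite basis_mul !(cTD, cTZ) cS_mk cT_mk cU_mk.
  by apply: contD; [apply: contD|]; apply: contM.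
- under eq_fun do rewrite basis_mul !(cUD, cUZ) cS_mk cT_mk cU_mk.
  by apply: contD; [apply: contD|]; apply: contM.
Qed.

(** The perturbed two-dimensional cocycle on the center-stable bundle, in the basis
of the edges of the center cone. *)
Lemma cs_entries e G H J p (a b : R) (f1 := mk 1 (bar (cT p)) (a + b * bar (cT p)))
    (f2 := mk 0 1 b) (b' := bar (cT (G p))) :
  near_model e G H -> near_jac e J -> `|a| <= c -> `|b| <= c ->
  [/\ `|cS (f1 *m J p) - diagS (cT p)| <= c, `|cS (f2 *m J p) - 1 / 4| <= c,
      `|cT (f1 *m J p) - b' * cS (f1 *m J p) - off (cT p)| <= c &
      `|cT (f2 *m J p) - b' * cS (f2 *m J p) - diagT (cT p)| <= c].
Proof.
move=> M NJ ha hb; have /andP[e0 e6] := e_le M.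
have bb := bar_bound (cT p); have bp := bar_bound (psi (cT p)).
have c1 : c <= 1 / 100 :> R by lra.
have n1 : N f1 <= 2.
  apply: N_mk; rewrite ?normr1 ?ler_norml; [lra | move: bb; clear; lra |].
  have : `|b * bar (cT p)| <= 1 / 100 * 2.
    by rewrite normrM; apply: ler_pM => //; [exact: le_trans c1 | rewrite ler_norml; lra].
  by move: ha c1; rewrite !ler_norml; clear; lra.
have n2 : N f2 <= 1 by apply: N_mk; rewrite ?normr1 ?normr0//; lra.
have le1 (x : R) v : N v <= 2 -> x <= e * N v -> x <= 2 * e.
  by move=> h; move=> /le_trans; apply; rewrite mulrC ler_wpM2r.
have n2' : N f2 <= 2 by lra.
have S1 := le1 _ _ n1 (nj_S NJ p f1); have S2 := le1 _ _ n2' (nj_S NJ p f2).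
have T1 := le1 _ _ n1 (nj_T NJ p f1); have T2 := le1 _ _ n2' (nj_T NJ p f2).
rewrite /f1 /f2 !cS_mk !cT_mk in S1 S2 T1 T2; rewrite -/f1 -/f2 in S1 S2 T1 T2.
have e100 : 100 * e <= c.
  have -> : c = 100 * (1 / 10) ^+ 6 by lra.
  by rewrite ler_pM2l.
have bl : `|b' - bar (psi (cT p))| <= 8 * e.
  by apply: le_trans (bar_lipschitz _ _) _; rewrite ler_pM2l// (nm_T0 M).
have S1' : `|cS (f1 *m J p) - diagS (cT p)| <= 2 * e.
  by move: S1; rewrite /diagS mulr1.
have S2' : `|cS (f2 *m J p) - 1 / 4| <= 2 * e by move: S2; rewrite mulr0 add0r.
have db := diagS_bound (cT p).
have nb' : `|b'| <= 2 by have := bar_bound (cT (G p)); rewrite -/b' ler_norml; lra.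
split.
- by move: S1' e100 e0; rewrite !ler_norml; clear; lra.
- by move: S2' e100 e0; rewrite !ler_norml; clear; lra.
- have -> : cT (f1 *m J p) - b' * cS (f1 *m J p) - off (cT p) =
    (cT (f1 *m J p) - dpsi (cT p) * bar (cT p)) - b' * (cS (f1 *m J p) - diagS (cT p))
    - (b' - bar (psi (cT p))) * diagS (cT p).
    by rewrite -(diagT_dpsi (cT p)); ring.
  have h1 : `|b' * (cS (f1 *m J p) - diagS (cT p))| <= 2 * (2 * e).
    by rewrite normrM; apply: ler_pM.
  have h2 : `|(b' - bar (psi (cT p))) * diagS (cT p)| <= 8 * e * 1.
    by rewrite normrM; apply: ler_pM => //; rewrite ler_norml; move: db; clear; lra.
  apply: le_trans (ler_normB _ _) _; apply: le_trans (lerD (ler_normB _ _) (lexx _)) _.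
  by move: T1 h1 h2 e100 e0; clear; lra.
- have -> : cT (f2 *m J p) - b' * cS (f2 *m J p) - diagT (cT p) =
    (cT (f2 *m J p) - dpsi (cT p) * 1) - b' * (cS (f2 *m J p) - 1 / 4)
    - (b' - bar (psi (cT p))) / 4.
    by rewrite /diagT; field.
  have h1 : `|b' * (cS (f2 *m J p) - 1 / 4)| <= 2 * (2 * e).
    by rewrite normrM; apply: ler_pM.
  have h2 : `|(b' - bar (psi (cT p))) / 4| <= 8 * e / 4.
    by rewrite normrM (@ger0_norm _ 4^-1)// ler_wpM2r.
  apply: le_trans (ler_normB _ _) _; apply: le_trans (lerD (ler_normB _ _) (lexx _)) _.
  by move: T2 h1 h2 e100 e0; clear; lra.
Qed.

Lemma off_diag (t : R) : off t <= 8 * diagS t /\ off t <= 9 * diagT t.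
Proof.
have bb := bar_bound t; have bp := bar_bound (psi t); have bl := bar_psi_le t.
have l1 := @lam_lt R; have l2 := @lam_gt R; have db := diagS_bound t.
have dp := dpsi_bound t.
have e1 : off t = dpsi t * bar t - bar (psi t) * diagS t by rewrite diagT_dpsi.
have e2 : bar t = dpsi t - lam := barE t.
have h1 : dpsi t * bar t <= dpsi t * (164 / 100) by apply: ler_wpM2l; lra.
have h2 : - bar (psi t) * diagS t <= 17 / 100 * diagS t by apply: ler_wpM2r; lra.
have e3 : diagS t = lam + bar t / 4 by [].
have e4 : diagT t = dpsi t - bar (psi t) / 4 by [].
split; first by rewrite e1; move: h1 h2 e3 e2 dp l1 l2; clear; lra.
rewrite e1 e4; move: h1 h2 e2 e3 bl dp l1 l2 db bp; clear.
by move: (bar (psi t)) (bar t) (dpsi t) (diagS t) lam => x y z w l; lra.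
Qed.

End Frames.

(** * The invariant frame *)

Section InvariantFrame.
Variable R : realType.
Local Notation V3 := 'rV[R]_3.
Local Notation psi := (@psi R).
Local Notation dpsi := (@dpsi R).
Local Notation bar := (@bar R).
Local Notation lam := (@lam R).
Implicit Types (e : R) (G H : V3 -> V3) (J : V3 -> 'M[R]_3) (p q n v : V3).

(** The directions carry a common normalization: [es] and [ec] project to the unit
vector of the [S]-axis, [eu] to that of the [U]-axis; [ks kc ku] are the dual
coordinates. *)
Record frame G J (es ec eu : V3 -> V3) (ks kc ku : V3 -> V3 -> R) : Prop := Frame {
  fr_esc : continuous es; fr_ecc : continuous ec; fr_euc : continuous eu;
  fr_per : forall p n, intv n -> [/\ es (p + n) = es p, ec (p + n) = ec p & eu (p + n) = eu p];
  fr_eta : forall p v, v = ks p v *: es p + kc p v *: ec p + ku p v *: eu p;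
  fr_coord : forall p x y z (v := x *: es p + y *: ec p + z *: eu p),
    [/\ ks p v = x, kc p v = y & ku p v = z];
  fr_k : forall p v, [/\ `|ks p v| <= 5000 * N v, `|kc p v| <= 5000 * N v & `|ku p v| <= 5000 * N v];
  fr_rate : forall p, exists rs rc ru, [/\ es p *m J p = rs *: es (G p),
    ec p *m J p = rc *: ec (G p), eu p *m J p = ru *: eu (G p) &
    [/\ 0 < rs <= 7 / 10, rs + 1 / 200 <= rc, rc <= 33 / 10 & 36 / 10 <= ru]];
  fr_S : forall p, [/\ cS (es p) = 1, cS (ec p) = 1 & cU (eu p) = 1];
  fr_T : forall p, 1 / 60 <= cT (ec p) - bar (cT p) <= 10 /\
    1 / 200 <= bar (cT p) - cT (es p) <= 10;
  fr_small : forall p, [/\ `|cU (es p)| <= 1 / 500, `|cU (ec p)| <= 1 / 500,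
    `|cS (eu p)| <= (1 / 10) ^+ 4 & `|cT (eu p)| <= (1 / 10) ^+ 4]
}.

Local Notation c := ((1 / 10) ^+ 4 : R).

(** The bounds that the entries of the perturbed cocycle inherit from those of the model. *)
Definition near_entries (l k m q : R) :=
  [/\ 20 / 100 <= l <= 69 / 100, 24 / 100 <= k <= 26 / 100,
      12 / 100 <= q <= 21 / 10, 1 / 70 <= m <= 42 / 10 &
      [/\ m <= 86 / 10 * l, m <= 98 / 10 * q & 1 / 40 <= l * q - k * m]].

Lemma near_entriesP (th l k m q : R) :
  `|l - diagS th| <= c -> `|k - 1 / 4| <= c -> `|m - off th| <= c -> `|q - diagT th| <= c ->
  near_entries l k m q.
Proof.
have [/andP[a1 a2] /andP[a3 a4] /andP[a5 a6] _ a7] := positive_entries_cone th.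
have [a8 a9] := off_diag th.
have c1 : 0 <= c <= 1 / 100 / 100 by rewrite exprn_ge0//; lra.
move: a1 a2 a3 a4 a5 a6 a7 a8 a9 c1; move: c (diagS th) (diagT th) (off th) => d l' q' m'.
move=> a1 a2 a3 a4 a5 a6 a7 a8 a9 /andP[d0 d1]; rewrite !ler_norml.
move=> /andP[l1 l2] /andP[k1 k2] /andP[m1 m2] /andP[q1 q2].
have A (x y lo hi : R) : lo <= y -> y <= hi -> - d <= x - y -> x - y <= d ->
  lo - 1 / 100 / 100 <= x <= hi + 1 / 100 / 100.
  by move: d1; clear; lra.
have /andP[L1 L2] := A _ _ _ _ a1 a2 l1 l2; have /andP[Q1 Q2] := A _ _ _ _ a3 a4 q1 q2.
have /andP[M1 M2] := A _ _ _ _ a5 a6 m1 m2.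
have h1 : `|(l - l') * q| <= d * 3.
  rewrite normrM; apply: ler_pM => //; rewrite ler_norml; first by rewrite l1.
  by move: Q1 Q2; clear; lra.
have h2 : `|l' * (q - q')| <= 1 * d.
  rewrite normrM; apply: ler_pM => //; rewrite ler_norml; last by rewrite q1.
  by move: a1 a2; clear; lra.
have h3 : `|(k - 1 / 4) * m| <= d * 5.
  rewrite normrM; apply: ler_pM => //; rewrite ler_norml; first by rewrite k1.
  by move: M1 M2; clear; lra.
split.
- by move: L1 L2; clear; lra.
- by move: k1 k2 d1; clear; lra.
- by move: Q1 Q2; clear; lra.
- by move: M1 M2; clear; lra.
split.
- by move: a8 L1 l1 m2 d1; clear; lra.
- by move: a9 Q1 q1 m2 d1; clear; lra.
have -> : l * q - k * m = (l' * q' - m' / 4) + (l - l') * q + l' * (q - q')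
   - (k - 1 / 4) * m - (m - m') / 4 by field.
by move: h1 h2 h3 a7 d1 m1 m2; rewrite !ler_norml; clear; lra.
Qed.

(** This makes the projective action of the cocycle a uniform contraction. *)
Lemma near_entries_det (l k m q : R) : near_entries l k m q ->
  0 <= l * q - k * m <= (1 - 1 / 500) * (l * q + k * m).
Proof.
move=> [/andP[l1 l2] /andP[k1 k2] /andP[q1 q2] /andP[m1 m2] [_ _ d]].
have h1 : 24 / 100 * (1 / 70) <= k * m.
  by apply: ler_pM => //; move: k1 m1; clear; lra.
have h2 : l * q <= 69 / 100 * (21 / 10).
  by apply: ler_pM => //; move: l1 q1; clear; lra.
by apply/andP; split; move: h1 h2 d; clear; lra.
Qed.

Lemma near_entries_c (l k m q r : R) : near_entries l k m q -> 1 / 60 <= r <= 10 ->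
  1 / 60 * (l + k * r) <= m + q * r <= 10 * (l + k * r).
Proof.
move=> [/andP[l1 l2] /andP[a1 a2] /andP[q1 q2] /andP[m1 m2] [b1 b2 _]] /andP[r1 r2].
have r0 : 0 <= r by move: r1; clear; lra.
have h1 : k * r <= 26 / 100 * r by exact: ler_wpM2r.
have h2 : 24 / 100 * r <= k * r by exact: ler_wpM2r.
have h3 : 12 / 100 * r <= q * r by exact: ler_wpM2r.
have h4 : q * r <= 21 / 10 * r by exact: ler_wpM2r.
by apply/andP; split; move: h1 h2 h3 h4 r1 r2 l1 l2 q1 q2 m1 m2 b1 b2; clear; lra.
Qed.

Lemma near_entries_s (l k m q r : R) : near_entries l k m q -> 1 / 200 <= r <= 10 ->
  1 / 200 * (q + k * r) <= m + l * r <= 10 * (q + k * r).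
Proof.
move=> [/andP[l1 l2] /andP[a1 a2] /andP[q1 q2] /andP[m1 m2] [b1 b2 _]] /andP[r1 r2].
have r0 : 0 <= r by move: r1; clear; lra.
have h1 : k * r <= 26 / 100 * r by exact: ler_wpM2r.
have h2 : 24 / 100 * r <= k * r by exact: ler_wpM2r.
have h3 : 20 / 100 * r <= l * r by exact: ler_wpM2r.
have h4 : l * r <= 69 / 100 * r by exact: ler_wpM2r.
by apply/andP; split; move: h1 h2 h3 h4 r1 r2 l1 l2 q1 q2 m1 m2 b1 b2; clear; lra.
Qed.

Lemma near_entries_gt0 (l k m q : R) : near_entries l k m q ->
  [/\ 0 < l, 0 < k, 0 < q & 0 < m].
Proof. by move=> [/andP[? _] /andP[? _] /andP[? _] /andP[? _] _]; split; lra. Qed.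

(** The first slope is that of the center; the second one, with the diagonal entries exchanged,
is that of the stable direction up to sign, attracted in backward time. *)
Lemma near_entries_section (X : topologicalType) (T : X -> X) (l k m q : X -> R) :
  continuous T -> continuous l -> continuous k -> continuous m -> continuous q ->
  (forall x, near_entries (l x) (k x) (m x) (q x)) ->
  (exists r : X -> R, [/\ continuous r, forall x, 1 / 60 <= r x <= 10,
    forall x, r x = (m (T x) + q (T x) * r (T x)) / (l (T x) + k (T x) * r (T x)) &
    forall rel : X -> X -> Prop, (forall x y, rel x y -> rel (T x) (T y)) ->
      (forall x y, rel x y -> [/\ l x = l y, k x = k y, m x = m y & q x = q y]) ->
      forall x y, rel x y -> r x = r y]) /\
  (exists r : X -> R, [/\ continuous r, forall x, 1 / 200 <= r x <= 10,
    forall x, r x = (m (T x) + l (T x) * r (T x)) / (q (T x) + k (T x) * r (T x)) &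
    forall rel : X -> X -> Prop, (forall x y, rel x y -> rel (T x) (T y)) ->
      (forall x y, rel x y -> [/\ q x = q y, k x = k y, m x = m y & l x = l y]) ->
      forall x y, rel x y -> r x = r y]).
Proof.
move=> Tc lc kc mc qc h.
have l0 x : 0 < l x by have [] := near_entries_gt0 (h x).
have k0 x : 0 < k x by have [] := near_entries_gt0 (h x).
have q0 x : 0 < q x by have [] := near_entries_gt0 (h x).
have m0 x : 0 < m x by have [] := near_entries_gt0 (h x).
have det x : 0 <= l x * q x - k x * m x by have /andP[] := near_entries_det (h x).
have det' x : l x * q x - k x * m x <= (1 - 1 / 500) * (l x * q x + k x * m x).
  by have /andP[] := near_entries_det (h x).
have k1 : 0 <= 1 - 1 / 500 :> R by clear; lra.
have k2 : 1 - 1 / 500 < 1 :> R by clear; lra.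
have c1 : 0 < 1 / 60 :> R by clear; lra.
have c2 : 1 / 60 <= 10 :> R by clear; lra.
have c3 : 0 < 1 / 200 :> R by clear; lra.
have c4 : 1 / 200 <= 10 :> R by clear; lra.
split; apply: (@positive_section R X T _ _ _ _ _ _ (1 - 1 / 500)) => //.
- by move=> x r; apply: near_entries_c.
- by move=> x; rewrite (mulrC (q x)).
- by move=> x; rewrite (mulrC (q x)).
- by move=> x r; apply: near_entries_s.
Qed.

(** The covector that annihilates the center-stable plane splits off the unstable component;
what remains is a two-dimensional system. *)
Lemma frame_coords (a b a' b' x rs rc : R)
    (es := mk 1 (x - rs) (a + b * (x - rs))) (ec := mk 1 (x + rc) (a + b * (x + rc)))
    (eu := mk a' b' 1) :
  `|a| <= c -> `|b| <= c -> `|a'| <= c -> `|b'| <= c -> `|x| <= 2 ->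
  1 / 200 <= rs <= 10 -> 1 / 60 <= rc <= 10 ->
  exists ks kc ku : V3 -> R,
    [/\ forall v, v = ks v *: es + kc v *: ec + ku v *: eu,
        forall y z w (v := y *: es + z *: ec + w *: eu), [/\ ks v = y, kc v = z & ku v = w] &
        forall v, [/\ `|ks v| <= 5000 * N v, `|kc v| <= 5000 * N v & `|ku v| <= 5000 * N v]].
Proof.
move=> ha hb ha' hb' hx /andP[s0 s1] /andP[c0 c1].
have cle : c <= 1 / 100 by clear; lra.
have aa : `|a * a'| <= 1 / 100 * (1 / 100).
  by rewrite normrM; apply: ler_pM => //; apply: le_trans cle.
have bb : `|b * b'| <= 1 / 100 * (1 / 100).
  by rewrite normrM; apply: ler_pM => //; apply: le_trans cle.
pose d := 1 - a * a' - b * b'.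
have d0 : 9 / 10 <= d by rewrite /d; move: aa bb; rewrite !ler_norml; clear; lra.
have rr : 1 / 60 <= rc + rs by move: s0 c0; clear; lra.
pose ku v := (cU v - a * cS v - b * cT v) / d.
pose y v := cS v - ku v * a'.
pose w v := cT v - ku v * b' - x * y v.
have dn : d != 0 by rewrite gt_eqF//; move: d0; clear; lra.
have rn : rc + rs != 0 by rewrite gt_eqF//; move: rr; clear; lra.
exists (fun v => (rc * y v - w v) / (rc + rs)), (fun v => (w v + rs * y v) / (rc + rs)), ku.
split.
- move=> v; have hd : d * ku v = cU v - a * cS v - b * cT v by rewrite mulrC divfK.
  have e1 : (rc * y v - w v) / (rc + rs) + (w v + rs * y v) / (rc + rs) = y v.
    by field.
  have e2 : (rc * y v - w v) / (rc + rs) * (x - rs) + (w v + rs * y v) / (rc + rs) * (x + rc) =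
      w v + x * y v by field.
  apply: coords_inj; rewrite !(cSD, cTD, cUD, cSZ, cTZ, cUZ) ?cS_mk ?cT_mk ?cU_mk.
  + by rewrite !mulr1 e1 /y; ring.
  + by rewrite e2 /w; ring.
  + move: e1 e2; set A := (_ / _); set B := (_ / _) => e1 e2.
    have -> : A * (a + b * (x - rs)) + B * (a + b * (x + rc)) + ku v * 1 =
      a * (A + B) + b * (A * (x - rs) + B * (x + rc)) + ku v by ring.
    by rewrite e1 e2 /w /y; move: hd; rewrite /d; move: (ku v) => k; clear; lra.
- move=> A B C v; rewrite /v.
  have ek : ku v = C.
    rewrite /ku /v !(cSD, cTD, cUD, cSZ, cTZ, cUZ) ?cS_mk ?cT_mk ?cU_mk.
    by apply: (mulIf dn); rewrite divfK// /d; ring.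
  have ey : y v = A + B.
    by rewrite /y ek /v !(cSD, cSZ) !cS_mk; ring.
  have ew : w v = B * rc - A * rs.
    by rewrite /w ey ek /v !(cTD, cTZ) !cT_mk; ring.
  rewrite -/v ek ey ew; split => //; first by field.
  by field.
- move=> v; have n0 := N_ge0 v; have nS := cS_le_N v; have nT := cT_le_N v; have nU := cU_le_N v.
  have kb : `|ku v| <= 2 * N v.
    rewrite /ku normrM normfV (@ger0_norm _ d); last by move: d0; clear; lra.
    rewrite ler_pdivrMr; last by move: d0; clear; lra.
    have h1 : `|a * cS v| <= 1 / 100 * N v.
      by rewrite normrM; apply: ler_pM => //; apply: le_trans cle.
    have h2 : `|b * cT v| <= 1 / 100 * N v.
      by rewrite normrM; apply: ler_pM => //; apply: le_trans cle.
    have h3 : N v * (9 / 10) <= N v * d by exact: ler_wpM2l.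
    by move: h1 h2 h3 nU n0; rewrite !ler_norml; clear; lra.
  have ka : `|ku v * a'| <= 2 * N v * (1 / 100).
    by rewrite normrM; apply: ler_pM => //; apply: le_trans cle.
  have kb' : `|ku v * b'| <= 2 * N v * (1 / 100).
    by rewrite normrM; apply: ler_pM => //; apply: le_trans cle.
  have yb : `|y v| <= 2 * N v.
    by rewrite /y; move: ka nS n0; rewrite !ler_norml; clear; lra.
  have xy : `|x * y v| <= 2 * (2 * N v) by rewrite normrM; exact: ler_pM.
  have wb : `|w v| <= 6 * N v.
    by rewrite /w; move: kb' nT n0 xy; rewrite !ler_norml; clear; lra.
  have r60 : (rc + rs)^-1 <= 60.
    rewrite -[leLHS]div1r ler_pdivrMr; last by move: rr; clear; lra.
    by move: rr; clear; lra.
  have dv z : `|z| <= 26 * N v -> `|z / (rc + rs)| <= 5000 * N v.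
    move=> hz; rewrite normrM normfV (@ger0_norm _ (rc + rs)); last by move: rr; clear; lra.
    have : `|z| * (rc + rs)^-1 <= 26 * N v * 60.
      by apply: ler_pM => //; rewrite invr_ge0; move: rr; clear; lra.
    have -> : 5000 * N v = 26 * N v * 60 + (50 * 70 - 6 * 10) * N v by ring.
    by move=> h; apply: le_trans h _; rewrite lerDl mulr_ge0//; clear; lra.
  have rcy : `|rc * y v| <= 10 * (2 * N v).
    by rewrite normrM; apply: ler_pM => //; rewrite ler_norml; move: c0 c1; clear; lra.
  have rsy : `|rs * y v| <= 10 * (2 * N v).
    by rewrite normrM; apply: ler_pM => //; rewrite ler_norml; move: s0 s1; clear; lra.
  split.
  + by apply: dv; move: rcy wb n0; rewrite !ler_norml; clear; lra.
  + by apply: dv; move: rsy wb n0; rewrite !ler_norml; clear; lra.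
  + apply: le_trans kb _; apply: ler_wpM2r => //.
    by have -> : 5000 = 50 * 100 :> R; [ring|clear; lra].
Qed.

Lemma bar_int (t z : R) : z \is a Num.int -> bar (t + z) = bar t.
Proof.
move=> /intrP[k ->].
have h (n : nat) x : bar (x + n%:R) = bar x.
  by elim: n x => [|n IHn] x; rewrite ?addr0// -natr1 addrA barE dpsiD1 -barE.
case: k => n; first by rewrite h.
by rewrite -[in RHS](subrK (n.+1%:~R : R) t) h NegzE mulrNz.
Qed.

Lemma frame_exists e G H J : near_model e G H -> near_jac e J ->
  exists es ec eu ks kc ku, frame G J es ec eu ks kc ku.
Proof.
move=> M NJ.
have [a [b [[ac bc] ab abp abi]]] := cs_slopes M NJ.
have [a' [b' [[ac' bc'] ab' abp' abi']]] := unstable_slopes M NJ.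
have barc : continuous (fun p : V3 => bar (cT p)) := cont_comp (@cT_continuous R) (@bar_continuous R).
pose f1 p := mk 1 (bar (cT p)) (a p + b p * bar (cT p)).
pose f2 p := mk 0 1 (b p).
pose l p := cS (f1 p *m J p). pose k p := cS (f2 p *m J p).
pose m p := cT (f1 p *m J p) - bar (cT (G p)) * cS (f1 p *m J p).
pose q p := cT (f2 p *m J p) - bar (cT (G p)) * cS (f2 p *m J p).
have ne p : near_entries (l p) (k p) (m p) (q p).
  by have [h1 h2] := ab p; have [h3 h4 h5 h6] := cs_entries p M NJ h1 h2; exact: (near_entriesP h3 h4 h5 h6).
have abc : continuous (fun p => a p + b p * bar (cT p)) := contD ac (contM bc barc).
have [lc l1c _] := jac_cont NJ (@cont_cst R _ 1) barc abc.
have [kc k1c _] := jac_cont NJ (@cont_cst R _ 0) (@cont_cst R _ 1) bc.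
have bGc : continuous (fun p : V3 => bar (cT (G p))) := cont_comp (nm_Gc M) barc.
have mc : continuous m by apply: contB => //; exact: contM.
have qc : continuous q by apply: contB => //; exact: contM.
have rel p p' : intv (p - p') -> [/\ l p = l p', k p = k p', m p = m p' & q p = q p'].
  move=> h; have h' : intv (p' - p) by rewrite -opprB => i; rewrite mxE rpredN.
  have [e1 e2] := abp p' _ h; rewrite addrC subrK in e1 e2.
  have bi x y : intv (x - y) -> bar (cT x) = bar (cT y).
    move=> hxy; rewrite -(subrK y x) cTD; move: (hxy j2); rewrite -/(cT (x - y)).
    by move=> hz; rewrite addrC bar_int.
  have e3 := bi _ _ h; have e4 := bi _ _ (intv_G M h).
  by rewrite /l /k /m /q /f1 /f2 e1 e2 e3 e4 (nj_rel NJ h').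
have [[rc [rcc rcb rce rcp]] _] := near_entries_section (nm_Hc M) lc kc mc qc ne.
have cH (f : V3 -> R) : continuous f -> continuous (fun p => f (H p)) := cont_comp (nm_Hc M).
have [_ [rs [rsc rsb rse rsp]]] := near_entries_section (nm_Gc M) (cH _ lc) (cH _ kc) (cH _ mc) (cH _ qc)
  (fun x => ne (H x)).
have relH x y : intv (x - y) -> intv (H x - H y) := intv_H M.
have {}rcp x y : intv (x - y) -> rc x = rc y by apply: (rcp (fun x y => intv (x - y))) => x' y'; [exact: relH|exact: rel].
have {}rsp x y : intv (x - y) -> rs x = rs y.
  apply: (rsp (fun x y => intv (x - y))) => [x' y'|x' y' h]; first exact: (intv_G M).
  by have [? ? ? ?] := rel _ _ (relH _ _ h).
have {}rce p : rc (G p) = (m p + q p * rc p) / (l p + k p * rc p).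
  by rewrite rce !(nm_GH M).
have {}rse p : rs p = (m p + l p * rs (G p)) / (q p + k p * rs (G p)).
  by rewrite rse !(nm_GH M).
pose es p := mk 1 (bar (cT p) - rs p) (a p + b p * (bar (cT p) - rs p)).
pose ec p := mk 1 (bar (cT p) + rc p) (a p + b p * (bar (cT p) + rc p)).
pose eu p := mk (a' p) (b' p) 1.
have bb p : `|bar (cT p)| <= 2.
  by have := bar_bound (cT p); rewrite ler_norml; clear; lra.
have /choice[kk kkP] p : exists kk : (V3 -> R) * (V3 -> R) * (V3 -> R),
    [/\ forall v, v = kk.1.1 v *: es p + kk.1.2 v *: ec p + kk.2 v *: eu p,
        forall y z w (v := y *: es p + z *: ec p + w *: eu p), [/\ kk.1.1 v = y, kk.1.2 v = z & kk.2 v = w] &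
        forall v, [/\ `|kk.1.1 v| <= 5000 * N v, `|kk.1.2 v| <= 5000 * N v & `|kk.2 v| <= 5000 * N v]].
  have [ha hb] := ab p; have [ha' hb'] := ab' p.
  have [ks [kc' [ku h]]] := frame_coords ha hb ha' hb' (bb p) (rsb p) (rcb p).
  by exists (ks, kc', ku).
have sl p r : `|r| <= 10 -> `|a p + b p * (bar (cT p) + r)| <= 1 / 500.
  move=> hr; have [h1 h2] := ab p.
  have : `|b p * (bar (cT p) + r)| <= c * 12.
    rewrite normrM; apply: ler_pM => //; apply: le_trans (ler_normD _ _) _.
    by have := bb p; move: hr; clear; lra.
  by move: h1; rewrite !ler_norml; clear; lra.
have ecJ p : ec p *m J p = (l p + k p * rc p) *: ec (G p).
  have e1 : ec p = f1 p + rc p *: f2 p.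
    by rewrite /ec /f1 /f2 -mkZ -mkD; congr mk; ring.
  have D0 : l p + k p * rc p != 0.
    have [l0 k0 _ _] := near_entries_gt0 (ne p); have /andP[r0 _] := rcb p.
    by rewrite gt_eqF// addr_gt0// mulr_gt0//; move: r0; clear; lra.
  have eS : cS (ec p *m J p) = l p + k p * rc p.
    by rewrite e1 mulmxDl -scalemxAl cSD cSZ /l /k; ring.
  have eT : cT (ec p *m J p) = (l p + k p * rc p) * (bar (cT (G p)) + rc (G p)).
    rewrite mulrDr rce [_ * (_ / _)]mulrC divfK// e1 mulmxDl -scalemxAl cTD cTZ /l /k /m /q; ring.
  have eU : cU (ec p) = a p * cS (ec p) + b p * cT (ec p).
    by rewrite /ec cS_mk cT_mk cU_mk; ring.
  apply: coords_inj; rewrite ?(abi _ _ eU) ?eS ?eT /ec ?cSZ ?cTZ ?cUZ ?cS_mk ?cT_mk ?cU_mk; ring.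
have dq p : 0 < q p + k p * rs (G p).
  have [_ k0 q0 _] := near_entries_gt0 (ne p); have /andP[r0 _] := rsb (G p).
  by rewrite addr_gt0// mulr_gt0//; move: r0; clear; lra.
have esJ p : es p *m J p = (l p - k p * rs p) *: es (G p).
  have e1 : es p = f1 p + (- rs p) *: f2 p.
    by rewrite /es /f1 /f2 -mkZ -mkD; congr mk; ring.
  have eS : cS (es p *m J p) = l p - k p * rs p.
    by rewrite e1 mulmxDl -scalemxAl cSD cSZ /l /k; ring.
  have D0 := gt_eqF (dq p).
  have eT : cT (es p *m J p) = (l p - k p * rs p) * (bar (cT (G p)) - rs (G p)).
    have : rs p * (q p + k p * rs (G p)) = m p + l p * rs (G p) by rewrite {1}rse divfK// D0.
    rewrite e1 mulmxDl -scalemxAl cTD cTZ /l /k /m /q; clear; lra.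
  have eU : cU (es p) = a p * cS (es p) + b p * cT (es p).
    by rewrite /es cS_mk cT_mk cU_mk; ring.
  apply: coords_inj; rewrite ?(abi _ _ eU) ?eS ?eT /es ?cSZ ?cTZ ?cUZ ?cS_mk ?cT_mk ?cU_mk; ring.
exists es, ec, eu, (fun p => (kk p).1.1), (fun p => (kk p).1.2), (fun p => (kk p).2); split.
- have h1 : continuous (fun p : V3 => 1 : R) := @cont_cst R _ 1.
  exact: (mk_continuous h1 (contB barc rsc) (contD ac (contM bc (contB barc rsc)))).
- have h1 : continuous (fun p : V3 => 1 : R) := @cont_cst R _ 1.
  exact: (mk_continuous h1 (contD barc rcc) (contD ac (contM bc (contD barc rcc)))).
- have h1 : continuous (fun p : V3 => 1 : R) := @cont_cst R _ 1.
  exact: (mk_continuous ac' bc' h1).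
- move=> p n hn; have h : intv (p + n - p) by rewrite addrC addKr.
  have [h1 h2] := abp p n hn; have [h3 h4] := abp' p n hn.
  by rewrite /es /ec /eu h1 h2 h3 h4 (rcp _ _ h) (rsp _ _ h) cTD (bar_int _ (hn j2)).
- by move=> p; have [] := kkP p.
- by move=> p; have [] := kkP p.
- by move=> p; have [] := kkP p.
- move=> p; have [ru hru eJ] := abi' p.
  exists (l p - k p * rs p), (l p + k p * rc p), ru; split => //.
  have [/andP[l1 l2] /andP[k1 k2] /andP[q1 q2] /andP[m1 m2] [_ _ det]] := ne p.
  have /andP[s1 s2] := rsb p; have /andP[r1 r2] := rcb p.
  have ks0 : 0 <= k p * rs p.
    by apply: mulr_ge0; [move: k1|move: s1]; clear; lra.
  have D0 := dq p.
  have pos : 0 < l p - k p * rs p.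
    rewrite -(pmulr_lgt0 _ D0).
    have : rs p * (q p + k p * rs (G p)) = m p + l p * rs (G p) by rewrite {1}rse divfK// gt_eqF.
    move: det => /(lt_le_trans _) h e1.
    have -> : (l p - k p * rs p) * (q p + k p * rs (G p)) = l p * q p - k p * m p.
      by rewrite mulrBl -[k p * _ * _]mulrA e1; ring.
    by apply: h; clear; lra.
  have k3 : 24 / 100 * (1 / 60 + 1 / 200) <= k p * (rc p + rs p).
    by apply: ler_pM => //; move: s1 r1; clear; lra.
  have k4 : k p * rc p <= 26 / 100 * 10.
    by apply: ler_pM => //; [move: k1|move: r1]; clear; lra.
  split=> //.
  + by rewrite pos; move: ks0 l2; clear; lra.
  + by move: k3; clear; lra.
  + by move: k4 l2; clear; lra.
- by move=> p; rewrite /es /ec /eu !cS_mk cU_mk.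
- move=> p; rewrite /es /ec !cT_mk; have /andP[s1 s2] := rsb p; have /andP[r1 r2] := rcb p.
  by split; apply/andP; split; move: s1 s2 r1 r2; clear; lra.
- move=> p; rewrite /es /ec /eu !cU_mk cS_mk cT_mk; have [h1 h2] := ab' p.
  have /andP[s1 s2] := rsb p; have /andP[r1 r2] := rcb p.
  by split=> //; apply: sl; rewrite ?normrN ler_norml; move: s1 s2 r1 r2; clear; lra.
Qed.

End InvariantFrame.

(** * Curves tangent to the center *)

Section CenterDirections.
Variable R : realType.
Local Notation V3 := 'rV[R]_3.
Local Notation bar := (@bar R).
Implicit Types (e : R) (G H : V3 -> V3) (J : V3 -> 'M[R]_3) (p q n v : V3).
Implicit Types (es ec eu : V3 -> V3) (ks kc ku : V3 -> V3 -> R).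

Lemma cone_coords (x y rs rc g1 g2 : R) : 1 / 200 <= rs <= 10 -> 1 / 60 <= rc <= 10 ->
  `|g1| <= (1 / 10) ^+ 4 * (`|x| + `|y|) -> `|g2| <= (1 / 10) ^+ 4 * (`|x| + `|y|) ->
  0 <= x + y + g1 -> 0 <= - rs * x + rc * y + g2 -> `|x| <= 3000 * `|y|.
Proof.
move=> /andP[s0 s1] /andP[c0 c1] h1 h2 P Q.
have c4 : (1 / 10) ^+ 4 <= 1 / 100 / 40 :> R by clear; lra.
have n0 : 0 <= `|x| + `|y| by rewrite addr_ge0.
have {}h1 : `|g1| <= 1 / 100 / 40 * (`|x| + `|y|) by apply: le_trans h1 _; exact: ler_wpM2r.
have {}h2 : `|g2| <= 1 / 100 / 100 * (`|x| + `|y|).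
  by apply: le_trans h2 _; apply: ler_wpM2r => //; clear; lra.
have K3 : 3000 = 30 * 100 :> R by ring.
have rcy : rc * y <= 10 * `|y|.
  apply: le_trans (ler_norm _) _; rewrite normrM; apply: ler_wpM2r => //.
  by rewrite ler_norml; move: c0 c1; clear; lra.
have [x0|x0] := leP 0 x.
  have rsx : 1 / 200 * x <= rs * x by exact: ler_wpM2r.
  move: h2; rewrite !(ger0_norm x0) ler_norml => /andP[_ h2].
  have y0 := normr_ge0 y; rewrite K3.
  by move: h2 Q rsx rcy y0; clear; lra.
move: h1; rewrite (ltr0_norm x0) ler_norml => /andP[_ h1]; rewrite K3.
by have := ler_norm y; have := normr_ge0 y; move: h1 P; clear; lra.
Qed.

Lemma frame_S G J es ec eu ks kc ku p v : frame G J es ec eu ks kc ku ->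
  cS v = ks p v + kc p v + ku p v * cS (eu p).
Proof.
move=> F; have [h1 h2 _] := fr_S F p.
by rewrite {1}(fr_eta F p v) !(cSD, cSZ) h1 h2 !mulr1.
Qed.

Lemma frame_T G J es ec eu ks kc ku p v : frame G J es ec eu ks kc ku ->
  cT v = ks p v * cT (es p) + kc p v * cT (ec p) + ku p v * cT (eu p).
Proof. by move=> F; rewrite {1}(fr_eta F p v) !(cTD, cTZ). Qed.

Lemma frame_U G J es ec eu ks kc ku p v : frame G J es ec eu ks kc ku ->
  cU v = ks p v * cU (es p) + kc p v * cU (ec p) + ku p v.
Proof.
move=> F; have [_ _ h] := fr_S F p.
by rewrite {1}(fr_eta F p v) !(cUD, cUZ) h mulr1.
Qed.

Lemma frame_linear G J es ec eu ks kc ku p v w : frame G J es ec eu ks kc ku ->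
  [/\ ks p (v + w) = ks p v + ks p w, kc p (v + w) = kc p v + kc p w &
      ku p (v + w) = ku p v + ku p w].
Proof.
move=> F.
have -> : v + w = (ks p v + ks p w) *: es p + (kc p v + kc p w) *: ec p + (ku p v + ku p w) *: eu p.
  rewrite {1}(fr_eta F p v) {1}(fr_eta F p w) !scalerDl.
  by rewrite addrACA [X in X + _]addrACA.
exact: (fr_coord F).
Qed.

Lemma frame_N G J es ec eu ks kc ku p : frame G J es ec eu ks kc ku -> [/\ N (es p) <= 12, N (ec p) <= 12 & N (eu p) <= 12].
Proof.
move=> F; have [h1 h2 h3] := fr_S F p; have [/andP[t1 t2] /andP[t3 t4]] := fr_T F p.
have [u1 u2 u3 u4] := fr_small F p; have bb := bar_bound (cT p).
have c4 : (1 / 10) ^+ 4 <= 12 :> R by clear; lra.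
split; apply: N_le; rewrite ?h1 ?h2 ?h3 ?normr1.
- by clear; lra.
- by rewrite ler_norml; move: t3 t4 bb; clear; lra.
- by apply: le_trans u1 _; clear; lra.
- by clear; lra.
- by rewrite ler_norml; move: t1 t2 bb; clear; lra.
- by apply: le_trans u2 _; clear; lra.
- exact: le_trans c4.
- exact: le_trans c4.
- by clear; lra.
Qed.

Lemma frame_N_le G J es ec eu ks kc ku p v : frame G J es ec eu ks kc ku ->
  N v <= 12 * (`|ks p v| + `|kc p v| + `|ku p v|).
Proof.
move=> F; have [h1 h2 h3] := frame_N p F.
rewrite {1}(fr_eta F p v); apply: le_trans (ND _ _) _; apply: le_trans (lerD (ND _ _) (lexx _)) _.
rewrite !NZ !mulrDr ![12 * _]mulrC.
by rewrite !lerD// ler_wpM2l.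
Qed.

(** The stable direction lies outside the center cone, at a distance from it, so the center
component controls the vectors of the cone. *)
Lemma cone_frame G J es ec eu ks kc ku p v : frame G J es ec eu ks kc ku ->
  flat v -> `|cT v| <= 10 * `|cS v| -> 0 <= cS v * (cT v - bar (cT p) * cS v) ->
  `|ks p v| <= 3000 * `|kc p v| /\ `|ku p v| <= 3000 * `|kc p v|.
Proof.
move=> F fl hT hQ.
have [t1 t2] := fr_T F p; have [u1 u2 u3 u4] := fr_small F p.
have eS := frame_S p v F; have eT := frame_T p v F; have eU := frame_U p v F.
move: (ks p v) (kc p v) (ku p v) eS eT eU => x y z eS eT eU.
set rc := cT (ec p) - bar (cT p) in t1; set rs := bar (cT p) - cT (es p) in t2.
have hU : `|cU v| <= 1 / 10 / 100 * `|cS v|.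
  apply: le_trans fl _; rewrite /Mx.
  have : Num.max `|cS v| `|cT v| <= 10 * `|cS v|.
    by rewrite ge_max hT andbT; have := normr_ge0 (cS v); clear; lra.
  by move=> h; apply: le_trans (_ : (1 / 10) ^+ 4 * (10 * `|cS v|) <= _);
    [apply: ler_wpM2l => //; exact: exprn_ge0|clear; lra].
have c4 : 0 <= ((1 / 10) ^+ 4 : R) <= 1 / 10 / 100 by rewrite exprn_ge0//=; clear; lra.
have /andP[c0 c1] := c4.
have x0 := normr_ge0 x; have y0 := normr_ge0 y; have z0 := normr_ge0 z.
have za : `|z * cS (eu p)| <= 1 / 10 / 100 * `|z|.
  by rewrite normrM mulrC; apply: ler_wpM2r => //; exact: le_trans c1.
have xu : `|x * cU (es p)| <= 1 / 500 * `|x| by rewrite normrM mulrC; exact: ler_wpM2r.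
have yu : `|y * cU (ec p)| <= 1 / 500 * `|y| by rewrite normrM mulrC; exact: ler_wpM2r.
have zb : `|z| <= 1 / 100 * (`|x| + `|y|).
  have hS : `|cS v| <= `|x| + `|y| + 1 / 10 / 100 * `|z|.
    rewrite eS; apply: le_trans (ler_normD _ _) _; apply: lerD => //.
    exact: ler_normD.
  have h : `|x * cU (es p) + y * cU (ec p) + z| <= 1 / 10 / 100 * (`|x| + `|y| + 1 / 10 / 100 * `|z|).
    by rewrite -eU; apply: le_trans hU _; apply: ler_wpM2l => //; clear; lra.
  have hz : `|z| <= `|x * cU (es p) + y * cU (ec p) + z| + `|x * cU (es p)| + `|y * cU (ec p)|.
    have {1}-> : z = (x * cU (es p) + y * cU (ec p) + z) - x * cU (es p) - y * cU (ec p) by ring.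
    by apply: le_trans (ler_normB _ _) _; apply: lerD => //; exact: ler_normB.
  by move: h hz xu yu x0 y0 z0; clear; lra.
have zS : `|z * cS (eu p)| <= (1 / 10) ^+ 4 * (`|x| + `|y|).
  rewrite normrM mulrC; apply: ler_pM => //; move: zb x0 y0; clear; lra.
pose g2 := z * (cT (eu p) - bar (cT p) * cS (eu p)).
have g2b : `|g2| <= (1 / 10) ^+ 4 * (`|x| + `|y|).
  have b1 : `|cT (eu p) - bar (cT p) * cS (eu p)| <= 3 * (1 / 10) ^+ 4.
    apply: le_trans (ler_normB _ _) _.
    have : `|bar (cT p) * cS (eu p)| <= 2 * (1 / 10) ^+ 4.
      by rewrite normrM; apply: ler_pM => //; have := bar_bound (cT p); rewrite ler_norml; clear; lra.
    by move: u4; clear; lra.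
  rewrite normrM; apply: le_trans (_ : 1 / 100 * (`|x| + `|y|) * (3 * (1 / 10) ^+ 4) <= _).
    exact: ler_pM.
  have -> : 1 / 100 * (`|x| + `|y|) * (3 * (1 / 10) ^+ 4) = (3 / 100) * ((1 / 10) ^+ 4 * (`|x| + `|y|)) by ring.
  by rewrite ler_piMl//; clear; lra.
have eQ : cT v - bar (cT p) * cS v = - rs * x + rc * y + g2.
  by rewrite eT eS /rs /rc /g2; ring.
have K : `|x| <= 3000 * `|y|.
  have [S0|S0|S0] := ltgtP (cS v) 0.
  - have Q : cT v - bar (cT p) * cS v <= 0 by move: hQ; rewrite nmulr_rge0.
    rewrite -(normrN x) -(normrN y).
    apply: (@cone_coords _ _ rs rc (- (z * cS (eu p))) (- g2)) => //; rewrite ?normrN//.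
    + by move: S0; rewrite eS; clear; lra.
    + by move: Q; rewrite eQ; clear; lra.
  - have Q : 0 <= cT v - bar (cT p) * cS v by move: hQ; rewrite pmulr_rge0.
    apply: (@cone_coords _ _ rs rc (z * cS (eu p)) g2) => //.
    + by move: S0; rewrite eS; clear; lra.
    + by move: Q; rewrite eQ.
  - have T0 : cT v = 0 by apply/eqP; rewrite -normr_le0; apply: le_trans hT _; rewrite S0 normr0 mulr0.
    apply: (@cone_coords _ _ rs rc (z * cS (eu p)) g2) => //.
    + by rewrite -eS S0.
    + by rewrite -eQ S0 T0 mulr0 subr0.
split=> //; apply: le_trans zb _.
have K3 : 3000 = 30 * 100 :> R by ring.
by move: K y0; rewrite K3; clear; lra.
Qed.

(** [J] is the derivative of [G], in the coordinate norm. *)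
Definition jac_expansion G J := forall p (eps : R), 0 < eps -> exists2 r : R, 0 < r &
  forall q, N (q - p) <= r -> N (G q - G p - (q - p) *m J p) <= eps * N (q - p).

Definition frame_rates (rs rc ru : R) :=
  [/\ 0 < rs <= 7 / 10, rs + 1 / 200 <= rc, rc <= 33 / 10 & 36 / 10 <= ru].

(** In the frame the map is diagonal up to the error of the first order expansion, which for
vectors of the center cone is small with respect to their center component. *)
Lemma center_expansion e G H J es ec eu ks kc ku Rel p (eta : R) :
  near_model e G H -> frame G J es ec eu ks kc ku -> jac_expansion G J -> center_rel G H Rel ->
  0 < eta ->
  exists rs rc ru, frame_rates rs rc ru /\ exists2 r : R, 0 < r &
    forall q (v := q - p) (v' := G q - G p), Rel p q -> N (q - p) <= r ->
      [/\ `|ks (G p) v' - rs * ks p v| <= eta * `|kc p v|,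
          `|kc (G p) v' - rc * kc p v| <= eta * `|kc p v| &
          `|ku (G p) v' - ru * ku p v| <= eta * `|kc p v|].
Proof.
move=> M F E CR eta0; have [rs [rc [ru [e1 e2 e3 rates]]]] := fr_rate F p.
exists rs, rc, ru; split=> //.
have [r1 r10 cone] := cr_cone CR.
have [k k0 kb] : exists2 k : R, 0 < k & forall w, [/\ `|ks (G p) w| <= k * N w,
    `|kc (G p) w| <= k * N w & `|ku (G p) w| <= k * N w].
  by exists 5000; [rewrite ltr0n|exact: (fr_k F)].
have [K K0 cf] : exists2 K : R, 0 < K & forall v, flat v -> `|cT v| <= 10 * `|cS v| ->
    0 <= cS v * (cT v - bar (cT p) * cS v) ->
    `|ks p v| <= K * `|kc p v| /\ `|ku p v| <= K * `|kc p v|.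
  by exists 3000; [rewrite ltr0n|move=> v; exact: (cone_frame F)].
have n12 : 0 < 12 :> R by rewrite ltr0n.
pose D : R := 12 * (K + 1 + K).
have D0 : 0 < D by rewrite mulr_gt0// !addr_gt0.
pose C : R := k * D; have C0 : 0 < C by rewrite mulr_gt0.
have [r2 r20 ex] := E p (eta / C) (divr_gt0 eta0 C0).
exists (Num.min r1 r2); first by rewrite lt_min r10.
move=> q v v' hR; rewrite le_min => /andP[h1 h2].
have [fl hT hQ] := cone p q hR h1.
have [kx kz] := cf _ fl hT hQ.
set w := v' - v *m J p.
have wN : N w <= eta / C * N v := ex q h2.
have vN : N v <= D * `|kc p v|.
  apply: le_trans (frame_N_le p v F) _.
  rewrite -mulrA; apply: ler_wpM2l; first exact: ltW.
  by rewrite !mulrDl mul1r; apply: lerD => //; exact: lerD.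
have wC : k * N w <= eta * `|kc p v|.
  apply: le_trans (_ : k * (eta / C * (D * `|kc p v|)) <= _).
    apply: ler_wpM2l; first exact: ltW.
    apply: le_trans wN _; apply: ler_wpM2l => //.
    by apply: ltW; exact: divr_gt0.
  have -> : k * (eta / C * (D * `|kc p v|)) = (eta / C) * C * `|kc p v|.
    by rewrite /C; ring.
  by rewrite divfK// gt_eqF.
have ev : v *m J p = (rs * ks p v) *: es (G p) + (rc * kc p v) *: ec (G p) + (ru * ku p v) *: eu (G p).
  rewrite {1}(fr_eta F p v) !mulmxDl -!scalemxAl e1 e2 e3 !scalerA.
  by congr (_ *: _ + _ *: _ + _ *: _); rewrite mulrC.
have [f1 f2 f3] := fr_coord F (G p) (rs * ks p v) (rc * kc p v) (ru * ku p v).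
rewrite -ev in f1 f2 f3.
have evw : v' = w + v *m J p by rewrite subrK.
have [g1 g2 g3] := frame_linear (G p) w (v *m J p) F.
have [b1 b2 b3] := kb w.
rewrite evw g1 g2 g3 f1 f2 f3 !addrK.
by split; [exact: le_trans b1 wC|exact: le_trans b2 wC|exact: le_trans b3 wC].
Qed.

(** The gap [1 / 200] between the rates pays for the nonlinear error [eta] and for a gain by the
factor [1 - 1 / 2000], written so as to keep its literals small. *)
Lemma cone_contraction (a eta rs rc ru y y' : R) : frame_rates rs rc ru -> 0 < a ->
  eta = a / (1 + a) / 300 -> `|y' - rc * y| <= eta * `|y| ->
  (rs * a + eta) * `|y| <= (1 - 1 / 20 / 100) * a * `|y'| /\
  (a * (rc + eta) + eta) <= ru * ((1 - 1 / 20 / 100) * a).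
Proof.
move=> [/andP[s0 s1] h1 h2 h3] a0 he hy.
have k0 : 0 <= 1 - 1 / 20 / 100 :> R by clear; lra.
have d0 : 0 < 1 + a by rewrite addr_gt0.
have eta0 : 0 < eta by rewrite he; apply: divr_gt0; rewrite ?ltr0n// divr_gt0.
have hE : eta + a * eta = a / 300.
  by rewrite he; field; rewrite gt_eqF.
have ae0 : 0 < a * eta by exact: mulr_gt0.
have aw (x b : R) : x <= b -> a * x <= a * b by move=> h; apply: ler_wpM2l => //; exact: ltW.
have b1 := aw _ _ h1; have b2 := aw _ _ h2; have b3 := aw _ _ h3.
split.
  have rc0 : 0 <= rc by apply: le_trans h1; rewrite addr_ge0// ltW.
  have y1 : (rc - eta) * `|y| <= `|y'|.
    rewrite mulrBl lerBlDr; have -> : rc * `|y| = `|rc * y| by rewrite normrM (ger0_norm rc0).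
    rewrite -lerBlDl; apply: le_trans hy; rewrite distrC; exact: lerB_dist.
  apply: le_trans (_ : (1 - 1 / 20 / 100) * a * ((rc - eta) * `|y|) <= _); last first.
    by apply: ler_wpM2l => //; apply: mulr_ge0 => //; exact: ltW.
  rewrite mulrA; apply: ler_wpM2r => //.
  have -> : (1 - 1 / 20 / 100) * a * (rc - eta) = a * rc - a * rc / 20 / 100 - a * eta + a * eta / 20 / 100.
    by clear; field.
  have e1 : a * (rs + 1 / 200) = rs * a + a / 200 by clear; field.
  by move: b1 b2 hE ae0 a0; rewrite e1; move: (a * eta) (a * rc) (rs * a) => X Y Z; clear; lra.
have -> : ru * ((1 - 1 / 20 / 100) * a) = a * ru - a * ru / 20 / 100 by clear; field.
by rewrite mulrDr; move: b2 b3 hE a0; move: (a * eta) (a * rc) (a * ru) => X Y Z; clear; lra.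
Qed.

(** The graph transform at work on the graph itself: the image of a cone is strictly
thinner with respect to [es], and its preimage with respect to [eu], so a set of points
that stays in one cone along the whole orbit is tangent to [ec]. *)
Lemma center_directions e G H J es ec eu ks kc ku Rel :
  near_model e G H -> frame G J es ec eu ks kc ku -> jac_expansion G J -> center_rel G H Rel ->
  forall (a : R) p, 0 < a -> exists2 r : R, 0 < r & forall q, Rel p q -> N (q - p) <= r ->
    `|ks p (q - p)| <= a * `|kc p (q - p)| /\ `|ku p (q - p)| <= a * `|kc p (q - p)|.
Proof.
move=> M F E CR.
pose P (a : R) p := exists2 r : R, 0 < r & forall q, Rel p q -> N (q - p) <= r ->
    `|ks p (q - p)| <= a * `|kc p (q - p)| /\ `|ku p (q - p)| <= a * `|kc p (q - p)|.
have near0 (f : V3 -> V3) p (r : R) : continuous f -> 0 < r ->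
    exists2 r' : R, 0 < r' & forall q, N (q - p) <= r' -> N (f q - f p) <= r.
  move=> fc r0; have r5 : 0 < r / 5 by rewrite divr_gt0.
  have /nbhs_ballP[d /= d0 hd] : \forall q \near p, `|f p - f q| < r / 5.
    exact: (@cvgr_dist_lt _ _ _ _ _ f (f p) (fc p) (r / 5)).
  exists (d / 6); first by rewrite divr_gt0.
  move=> q hq; apply: le_trans (N_le_norm _) _; rewrite mulrC -ler_pdivlMr//.
  rewrite distrC; apply: ltW; apply: hd; rewrite -ball_normE /= distrC.
  by apply: le_lt_trans (norm_le_N _) _; move: hq d0; clear; lra.
have [K K0 P0] : exists2 K : R, 0 < K & forall p, P K p.
  exists 3000; [by rewrite ltr0n|move=> p].
  have [r r0 cone] := cr_cone CR; exists r => // q hR hq.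
  by have [fl hT hQ] := cone p q hR hq; exact: (cone_frame F fl hT hQ).
have Pstep (a : R) : 0 < a -> (forall p, P a p) -> forall p, P ((1 - 1 / 20 / 100) * a) p.
  move=> a0 Pa p; pose eta := a / (1 + a) / 300.
  have eta0 : 0 < eta by apply: divr_gt0; rewrite ?ltr0n// divr_gt0// addr_gt0.
  have [rs [rc [ru [rates [r1 r10 h1]]]]] := center_expansion (H p) M F E CR eta0.
  have [rs' [rc' [ru' [rates' [r2 r20 h2]]]]] := center_expansion p M F E CR eta0.
  have [r3 r30 h3] := Pa (H p); have [r4 r40 h4] := Pa (G p).
  have [r5 r50 h5] := near0 H p r1 (nm_Hc M) r10; have [r6 r60 h6] := near0 H p r3 (nm_Hc M) r30.
  have [r7 r70 h7] := near0 G p r4 (nm_Gc M) r40.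
  exists (Num.min (Num.min r2 r5) (Num.min r6 r7)); first by rewrite !lt_min r20 r50 r60 r70.
  move=> q hR; rewrite !le_min => /andP[/andP[q2 q5] /andP[q6 q7]].
  (* [ks] becomes small by applying [G] to the preimages, [ku] by applying [H] to the images. *)
  have [c1 _] := h3 (H q) (cr_H CR hR) (h6 q q6).
  have [_ c2] := h4 (G q) (cr_G CR hR) (h7 q q7).
  have := h1 (H q) (cr_H CR hR) (h5 q q5); rewrite !(nm_HG M) => -[a1 a2 _].
  have [_ b2 b3] := h2 q hR q2.
  have [e1 _] := cone_contraction rates a0 erefl a2.
  have [_ e2] := cone_contraction rates' a0 erefl b2.
  split.
    apply: le_trans e1; rewrite mulrDl.
    have -> : ks p (q - p) = rs * ks (H p) (H q - H p) + (ks p (q - p) - rs * ks (H p) (H q - H p)) by ring.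
    apply: le_trans (ler_normD _ _) _; apply: lerD => //.
    have [/andP[/ltW s0 _] _ _ _] := rates.
    by rewrite normrM (ger0_norm s0) -mulrA ler_wpM2l.
  have [_ _ _ u36] := rates'; have u0 : 0 < ru' by apply: lt_le_trans u36.
  rewrite -(ler_pM2l u0) mulrA.
  apply: le_trans (_ : (a * (rc' + eta) + eta) * `|kc p (q - p)| <= _); last exact: ler_wpM2r.
  have -> : ru' * `|ku p (q - p)| = `|ku (G p) (G q - G p) - (ku (G p) (G q - G p) - ru' * ku p (q - p))|.
    by rewrite subKr normrM (gtr0_norm u0).
  rewrite mulrDl; apply: le_trans (ler_normB _ _) _; apply: lerD b3.
  apply: le_trans c2 _; rewrite -mulrA; apply: ler_wpM2l; first exact: ltW.
  have -> : kc (G p) (G q - G p) = rc' * kc p (q - p) + (kc (G p) (G q - G p) - rc' * kc p (q - p)) by ring.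
  apply: le_trans (ler_normD _ _) _; rewrite mulrDl; apply: lerD b2.
  have [/andP[s0 _] hrc _ _] := rates'.
  by rewrite normrM ger0_norm//; apply: le_trans hrc; rewrite addr_ge0// ltW.
have Piter (n : nat) : forall p, P ((1 - 1 / 20 / 100) ^+ n * K) p.
  elim: n => [|n IHn]; first by rewrite expr0 mul1r.
  rewrite exprS -mulrA; apply: Pstep => //; rewrite mulr_gt0// exprn_gt0//; clear; lra.
move=> a p a0.
have [||n hn] := @geometric_small R K (1 - 1 / 20 / 100) a _ _ a0; [by clear; lra|by clear; lra|].
have [r r0 h] := Piter n p; exists r => // q hR hq; have [h1 h2] := h q hR hq.
have le : (1 - 1 / 20 / 100) ^+ n * K <= a by rewrite mulrC; exact: ltW.
by split; [apply: le_trans h1 _|apply: le_trans h2 _]; exact: ler_wpM2r.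
Qed.

(** As [cS (ec p) = 1], a curve parametrized by [cS] can only have the velocity [ec]; that it has
one is [center_directions] for all [a]. *)
Lemma center_curve e G H J es ec eu ks kc ku Rel (c : R -> V3) :
  near_model e G H -> frame G J es ec eu ks kc ku -> jac_expansion G J -> center_rel G H Rel ->
  continuous c -> (forall s, cS (c s) = s) -> (forall s t, Rel (c s) (c t)) ->
  forall s, derivable c s 1 /\ derive1 c s = ec (c s).
Proof.
move=> M F E CR cc cS_c cR s.
have key (eps : R) : 0 < eps -> \forall h \near (0 : R), N (c (s + h) - c s - h *: ec (c s)) <= eps * `|h|.
  move=> eps0; pose a := Num.min (1 / 4) (eps / 100).
  have a0 : 0 < a by rewrite lt_min !divr_gt0.
  have a4 : a <= 1 / 4 by rewrite ge_min lexx.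
  have ae : a <= eps / 100 by rewrite ge_min lexx orbT.
  have [r r0 hr] := center_directions M F E CR (c s) a0.
  have r5 : 0 < r / 5 by rewrite divr_gt0.
  have /nbhs_ballP[d /= d0 hd] : \forall t \near s, `|c s - c t| < r / 5.
    exact: (@cvgr_dist_lt _ _ _ _ _ c (c s) (cc s) (r / 5)).
  apply/nbhs_ballP; exists d => // h; rewrite -ball_normE /= sub0r normrN => hd0.
  have hh : `|c s - c (s + h)| < r / 5.
    by apply: hd; rewrite -ball_normE /= opprD addNKr normrN.
  have hN : N (c (s + h) - c s) <= r.
    apply: le_trans (N_le_norm _) _; rewrite distrC mulrC -ler_pdivlMr//; exact: ltW.
  have [kx kz] := hr _ (cR s (s + h)) hN.
  have eS := frame_S (c s) (c (s + h) - c s) F.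
  have [_ _ u3 _] := fr_small F (c s).
  set v := c (s + h) - c s in hN kx kz eS *.
  rewrite {1}/v cSB !cS_c addrAC subrr add0r in eS.
  set x := ks _ v in kx eS *; set y := kc _ v in kx kz eS *; set z := ku _ v in kz eS *.
  have n0 := normr_ge0 y.
  have zu : `|z * cS (eu (c s))| <= `|z| * 1.
    by rewrite normrM; apply: ler_wpM2l => //; apply: le_trans u3 _; clear; lra.
  have ay : a * `|y| <= 1 / 4 * `|y| by exact: ler_wpM2r.
  have hy : `|y| <= 2 * `|h|.
    rewrite eS; have -> : x + y + z * cS (eu (c s)) = y + (x + z * cS (eu (c s))) by ring.
    have := lerB_normD y (x + z * cS (eu (c s))).
    have := ler_normD x (z * cS (eu (c s))).
    by move: zu kx kz ay; clear; lra.
  have [n1 n2 n3] := frame_N (c s) F.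
  have -> : v - h *: ec (c s) = x *: (es (c s) - ec (c s)) + z *: (eu (c s) - cS (eu (c s)) *: ec (c s)).
    have ev : v = x *: es (c s) + y *: ec (c s) + z *: eu (c s) := fr_eta F (c s) v.
    by rewrite [in LHS]ev eS; apply/rowP => i; rewrite !mxE; ring.
  have N1 : N (es (c s) - ec (c s)) <= 24.
    by apply: le_trans (ND _ _) _; rewrite NN; move: n1 n2; clear; lra.
  have N2 : N (eu (c s) - cS (eu (c s)) *: ec (c s)) <= 24.
    apply: le_trans (ND _ _) _; rewrite NN NZ.
    have : `|cS (eu (c s))| * N (ec (c s)) <= 1 * 12.
      by apply: ler_pM => //; [exact: N_ge0|apply: le_trans u3 _; clear; lra].
    by move: n3; clear; lra.
  apply: le_trans (ND _ _) _; rewrite !NZ.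
  have h1 : `|x| * N (es (c s) - ec (c s)) <= a * `|y| * 24 by apply: ler_pM => //; exact: N_ge0.
  have h2 : `|z| * N (eu (c s) - cS (eu (c s)) *: ec (c s)) <= a * `|y| * 24.
    by apply: ler_pM => //; exact: N_ge0.
  have h3 : a * `|y| <= eps / 100 * (2 * `|h|).
    by apply: ler_pM => //; exact: ltW.
  have eh : 0 <= eps * `|h| by rewrite mulr_ge0// ltW.
  by move: h1 h2 h3 eh; clear; lra.
have lim : (fun h : R => h^-1 *: (c (h *: 1 + s) - c s)) @ 0^' --> ec (c s).
  apply: cvg_N => eps eps0; have eps2 : 0 < eps / 2 by rewrite divr_gt0.
  have := key _ eps2; rewrite near_withinE; apply: filterS => h hh h0.
  have -> : h^-1 *: (c (h *: 1 + s) - c s) - ec (c s) = h^-1 *: (c (s + h) - c s - h *: ec (c s)).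
    by rewrite [in RHS]scalerBr scalerA mulVf// scale1r [s + h]addrC /GRing.scale /= mulr1.
  have hp : 0 < `|h| by rewrite normr_gt0.
  rewrite NZ normfV mulrC ltr_pdivrMr//; apply: le_lt_trans hh _.
  by rewrite ltr_pM2r//; move: eps0; clear; lra.
split; first by apply/cvg_ex; exists (ec (c s)).
by rewrite derive1E; exact: cvg_lim lim.
Qed.

End CenterDirections.

(** * The torus and its cover *)

Section TorusCover.
Variable R : realType.
Local Notation V3 := 'rV[R]_3.
Local Notation T3 := (torus R).
Local Notation tpi := (@tpi R).
Implicit Types (p q n v : V3) (x y : T3) (F G H : V3 -> V3) (f g : T3 -> T3).

Lemma tpi_repr x : tpi (repr x) = x.
Proof. exact: reprK. Qed.

Lemma tpiP p q : tpi p = tpi q <-> intv (p - q).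
Proof.
split=> [h i|h].
- have /eqP/eqquotP : (p == q %[mod {eq_quot lattice_equiv R}])%qT by apply/eqP.
  by move/forallP/(_ i); rewrite !mxE.
- by apply/eqquotP/forallP => i; have := h i; rewrite !mxE.
Qed.

Lemma intvN n : intv n -> intv (- n).
Proof. by move=> h i; rewrite mxE rpredN. Qed.
Lemma intvD n m : intv n -> intv m -> intv (n + m).
Proof. by move=> h k i; rewrite mxE rpredD. Qed.

Lemma tpiD p n : intv n -> tpi (p + n) = tpi p.
Proof. by move=> h; apply/tpiP; rewrite addrAC subrr add0r. Qed.

Lemma repr_tpi p : exists2 n, intv n & repr (tpi p) = p + n.
Proof.
by exists (repr (tpi p) - p); [apply/tpiP; rewrite tpi_repr|rewrite addrC subrK].
Qed.

Lemma tpi_continuous : continuous tpi.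
Proof. exact: pi_continuous. Qed.

(** The universal property of the quotient topology. *)
Lemma torus_continuous (Z : topologicalType) (f : T3 -> Z) :
  continuous (f \o tpi) -> continuous f.
Proof. by move=> h; apply/quotient_continuous. Qed.

Lemma shift_continuous (V : normedModType R) (n : V) : continuous (fun p : V => p + n).
Proof. by move=> p; apply: cvgD; [exact: cvg_id|exact: cvg_cst]. Qed.

Lemma line_continuous (V : normedModType R) (p v : V) : continuous (fun t : R => p + t *: v).
Proof. by move=> t; apply: cvgD; [exact: cvg_cst|apply: cvgZl; exact: cvg_id]. Qed.

Lemma V3_shift_continuous n : continuous (fun p : V3 => p + n).
Proof. exact: (@shift_continuous V3 n). Qed.

Lemma V3_contB (X : topologicalType) (h k : X -> V3) : continuous h -> continuous k ->
  continuous (fun z => h z - k z).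
Proof.
have H (V : normedModType R) (h' k' : X -> V) : continuous h' -> continuous k' ->
    continuous (fun z => h' z - k' z).
  by move=> hf hg z; apply: cvgB; [exact: hf|exact: hg].
exact: (H V3).
Qed.

Lemma mulmx_inj (A B : 'M[R]_3) : (forall v : V3, v *m A = v *m B) -> A = B.
Proof. by move=> h; apply/row_matrixP => i; rewrite !rowE. Qed.

(** The saturation of an open set is the union of its integer translates. *)
Lemma tpi_open (A : set V3) : open A -> open (tpi @` A).
Proof.
move=> oA; rewrite /open /= /quotient_open.
have -> : \pi_(quotient_topology {eq_quot lattice_equiv R})%qT @^-1` (tpi @` A) =
    \bigcup_(n in [set n : V3 | intv n]) ((fun p => p + n) @^-1` A).
  apply/seteqP; split=> [p [q Aq /tpiP h]|p [n hn An]].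
    by exists (q - p) => //=; rewrite addrC subrK.
  by exists (p + n) => //; exact: tpiD.
apply: bigcup_open => n hn; apply: open_comp => // p _.
exact: shift_continuous.
Qed.

(** Along a segment, by the intermediate value theorem. *)
Lemma int_valued_const (h : V3 -> R) : continuous h -> (forall p, h p \is a Num.int) ->
  forall p q, h p = h q.
Proof.
move=> hc hi p q; pose k t := h (p + t *: (q - p)).
have kc : continuous k.
  have c1 : continuous (fun t : R => p + t *: (q - p)) := @line_continuous V3 p (q - p).
  exact: (cont_comp c1 hc).
have k0 : k 0 = h p by rewrite /k scale0r addr0.
have k1 : k 1 = h q by rewrite /k scale1r addrC subrK.
rewrite -k0 -k1; apply/eqP/negPn/negP => ne.
pose m := Num.min (k 0) (k 1).
have ki t : k t \is a Num.int by exact: hi.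
have mi : m \is a Num.int by rewrite /m; case: (leP (k 0)) => _.
have mM : m + 1 <= Num.max (k 0) (k 1).
  have : m < Num.max (k 0) (k 1) by rewrite /m; move: ne; case: (ltgtP (k 0) (k 1)) => // ->; rewrite eqxx.
  have : Num.max (k 0) (k 1) \is a Num.int by case: (leP (k 0)) => _.
  by move=> /intrP[a ->]; move: mi => /intrP[b ->]; rewrite ltr_int -intrD1 ler_int lezD1.
have [|t _ kt] := @IVT R k 0 1 (m + 1 / 2) ler01 (continuous_subspaceT kc).
  by rewrite -/m; apply/andP; split; move: mM; lra.
have /intrP[a ea] := hi (p + t *: (q - p)); rewrite -/(k t) kt in ea.
move/intrP : mi => [b eb]; rewrite eb in ea.
have e2 : (2 * b + 1)%:~R = (2 * a)%:~R :> R.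
  by rewrite intrD !intrM -ea mulrDr; congr (_ + _); field.
have /intr_inj := e2; lia.
Qed.

Lemma intv_valued_const (h : V3 -> V3) : continuous h -> (forall p, intv (h p)) ->
  forall p q, h p = h q.
Proof.
move=> hc hi p q; apply/rowP => i.
apply: (@int_valued_const (fun p => h p ord0 i)) => [|p']; last exact: hi.
exact: (cont_comp hc (@coord_continuous _ _ _ ord0 i)).
Qed.

Lemma C1_continuous F : C1_map F -> continuous F.
Proof. by move=> [d _] p; exact: differentiable_continuous. Qed.

Lemma lift_unique f F G : C1_lift f F -> C1_lift f G ->
  exists2 n, intv n & forall p, G p = F p + n.
Proof.
move=> [F1 Ff] [G1 Gf].
have hi p : intv (G p - F p) by apply/tpiP; rewrite Gf Ff.
exists (G 0 - F 0) => [//|p].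
have c : continuous (fun p => G p - F p).
  exact: V3_contB (C1_continuous G1) (C1_continuous F1).
by rewrite -(intv_valued_const c hi p 0) addrC subrK.
Qed.

Lemma jacE F p v : differentiable F p -> v *m jacobian F p = 'D_v F p.
Proof. by move=> d; exact: esym (deriveEjacobian v d). Qed.

Lemma jacobian_eq F G p : differentiable F p -> differentiable G p ->
  (forall v, 'D_v F p = 'D_v G p) -> jacobian F p = jacobian G p.
Proof.
move=> dF dG h; apply: mulmx_inj => v.
exact: (etrans (jacE v dF) (etrans (h v) (esym (jacE v dG)))).
Qed.

Lemma derive_shift F n m p v : (forall q, F (q + n) = F q + m) -> 'D_v F (p + n) = 'D_v F p.
Proof.
move=> h; rewrite /derive.
rewrite (_ : (fun t : R => _) = (fun t : R => t^-1 *: ((F \o shift p) (t *: v) - F p)))//.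
by apply/funext => t /=; rewrite addrA !h opprD addrACA subrr addr0.
Qed.

Lemma lift_period f F n : C1_lift f F -> intv n ->
  exists2 m, intv m & forall p, F (p + n) = F p + m.
Proof.
move=> [F1 Ff] hn.
have hi p : intv (F (p + n) - F p) by apply/tpiP; rewrite !Ff tpiD.
exists (F (0 + n) - F 0) => [//|p].
have c : continuous (fun p => F (p + n) - F p).
  apply: V3_contB (C1_continuous F1).
  exact: (cont_comp (@V3_shift_continuous n) (C1_continuous F1)).
by rewrite -(intv_valued_const c hi p 0) addrCA subrr addr0.
Qed.

Lemma lift_jacobian_period f F n p : C1_lift f F -> intv n -> jacobian F (p + n) = jacobian F p.
Proof.
move=> LF hn; have [m hm h] := lift_period LF hn; have [[dF _] _] := LF.
apply: mulmx_inj => v.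
exact: (etrans (jacE v (dF (p + n))) (etrans (derive_shift p v h) (esym (jacE v (dF p))))).
Qed.

(** The derivative of a lift is periodic, and two lifts differ by a constant. *)
Lemma tangent_map_tpi f F p : C1_lift f F -> tangent_map f (tpi p) = jacobian F p.
Proof.
move=> LF; rewrite /tangent_map.
have LG := xgetI (fun=> 0) (LF : [set F | C1_lift f F] F).
move: (xget _ _) LG => G /= LG.
have [n hn ->] := repr_tpi p; rewrite (lift_jacobian_period p LG hn).
have [m _ h] := lift_unique LF LG.
have [[dF _] _] := LF; have [[dG _] _] := LG.
apply: jacobian_eq => // v.
rewrite /derive (_ : (fun t : R => _) = (fun t : R => t^-1 *: ((F \o shift p) (t *: v) - F p)))//.
by apply/funext => t /=; rewrite !h opprD addrACA subrr addr0.
Qed.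

Lemma jacobian_comp F G p : differentiable F p -> differentiable G (F p) ->
  jacobian (G \o F) p = jacobian F p *m jacobian G (F p).
Proof.
move=> dF dG; apply: mulmx_inj => v; rewrite mulmxA.
have dGF : differentiable (G \o F) p by exact: differentiable_comp.
apply: etrans (jacE v dGF) _; apply: etrans (esym (jacE _ dG)).
have -> : v *m jacobian F p = 'd F p v by exact: etrans (jacE v dF) (deriveE v dF).
apply: etrans (deriveE v dGF) _.
apply: etrans (esym (deriveE ('d F p v) dG)).
exact: (congr1 (fun h : V3 -> V3 => h v) (diff_comp dF dG)).
Qed.

End TorusCover.

(** * Lifts of nearby diffeomorphisms *)

Section NearLifts.
Variable R : realType.
Local Notation V3 := 'rV[R]_3.
Local Notation T3 := (torus R).
Local Notation tpi := (@tpi R).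
Local Notation psi := (@psi R).
Local Notation dpsi := (@dpsi R).
Local Notation lam := (@lam R).
Implicit Types (p q n v : V3) (x y : T3) (F G H : V3 -> V3) (f g : T3 -> T3).

Lemma intv_small n : intv n -> `|n| < 1 -> n = 0.
Proof.
move=> hn n1; apply/rowP => i; rewrite mxE; apply/eqP.
have /intrP[k ek] := hn i; rewrite ek.
have : `|n ord0 i| < 1 by apply: le_lt_trans (coord_le_norm _ _) n1.
by rewrite ek -intr_norm -[X in _ < X]/(1%:~R) ltr_int intr_eq0; lia.
Qed.

Lemma near_and (X : topologicalType) (z : X) (P Q S : X -> Prop) :
  (\forall z' \near z, P z') -> (\forall z' \near z, Q z') ->
  (forall z', P z' -> Q z' -> S z') -> \forall z' \near z, S z'.
Proof. by move=> hP hQ h; apply: filterS2 hP hQ; exact: h. Qed.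

Lemma V3_continuous (X : topologicalType) (h : X -> V3) :
  (forall z (eps : R), 0 < eps -> \forall z' \near z, N (h z' - h z) < eps) -> continuous h.
Proof. by move=> H z; apply: cvg_N => eps eps0; exact: H. Qed.

Lemma lift_add g G m : C1_lift g G -> intv m -> C1_lift g (fun p => G p + m).
Proof.
move=> [[dG cG] Gg] hm.
have dGn p v : 'D_v (fun p => G p + m) p = 'D_v G p.
  rewrite /derive (_ : (fun t : R => _) = (fun t : R => t^-1 *: ((G \o shift p) (t *: v) - G p)))//.
  by apply/funext => t /=; rewrite opprD addrACA subrr addr0.
have dG' p : differentiable (fun p => G p + m) p.
  by apply: differentiableD => //; exact: differentiable_cst.
have jG : jacobian (fun p => G p + m) = jacobian G.
  by apply/funext => p; apply: jacobian_eq.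
split; last by move=> p; rewrite tpiD.
by split; [exact: dG'|rewrite jG; exact: cG].
Qed.

(** At each point some translate of a given lift is close to [F]. The translation vector is
locally constant, because distinct integer vectors are at distance at least 1. *)
Lemma close_lift f g F (e : R) : C1_lift f F -> C1_torus_map g -> e <= 1 / 8 -> C1_close e f g ->
  exists G, [/\ C1_lift g G, forall p, `|F p - G p| < e &
    forall p, `|jacobian F p - jacobian G p| < e].
Proof.
move=> LF [G0 LG] e8 cl; have [[_ _] Ff] := LF; have [[dG cG] Gg] := LG.
have Fc := C1_continuous LF.1; have Gc := C1_continuous LG.1.
have /choice[nn hnn] p : exists m, intv m /\ `|F p - (G0 p + m)| < e.
  have [[a [b [ea eb ab]]] _] := cl (tpi p).
  exists ((F p - a) + (b - G0 p)); split.
    by apply: intvD; apply/tpiP; rewrite ?ea ?eb ?Ff ?Gg.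
  rewrite (_ : F p - _ = a - b)//; apply/rowP => i; rewrite !mxE; ring.
have nnc : continuous nn.
  apply: V3_continuous => p a a0.
  have d8 : 0 < 1 / 8 :> R by [].
  have nF : \forall q \near p, `|F p - F q| < 1 / 8.
    exact: (@cvgr_dist_lt _ _ _ _ _ F (F p) (Fc p) (1 / 8)).
  have nG : \forall q \near p, `|G0 p - G0 q| < 1 / 8.
    exact: (@cvgr_dist_lt _ _ _ _ _ G0 (G0 p) (Gc p) (1 / 8)).
  apply: (near_and nF nG) => q h1 h2.
  suff -> : nn q = nn p by rewrite subrr /N !raddf0 normr0 !maxxx.
  apply/eqP; rewrite -subr_eq0; apply/eqP; apply: intv_small.
    by apply: intvD; [have [] := hnn q|apply: intvN; have [] := hnn p].
  have -> : nn q - nn p = (F q - F p) - (G0 q - G0 p) - (F q - (G0 q + nn q)) + (F p - (G0 p + nn p)).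
    by apply/rowP => i; rewrite !mxE; ring.
  have [_ h3] := hnn p; have [_ h4] := hnn q.
  rewrite distrC in h1; rewrite distrC in h2.
  apply: le_lt_trans (ler_normD _ _) _; apply: le_lt_trans (lerD (ler_normB _ _) (lexx _)) _.
  apply: le_lt_trans (lerD (lerD (ler_normB _ _) (lexx _)) (lexx _)) _.
  by move: h1 h2 h3 h4 e8; clear; lra.
have nni p : intv (nn p) by have [] := hnn p.
have nnE p : nn p = nn 0 := intv_valued_const nnc nni p 0.
exists (fun p => G0 p + nn 0).
have LG' := lift_add LG (nni 0).
split=> // p; first by rewrite -(nnE p); have [] := hnn p.
have [_] := cl (tpi p).
by rewrite (tangent_map_tpi p LF) (tangent_map_tpi p LG').
Qed.

Lemma close_lift_period g F G n m (e : R) : C1_lift g G -> intv n -> intv m ->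
  (forall p, F (p + n) = F p + m) -> e <= 1 / 8 -> (forall p, `|F p - G p| < e) ->
  forall p, G (p + n) = G p + m.
Proof.
move=> LG hn hm hF e8 cl p; have [m' hm' hG] := lift_period LG hn.
rewrite hG; congr (_ + _); apply/eqP; rewrite -subr_eq0; apply/eqP; apply: intv_small.
  by apply: intvD => //; exact: intvN.
have -> : m' - m = (F p - G p) - (F (p + n) - G (p + n)).
  by rewrite hG hF; apply/rowP => i; rewrite !mxE; ring.
apply: le_lt_trans (ler_normB _ _) _; have := cl p; have := cl (p + n); move: e8; clear; lra.
Qed.

(** A lift of the inverse composed with [G] is a translation by an integer vector, which can
be undone. *)
Lemma inverse_lift g h G : C1_lift g G -> inverse_maps g h -> C1_torus_map h ->
  exists H, [/\ C1_lift h H, cancel G H & cancel H G].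
Proof.
move=> LG [gh hg] [H0 LH]; have [[dH cH] Hh] := LH; have [_ Gg] := LG.
have Gc := C1_continuous LG.1; have Hc := C1_continuous LH.1.
have id_c : continuous (fun p : V3 => p) by move=> p.
have c1 : continuous (fun p => H0 (G p) - p) := V3_contB (cont_comp Gc Hc) id_c.
have i1 p : intv (H0 (G p) - p) by apply/tpiP; rewrite Hh Gg gh.
have [m im e1] : exists2 m, intv m & forall p, H0 (G p) = p + m.
  exists (H0 (G 0) - 0) => [|p]; first exact: i1.
  by rewrite -(intv_valued_const c1 i1 p 0) addrC subrK.
pose H p := H0 p + (- m).
have GH : cancel G H by move=> p; rewrite /H e1 addrK.
have LH' : C1_lift h H := lift_add LH (intvN im).
have tH := LH'.2.
have c2 : continuous (fun p => G (H p) - p) := V3_contB (cont_comp (C1_continuous LH'.1) Gc) id_c.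
have i2 p : intv (G (H p) - p) by apply/tpiP; rewrite Gg tH hg.
exists H; split=> // p.
have := intv_valued_const c2 i2 p (G 0).
by rewrite GH subrr => /eqP; rewrite subr_eq0 => /eqP.
Qed.

Lemma is_derive_along (l : {linear V3 -> R}) G p v : continuous l -> (forall q, differentiable G q) ->
  forall t : R, is_derive t (1 : R) (fun t => l (G (p + t *: v))) (l (v *m jacobian G (p + t *: v))).
Proof.
move=> lc dG t.
have dv := @diff_derivable _ _ _ G (p + t *: v) v (dG _).
have lim : (fun s : R => s^-1 *: ((G \o shift (p + t *: v)) (s *: v) - G (p + t *: v))) @ 0^' -->
    v *m jacobian G (p + t *: v).
  by rewrite (jacE v (dG _)); exact: dv.
have lim2 : (fun s : R => s^-1 *: (((fun t => l (G (p + t *: v))) \o shift t) (s *: 1) - l (G (p + t *: v)))) @ 0^' -->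
    l (v *m jacobian G (p + t *: v)).
  have := @cvg_comp _ _ _ _ l _ _ _ lim (lc _).
  rewrite (_ : l \o _ = (fun s : R => s^-1 *: (((fun t => l (G (p + t *: v))) \o shift t) (s *: 1) - l (G (p + t *: v)))))//.
  apply/funext => s /=; rewrite linearZ linearB /= -[s%:A]/(s * 1) mulr1 scalerDl.
  by rewrite [p + (_ + _)]addrCA.
split; first by apply/cvg_ex; eexists; exact: lim2.
exact: cvg_lim lim2.
Qed.

(** The mean value theorem along the segment from [p] to [q]. *)
Lemma difference_bound (l : {linear V3 -> R}) F G (k : R) : continuous l ->
  (forall q, differentiable F q) -> (forall q, differentiable G q) ->
  (forall q v, `|l (v *m jacobian G q) - l (v *m jacobian F q)| <= k * N v) ->
  forall p q, `|(l (G q) - l (G p)) - (l (F q) - l (F p))| <= k * N (q - p).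
Proof.
move=> lc dF dG hk p q; set v := q - p.
have dF' := @is_derive_along l F p v lc dF.
have dG' := @is_derive_along l G p v lc dG.
have dd (t : R) := is_deriveB (dG' t) (dF' t).
have [c _] := mean_value dd ltr01.
have e1 : p + (1 : R) *: v = q by rewrite scale1r /v addrC subrK.
have e0 : p + (0 : R) *: v = p by rewrite scale0r addr0.
rewrite -[(_ - _) 1]/(l (G (p + 1 *: v)) - l (F (p + 1 *: v))) -[(_ - _) 0]/(l (G (p + 0 *: v)) - l (F (p + 0 *: v))).
rewrite e1 e0 subr0 mulr1 => e.
have -> : (l (G q) - l (G p)) - (l (F q) - l (F p)) = l (G q) - l (F q) - (l (G p) - l (F p)) by ring.
by rewrite e; exact: hk.
Qed.

Lemma differentiable_expansion G : (forall p, differentiable G p) -> jac_expansion G (jacobian G).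
Proof.
move=> dG p eps eps0.
have e15 : 0 < eps / 15 by rewrite divr_gt0.
have /diff_locally/eqaddoP/(_ _ e15)/nbhs_ballP[r /= r0 hr] := dG p.
exists (r / 6); first by rewrite divr_gt0.
move=> q hq; set h := q - p.
have hb : ball (0 : V3) r h.
  rewrite -ball_normE /= sub0r normrN; apply: le_lt_trans (norm_le_N _) _.
  by move: hq r0; rewrite -/h; clear; lra.
have := hr h hb.
rewrite /= -[(_ - _) h]/(G (h + p) - (G p + 'd G p h)).
have -> : 'd G p h = h *m jacobian G p by rewrite (jacE h (dG p)) deriveE.
rewrite {1}/h subrK opprD addrA => hh.
apply: le_trans (N_le_norm _) _.
apply: le_trans (_ : 5 * (eps / 15 * `|h|) <= _); first exact: ler_wpM2l.
have : eps / 15 * `|h| <= eps / 15 * (3 * N h) by apply: ler_wpM2l (norm_le_N _); exact: ltW.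
by clear; lra.
Qed.

End NearLifts.

(** * The model *)

Section Model.
Variable R : realType.
Local Notation V3 := 'rV[R]_3.
Local Notation T3 := (torus R).
Local Notation tpi := (@tpi R).
Local Notation psi := (@psi R).
Local Notation dpsi := (@dpsi R).
Local Notation lam := (@lam R).
Implicit Types (p q n v : V3) (x y : T3) (F G H : V3 -> V3) (f g : T3 -> T3).

Lemma mulmx_norm_le v (M : 'M[R]_3) : `|v *m M| <= 3 * (`|v| * `|M|).
Proof.
apply: norm_le_coord => [|j]; first by rewrite !mulr_ge0.
rewrite mxE; apply: le_trans (ler_norm_sum _ _ _) _.
have -> : 3 * (`|v| * `|M|) = \sum_(i < 3) `|v| * `|M|.
  by rewrite big_const_ord iter_addr_0 mulr_natl.
apply: ler_sum => i _; rewrite normrM; apply: ler_pM => //; first exact: coord_le_norm.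
rewrite [leRHS]mx_normrE.
exact: (le_bigmax_cond 0 (fun ij : 'I_3 * 'I_3 => `|M ij.1 ij.2|) (j := (i, j)) isT).
Qed.

Lemma mulmx_N_le v (M : 'M[R]_3) : N (v *m M) <= 45 * `|M| * N v.
Proof.
apply: le_trans (N_le_norm _) _.
apply: le_trans (_ : 5 * (3 * (3 * N v * `|M|)) <= _).
  apply: ler_wpM2l => //; apply: le_trans (mulmx_norm_le _ _) _.
  by rewrite ler_wpM2l// ler_wpM2r// norm_le_N.
by rewrite le_eqVlt; apply/orP; left; apply/eqP; ring.
Qed.

Lemma mulmx_cont (X : topologicalType) (J : X -> 'M[R]_3) (l : {linear V3 -> R}) v :
  (forall w, `|l w| <= N w) -> continuous J -> continuous (fun z => l (v *m J z)).
Proof.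
move=> lN Jc z; apply: continuous_eps => eps eps0.
have K0 : 0 < 45 * N v + 1 by rewrite ltr_wpDl// mulr_ge0// N_ge0.
have d0 : 0 < eps / (45 * N v + 1) by rewrite divr_gt0.
have near : \forall z' \near z, `|J z - J z'| < eps / (45 * N v + 1).
  exact: (@cvgr_dist_lt _ _ _ _ _ J (J z) (Jc z) _ d0).
apply: filterS near => z' hz; rewrite -linearB -mulmxBr.
apply: le_lt_trans (lN _) _; apply: le_lt_trans (mulmx_N_le _ _) _.
apply: le_lt_trans (_ : `|J z - J z'| * (45 * N v + 1) < eps); last by rewrite -ltr_pdivlMr.
by rewrite mulrDr mulr1 -mulrA mulrCA lerDl.
Qed.

Definition shear (B : 'M[R]_3) (s : R -> R) (w : V3) p : V3 := p *m B + s (cT p) *: w.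

Lemma shear_C1 B s ds w : (forall t, is_derive t (1 : R) s (ds t)) -> continuous ds ->
  C1_map (shear B s w) /\
  forall p v, v *m jacobian (shear B s w) p = v *m B + (ds (cT p) * cT v) *: w.
Proof.
move=> sd dsc.
have dF p : differentiable (shear B s w) p.
  have -> : shear B s w = (fun p => p ord0 j0 *: row j0 B + p ord0 j1 *: row j1 B +
      p ord0 j2 *: row j2 B + s (p ord0 j2) *: w).
    by apply/funext => q; rewrite /shear mulmx_sum_row !big_ord_recl big_ord0 addr0 !addrA.
  have dc i : differentiable (fun q : V3 => q ord0 i) p by exact: differentiable_coord.
  apply: differentiableD; first apply: differentiableD; first apply: differentiableD.
  - exact: (differentiableZl _ (dc j0)).
  - exact: (differentiableZl _ (dc j1)).
  - exact: (differentiableZl _ (dc j2)).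
  apply: differentiableZl; apply: (differentiable_comp (dc j2)).
  by apply/derivable1_diffP; exact: ex_derive.
have jE p v : v *m jacobian (shear B s w) p = v *m B + (ds (cT p) * cT v) *: w.
  have key (l : {linear V3 -> R}) : continuous l ->
      l (v *m jacobian (shear B s w) p) = l (v *m B + (ds (cT p) * cT v) *: w).
    move=> lc.
    have := @is_derive_along _ l (shear B s w) p v lc dF 0; rewrite scale0r addr0 => D1.
    have D2 : is_derive (0 : R) (1 : R) (fun t : R => l (shear B s w (p + t *: v)))
        (l (v *m B + (ds (cT p) * cT v) *: w)).
      rewrite (_ : (fun t : R => _) = (fun t : R => (l (p *m B) + t * l (v *m B)) + s (cT p + t * cT v) * l w)).
        have d1 : is_derive (0 : R) (1 : R) (fun t : R => cT p + t * cT v) (cT v).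
          by apply: is_derive_eq; rewrite /GRing.scale /=; ring.
        have d2 : is_derive (0 : R) (1 : R) (s \o (fun t : R => cT p + t * cT v)) (ds (cT p) * cT v).
          have e0 : cT p + 0 * cT v = cT p by rewrite mul0r addr0.
          have sd' : is_derive (cT p + 0 * cT v) 1 s (ds (cT p)) by rewrite e0.
          by have := @is_derive1_comp R s (fun t : R => cT p + t * cT v) 0 _ _ sd' d1.
        have d3 (h : R -> R) (dh a b k : R) : is_derive (0 : R) (1 : R) h dh ->
            is_derive (0 : R) (1 : R) (fun t : R => a + t * b + h t * k) (b + dh * k).
          by move=> hh; apply: is_derive_eq; rewrite /GRing.scale /=; ring.
        by rewrite linearD linearZ /=; exact: (d3 _ _ _ _ _ d2).
      apply/funext => t; rewrite /shear mulmxDl -scalemxAl cTD cTZ !linearD !linearZ /=.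
      by rewrite /GRing.scale /=.
    by have [_ <-] := D1; have [_ <-] := D2.
  by apply: coords_inj; apply: key; [exact: cS_continuous|exact: cT_continuous|exact: cU_continuous].
split=> //; split=> //.
pose E : 'M[R]_3 := delta_mx j2 ord0 *m w.
have -> : jacobian (shear B s w) = (fun p => B + ds (cT p) *: E).
  apply/funext => p; apply: mulmx_inj => v; rewrite jE mulmxDr -scalemxAr /E mulmxA.
  rewrite (_ : v *m delta_mx j2 ord0 = (cT v)%:M); last first.
    by apply/matrixP => i j; rewrite !ord1 !mxE (bigD1 j2)//= !mxE big1 ?addr0 ?mulr1// => k /negPf hk;
      rewrite !mxE hk mulr0.
  by rewrite mul_scalar_mx scalerA.
have c1 : continuous (fun p : V3 => ds (cT p)) := cont_comp (@cT_continuous R) dsc.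
have gen (X : topologicalType) (V : normedModType R) (h : X -> R) (a b : V) : continuous h ->
    continuous (fun z => a + h z *: b).
  by move=> hc z; apply: cvgD; [exact: cvg_cst|apply: cvgZl; exact: hc].
exact: (@gen V3 'M[R]_3).
Qed.

Definition invA3 : 'M[R]_3 :=
  \matrix_(i < 3, j < 3) nth 0 (nth [::] [:: [:: 1; -1; 0]; [:: -2; 3; 0]; [:: 0; 0; 1]] i) j.

Lemma mul_invA3 p : p *m invA3 =
  row3 (p ord0 j0 - 2 * p ord0 j1) (3 * p ord0 j1 - p ord0 j0) (p ord0 j2).
Proof.
by apply: row3_inj; rewrite !row3E !mxE !big_ord_recl big_ord0 !mxE /=; rewrite /j0 /j1 /j2; ring.
Qed.

Lemma A3K p : p *m invA3 *m (A3 R) = p.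
Proof. by rewrite mulA3 mul_invA3 !row3E; apply: row3_inj; rewrite !row3E //; ring. Qed.

Lemma invA3K p : p *m (A3 R) *m invA3 = p.
Proof. by rewrite mul_invA3 mulA3 !row3E; apply: row3_inj; rewrite !row3E //; ring. Qed.

Lemma cT_mul_invA3 p : cT (p *m invA3) = cT p.
Proof. by rewrite mul_invA3 /cT !row3E. Qed.

Lemma intv_invA3 n : intv n -> intv (n *m invA3).
Proof.
by move=> hn; rewrite mul_invA3; apply: forall_I3; rewrite row3E ?rpredB ?rpredM ?natr_int.
Qed.

(** The vector of the shear has vanishing [cS] and [cU], so only [cT] is affected by the shear.
The inverse of such a map is of the same form. *)
Definition model : V3 -> V3 := shear (A3 R) (fun t => psi t - t) (mk 0 1 0).
Definition model_inv : V3 -> V3 := shear invA3 (fun t => @phi R t - t) (mk 0 1 0 *m invA3).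

Lemma cT_model p : cT (model p) = psi (cT p).
Proof. by rewrite /model /shear cTD cTZ cT_mulA3 cT_mk mulr1 addrC subrK. Qed.

Lemma cS_model p : cS (model p) = lam * cS p + cT p / 4.
Proof. by rewrite /model /shear cSD cSZ cS_mulA3 cS_mk mulr0 addr0. Qed.

Lemma cU_model p : cU (model p) = (4 - lam) * cU p.
Proof. by rewrite /model /shear cUD cUZ cU_mulA3 cU_mk mulr0 addr0. Qed.

Lemma modelK : cancel model model_inv.
Proof.
move=> p; rewrite {1}/model_inv /shear cT_model psiK {1}/model /shear mulmxDl invA3K.
by rewrite -scalemxAl -addrA -scalerDl addrA subrK subrr scale0r addr0.
Qed.

Lemma model_invK : cancel model_inv model.
Proof.
move=> p; have eT : cT (model_inv p) = phi (cT p).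
  by rewrite /model_inv /shear cTD cTZ !cT_mul_invA3 cT_mk mulr1 addrC subrK.
rewrite {1}/model /shear eT phiK {1}/model_inv /shear mulmxDl A3K -scalemxAl A3K.
by rewrite -addrA -scalerDl addrA subrK subrr scale0r addr0.
Qed.

Lemma shear_period B s w p n : (forall t z : R, z \is a Num.int -> s (t + z) = s t) ->
  intv n -> shear B s w (p + n) = shear B s w p + n *m B.
Proof. move=> hs hn; rewrite /shear mulmxDl cTD (hs _ _ (hn j2)) -!addrA; congr (_ + _).
exact: addrC. Qed.

Lemma psi_int (t z : R) : z \is a Num.int -> psi (t + z) = psi t + z.
Proof.
move=> /intrP[k ->].
have h (n : nat) (x : R) : psi (x + n%:R) = psi x + n%:R.
  by elim: n x => [|n IHn] x; rewrite ?addr0// -natr1 addrA psiD1 IHn addrA.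
case: k => n; first by rewrite h.
rewrite -[in RHS](subrK (n.+1%:~R : R) t) h NegzE mulrNz.
by rewrite addrK.
Qed.

Lemma phi_int (t z : R) : z \is a Num.int -> phi (t + z) = phi t + z.
Proof. by move=> hz; apply: (can_inj (@psiK R)); rewrite phiK psi_int// phiK. Qed.

Lemma model_period p n : intv n -> model (p + n) = model p + n *m A3 R.
Proof.
move=> hn; apply: shear_period => // t z hz; rewrite psi_int//.
by rewrite opprD addrACA subrr addr0.
Qed.

Lemma model_inv_period p n : intv n -> model_inv (p + n) = model_inv p + n *m invA3.
Proof.
move=> hn; apply: shear_period => // t z hz; rewrite phi_int//.
by rewrite opprD addrACA subrr addr0.
Qed.

Definition torus_model (x : T3) : T3 := tpi (model (repr x)).
Definition torus_model_inv (x : T3) : T3 := tpi (model_inv (repr x)).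

Lemma torus_model_tpi p : tpi (model p) = torus_model (tpi p).
Proof.
rewrite /torus_model; have [n hn ->] := repr_tpi p.
by rewrite model_period// tpiD//; exact: intv_mulA3.
Qed.

Lemma torus_model_inv_tpi p : tpi (model_inv p) = torus_model_inv (tpi p).
Proof.
rewrite /torus_model_inv; have [n hn ->] := repr_tpi p.
by rewrite model_inv_period// tpiD//; exact: intv_invA3.
Qed.

Lemma is_derive_sub_id (s : R -> R) (ds t : R) : is_derive t (1 : R) s ds ->
  is_derive t (1 : R) (fun t => s t - t) (ds - 1).
Proof. by move=> h; apply: is_derive_eq. Qed.

Lemma model_C1 : C1_map model /\
  forall p v, v *m jacobian model p = v *m A3 R + ((dpsi (cT p) - 1) * cT v) *: mk 0 1 0.
Proof.
have sd t : is_derive t (1 : R) (fun t => psi t - t) (dpsi t - 1).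
  by apply: is_derive_sub_id; exact: is_derive_psi.
have sc : continuous (fun t => dpsi t - 1) := contB (@dpsi_continuous R) (@cont_cst R _ 1).
exact: (@shear_C1 (A3 R) _ _ (mk 0 1 0) sd sc).
Qed.

Lemma torus_model_lift : C1_lift torus_model model.
Proof. by split; [exact: model_C1.1|exact: torus_model_tpi]. Qed.

Lemma torus_model_inv_lift : C1_lift torus_model_inv model_inv.
Proof.
split; last exact: torus_model_inv_tpi.
have sd t : is_derive t (1 : R) (fun t => phi t - t) ((dpsi (phi t))^-1 - 1).
  by apply: is_derive_sub_id; exact: is_derive_phi.
have dn t : dpsi (phi t) != 0 by rewrite gt_eqF// dpsi_gt0.
have sc : continuous (fun t => (dpsi (phi t))^-1 - 1).
  exact: contB (contV (cont_comp (@phi_continuous R) (@dpsi_continuous R)) dn) (@cont_cst R _ 1).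
exact: (@shear_C1 invA3 _ _ _ sd sc).1.
Qed.

Lemma torus_model_Diff1 : Diff1 torus_model.
Proof.
split; first by exists model; exact: torus_model_lift.
exists torus_model_inv; last by exists model_inv; exact: torus_model_inv_lift.
split=> x; rewrite -(tpi_repr x).
  by rewrite -torus_model_tpi -torus_model_inv_tpi modelK.
by rewrite -torus_model_inv_tpi -torus_model_tpi model_invK.
Qed.

End Model.

(** * Neighbourhoods of the model *)

Section CloseToModel.
Variable R : realType.
Local Notation V3 := 'rV[R]_3.
Local Notation T3 := (torus R).
Local Notation tpi := (@tpi R).
Local Notation psi := (@psi R).
Local Notation dpsi := (@dpsi R).
Local Notation lam := (@lam R).
Local Notation model := (@model R).
Implicit Types (p q n v : V3) (x y : T3) (F G H : V3 -> V3) (f g h : T3 -> T3).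

Lemma jac_model p v : [/\ cS (v *m jacobian model p) = lam * cS v + cT v / 4,
  cT (v *m jacobian model p) = dpsi (cT p) * cT v &
  cU (v *m jacobian model p) = (4 - lam) * cU v].
Proof.
rewrite (@model_C1 R).2 !(cSD, cTD, cUD, cSZ, cTZ, cUZ) cS_mulA3 cT_mulA3 cU_mulA3.
by rewrite cS_mk cT_mk cU_mk; split; ring.
Qed.

Lemma near_of_bounds (e0 e : R) G H : (forall p, differentiable G p) -> continuous (jacobian G) ->
  (forall p n, intv n -> jacobian G (p + n) = jacobian G p) ->
  0 < e0 -> e = 45 * e0 -> 0 < e <= om R -> (forall a b : R, `|a - b| <= e -> `|al a - al b| <= om R) ->
  cancel G H -> cancel H G -> continuous G -> continuous H ->
  (forall p n, intv n -> G (p + n) = G p + n *m A3 R) ->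
  (forall p, `|model p - G p| < e0) -> (forall p, `|jacobian model p - jacobian G p| < e0) ->
  near_model e G H /\ near_jac e (jacobian G).
Proof.
move=> dG cJ pJ e00 ee eom eal GH HG Gc Hc per c0 c1.
have [[dF _] _] := @model_C1 R.
have e5 p : N (G p - model p) <= e.
  apply: le_trans (N_le_norm _) _; rewrite distrC ee.
  by have := c0 p; have := normr_ge0 (model p - G p); move: e00; clear; lra.
have j5 p v : N (v *m jacobian G p - v *m jacobian model p) <= e * N v.
  rewrite -mulmxBr; apply: le_trans (mulmx_N_le _ _) _; apply: ler_wpM2r; first exact: N_ge0.
  by rewrite ee ler_wpM2l// distrC ltW.
have jS p v : `|cS (v *m jacobian G p) - cS (v *m jacobian model p)| <= e * N v.
  by rewrite -cSB; apply: le_trans (cS_le_N _) (j5 p v).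
have jT p v : `|cT (v *m jacobian G p) - cT (v *m jacobian model p)| <= e * N v.
  by rewrite -cTB; apply: le_trans (cT_le_N _) (j5 p v).
have jU p v : `|cU (v *m jacobian G p) - cU (v *m jacobian model p)| <= e * N v.
  by rewrite -cUB; apply: le_trans (cU_le_N _) (j5 p v).
split; split=> //.
- by move=> p; rewrite -cS_model -cSB; apply: le_trans (cS_le_N _) (e5 p).
- by move=> p; rewrite -cT_model -cTB; apply: le_trans (cT_le_N _) (e5 p).
- by move=> p; rewrite -cU_model -cUB; apply: le_trans (cU_le_N _) (e5 p).
- move=> p q; have := difference_bound (@cS_continuous R) dF dG jS p q.
  by rewrite /= !cS_model; congr (`|_| <= _); ring.
- move=> p q; have := difference_bound (@cT_continuous R) dF dG jT p q.
  by rewrite /= !cT_model.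
- move=> p q; have := difference_bound (@cU_continuous R) dF dG jU p q.
  by rewrite /= !cU_model mulrBr.
- move=> v; exact: (@mulmx_cont R V3 (jacobian G) (GRing.Linear.clone _ _ _ _ (@cS R) _) v (@cS_le_N R) cJ).
- move=> v; exact: (@mulmx_cont R V3 (jacobian G) (GRing.Linear.clone _ _ _ _ (@cT R) _) v (@cT_le_N R) cJ).
- move=> v; exact: (@mulmx_cont R V3 (jacobian G) (GRing.Linear.clone _ _ _ _ (@cU R) _) v (@cU_le_N R) cJ).
- by move=> p v; have [<- _ _] := jac_model p v; exact: jS.
- by move=> p v; have [_ <- _] := jac_model p v; exact: jT.
- by move=> p v; have [_ _ <-] := jac_model p v; exact: jU.
Qed.

(** The constant 45 compares the norms of vectors and matrices with [N]. *)
Lemma close_to_model : exists2 e0 : R, 0 < e0 & forall g, Diff1 g ->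
  C1_close e0 (@torus_model R) g -> exists e G H h,
    [/\ C1_lift g G, C1_lift h H, inverse_maps g h, near_model e G H & near_jac e (jacobian G)].
Proof.
have o0 := om_gt0 R; have [d d0 hd] := al_unif o0.
pose e := Num.min (om R) d; have e0 : 0 < e by rewrite lt_min o0.
have e45 : 0 < e / 45 by rewrite divr_gt0.
exists (e / 45) => // g [gC [h gh hC]] cl.
have e8 : e / 45 <= 1 / 8.
  have : e <= om R by rewrite ge_min lexx.
  have : om R <= (1 / 10) ^+ 6 by exact: om_le.
  by clear; lra.
have [G [LG c0 c1]] := close_lift (@torus_model_lift R) gC e8 cl.
have [H [LH GH HG]] := inverse_lift LG gh hC.
have per p n : intv n -> G (p + n) = G p + n *m A3 R.
  move=> hn; apply: (close_lift_period LG hn (intv_mulA3 hn) _ e8 c0).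
  by move=> q; exact: model_period.
exists e, G, H, h.
have [||||||||||||NM NJ] := @near_of_bounds (e / 45) e G H LG.1.1 LG.1.2.
- by move=> p n hn; exact: (lift_jacobian_period p LG hn).
- exact: e45.
- by rewrite mulrC divfK.
- by rewrite e0 ge_min lexx.
- by move=> x y hxy; apply: hd; apply: le_trans hxy _; rewrite ge_min lexx orbT.
- exact: GH.
- exact: HG.
- exact: (C1_continuous LG.1).
- exact: (C1_continuous LH.1).
- exact: per.
- exact: c0.
- exact: c1.
by split.
Qed.

Lemma torus_close_trans (a b : R) x y z : torus_close a x y -> torus_close b y z ->
  torus_close (a + b) x z.
Proof.
move=> [p [q [<- <- pq]]] [p' [q' [/tpiP h <- pq']]].
exists p, (q' - (p' - q)); split=> //; first by rewrite tpiD//; exact: intvN.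
have -> : p - (q' - (p' - q)) = (p - q) + (p' - q') by apply/rowP => i; rewrite !mxE; ring.
by apply: le_lt_trans (ler_normD _ _) _; rewrite ltrD.
Qed.

Lemma C1_close_trans (a b : R) f g h : C1_close a f g -> C1_close b g h -> C1_close (a + b) f h.
Proof.
move=> fg gh x; have [h1 h2] := fg x; have [h3 h4] := gh x; split.
  exact: torus_close_trans h1 h3.
rewrite -(subrKA (tangent_map g x)).
by apply: le_lt_trans (ler_normD _ _) _; rewrite ltrD.
Qed.

Lemma C1_close_le (a b : R) f g : a <= b -> C1_close a f g -> C1_close b f g.
Proof.
move=> ab fg x; have [[p [q [h1 h2 h3]]] h4] := fg x.
by split; [exists p, q; split => //; exact: lt_le_trans ab|exact: lt_le_trans ab].
Qed.

(** Closeness within [e0] is a strict inequality at each point, which is not an open condition;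
closeness within some smaller radius is one. *)
Lemma C1_ball_open (e0 : R) f :
  C1_open [set g | Diff1 g /\ exists2 e, e < e0 & C1_close e f g].
Proof.
split=> [g []//|g [_ [e ee0 fg]]]; exists ((e0 - e) / 2); first by rewrite divr_gt0// subr_gt0.
move=> h hD gh; split=> //; exists (e + (e0 - e) / 2); first by move: ee0; clear; lra.
exact: C1_close_trans fg gh.
Qed.

Lemma C1_close_refl (e : R) f : 0 < e -> C1_close e f f.
Proof.
move=> e0 x; split; last by rewrite subrr normr0.
by exists (repr (f x)), (repr (f x)); split; rewrite ?tpi_repr// subrr normr0.
Qed.

End CloseToModel.

(** * Partial hyperbolicity *)

Section Hyperbolicity.
Variable R : realType.
Local Notation V3 := 'rV[R]_3.
Local Notation T3 := (torus R).
Local Notation tpi := (@tpi R).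
Implicit Types (p q n v w : V3) (x y : T3) (G H : V3 -> V3) (g h : T3 -> T3).
Implicit Types (es ec eu : V3 -> V3) (ks kc ku : V3 -> V3 -> R).

(** All that the sequel uses of a diffeomorphism near the model. *)
Record framed_diffeo g h e G H es ec eu ks kc ku : Prop := FramedDiffeo {
  fd_G : C1_lift g G;
  fd_H : C1_lift h H;
  fd_gh : inverse_maps g h;
  fd_near : near_model e G H;
  fd_frame : frame G (jacobian G) es ec eu ks kc ku
}.

Definition line_field (v : V3 -> V3) x : {vspace V3} := <[v (repr x)]>%VS.

Lemma line_field_tpi (v : V3 -> V3) p : (forall p n, intv n -> v (p + n) = v p) ->
  line_field v (tpi p) = <[v p]>%VS.
Proof. by move=> hv; rewrite /line_field; have [n hn ->] := repr_tpi p; rewrite hv. Qed.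

Lemma periodic_continuous (v : V3 -> V3) : (forall p n, intv n -> v (p + n) = v p) ->
  continuous v -> continuous (fun x => v (repr x)).
Proof.
move=> hv vc; apply: torus_continuous.
rewrite (_ : _ \o tpi = v)//; apply/funext => p /=.
by have [n hn ->] := repr_tpi p; rewrite hv.
Qed.

Lemma near_all (X : topologicalType) (z : X) (P : X -> Prop) : (forall z', P z') ->
  \forall z' \near z, P z'.
Proof. by move=> h; exact: nearW. Qed.

Lemma line_field_bundle (v : V3 -> V3) : (forall p n, intv n -> v (p + n) = v p) -> continuous v ->
  (forall p, v p != 0) -> line_bundle (line_field v).
Proof.
move=> hv vc v0 x; exists (fun x => v (repr x)); apply: near_all => y; split=> //.
exact: (periodic_continuous hv vc).
Qed.

Lemma line_field_invariant g G (v : V3 -> V3) : C1_lift g G ->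
  (forall p n, intv n -> v (p + n) = v p) ->
  (forall p, exists2 r, r != 0 & v p *m jacobian G p = r *: v (G p)) ->
  invariant_bundle g (line_field v).
Proof.
move=> LG hv hr x; rewrite -(tpi_repr x); move: (repr x) => p.
rewrite (tangent_map_tpi p LG) -LG.2 !line_field_tpi// limg_line lfunE /=.
have [r r0 ->] := hr p; apply/eqP; rewrite eqEsubv.
apply/andP; split; apply/subvP => w /vlineP[k ->].
  by rewrite scalerA memvZ// memv_line.
by apply/vlineP; exists (k / r); rewrite scalerA divfK.
Qed.

Lemma frame_directs (a b d : V3) (ka kb kd : V3 -> R) :
  (forall v, v = ka v *: a + kb v *: b + kd v *: d) -> a != 0 -> b != 0 -> d != 0 ->
  (<[a]> + <[b]> + <[d]>)%VS = fullv /\ directv (<[a]> + <[b]> + <[d]>)%VS.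
Proof.
move=> h a0 b0 d0.
have full : (<[a]> + <[b]> + <[d]>)%VS = fullv.
  apply/eqP; rewrite eqEsubv subvf; apply/subvP => v _; rewrite (h v).
  by rewrite !memv_add// memvZ// memv_line.
split=> //; rewrite directvE /= full dimvf !dim_vline a0 b0 d0 /=.
by rewrite dim_matrix.
Qed.

(** The quadratic form [40000 S^2 + T^2 + U^2]: its unit ball is thin enough in the
direction of [S] for the vectors [es] and [ec] to have nearly the same length. *)
Definition quad v : R := 200 ^+ 2 * cS v ^+ 2 + cT v ^+ 2 + cU v ^+ 2.

Lemma quadZ a v : quad (a *: v) = a ^+ 2 * quad v.
Proof. by rewrite /quad cSZ cTZ cUZ; ring. Qed.

Lemma quad_ge0 v : 0 <= quad v.
Proof. apply: addr_ge0; last exact: sqr_ge0.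
by apply: addr_ge0; [apply: mulr_ge0|]; exact: sqr_ge0. Qed.

Lemma quad_gt0 v : v != 0 -> 0 < quad v.
Proof.
move=> v0; rewrite lt_neqAle quad_ge0 andbT eq_sym; apply: contra v0 => /eqP h.
have s0 := sqr_ge0 (cS v); have t0 := sqr_ge0 (cT v); have u0 := sqr_ge0 (cU v).
have k0 : 0 <= 200 ^+ 2 * cS v ^+ 2 by apply: mulr_ge0; exact: sqr_ge0.
have hT : cT v ^+ 2 = 0 by apply/eqP; rewrite eq_le t0 andbT; move: h k0 u0; rewrite /quad; clear; lra.
have hU : cU v ^+ 2 = 0 by apply/eqP; rewrite eq_le u0 andbT; move: h k0 t0; rewrite /quad; clear; lra.
have hS : 200 ^+ 2 * cS v ^+ 2 = 0 by move: h; rewrite /quad hT hU; clear; lra.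
have K : 200 ^+ 2 != 0 :> R by rewrite expf_neq0 ?pnatr_eq0.
move: h k0 => _ _.
have {}hS : cS v ^+ 2 = 0 by apply/eqP; move/eqP: hS; rewrite mulf_eq0 (negPf K).
have z (a : R) : a ^+ 2 = 0 -> a = 0 by move/eqP; rewrite sqrf_eq0 => /eqP.
by apply/eqP; apply: coords_inj; rewrite raddf0; apply: z.
Qed.

Definition metric_mx : 'M[R]_3 :=
  let m l := lin1_mx (fun v : V3 => (l v)%:M : 'rV[R]_1) in
  200 ^+ 2 *: (m cS *m (m cS)^T) + m cT *m (m cT)^T + m cU *m (m cU)^T.

Lemma metric_mxE v : (v *m metric_mx *m v^T) ord0 ord0 = quad v.
Proof.
pose m (l : {linear V3 -> R}) := lin1_mx (fun v : V3 => (l v)%:M : 'rV[R]_1).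
have e (l : {linear V3 -> R}) : v *m m l = (l v)%:M.
  pose f := fun v : V3 => (l v)%:M : 'rV[R]_1.
  have fl : linear f by move=> a u w; rewrite /f linearP /= raddfD /= -scale_scalar_mx.
  pose F : {linear V3 -> 'rV[R]_1} := HB.pack f (GRing.isLinear.Build _ _ _ _ f fl).
  exact: (mul_rV_lin1 F).
have q (l : {linear V3 -> R}) : v *m (m l *m (m l)^T) *m v^T = (l v ^+ 2)%:M.
  by rewrite mulmxA -mulmxA -trmx_mul e tr_scalar_mx -scalar_mxM expr2.
rewrite /metric_mx !mulmxDr !mulmxDl -scalemxAr -scalemxAl.
by rewrite (q cS) (q cT) (q cU) !mxE eqxx !mulr1n.
Qed.

Lemma metric_mx_sym : metric_mx^T = metric_mx.
Proof. by rewrite /metric_mx /= !raddfD /= linearZ /= !trmx_mul !trmxK. Qed.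

Lemma metric_smooth : riemannian_metric (fun _ : T3 => metric_mx).
Proof.
split=> [i j s p|x|x v v0]; last 2 first.
- exact: metric_mx_sym.
- by rewrite metric_mxE quad_gt0.
have [c ->] : exists c : R, foldr (fun v k => 'D_v k) (fun p : V3 => metric_mx i j) s = cst c.
  elim: s => [|v s [c IHs]] /=; first by exists (metric_mx i j).
  by exists 0; rewrite IHs; apply/funext => q; rewrite derive_cst.
exact: differentiable_cst.
Qed.

Lemma metric_norm_quad x v : metric_norm (fun _ : T3 => metric_mx) x v = Num.sqrt (quad v).
Proof. by rewrite /metric_norm metric_mxE. Qed.

Lemma unit_in_line (e : V3) x v : v \in <[e]>%VS -> metric_norm (fun _ : T3 => metric_mx) x v = 1 ->
  exists2 a, v = a *: e & a ^+ 2 * quad e = 1.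
Proof.
move=> /vlineP[a ->]; rewrite metric_norm_quad quadZ => h; exists a => //.
rewrite -[LHS]sqr_sqrtr; first by rewrite h expr1n.
by rewrite mulr_ge0 ?sqr_ge0// quad_ge0.
Qed.

(** All three vectors have nearly constant length: the coefficient of [cS] is large, and the
other coordinates of [es] and [ec] are at most 12. *)
Lemma quad_frame g h e G H es ec eu ks kc ku p : framed_diffeo g h e G H es ec eu ks kc ku ->
  [/\ 200 ^+ 2 <= quad (es p) <= 200 ^+ 2 + 145, 200 ^+ 2 <= quad (ec p) <= 200 ^+ 2 + 145 &
      1 <= quad (eu p) <= 1 + 1 / 100].
Proof.
move=> D; have F := fd_frame D; have [s1 s2 u3] := fr_S F p.
have [/andP[t1 t2] /andP[t3 t4]] := fr_T F p; have [u1 u2 u4 u5] := fr_small F p.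
have bb := bar_bound (cT p).
have sq (x b : R) : `|x| <= b -> 0 <= x ^+ 2 <= b ^+ 2.
  by move=> hx; rewrite sqr_ge0/= -real_normK ?num_real// lerXn2r// nnegrE// (le_trans _ hx).
have /andP[T1 T1'] : 0 <= cT (es p) ^+ 2 <= 12 ^+ 2.
  by apply: sq; rewrite ler_norml; move: t3 t4 bb; clear; lra.
have /andP[T2 T2'] : 0 <= cT (ec p) ^+ 2 <= 12 ^+ 2.
  by apply: sq; rewrite ler_norml; move: t1 t2 bb; clear; lra.
have /andP[U1 U1'] := sq _ _ u1; have /andP[U2 U2'] := sq _ _ u2.
have /andP[S4 S4'] := sq _ _ u4; have /andP[T5 T5'] := sq _ _ u5.
have k0 : 0 <= 200 ^+ 2 :> R by rewrite exprn_ge0 ?ler0n.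
have hS : 200 ^+ 2 * cS (eu p) ^+ 2 <= (2 / 100) ^+ 2.
  apply: le_trans (ler_wpM2l k0 S4') _; rewrite -exprMn lerXn2r ?nnegrE//.
  by clear; lra.
have hS0 : 0 <= 200 ^+ 2 * cS (eu p) ^+ 2 by rewrite mulr_ge0.
have c8 : ((1 / 10) ^+ 4) ^+ 2 <= 1 / 200 :> R by clear; lra.
move: k0; rewrite /quad s1 s2 u3 expr1n !mulr1; move: (200 ^+ 2) hS hS0 => K hS hS0 _.
split; apply/andP; split.
- by move: T1 U1; clear; lra.
- by move: T1' U1'; clear; lra.
- by move: T2 U2; clear; lra.
- by move: T2' U2'; clear; lra.
- by move: hS0 T5; clear; lra.
- by move: hS T5' c8; clear; lra.
Qed.

(** How a nearly constant norm distorts the rates. *)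
Lemma unit_image (K k q q' x r : R) : 0 < K -> 0 <= k -> K <= q <= K * (1 + k) -> K <= q' <= K * (1 + k) ->
  x * q = 1 -> r ^+ 2 <= (1 + k) * (x * (r ^+ 2 * q')) /\ x * (r ^+ 2 * q') <= (1 + k) * r ^+ 2.
Proof.
move=> K0 k0 /andP[q1 q2] /andP[q1' q2'] xq.
have q0 : 0 < q by exact: lt_le_trans q1.
have ex : x = q^-1 by rewrite -[LHS](mulfK (lt0r_neq0 q0)) xq mul1r.
have k1 : 0 < 1 + k by rewrite ltr_wpDr.
have r0 := sqr_ge0 r.
have -> : x * (r ^+ 2 * q') = r ^+ 2 * q' / q by rewrite ex; ring.
split.
  rewrite mulrA ler_pdivlMr// mulrCA; apply: ler_wpM2l => //.
  by apply: le_trans q2 _; rewrite mulrC ler_pM2l.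
rewrite ler_pdivrMr//; have -> : (1 + k) * r ^+ 2 * q = r ^+ 2 * ((1 + k) * q) by ring.
apply: ler_wpM2l => //.
by apply: le_trans q2' _; rewrite mulrC ler_pM2l.
Qed.

Lemma inverse_jacobian G H p : (forall q, differentiable G q) -> (forall q, differentiable H q) ->
  cancel G H -> jacobian G p *m jacobian H (G p) = 1%:M.
Proof.
move=> dG dH GH; rewrite -(jacobian_comp (dG p) (dH (G p))).
rewrite (_ : H \o G = idfun); last by apply/funext => q /=; rewrite GH.
have di : differentiable (@idfun V3) p.
  by apply: (@linear_differentiable R V3 V3 idfun) => z; exact: cvg_id.
apply: mulmx_inj => w; rewrite mulmx1; apply: etrans (jacE w di) _.
exact: (@derive_id _ V3).
Qed.

(** The rates of the frame are separated by more than the distortion of the norm. *)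
Lemma fd_splitting g h e G H es ec eu ks kc ku : framed_diffeo g h e G H es ec eu ks kc ku ->
  ph_splitting g (line_field es) (line_field ec) (line_field eu).
Proof.
move=> D; have F := fd_frame D; have LG := fd_G D; have LH := fd_H D.
have pes p n : intv n -> es (p + n) = es p by move=> hn; have [] := fr_per F p hn.
have pec p n : intv n -> ec (p + n) = ec p by move=> hn; have [] := fr_per F p hn.
have peu p n : intv n -> eu (p + n) = eu p by move=> hn; have [] := fr_per F p hn.
have nz (v : V3) (l : {linear V3 -> R}) : l v = 1 -> v != 0.
  by move=> h1; apply/eqP => v0; move: h1; rewrite v0 linear0 => /eqP; rewrite eq_sym oner_eq0.
have es0 p : es p != 0 by have [h1 _ _] := fr_S F p; exact: nz h1.
have ec0 p : ec p != 0 by have [_ h1 _] := fr_S F p; exact: nz h1.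
have eu0 p : eu p != 0 by have [_ _ h1] := fr_S F p; exact: nz h1.
split.
- split.
  + exact: line_field_bundle pes (fr_esc F) es0.
  + exact: line_field_bundle pec (fr_ecc F) ec0.
  + exact: line_field_bundle peu (fr_euc F) eu0.
- by move=> x; apply: frame_directs (fr_eta F (repr x)) _ _ _.
- split; apply: (line_field_invariant LG) => // p; have [rs [rc [ru [h1 h2 h3 [h4 h5 h6 h7]]]]] := fr_rate F p.
  + by exists rs => //; rewrite gt_eqF//; case/andP: h4.
  + by exists rc => //; rewrite gt_eqF//; case/andP: h4 => h4 _; move: h4 h5; clear; lra.
  + by exists ru => //; rewrite gt_eqF//; move: h7; clear; lra.
exists (fun=> metric_mx); first exact: metric_smooth.
have K0 : 0 < 200 ^+ 2 :> R by rewrite exprn_gt0 ?ltr0n.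
have kk p : 200 ^+ 2 <= quad (es p) <= 200 ^+ 2 * (1 + 1 / 250) /\
    200 ^+ 2 <= quad (ec p) <= 200 ^+ 2 * (1 + 1 / 250).
  have e1 : 200 ^+ 2 + 145 <= 200 ^+ 2 * (1 + 1 / 250) :> R.
    by rewrite mulrDr mulr1 lerD2l expr2 -mulrA mulrCA; clear; lra.
  have [/andP[h1 h2] /andP[h3 h4] _] := quad_frame p D.
  by rewrite h1 h3 !(le_trans _ e1).
have ku1 p : 1 <= quad (eu p) <= 1 * (1 + 1 / 100).
  by rewrite mul1r; have [] := quad_frame p D.
have k1 : 0 <= 1 / 250 :> R by clear; lra.
have k2 : 0 <= 1 / 100 :> R by clear; lra.
have sqle (a b : R) : 0 <= a -> a < b -> a ^+ 2 < b ^+ 2 by move=> a0 ab; rewrite ltrXn2r ?nnegrE// (le_trans a0)// ltW.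
split.
- move=> x vs vc vu; rewrite -(tpi_repr x); move: (repr x) => p.
  rewrite (tangent_map_tpi p LG) !line_field_tpi//.
  move=> /unit_in_line hs /unit_in_line hc /unit_in_line hu /hs[a -> ha] /hc[b -> hb] /hu[d -> hd].
  have [rs [rc [ru [h1 h2 h3 [/andP[h4 h4'] h5 h6 h7]]]]] := fr_rate F p.
  rewrite -!scalemxAl h1 h2 h3 !metric_norm_quad !quadZ.
  have [ks1 kc1] := kk p; have [ks2 kc2] := kk (G p).
  have [_ Es] := unit_image rs K0 k1 ks1 ks2 ha.
  have [Ec Ec'] := unit_image rc K0 k1 kc1 kc2 hb.
  have [Eu _] := unit_image ru ltr01 k2 (ku1 p) (ku1 (G p)) hd.
  have s2 : ((1 + 1 / 250) * rs) ^+ 2 < rc ^+ 2.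
    apply: sqle; last by move: h4' h5; clear; lra.
    by apply: mulr_ge0 => //; exact: ltW.
  have s3 : rc ^+ 2 <= (33 / 10) ^+ 2.
    by rewrite lerXn2r ?nnegrE//; move: h4 h5; clear; lra.
  have s4 : (36 / 10) ^+ 2 <= ru ^+ 2.
    by rewrite lerXn2r ?nnegrE//; move: h7; clear; lra.
  have pos (z r c c' : R) : z ^+ 2 * c = 1 -> 0 < c -> r != 0 -> 0 < c' -> 0 < z ^+ 2 * (r ^+ 2 * c').
    move=> zq q0 r0 q0'; rewrite mulr_gt0//.
      by rewrite -(pmulr_lgt0 _ q0) zq.
    by rewrite mulr_gt0// exprn_even_gt0.
  have rc0 : rc != 0 by rewrite gt_eqF//; move: h4 h5; clear; lra.
  have ru0 : ru != 0 by rewrite gt_eqF//; move: h7; clear; lra.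
  split; rewrite ltr_sqrt.
  + move: Es Ec s2; rewrite exprMn; move: (a ^+ 2 * _) (b ^+ 2 * _) => X Y; move: (rs ^+ 2) (rc ^+ 2) => A B.
    by rewrite !expr2; clear; lra.
  + exact: (pos _ _ _ _ hb (quad_gt0 (ec0 _)) rc0 (quad_gt0 (ec0 _))).
  + move: Ec' Eu s3 s4; move: (b ^+ 2 * _) (d ^+ 2 * _) => X Y; move: (rc ^+ 2) (ru ^+ 2) => A B.
    by clear; lra.
  + exact: (pos _ _ _ _ hd (quad_gt0 (eu0 _)) ru0 (quad_gt0 (eu0 _))).
- apply: le_lt_trans (_ : (Num.sqrt (1 / 2))%:E < 1)%E; last first.
    by rewrite lte_fin -[ltRHS]sqrtr1 ltr_sqrt//; clear; lra.
  apply: ub_ereal_sup => _ [x [v [hv hv1 ->]]]; move: hv hv1.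
  rewrite -(tpi_repr x); move: (repr x) => p.
  rewrite (tangent_map_tpi p LG) !line_field_tpi// => /unit_in_line hs /hs[a -> ha].
  have [rs [rc [ru [h1 h2 h3 [/andP[h4 h4'] h5 h6 h7]]]]] := fr_rate F p.
  rewrite lee_fin -!scalemxAl h1 metric_norm_quad !quadZ ler_wsqrtr//.
  have [ks1 kc1] := kk p; have [ks2 kc2] := kk (G p).
  have [_ Es] := unit_image rs K0 k1 ks1 ks2 ha.
  have s1 : rs ^+ 2 <= (7 / 10) ^+ 2.
    by rewrite lerXn2r ?nnegrE//; exact: ltW.
  by apply: le_trans Es _; move: s1; clear; lra.
- exists h; first exact: (fd_gh D).
  apply: le_lt_trans (_ : (Num.sqrt (1 / 2))%:E < 1)%E; last first.
    by rewrite lte_fin -[ltRHS]sqrtr1 ltr_sqrt//; clear; lra.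
  apply: ub_ereal_sup => _ [x [v [hv hv1 ->]]]; move: hv hv1.
  rewrite -(tpi_repr x); move: (repr x) => p.
  rewrite (tangent_map_tpi p LH) !line_field_tpi// => /unit_in_line hs /hs[a -> ha].
  have M := fd_near D.
  have [rs [rc [ru [h1 h2 h3 [/andP[h4 h4'] h5 h6 h7]]]]] := fr_rate F (H p).
  rewrite (nm_HG M) in h3.
  have ru0 : 0 < ru by move: h7; clear; lra.
  have jj : jacobian G (H p) *m jacobian H p = 1%:M.
    by rewrite -{2}(nm_HG M p); exact: (inverse_jacobian (H p) LG.1.1 LH.1.1 (nm_GH M)).
  have eJ : eu p *m jacobian H p = ru^-1 *: eu (H p).
    rewrite -[LHS]scale1r -(mulVf (lt0r_neq0 ru0)) -scalerA; congr (_ *: _).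
    by rewrite scalemxAl -h3 -mulmxA jj mulmx1.
  rewrite lee_fin -!scalemxAl eJ metric_norm_quad !quadZ ler_wsqrtr//.
  have [_ Eu] := unit_image ru^-1 ltr01 k2 (ku1 p) (ku1 (H p)) ha.
  have s1 : ru^-1 ^+ 2 <= (1 / 2) ^+ 2.
    rewrite lerXn2r ?nnegrE ?invr_ge0//; first exact: ltW.
    by rewrite -[leLHS]mul1r ler_pdivrMr//; move: h7; clear; lra.
  by apply: le_trans Eu _; move: s1; clear; lra.
Qed.

End Hyperbolicity.

(** * Bounded angles of a continuous splitting *)

Section SplittingBounds.
Variable R : realType.
Local Notation V3 := 'rV[R]_3.
Local Notation T3 := (torus R).
Local Notation tpi := (@tpi R).
Implicit Types (p q n v u w t : V3) (x y : T3) (g h : T3 -> T3) (E : T3 -> {vspace V3}).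

Lemma compact_cube : compact [set p : V3 | forall i, 0 <= p ord0 i <= 1].
Proof.
have := @rV_compact _ 3 (fun _ => `[(0 : R), 1]%classic) (fun _ => @segment_compact R 0 1).
by congr compact; apply/seteqP; split => p /= hp i; have := hp i; rewrite /= in_itv.
Qed.

Lemma cube_translate p : exists2 n, intv n & forall i, 0 <= (p + n) ord0 i <= 1.
Proof.
exists (\row_i - (Num.floor (p ord0 i))%:~R).
  by move=> i; rewrite mxE rpredN intr_int.
move=> i; rewrite !mxE; have := floor_le (p ord0 i); have := floorD1_gt (p ord0 i).
by rewrite intrD; lra.
Qed.

(** A local bound on a periodic property is global, by compactness of the cube. *)
Lemma periodic_bound (P : R -> V3 -> Prop) :
  (forall (a b : R) p, a <= b -> P a p -> P b p) ->
  (forall a p n, intv n -> P a (p + n) -> P a p) ->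
  (forall p, exists a, \forall q \near p, P a q) -> exists a, forall p, P a p.
Proof.
move=> mono per loc.
have cov := (compact_near_coveringP _).1 compact_cube.
have H : \forall a \near (+oo : set_system R), [set p : V3 | forall i, 0 <= p ord0 i <= 1] `<=` P a.
  apply: cov => p _; have [a ha] := loc p.
  exists ([set q | P a q], [set b | a <= b]); first by split => //; apply: nbhs_pinfty_ge; exact: num_real.
  by move=> [q b] /= [h1 h2]; exact: mono h2 h1.
have [a ha] := filter_ex H; exists a => p.
by have [n hn hp] := cube_translate p; apply: (per a p n hn); exact: ha.
Qed.

(** The constant [C] bounds the angles of the splitting from below, and the ratio of the two
norms on its lines. *)
Definition tame_splitting (L1 L2 L3 : V3 -> Prop) (m : V3 -> R) (C : R) :=
  (forall u w t, L1 u -> L2 w -> L3 t ->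
    [/\ N u <= C * N (u + w + t), N w <= C * N (u + w + t) & N t <= C * N (u + w + t)]) /\
  (forall u, L1 u \/ L2 u \/ L3 u -> m u <= C * N u /\ N u <= C * m u).

Lemma tame_le L1 L2 L3 m (C D : R) : (forall u, 0 <= m u) -> C <= D ->
  tame_splitting L1 L2 L3 m C -> tame_splitting L1 L2 L3 m D.
Proof.
move=> m0 CD [h1 h2]; split=> [u w t hu hw ht|u hu].
  have [a b c] := h1 u w t hu hw ht; have n0 := N_ge0 (u + w + t).
  by split; [apply: le_trans a _|apply: le_trans b _|apply: le_trans c _]; exact: ler_wpM2r.
have [a b] := h2 u hu.
by split; [apply: le_trans a _|apply: le_trans b _]; apply: ler_wpM2r => //; exact: N_ge0.
Qed.

(** The inverse of the matrix with rows [a], [b] and [d] is bounded. *)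
Lemma independent_bound (a b d : V3) : (<[a]> + <[b]> + <[d]>)%VS = fullv ->
  exists2 k : R, 0 < k & forall r s z : R, k * (`|r| + `|s| + `|z|) <= N (r *: a + s *: b + z *: d).
Proof.
move=> full.
pose M : 'M[R]_3 := \matrix_(i < 3) nth 0 [:: a; b; d] i.
have eM (y : V3) : y *m M = y ord0 j0 *: a + y ord0 j1 *: b + y ord0 j2 *: d.
  by rewrite mulmx_sum_row !big_ord_recl big_ord0 addr0 !rowK /= addrA.
have /choice[K hK] : forall v : V3, exists y : V3, y *m M = v.
  move=> v; have : v \in fullv by exact: memvf.
  rewrite -full => /memv_addP[w /memv_addP[_ /vlineP[r ->] [_ /vlineP[s ->] ->]] [_ /vlineP[z ->] ->]].
  by exists (row3 r s z); rewrite eM !row3E.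
have Mu : M \in unitmx.
  apply: (@mulmx1_unit _ _ (\matrix_(i < 3) K (delta_mx 0 i)) M _).2.
  by apply/row_matrixP => i; rewrite row_mul rowK hK rowE mulmx1.
exists (27 * `|invmx M| + 1)^-1; first by rewrite invr_gt0 ltr_wpDl// mulr_ge0.
move=> r s z; rewrite mulrC ler_pdivrMr; last by rewrite ltr_wpDl// mulr_ge0.
set v := _ + z *: d; have ev : row3 r s z = v *m invmx M.
  by apply: (can_inj (mulmxK Mu)); rewrite mulmxKV// eM !row3E.
have c (i : 'I_3) : `|row3 r s z ord0 i| <= 9 * N v * `|invmx M|.
  apply: le_trans (coord_le_norm _ _) _; rewrite ev; apply: le_trans (mulmx_norm_le _ _) _.
  rewrite mulrA; apply: ler_wpM2r => //.
  by have := norm_le_N v; clear; lra.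
have := c j0; have := c j1; have := c j2; rewrite !row3E.
by have := N_ge0 v; move: (N v) `|invmx M| => A B; clear; lra.
Qed.

Lemma continuous_at_N (X : topologicalType) (z : X) (v : X -> V3) (e : R) : 0 < e ->
  {for z, continuous v} -> \forall z' \near z, N (v z' - v z) <= e.
Proof.
move=> e0 vc; have e5 : 0 < e / 5 by rewrite divr_gt0.
have : \forall z' \near z, `|v z - v z'| < e / 5.
  exact: (@cvgr_dist_lt _ _ _ _ _ v (v z) vc).
apply: filterS => z' h; apply: le_trans (N_le_norm _) _; rewrite distrC.
by move: h; clear; lra.
Qed.

Lemma continuous_at_coord (X : topologicalType) (z : X) (v : X -> V3) i :
  {for z, continuous v} -> {for z, continuous (fun z' => v z' ord0 i)}.
Proof.
by move=> vc; apply: (@continuous_cvg _ _ _ (nbhs z) _ v (fun w : V3 => w ord0 i));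
  [exact: coord_continuous|exact: vc].
Qed.

Lemma sum_continuous_at (X : topologicalType) (z : X) (k : 'I_3 -> X -> R) :
  (forall i, {for z, continuous (k i)}) -> {for z, continuous (fun z' => \sum_i k i z')}.
Proof.
move=> kc; rewrite (_ : (fun z' => _) = (fun z' => k j0 z' + (k j1 z' + k j2 z'))).
  by apply: cvgD; [exact: kc|apply: cvgD; exact: kc].
by apply/funext => z'; rewrite !big_ord_recl big_ord0 addr0.
Qed.

Lemma metric_normZ (A : T3 -> 'M[R]_3) x (r : R) v :
  metric_norm A x (r *: v) = `|r| * metric_norm A x v.
Proof.
rewrite /metric_norm linearZ /= -!scalemxAl -scalemxAr mxE [in X in _ * X]mxE mulrA -expr2.
by rewrite sqrtrM ?sqr_ge0// sqrtr_sqr.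
Qed.

Lemma quadratic_continuous (X : topologicalType) (z : X) (v : X -> V3) (A : X -> 'M[R]_3) :
  {for z, continuous v} -> (forall i j, {for z, continuous (fun z' => A z' i j)}) ->
  {for z, continuous (fun z' => (v z' *m A z' *m (v z')^T) ord0 ord0)}.
Proof.
move=> vc Ac.
have vi i := @continuous_at_coord X z v i vc.
rewrite (_ : (fun z' => _) = (fun z' => \sum_j (\sum_i v z' ord0 i * A z' i j) * v z' ord0 j)); last first.
  by apply/funext => z'; rewrite mxE; apply: eq_bigr => j _; rewrite !mxE.
apply: sum_continuous_at => j; apply: cvgM; last exact: vi.
by apply: sum_continuous_at => i; apply: cvgM; [exact: vi|exact: Ac].
Qed.

Lemma metric_continuous (A : T3 -> 'M[R]_3) x i j : riemannian_metric A ->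
  {for x, continuous (fun y => A y i j)}.
Proof.
move=> [sm _ _]; have c : continuous (fun y => A y i j).
  apply: torus_continuous => p; apply: differentiable_continuous.
  exact: (sm i j [::] p).
exact: c.
Qed.

(** The metric norm and [N] are both continuous and positive on the spanning section. *)
Lemma line_bounds (A : T3 -> 'M[R]_3) x (v : T3 -> V3) : riemannian_metric A ->
  {for x, continuous v} -> v x != 0 ->
  exists2 C : R, 0 < C & \forall y \near x, forall r : R,
    metric_norm A y (r *: v y) <= C * N (r *: v y) /\ N (r *: v y) <= C * metric_norm A y (r *: v y).
Proof.
move=> mA vc v0; have [_ _ pos] := mA.
pose q y := (v y *m A y *m (v y)^T) ord0 ord0.
have qc : {for x, continuous q}.
  by apply: quadratic_continuous => // i j; exact: metric_continuous.
have q0 : 0 < q x by exact: pos.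
have n0 : 0 < N (v x).
  by rewrite lt_neqAle N_ge0 andbT eq_sym; apply: contra v0 => /eqP/N_eq0 ->.
pose c := Num.sqrt (q x / 2); pose d := Num.sqrt (q x * 2).
have c0 : 0 < c by rewrite sqrtr_gt0 divr_gt0.
have d0 : 0 < d by rewrite sqrtr_gt0 mulr_gt0.
have h1 : \forall y \near x, `|q x - q y| < q x / 2.
  by apply: (@cvgr_dist_lt _ _ _ _ _ q (q x) qc); rewrite divr_gt0.
have h2 : \forall y \near x, N (v y - v x) <= N (v x) / 2.
  by apply: continuous_at_N => //; rewrite divr_gt0.
exists (d / (N (v x) / 2) + (N (v x) * 2) / c); first by rewrite addr_gt0// divr_gt0// ?mulr_gt0// divr_gt0.
apply: (near_and h1 h2) => y k1 k2 r.
have em : metric_norm A y (r *: v y) = `|r| * Num.sqrt (q y).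
  by rewrite metric_normZ.
have qy : q x / 2 <= q y <= q x * 2.
  by move: k1 q0; rewrite ltr_norml; clear; move: (q x) (q y) => a b; lra.
have [q1 q2] : c <= Num.sqrt (q y) /\ Num.sqrt (q y) <= d.
  by case/andP: qy => a b; split; apply: ler_wsqrtr.
have [n1 n2] : N (v x) / 2 <= N (v y) /\ N (v y) <= N (v x) * 2.
  have e : N (v x - v y) = N (v y - v x) by rewrite -opprB NN.
  have := ND (v x - v y) (v y); have := ND (v y - v x) (v x); rewrite !subrK e.
  by move: k2 n0; clear=> *; split; lra.
have m0 : 0 < N (v x) / 2 by rewrite divr_gt0.
rewrite em NZ; have r0 := normr_ge0 r.
split; rewrite mulrCA; apply: ler_wpM2l => //; rewrite mulrDl.
  apply: le_trans q2 _; apply: le_trans (_ : d / (N (v x) / 2) * N (v y) <= _).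
    by rewrite mulrAC ler_pdivlMr// ler_pM2l.
  by rewrite lerDl mulr_ge0 ?N_ge0// divr_ge0 ?mulr_ge0// ltW.
apply: le_trans n2 _; apply: le_trans (_ : N (v x) * 2 / c * Num.sqrt (q y) <= _).
  by rewrite mulrAC ler_pdivlMr// ler_pM2l// mulr_gt0.
by rewrite lerDr mulr_ge0 ?sqrtr_ge0// divr_ge0// ltW.
Qed.

Lemma near_conj (X : topologicalType) (z : X) (P Q : X -> Prop) :
  (\forall z' \near z, P z') -> (\forall z' \near z, Q z') -> \forall z' \near z, P z' /\ Q z'.
Proof. by move=> hP hQ; apply: (near_and hP hQ). Qed.

(** Near [x] the bundles are spanned by continuous vectors that are almost those at [x], where
the independence is quantitative. *)
Lemma local_tame (A : T3 -> 'M[R]_3) Es Ec Eu x : riemannian_metric A ->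
  line_bundle Es -> line_bundle Ec -> line_bundle Eu ->
  (Es x + Ec x + Eu x)%VS = fullv ->
  exists C : R, \forall y \near x, tame_splitting (fun u => u \in Es y) (fun u => u \in Ec y)
    (fun u => u \in Eu y) (metric_norm A y) C.
Proof.
move=> mA /(_ x)[a ha] /(_ x)[b hb] /(_ x)[d hd] full.
have [ac a0 ea] := nbhs_singleton ha; have [bc b0 eb] := nbhs_singleton hb.
have [dc d0 ed] := nbhs_singleton hd.
rewrite ea eb ed in full; have [k k0 ind] := independent_bound full.
have [Ca Ca0 la] := line_bounds mA ac a0; have [Cb Cb0 lb] := line_bounds mA bc b0.
have [Cd Cd0 ld] := line_bounds mA dc d0.
have k2 : 0 < k / 2 by rewrite divr_gt0.
have na := continuous_at_N k2 ac; have nb := continuous_at_N k2 bc; have nd := continuous_at_N k2 dc.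
pose B := N (a x) + N (b x) + N (d x) + k.
have B0 : 0 < B by rewrite ltr_wpDl// !addr_ge0// N_ge0.
have Bk : 0 < B / (k / 2) by rewrite divr_gt0.
exists (B / (k / 2) + (Ca + Cb + Cd)).
have H := near_conj hb (near_conj hd (near_conj la (near_conj lb (near_conj ld (near_conj na (near_conj nb nd)))))).
apply: (near_and ha H) => y [_ _ ya] [[_ _ yb] [[_ _ yd] [ma [mb [md [qa [qb qd]]]]]]].
have bnd (z : T3 -> V3) : N (z y - z x) <= k / 2 -> N (z x) + k <= B -> N (z y) <= B.
  move=> h1 h2; have := ND (z y - z x) (z x); rewrite subrK; move: h1 h2 k0; clear; lra.
have n1 := N_ge0 (a x); have n2 := N_ge0 (b x); have n3 := N_ge0 (d x).
have yaB : N (a y) <= B by apply: bnd => //; rewrite /B; move: n1 n2 n3; clear; lra.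
have ybB : N (b y) <= B by apply: bnd => //; rewrite /B; move: n1 n2 n3; clear; lra.
have ydB : N (d y) <= B by apply: bnd => //; rewrite /B; move: n1 n2 n3; clear; lra.
have key (r s z : R) : k / 2 * (`|r| + `|s| + `|z|) <= N (r *: a y + s *: b y + z *: d y).
  have := ind r s z.
  have e1 : r *: a x + s *: b x + z *: d x = (r *: a y + s *: b y + z *: d y) -
      (r *: (a y - a x) + s *: (b y - b x) + z *: (d y - d x)).
    by apply/rowP => i; rewrite !mxE; ring.
  have e2 : N (r *: (a y - a x) + s *: (b y - b x) + z *: (d y - d x)) <= k / 2 * (`|r| + `|s| + `|z|).
    apply: le_trans (ND _ _) _; apply: le_trans (lerD (ND _ _) (lexx _)) _; rewrite !NZ.
    have w (c : R) v : N v <= k / 2 -> `|c| * N v <= k / 2 * `|c| by move=> h; rewrite mulrC ler_wpM2r.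
    by have := w r _ qa; have := w s _ qb; have := w z _ qd; clear; lra.
  rewrite e1; have := ND (r *: a y + s *: b y + z *: d y)
      (- (r *: (a y - a x) + s *: (b y - b x) + z *: (d y - d x))).
  by rewrite NN; move: e2; clear; lra.
have C1 : B / (k / 2) <= B / (k / 2) + (Ca + Cb + Cd) by rewrite lerDl !addr_ge0// ltW.
split.
- move=> u w t; rewrite ya yb yd => /vlineP[r ->] /vlineP[s ->] /vlineP[z ->].
  have h (c : R) v : N v <= B -> `|c| <= `|r| + `|s| + `|z| ->
      N (c *: v) <= (B / (k / 2) + (Ca + Cb + Cd)) * N (r *: a y + s *: b y + z *: d y).
    move=> hv hc; rewrite NZ; apply: le_trans (_ : B / (k / 2) * N (r *: a y + s *: b y + z *: d y) <= _); last first.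
      by apply: ler_wpM2r C1; exact: N_ge0.
    rewrite mulrAC ler_pdivlMr//.
    apply: le_trans (_ : (`|r| + `|s| + `|z|) * B * (k / 2) <= _).
      by apply: ler_wpM2r; [exact: ltW|apply: ler_pM => //; exact: N_ge0].
    by rewrite mulrC mulrA [B * _]mulrC; apply: ler_wpM2r (key r s z); exact: ltW.
  have r0 := normr_ge0 r; have s0 := normr_ge0 s; have z0 := normr_ge0 z.
  by split; apply: h => //; move: r0 s0 z0; clear; lra.
- have up (c : R) (v : V3) : c <= Ca + Cb + Cd ->
      metric_norm A y v <= c * N v /\ N v <= c * metric_norm A y v ->
      metric_norm A y v <= (B / (k / 2) + (Ca + Cb + Cd)) * N v /\
      N v <= (B / (k / 2) + (Ca + Cb + Cd)) * metric_norm A y v.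
    move=> hc [h1 h2]; have cC : c <= B / (k / 2) + (Ca + Cb + Cd).
      by apply: le_trans hc _; rewrite lerDr ltW.
    split; [apply: le_trans h1 _|apply: le_trans h2 _]; apply: ler_wpM2r => //; first exact: N_ge0.
    exact: sqrtr_ge0.
  move=> u [|[|]]; [rewrite ya|rewrite yb|rewrite yd] => /vlineP[r ->].
  + by apply: (up Ca) (ma r); move: Cb0 Cd0; clear; lra.
  + by apply: (up Cb) (mb r); move: Ca0 Cd0; clear; lra.
  + by apply: (up Cd) (md r); move: Ca0 Cb0; clear; lra.
Qed.

Lemma global_tame (A : T3 -> 'M[R]_3) Es Ec Eu : riemannian_metric A ->
  line_bundle Es -> line_bundle Ec -> line_bundle Eu ->
  (forall x, (Es x + Ec x + Eu x)%VS = fullv) ->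
  exists C : R, forall x, tame_splitting (fun u => u \in Es x) (fun u => u \in Ec x)
    (fun u => u \in Eu x) (metric_norm A x) C.
Proof.
move=> mA Ls Lc Lu full.
pose P C p := tame_splitting (fun u => u \in Es (tpi p)) (fun u => u \in Ec (tpi p))
    (fun u => u \in Eu (tpi p)) (metric_norm A (tpi p)) C.
have [|||C hC] := @periodic_bound P.
- by move=> a b p ab; apply: tame_le => // u; exact: sqrtr_ge0.
- by move=> a p n hn; rewrite /P tpiD.
- move=> p; have [C hC] := local_tame mA Ls Lc Lu (full (tpi p)).
  by exists C; exact: (tpi_continuous hC).
by exists C => x; rewrite -(tpi_repr x); exact: hC.
Qed.

End SplittingBounds.

(** * Growth rates of two splittings *)

Section TwoSplittings.
Variable R : realType.
Local Notation V3 := 'rV[R]_3.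
Implicit Types (p q v u w t z : V3) (n : nat).

(** A sequence of linear maps with two invariant splittings: a frame [e1 e2 e3] with
uniformly separated rates, and lines [L1 L2 L3] of which the first is dominated by the two
others, only pointwise, for the norms [m]. *)
Record two_splittings (A : nat -> 'M[R]_3) (e1 e2 e3 : nat -> V3) (k1 k2 k3 : nat -> V3 -> R)
    (r1 r2 r3 : nat -> R) (L1 L2 L3 : nat -> {vspace V3}) (m : nat -> V3 -> R)
    (th mu K C : R) : Prop := TwoSplittings {
  ts_eta : forall n v, v = k1 n v *: e1 n + k2 n v *: e2 n + k3 n v *: e3 n;
  ts_coord : forall n (x y z : R) (v := x *: e1 n + y *: e2 n + z *: e3 n),
    [/\ k1 n v = x, k2 n v = y & k3 n v = z];
  ts_k : forall n v, [/\ `|k1 n v| <= K * N v, `|k2 n v| <= K * N v & `|k3 n v| <= K * N v];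
  ts_e : forall n, [/\ N (e1 n) <= K, N (e2 n) <= K & N (e3 n) <= K];
  ts_A : forall n, [/\ e1 n *m A n = r1 n *: e1 n.+1, e2 n *m A n = r2 n *: e2 n.+1 &
    e3 n *m A n = r3 n *: e3 n.+1];
  ts_r : forall n, [/\ 0 < r1 n, r1 n <= th * r2 n, r2 n <= th * r3 n & mu <= r3 n];
  ts_th : 0 <= th < 1;
  ts_mu : 1 < mu;
  ts_K : 0 < K;
  ts_C : 0 < C;
  ts_L : forall n v, [/\ v \in L1 n -> v *m A n \in L1 n.+1, v \in L2 n -> v *m A n \in L2 n.+1 &
    v \in L3 n -> v *m A n \in L3 n.+1];
  ts_full : forall n, (L1 n + L2 n + L3 n)%VS = fullv;
  ts_line : forall n, exists2 v, v != 0 & L1 n = <[v]>%VS;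
  ts_tame : forall n, tame_splitting (fun v => v \in L1 n) (fun v => v \in L2 n)
    (fun v => v \in L3 n) (m n) C;
  ts_m0 : forall n v, 0 <= m n v;
  ts_contr : forall n v, v \in L1 n -> m n.+1 (v *m A n) <= m n v;
  ts_dom : forall n v w, v \in L1 n -> w \in L2 n \/ w \in L3 n ->
    m n.+1 (v *m A n) * m n w <= m n.+1 (w *m A n) * m n v
}.

Fixpoint orbit (A : nat -> 'M[R]_3) v n : V3 :=
  if n is k.+1 then orbit A v k *m A k else v.

Lemma orbitD A v w n : orbit A (v + w) n = orbit A v n + orbit A w n.
Proof. by elim: n => //= n ->; rewrite mulmxDl. Qed.

Definition rates (r : nat -> R) n : R := \prod_(i < n) r i.

Lemma ratesS r n : rates r n.+1 = rates r n * r n.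
Proof. by rewrite /rates big_ord_recr. Qed.

Lemma ts_rates A e1 e2 e3 k1 k2 k3 r1 r2 r3 L1 L2 L3 m th mu K C n :
  two_splittings A e1 e2 e3 k1 k2 k3 r1 r2 r3 L1 L2 L3 m th mu K C ->
  [/\ 0 < rates r1 n, rates r1 n <= th ^+ n * rates r2 n, rates r2 n <= th ^+ n * rates r3 n,
      mu ^+ n <= rates r3 n & [/\ rates r1 n <= rates r2 n & 0 < rates r2 n /\ 0 < rates r3 n]].
Proof.
move=> T; have /andP[th0 th1] := ts_th T; have mu1 := ts_mu T.
have r20 k : 0 < r2 k /\ 0 < r3 k.
  have [a b c d] := ts_r T k.
  have r3k : 0 < r3 k by apply: lt_le_trans d; exact: lt_trans mu1.
  split=> //; have : 0 < th * r2 k by exact: lt_le_trans b.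
  by move: th0; rewrite le_eqVlt => /predU1P[<-|th0]; rewrite ?mul0r ?ltxx// pmulr_rgt0.
elim: n => [|n [p1 p2 p3 p4 [p5 [p6 p7]]]].
  by rewrite /rates !big_ord0 !expr0 mul1r; split=> //; split.
have [a b c d] := ts_r T n; have [q2 q3] := r20 n.
rewrite !ratesS !exprS.
have mul2 (x y z w s : R) : 0 <= x -> 0 <= y -> x <= s * z -> y <= th * w -> x * y <= th * s * (z * w).
  by move=> x0 y0 h1 h2; rewrite [th * s]mulrC mulrACA; exact: ler_pM.
split.
- by rewrite mulr_gt0.
- by apply: mul2 => //; exact: ltW.
- by apply: mul2 => //; exact: ltW.
- rewrite mulrC; apply: ler_pM => //; first by rewrite exprn_ge0// ltW// (lt_trans _ mu1).
  by rewrite ltW// (lt_trans _ mu1).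
split; last by rewrite !mulr_gt0.
apply: ler_pM => //; [exact: ltW|exact: ltW|].
by apply: le_trans b _; rewrite ler_piMl// ltW.
Qed.

Lemma ts_orbit A e1 e2 e3 k1 k2 k3 r1 r2 r3 L1 L2 L3 m th mu K C v n :
  two_splittings A e1 e2 e3 k1 k2 k3 r1 r2 r3 L1 L2 L3 m th mu K C ->
  orbit A v n = (rates r1 n * k1 0%N v) *: e1 n + (rates r2 n * k2 0%N v) *: e2 n +
    (rates r3 n * k3 0%N v) *: e3 n.
Proof.
move=> T; elim: n => [|n IHn] /=.
  by rewrite /rates !big_ord0 !mul1r; exact: (ts_eta T).
have [a1 a2 a3] := ts_A T n.
rewrite IHn !mulmxDl -!scalemxAl a1 a2 a3 !scalerA !ratesS.
by congr (_ *: _ + _ *: _ + _ *: _); rewrite mulrAC.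
Qed.

Lemma ts_orbit_coord A e1 e2 e3 k1 k2 k3 r1 r2 r3 L1 L2 L3 m th mu K C v n :
  two_splittings A e1 e2 e3 k1 k2 k3 r1 r2 r3 L1 L2 L3 m th mu K C ->
  [/\ k1 n (orbit A v n) = rates r1 n * k1 0%N v, k2 n (orbit A v n) = rates r2 n * k2 0%N v &
      k3 n (orbit A v n) = rates r3 n * k3 0%N v].
Proof. by move=> T; rewrite (ts_orbit v n T); exact: (ts_coord T). Qed.

Lemma ts_mem A e1 e2 e3 k1 k2 k3 r1 r2 r3 L1 L2 L3 m th mu K C v n :
  two_splittings A e1 e2 e3 k1 k2 k3 r1 r2 r3 L1 L2 L3 m th mu K C ->
  [/\ v \in L1 0%N -> orbit A v n \in L1 n, v \in L2 0%N -> orbit A v n \in L2 n &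
      v \in L3 0%N -> orbit A v n \in L3 n].
Proof.
move=> T; elim: n => [|n [h1 h2 h3]] //=.
by have [g1 g2 g3] := ts_L T n (orbit A v n); split=> [/h1|/h2|/h3].
Qed.

(** A vector of the slow line [L1] cannot grow, so it has no [e3]-component. If it had an
[e2]-component it would grow faster than [e1], and so would, by domination, the
components of [e1] in [L2] and [L3]; hence [e1] would lie in [L1] itself. *)
Lemma slow_line A e1 e2 e3 k1 k2 k3 r1 r2 r3 L1 L2 L3 m th mu K C v :
  two_splittings A e1 e2 e3 k1 k2 k3 r1 r2 r3 L1 L2 L3 m th mu K C ->
  v \in L1 0%N -> k2 0%N v = 0 /\ k3 0%N v = 0.
Proof.
move=> T Lv; have /andP[th0 th1] := ts_th T; have mu1 := ts_mu T.
have K0 := ts_K T; have C0 := ts_C T.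
pose vn n := orbit A v n.
have Lvn n : vn n \in L1 n by have [h _ _] := ts_mem v n T; exact: h.
have mv n : m n (vn n) <= m 0%N v.
  elim: n => //= n IHn; apply: le_trans IHn.
  exact: (ts_contr T (Lvn n)).
have Nm n z : z \in L1 n -> N z <= C * m n z.
  by move=> hz; have [_ h] := ts_tame T n; have [] := h z (or_introl hz).
have k3v : k3 0%N v = 0.
  apply/eqP; rewrite -normr_le0.
  apply: (@le0_geometric R _ (K * (C * m 0%N v)) mu^-1).
  - by rewrite invr_ge0 ltW// (lt_trans _ mu1).
  - by rewrite invf_lt1// (lt_trans _ mu1).
  move=> n; have [_ _ _ p4 _] := ts_rates n T.
  have mun : 0 < mu ^+ n by rewrite exprn_gt0// (lt_trans _ mu1).
  rewrite exprVn ler_pdivlMr//.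
  apply: le_trans (_ : `|k3 n (vn n)| <= _).
    have [_ _ ->] := ts_orbit_coord v n T.
    rewrite normrM mulrC; apply: ler_wpM2r => //.
    by apply: le_trans p4 _; exact: ler_norm.
  have [_ _ h] := ts_k T n (vn n); apply: le_trans h _; apply: ler_wpM2l; first exact: ltW.
  by apply: le_trans (Nm n _ (Lvn n)) _; apply: ler_wpM2l; [exact: ltW|exact: mv].
split=> //; apply/eqP/negPn/negP => k2v.
have vn0 n : 0 < m n (vn n).
  have : 0 < C * m n (vn n).
    apply: lt_le_trans (Nm n _ (Lvn n)).
    rewrite lt_neqAle N_ge0 andbT eq_sym; apply/eqP => /N_eq0 h.
    have [_ h2 _] := ts_orbit_coord v n T.
    have [_ _ _ _ [_ [p6 _]]] := ts_rates n T.
    have [_ b _] := ts_k T n (vn n).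
    move: b; rewrite h2 h /N !raddf0 normr0 !maxxx mulr0 normr_le0 mulf_eq0 gt_eqF//=.
    by move/eqP => k20; move: k2v; rewrite k20 eqxx.
  by rewrite pmulr_rgt0.
(* Components of [e1] in [L2] and [L3]: by domination they grow at least like the orbit of [v],
hence like [rates r2], but they are bounded by the orbit of [e1], which grows like
[rates r1]. *)
have vanish z : z \in L2 0%N \/ z \in L3 0%N ->
    (forall n, N (orbit A z n) <= C * N (orbit A (e1 0%N) n)) -> z = 0.
  move=> hz hb; pose zn n := orbit A z n.
  have Lz n : zn n \in L2 n \/ zn n \in L3 n.
    by have [_ a b] := ts_mem z n T; case: hz => [/a|/b]; [left|right].
  have dom n : m n (vn n) * m 0%N z <= m n (zn n) * m 0%N v.
    elim: n => [|n IHn]; first by rewrite mulrC.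
    have d := ts_dom T (Lvn n) (Lz n).
    rewrite -(ler_pM2l (vn0 n)).
    apply: le_trans (_ : m n.+1 (vn n.+1) * (m n (zn n) * m 0%N v) <= _).
      by rewrite mulrCA; apply: ler_wpM2l => //; exact: (ts_m0 T).
    have -> : m n (vn n) * (m n.+1 (zn n.+1) * m 0%N v) = m n.+1 (zn n.+1) * m n (vn n) * m 0%N v by ring.
    by rewrite mulrA; apply: ler_wpM2r d; exact: (ts_m0 T).
  have z0 : `|k2 0%N v| * m 0%N z <= 0.
    apply: (@le0_geometric R _ (K * C * (C * (C * K) * m 0%N v)) th) => // n.
    have [p1 p2 _ _ [_ [p6 _]]] := ts_rates n T.
    have e1n : orbit A (e1 0%N) n = rates r1 n *: e1 n.
      rewrite (ts_orbit _ n T).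
      have [-> -> ->] : [/\ k1 0%N (e1 0%N) = 1, k2 0%N (e1 0%N) = 0 & k3 0%N (e1 0%N) = 0].
        by have := ts_coord T 0%N 1 0 0; rewrite scale1r !scale0r !addr0.
      by rewrite !mulr0 mulr1 !scale0r !addr0.
    have mz : m n (zn n) <= C * (C * K) * (th ^+ n * rates r2 n).
      have [_ h] := ts_tame T n.
      have hzn : zn n \in L1 n \/ zn n \in L2 n \/ zn n \in L3 n by right; exact: Lz.
      have [h1 _] := h _ hzn; apply: le_trans h1 _; rewrite -mulrA; apply: ler_wpM2l; first exact: ltW.
      apply: le_trans (hb n) _; rewrite -mulrA; apply: ler_wpM2l; first exact: ltW.
      rewrite e1n NZ (gtr0_norm p1) mulrC; have [h2 _ _] := ts_e T n.
      by apply: ler_pM => //; [exact: N_ge0|exact: ltW].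
    have kv : rates r2 n * `|k2 0%N v| <= K * (C * m n (vn n)).
      have [_ h2 _] := ts_orbit_coord v n T; have [_ h3 _] := ts_k T n (vn n).
      rewrite -{1}(gtr0_norm p6) -normrM -h2; apply: le_trans h3 _; apply: ler_wpM2l; first exact: ltW.
      exact: Nm (Lvn n).
    have m0 := ts_m0 T; have mz0 := m0 0%N z; have mv0 := m0 0%N v.
    rewrite -(ler_pM2l p6) [leLHS]mulrA.
    apply: le_trans (_ : K * (C * m n (vn n)) * m 0%N z <= _); first exact: ler_wpM2r.
    rewrite -!mulrA; apply: le_trans (_ : K * (C * (m n (zn n) * m 0%N v)) <= _).
      by rewrite !ler_pM2l.
    apply: le_trans (_ : K * (C * (C * (C * K) * (th ^+ n * rates r2 n) * m 0%N v)) <= _).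
      by rewrite !ler_pM2l//; exact: ler_wpM2r.
    by rewrite le_eqVlt; apply/orP; left; apply/eqP; ring.
  have mz0 : m 0%N z <= 0.
    by move: z0; rewrite pmulr_rle0// normr_gt0.
  apply: N_eq0; apply/eqP; rewrite eq_le N_ge0 andbT.
  have [_ h] := ts_tame T 0%N.
  have hz' : z \in L1 0%N \/ z \in L2 0%N \/ z \in L3 0%N by right.
  have [_ h2] := h _ hz'; apply: le_trans h2 _.
  by apply: mulr_ge0_le0 => //; exact: ltW.
have : e1 0%N \in fullv by exact: memvf.
rewrite -(ts_full T 0%N) => /memv_addP[y /memv_addP[u Lu [w Lw ->]] [t Lt e]].
have sum_bound n : [/\ N (orbit A w n) <= C * N (orbit A (e1 0%N) n) &
    N (orbit A t n) <= C * N (orbit A (e1 0%N) n)].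
  have [h _] := ts_tame T n; rewrite e !orbitD.
  have [a1 a2 a3] := ts_mem u n T; have [b1 b2 b3] := ts_mem w n T; have [c1 c2 c3] := ts_mem t n T.
  by have [_ h2 h3] := h _ _ _ (a1 Lu) (b2 Lw) (c3 Lt).
have w0 : w = 0 by apply: vanish; [left|move=> n; have [] := sum_bound n].
have t0 : t = 0 by apply: vanish; [right|move=> n; have [] := sum_bound n].
have [a a0 La] := ts_line T 0%N.
move: Lu Lv; rewrite La => /vlineP[r hr] /vlineP[s hs].
have ce := ts_coord T 0%N 1 0 0; rewrite scale1r !scale0r !addr0 in ce.
have [c1 c2 c3] := ce.
have e1a : e1 0%N = r *: a by rewrite e w0 t0 !addr0.
have r0 : r != 0 by apply/eqP => r0; move: c1; rewrite e1a r0 scale0r => h;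
  have [/esym h1 _ _] := ts_coord T 0%N 0 0 0; move: h1; rewrite !scale0r !addr0 h => /eqP; rewrite eq_sym oner_eq0.
have ve : v = (s / r) *: e1 0%N by rewrite e1a scalerA divfK.
have [_ h _] := ts_coord T 0%N (s / r) 0 0.
by move: k2v; rewrite ve; move: h; rewrite !scale0r !addr0 => ->; rewrite eqxx.
Qed.

(** Given that [L3] is spanned by [e3], a vector of [L2] with an [e3]-component would
approach the line [L3] along its orbit, which the angle between the lines prevents. *)
Lemma middle_line A e1 e2 e3 k1 k2 k3 r1 r2 r3 L1 L2 L3 m th mu K C v :
  two_splittings A e1 e2 e3 k1 k2 k3 r1 r2 r3 L1 L2 L3 m th mu K C ->
  (forall n, e3 n \in L3 n) -> v \in L2 0%N -> k3 0%N v = 0.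
Proof.
move=> T L3e Lv; have /andP[th0 th1] := ts_th T.
have K0 := ts_K T; have C0 := ts_C T.
apply/eqP; rewrite -normr_le0.
apply: (@le0_geometric R _ (K * (C * (K * (`|k1 0%N v| + `|k2 0%N v|)))) th) => // n.
have [p1 p2 p3 _ [p5 [p6 p7]]] := ts_rates n T.
have [_ Lvn _] := ts_mem v n T; have {}Lvn := Lvn Lv.
pose t := - (rates r3 n * k3 0%N v) *: e3 n.
have Lt : t \in L3 n by apply: memvZ; exact: L3e.
have [h _] := ts_tame T n.
have [_ _] := h 0 _ _ (mem0v _) Lvn Lt; rewrite add0r.
have -> : orbit A v n + t = (rates r1 n * k1 0%N v) *: e1 n + (rates r2 n * k2 0%N v) *: e2 n.
  by rewrite (ts_orbit v n T) /t scaleNr addrK.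
rewrite /t NZ normrN normrM (gtr0_norm p7) => hN.
have [g1 g2 g3] := ts_e T n.
have bX : N ((rates r1 n * k1 0%N v) *: e1 n + (rates r2 n * k2 0%N v) *: e2 n) <=
    K * (`|k1 0%N v| + `|k2 0%N v|) * (th ^+ n * rates r3 n).
  apply: le_trans (ND _ _) _; rewrite !NZ !normrM (gtr0_norm p1) (gtr0_norm p6).
  have h1 : rates r1 n * `|k1 0%N v| * N (e1 n) <= (th ^+ n * rates r3 n) * `|k1 0%N v| * K.
    apply: ler_pM => //; [by rewrite mulr_ge0// ltW|exact: N_ge0|].
    by apply: ler_wpM2r => //; exact: le_trans p5 p3.
  have h2 : rates r2 n * `|k2 0%N v| * N (e2 n) <= (th ^+ n * rates r3 n) * `|k2 0%N v| * K.
    apply: ler_pM => //; [by rewrite mulr_ge0// ltW|exact: N_ge0|].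
    exact: ler_wpM2r.
  by apply: le_trans (lerD h1 h2) _; rewrite le_eqVlt; apply/orP; left; apply/eqP; ring.
have e3K : 1 <= K * N (e3 n).
  have [_ _ c3] := ts_coord T n 0 0 1; rewrite !scale0r !add0r scale1r in c3.
  by have [_ _] := ts_k T n (e3 n); rewrite c3 normr1.
rewrite -(ler_pM2l p7).
apply: le_trans (_ : K * (rates r3 n * `|k3 0%N v| * N (e3 n)) <= _).
  by rewrite mulrCA; apply: ler_peMr => //; apply: mulr_ge0 => //; exact: ltW.
apply: le_trans (_ : K * (C * (K * (`|k1 0%N v| + `|k2 0%N v|) * (th ^+ n * rates r3 n))) <= _).
  apply: ler_wpM2l; first exact: ltW.
  by apply: le_trans hN _; apply: ler_wpM2l => //; exact: ltW.
by rewrite le_eqVlt; apply/orP; left; apply/eqP; ring.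
Qed.

End TwoSplittings.

(** * Uniqueness of the center bundle *)

Section CenterUnique.
Variable R : realType.
Local Notation V3 := 'rV[R]_3.
Local Notation T3 := (torus R).
Local Notation tpi := (@tpi R).
Implicit Types (p q v u w t : V3) (x y : T3) (G H : V3 -> V3) (f g h : T3 -> T3).
Implicit Types (es ec eu : V3 -> V3) (ks kc ku : V3 -> V3 -> R) (E : T3 -> {vspace V3}).
Implicit Types (A : T3 -> 'M[R]_3).

Lemma metric_norm_gt0 A x v : riemannian_metric A -> v != 0 -> 0 < metric_norm A x v.
Proof. by move=> [_ _ pos] v0; rewrite sqrtr_gt0; exact: pos. Qed.

Lemma metric_norm0 A x : metric_norm A x 0 = 0.
Proof. by rewrite /metric_norm !mul0mx mxE sqrtr0. Qed.

Lemma line_bundle_line E x : line_bundle E -> exists2 v, v != 0 & E x = <[v]>%VS.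
Proof. by move=> /(_ x)[v /nbhs_singleton[_ v0 e]]; exists (v x). Qed.

Lemma restricted_contraction A f E x v : riemannian_metric A -> (restricted_norm A f E < 1)%E ->
  v \in E x -> metric_norm A (f x) (v *m tangent_map f x) <= metric_norm A x v.
Proof.
move=> mA h vE; have [->|v0] := eqVneq v 0; first by rewrite mul0mx !metric_norm0.
have n0 := metric_norm_gt0 x mA v0.
have uE : (metric_norm A x v)^-1 *: v \in E x by exact: memvZ.
have u1 : metric_norm A x ((metric_norm A x v)^-1 *: v) = 1.
  by rewrite metric_normZ normfV gtr0_norm// mulVf// gt_eqF.
have : ((metric_norm A (f x) ((metric_norm A x v)^-1 *: v *m tangent_map f x))%:E <= 1)%E.
  apply: le_trans (ltW h); apply: ereal_sup_ubound.
  by exists x, ((metric_norm A x v)^-1 *: v).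
rewrite lee_fin -scalemxAl metric_normZ normfV (gtr0_norm n0).
by rewrite mulrC ler_pdivrMr// mul1r.
Qed.

Lemma unit_scale A x v (J : 'M[R]_3) y : riemannian_metric A -> v != 0 ->
  metric_norm A x ((metric_norm A x v)^-1 *: v) = 1 /\
  metric_norm A y ((metric_norm A x v)^-1 *: v *m J) = metric_norm A y (v *m J) / metric_norm A x v.
Proof.
move=> mA v0; have n0 := metric_norm_gt0 x mA v0.
split; first by rewrite metric_normZ normfV gtr0_norm// mulVf// gt_eqF.
by rewrite -scalemxAl metric_normZ normfV (gtr0_norm n0) mulrC.
Qed.

(** Domination, for vectors of arbitrary length. *)
Lemma dominated_pairs A f Es Ec Eu x v w : riemannian_metric A ->
  line_bundle Es -> line_bundle Ec -> line_bundle Eu ->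
  (forall x vs vc vu, vs \in Es x -> vc \in Ec x -> vu \in Eu x ->
    metric_norm A x vs = 1 -> metric_norm A x vc = 1 -> metric_norm A x vu = 1 ->
    metric_norm A (f x) (vs *m tangent_map f x) < metric_norm A (f x) (vc *m tangent_map f x) /\
    metric_norm A (f x) (vc *m tangent_map f x) < metric_norm A (f x) (vu *m tangent_map f x)) ->
  (v \in Es x /\ (w \in Ec x \/ w \in Eu x)) \/ (v \in Ec x /\ w \in Eu x) ->
  metric_norm A (f x) (v *m tangent_map f x) * metric_norm A x w <=
  metric_norm A (f x) (w *m tangent_map f x) * metric_norm A x v.
Proof.
move=> mA Ls Lc Lu dom hvw.
have [->|v0] := eqVneq v 0; first by rewrite mul0mx !metric_norm0 mulr0 mul0r.
have [->|w0] := eqVneq w 0; first by rewrite mul0mx !metric_norm0 mulr0 mul0r.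
have [vs s0 es] := line_bundle_line x Ls; have [vc c0 ec] := line_bundle_line x Lc.
have [vu u0 eu] := line_bundle_line x Lu.
have key a b d : a \in Es x -> b \in Ec x -> d \in Eu x -> a != 0 -> b != 0 -> d != 0 ->
    metric_norm A (f x) (a *m tangent_map f x) / metric_norm A x a <
      metric_norm A (f x) (b *m tangent_map f x) / metric_norm A x b /\
    metric_norm A (f x) (b *m tangent_map f x) / metric_norm A x b <
      metric_norm A (f x) (d *m tangent_map f x) / metric_norm A x d.
  move=> Ea Eb Ed a0 b0 d0.
  have [a1 <-] := unit_scale x (tangent_map f x) (f x) mA a0.
  have [b1 <-] := unit_scale x (tangent_map f x) (f x) mA b0.
  have [d1 <-] := unit_scale x (tangent_map f x) (f x) mA d0.
  by apply: dom => //; exact: memvZ.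
have sE : vs \in Es x by rewrite es memv_line.
have cE : vc \in Ec x by rewrite ec memv_line.
have uE : vu \in Eu x by rewrite eu memv_line.
have nv := metric_norm_gt0 x mA v0; have nw := metric_norm_gt0 x mA w0.
suff : metric_norm A (f x) (v *m tangent_map f x) / metric_norm A x v <=
    metric_norm A (f x) (w *m tangent_map f x) / metric_norm A x w.
  by rewrite ler_pdivrMr// mulrAC ler_pdivlMr.
have [[vE [wE|wE]]|[vE wE]] := hvw.
- by have [h _] := key v w vu vE wE uE v0 w0 u0; exact: ltW.
- by have [h1 h2] := key v vc w vE cE wE v0 c0 w0; exact: ltW (lt_trans h1 h2).
- by have [_ h] := key vs v w sE vE wE s0 v0 w0; exact: ltW.
Qed.

Lemma invariant_mem f E x v : invariant_bundle f E -> v \in E x -> v *m tangent_map f x \in E (f x).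
Proof.
move=> inv vE; rewrite -inv; have := memv_img (linfun (mulmxr (tangent_map f x))) vE.
by rewrite lfunE.
Qed.

Lemma tangent_inverse g h G H x : C1_lift g G -> C1_lift h H -> cancel G H -> inverse_maps g h ->
  tangent_map g x *m tangent_map h (g x) = 1%:M.
Proof.
move=> LG LH GH gh; rewrite -(tpi_repr x); move: (repr x) => p.
rewrite -LG.2 (tangent_map_tpi p LG) (tangent_map_tpi (G p) LH).
exact: (inverse_jacobian p LG.1.1 LH.1.1 GH).
Qed.

Lemma add3_rev (V : zmodType) (a b c : V) : a + b + c = c + b + a.
Proof. by rewrite addrC [a + b]addrC addrA. Qed.

(* The rates satisfy [rs + 1 / 200 <= rc <= 33 / 10], so their ratio is below [1 - 1 / 660]. *)
Local Notation th := (1 - 1 / 700 : R).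

(** Along a forward orbit the first line is the stable one; along a backward orbit, in the next
lemma, it is the unstable one. *)
Lemma frame_splittings g h e G H es ec eu ks kc ku A Es Ec Eu C :
  framed_diffeo g h e G H es ec eu ks kc ku -> riemannian_metric A -> 0 < C ->
  line_bundle Es -> line_bundle Ec -> line_bundle Eu ->
  (forall x, (Es x + Ec x + Eu x)%VS = fullv) ->
  invariant_bundle g Es -> invariant_bundle g Ec -> invariant_bundle g Eu ->
  (forall x, tame_splitting (fun u => u \in Es x) (fun u => u \in Ec x)
    (fun u => u \in Eu x) (metric_norm A x) C) ->
  (forall x vs vc vu, vs \in Es x -> vc \in Ec x -> vu \in Eu x ->
    metric_norm A x vs = 1 -> metric_norm A x vc = 1 -> metric_norm A x vu = 1 ->
    metric_norm A (g x) (vs *m tangent_map g x) < metric_norm A (g x) (vc *m tangent_map g x) /\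
    metric_norm A (g x) (vc *m tangent_map g x) < metric_norm A (g x) (vu *m tangent_map g x)) ->
  (restricted_norm A g Es < 1)%E -> (restricted_norm A h Eu < 1)%E ->
  forall p, exists K rs rc ru (P := fun n => iter n G p),
   two_splittings (fun n => jacobian G (P n)) (fun n => es (P n)) (fun n => ec (P n))
    (fun n => eu (P n)) (fun n => ks (P n)) (fun n => kc (P n)) (fun n => ku (P n)) rs rc ru
    (fun n => Es (tpi (P n))) (fun n => Ec (tpi (P n))) (fun n => Eu (tpi (P n)))
    (fun n => metric_norm A (tpi (P n))) th (36 / 10) K C.
Proof.
move=> D mA C0 Ls Lc Lu full Is Ic Iu tame dom cs cu p.
have F := fd_frame D; have LG := fd_G D.
have /choice[rr hrr] : forall q, exists r : R * R * R, [/\ es q *m jacobian G q = r.1.1 *: es (G q),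
    ec q *m jacobian G q = r.1.2 *: ec (G q), eu q *m jacobian G q = r.2 *: eu (G q) &
    frame_rates r.1.1 r.1.2 r.2].
  by move=> q; have [rs [rc [ru h']]] := fr_rate F q; exists (rs, rc, ru).
have gP n : g (tpi (iter n G p)) = tpi (iter n.+1 G p) by rewrite -LG.2.
have tP n : tangent_map g (tpi (iter n G p)) = jacobian G (iter n G p) := tangent_map_tpi _ LG.
exists 5000, (fun n => (rr (iter n G p)).1.1), (fun n => (rr (iter n G p)).1.2),
  (fun n => (rr (iter n G p)).2); split.
- by move=> n v; exact: (fr_eta F).
- by move=> n x y z; exact: (fr_coord F).
- by move=> n v; exact: (fr_k F).
- move=> n; have [h1 h2 h3] := frame_N (iter n G p) F.
  have k5 : 12 <= 5000 :> R by rewrite ler_nat.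
  by rewrite !(le_trans _ k5).
- by move=> n; have [] := hrr (iter n G p).
- move=> n; have [_ _ _ [/andP[h1 h2] h3 h4 h5]] := hrr (iter n G p).
  by split=> //; move: h1 h2 h3 h4 h5; clear; lra.
- by apply/andP; split; clear; lra.
- by clear; lra.
- by rewrite ltr0n.
- exact: C0.
- by move=> n v; rewrite -tP -gP; split; exact: invariant_mem.
- by move=> n; exact: full.
- by move=> n; exact: line_bundle_line.
- by move=> n; exact: tame.
- by move=> n v; exact: sqrtr_ge0.
- by move=> n v hv; rewrite -tP -gP; exact: (restricted_contraction mA cs).
- by move=> n v w hv hw; rewrite -tP -gP; apply: (dominated_pairs mA Ls Lc Lu dom); left.
Qed.

Lemma frame_splittings_inv g h e G H es ec eu ks kc ku A Es Ec Eu C :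
  framed_diffeo g h e G H es ec eu ks kc ku -> riemannian_metric A -> 0 < C ->
  line_bundle Es -> line_bundle Ec -> line_bundle Eu ->
  (forall x, (Es x + Ec x + Eu x)%VS = fullv) ->
  invariant_bundle g Es -> invariant_bundle g Ec -> invariant_bundle g Eu ->
  (forall x, tame_splitting (fun u => u \in Es x) (fun u => u \in Ec x)
    (fun u => u \in Eu x) (metric_norm A x) C) ->
  (forall x vs vc vu, vs \in Es x -> vc \in Ec x -> vu \in Eu x ->
    metric_norm A x vs = 1 -> metric_norm A x vc = 1 -> metric_norm A x vu = 1 ->
    metric_norm A (g x) (vs *m tangent_map g x) < metric_norm A (g x) (vc *m tangent_map g x) /\
    metric_norm A (g x) (vc *m tangent_map g x) < metric_norm A (g x) (vu *m tangent_map g x)) ->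
  (restricted_norm A g Es < 1)%E -> (restricted_norm A h Eu < 1)%E ->
  forall p, exists K rs rc ru (P := fun n => iter n H p),
   two_splittings (fun n => jacobian H (P n)) (fun n => eu (P n)) (fun n => ec (P n))
    (fun n => es (P n)) (fun n => ku (P n)) (fun n => kc (P n)) (fun n => ks (P n)) ru rc rs
    (fun n => Eu (tpi (P n))) (fun n => Ec (tpi (P n))) (fun n => Es (tpi (P n)))
    (fun n => metric_norm A (tpi (P n))) th (10 / 7) K C.
Proof.
move=> D mA C0 Ls Lc Lu full Is Ic Iu tame dom cs cu p.
have F := fd_frame D; have LG := fd_G D; have LH := fd_H D; have M := fd_near D.
have [gh hg] := fd_gh D.
have /choice[rr hrr] : forall q, exists r : R * R * R, [/\ es q *m jacobian G q = r.1.1 *: es (G q),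
    ec q *m jacobian G q = r.1.2 *: ec (G q), eu q *m jacobian G q = r.2 *: eu (G q) &
    frame_rates r.1.1 r.1.2 r.2].
  by move=> q; have [rs [rc [ru h']]] := fr_rate F q; exists (rs, rc, ru).
have gP n : h (tpi (iter n H p)) = tpi (iter n.+1 H p) by rewrite -LH.2.
have tP n : tangent_map h (tpi (iter n H p)) = jacobian H (iter n H p) := tangent_map_tpi _ LH.
have TI x := tangent_inverse x LG LH (nm_GH M) (fd_gh D).
have inv E x v : invariant_bundle g E -> v \in E x -> v *m tangent_map h x \in E (h x).
  move=> IE; rewrite -{1}(hg x) -IE => /memv_imgP[w wE].
  rewrite lfunE /= => ->; rewrite -mulmxA -{2}(hg x) TI mulmx1.
  exact: wE.
have back (v : V3) q r : r != 0 -> forall v', v *m jacobian G q = r *: v' -> v' *m jacobian H (G q) = r^-1 *: v.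
  move=> r0 v' hv; rewrite -[v']scale1r -(mulVf r0) -scalerA -hv -scalemxAl -mulmxA.
  by rewrite (inverse_jacobian q LG.1.1 LH.1.1 (nm_GH M)) mulmx1.
pose r n := rr (iter n.+1 H p).
have rP n : [/\ es (iter n H p) *m jacobian H (iter n H p) = (r n).1.1^-1 *: es (iter n.+1 H p),
    ec (iter n H p) *m jacobian H (iter n H p) = (r n).1.2^-1 *: ec (iter n.+1 H p),
    eu (iter n H p) *m jacobian H (iter n H p) = (r n).2^-1 *: eu (iter n.+1 H p) &
    frame_rates (r n).1.1 (r n).1.2 (r n).2].
  have [h1 h2 h3 h4] := hrr (iter n.+1 H p).
  have [/andP[s0 _] sc _ u0] := h4.
  have c0 : 0 < (rr (iter n.+1 H p)).1.2 by move: s0 sc; clear; lra.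
  have {}u0 : 0 < (rr (iter n.+1 H p)).2 by move: u0; clear; lra.
  have eP : G (iter n.+1 H p) = iter n H p by rewrite /= (nm_HG M).
  rewrite eP in h1 h2 h3.
  by split=> //; rewrite -{2}eP; apply: back; rewrite ?gt_eqF// eP.
exists 5000, (fun n => (r n).1.1^-1), (fun n => (r n).1.2^-1), (fun n => (r n).2^-1); split.
- by move=> n v; exact: (etrans (fr_eta F (iter n H p) v) (add3_rev _ _ _)).
- move=> n x y z.
  have [h1 h2 h3] := fr_coord F (iter n H p) z y x.
  have e1 : x *: eu (iter n H p) + y *: ec (iter n H p) + z *: es (iter n H p) =
      z *: es (iter n H p) + y *: ec (iter n H p) + x *: eu (iter n H p).
    by apply/rowP => i; rewrite !mxE; ring.
  by rewrite e1; split.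
- by move=> n v; have [h1 h2 h3] := fr_k F (iter n H p) v.
- move=> n; have [h1 h2 h3] := frame_N (iter n H p) F.
  have k5 : 12 <= 5000 :> R by rewrite ler_nat.
  by rewrite !(le_trans _ k5).
- by move=> n; have [] := rP n.
- move=> n; have [_ _ _ [/andP[h1 h2] h3 h4 h5]] := rP n.
  have c0 : 0 < (r n).1.2 by move: h1 h3; clear; lra.
  have u0 : 0 < (r n).2 by move: h5; clear; lra.
  split.
  + by rewrite invr_gt0.
  + by rewrite ler_pdivlMr// mulrC ler_pdivrMr//; move: h4 h5; clear; lra.
  + by rewrite ler_pdivlMr// mulrC ler_pdivrMr//; move: h1 h3 h4; clear; lra.
  + rewrite -[leRHS]div1r ler_pdivlMr//; move: h2; clear; lra.
- by apply/andP; split; clear; lra.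
- by clear; lra.
- by rewrite ltr0n.
- exact: C0.
- by move=> n v; rewrite -tP -gP; split; exact: inv.
- by move=> n; rewrite -(full (tpi (iter n H p))) addvC [(Eu _ + Ec _)%VS]addvC addvA.
- by move=> n; exact: line_bundle_line.
- move=> n; have [t1 t2] := tame (tpi (iter n H p)); split.
    move=> u w t hu hw ht; have [h1 h2 h3] := t1 t w u ht hw hu.
    by rewrite add3_rev.
  by move=> u hu; apply: t2; move: hu => [|[]]; [right; right|right; left|left].
- by move=> n v; exact: sqrtr_ge0.
- by move=> n v hv; rewrite -tP -gP; exact: (restricted_contraction mA cu).
- move=> n v w hv hw; rewrite -tP -gP; set x := tpi (iter n H p) in hv hw *.
  have IT z : z *m tangent_map h x *m tangent_map g (h x) = z.
    have := TI (h x); rewrite hg => /mulmx1C TI'.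
    by rewrite -mulmxA TI' mulmx1.
  have d : (w *m tangent_map h x \in Es (h x) /\ (v *m tangent_map h x \in Ec (h x) \/ v *m tangent_map h x \in Eu (h x))) \/
      (w *m tangent_map h x \in Ec (h x) /\ v *m tangent_map h x \in Eu (h x)).
    by case: hw => hw; [right; split; apply: inv|left; split; [apply: inv|right; apply: inv]].
  by have := dominated_pairs mA Ls Lc Lu dom d; rewrite !IT hg mulrC [leRHS]mulrC.
Qed.

(** Forward growth identifies the stable line and backward growth the unstable one; then the
center vectors have no component along either. *)
Lemma center_unique g h e G H es ec eu ks kc ku Ec :
  framed_diffeo g h e G H es ec eu ks kc ku -> center_bundle g Ec ->
  Ec = line_field ec.
Proof.
move=> D [Es [Eu [[Ls Lc Lu] full [Is Ic Iu] [A mA [dom cs [h' gh' cu]]]]]].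
have F := fd_frame D; have [gh hg] := fd_gh D.
have eh : h' = h.
  have [g1 g2] := gh'; apply/funext => x; by rewrite -{1}(hg x) g1.
rewrite {}eh in cu.
have {}full x : (Es x + Ec x + Eu x)%VS = fullv by have [] := full x.
have [C1 tame1] := global_tame mA Ls Lc Lu full.
pose C := Num.max C1 1.
have C0 : 0 < C by rewrite lt_max ltr01 orbT.
have tame x : tame_splitting (fun u => u \in Es x) (fun u => u \in Ec x)
    (fun u => u \in Eu x) (metric_norm A x) C.
  by apply: tame_le (tame1 x) => [u|]; [exact: sqrtr_ge0|rewrite le_max lexx].
have fwd := frame_splittings D mA C0 Ls Lc Lu full Is Ic Iu tame dom cs cu.
have bwd := frame_splittings_inv D mA C0 Ls Lc Lu full Is Ic Iu tame dom cs cu.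
have linE (E : {vspace V3}) (a b : V3) : a != 0 -> E = <[b]>%VS -> (forall v, v \in E -> v \in <[a]>%VS) -> b != 0 ->
    E = <[a]>%VS.
  move=> a0 -> hab b0; have /vlineP[r hr] := hab b (memv_line b).
  have r0 : r != 0 by apply/eqP => r0; move: b0; rewrite hr r0 scale0r eqxx.
  apply/eqP; rewrite eqEsubv; apply/andP; split; apply/subvP => v; first exact: hab.
  by move=> /vlineP[k ->]; apply/vlineP; exists (k / r); rewrite hr scalerA divfK.
have nz (v : V3) (l : {linear V3 -> R}) : l v = 1 -> v != 0.
  by move=> h1; apply/eqP => v0; move: h1; rewrite v0 linear0 => /eqP; rewrite eq_sym oner_eq0.
have EsE p : es p \in Es (tpi p).
  have [K [rs [rc [ru T]]]] := fwd p.
  have [b b0 eb] := line_bundle_line (tpi p) Ls.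
  have [h1 _ _] := fr_S F p; have es0 : es p != 0 := nz _ _ h1.
  rewrite (linE _ _ _ es0 eb _ b0) ?memv_line// => v vE.
  have [k2 k3] := slow_line T vE; apply/vlineP; exists (ks p v).
  by rewrite {1}(fr_eta F p v); rewrite /= in k2 k3; rewrite k2 k3 !scale0r !addr0.
have EuE p : eu p \in Eu (tpi p).
  have [K [rs [rc [ru T]]]] := bwd p.
  have [b b0 eb] := line_bundle_line (tpi p) Lu.
  have [_ _ h1] := fr_S F p; have eu0 : eu p != 0 := nz _ _ h1.
  rewrite (linE _ _ _ eu0 eb _ b0) ?memv_line// => v vE.
  have [k2 k3] := slow_line T vE; apply/vlineP; exists (ku p v).
  by rewrite {1}(fr_eta F p v); rewrite /= in k2 k3; rewrite k2 k3 !scale0r !add0r.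
apply/funext => x; rewrite -(tpi_repr x); move: (repr x) => p.
rewrite line_field_tpi; last by move=> q n hn; have [] := fr_per F q hn.
have [b b0 eb] := line_bundle_line (tpi p) Lc.
have [_ h1 _] := fr_S F p; have ec0 : ec p != 0 := nz _ _ h1.
apply: (linE _ _ _ ec0 eb _ b0) => v vE.
have [K [rs [rc [ru T]]]] := fwd p; have [K' [rs' [rc' [ru' T']]]] := bwd p.
have k3 := middle_line T (fun n => EuE (iter n G p)) vE.
have k1 := middle_line T' (fun n => EsE (iter n H p)) vE.
apply/vlineP; exists (kc p v); rewrite {1}(fr_eta F p v); rewrite /= in k1 k3.
by rewrite k1 k3 !scale0r add0r addr0.
Qed.

End CenterUnique.

(** * Boxes of leaves *)

Section LeafBoxes.
Variable R : realType.
Local Notation V3 := 'rV[R]_3.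
Local Notation V2 := 'rV[R]_2.
Local Notation T3 := (torus R).
Local Notation tpi := (@tpi R).
Implicit Types (p q n v : V3) (s t : R) (y z : V2) (w : R * V2).

(** The plaques are to be parametrized smoothly by the whole line; the factor 1/16 keeps the
boxes of leaves smaller than the integer lattice. *)
Definition squeeze t : R := atan t / 16.
Definition unsqueeze s : R := tan (s * 16).
Definition squeezed s : Prop := `|s * 16| < pi / 2.

Lemma squeezeK t : unsqueeze (squeeze t) = t.
Proof. by rewrite /unsqueeze /squeeze divfK// atanK. Qed.

Lemma squeezed_squeeze t : squeezed (squeeze t).
Proof.
by rewrite /squeezed /squeeze divfK// ltr_norml atan_gtNpi2 atan_ltpi2.
Qed.

Lemma unsqueezeK s : squeezed s -> squeeze (unsqueeze s) = s.
Proof.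
rewrite /squeezed ltr_norml => h.
by rewrite /squeeze /unsqueeze tanK ?in_itv//= mulfK.
Qed.

Lemma squeezed_lt s : squeezed s -> `|s| < 1 / 8.
Proof.
rewrite /squeezed => h; have := lt_trans h (@pihalf_lt2 R).
by rewrite normrM (@gtr0_norm _ 16)//; clear; lra.
Qed.

Lemma is_derive_squeeze t : is_derive t (1 : R) squeeze ((1 + t ^+ 2)^-1 / 16).
Proof.
have h : is_derive t (1 : R) atan (1 + t ^+ 2)^-1 by exact: is_derive1_atan.
by rewrite /squeeze; apply: is_derive_eq; rewrite /GRing.scale /=; ring.
Qed.

Lemma squeeze_continuous : continuous squeeze.
Proof. exact: is_derive_continuous is_derive_squeeze. Qed.

Lemma unsqueeze_continuous s : squeezed s -> {for s, continuous unsqueeze}.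
Proof.
rewrite /squeezed ltr_norml => h.
apply: (@continuous_comp _ _ _ (fun s : R => s * 16) tan).
  by apply: cvgMl; exact: cvg_id.
by apply: continuous_tan; rewrite gt_eqF// cos_gt0_pihalf.
Qed.

Lemma squeezed_near s : squeezed s -> \forall s' \near s, squeezed s'.
Proof.
move=> h; have c : {for s, continuous (fun s : R => `|s * 16|)}.
  by apply: cvg_norm; apply: cvgMl; exact: cvg_id.
exact: (cvgr_lt _ c).
Qed.

Definition box w (a : R * V2) : R * V2 :=
  (w.1 + squeeze a.1, vec2 (w.2 ord0 ord0 + squeeze (a.2 ord0 ord0))
     (w.2 ord0 (lift ord0 ord0) + squeeze (a.2 ord0 (lift ord0 ord0)))).

Definition unbox w (b : R * V2) : R * V2 :=
  (unsqueeze (b.1 - w.1), vec2 (unsqueeze (b.2 ord0 ord0 - w.2 ord0 ord0))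
     (unsqueeze (b.2 ord0 (lift ord0 ord0) - w.2 ord0 (lift ord0 ord0)))).

Definition boxed w (b : R * V2) : Prop :=
  [/\ squeezed (b.1 - w.1), squeezed (b.2 ord0 ord0 - w.2 ord0 ord0) &
      squeezed (b.2 ord0 (lift ord0 ord0) - w.2 ord0 (lift ord0 ord0))].

Lemma boxK w a : unbox w (box w a) = a.
Proof.
case: a => s y; rewrite /unbox /box /= !vec2E.
by rewrite !(addrC _ (squeeze _)) !addrK !squeezeK vec2_eta.
Qed.

Lemma boxed_box w a : boxed w (box w a).
Proof.
by rewrite /boxed /box /= !vec2E !(addrC _ (squeeze _)) !addrK; split; exact: squeezed_squeeze.
Qed.

Lemma unboxK w b : boxed w b -> box w (unbox w b) = b.
Proof.
case: b => s y [h1 h2 h3]; rewrite /unbox /box /= !vec2E !unsqueezeK//.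
by rewrite ![_ + (_ - _)]addrC !subrK vec2_eta.
Qed.

Lemma vec2_cvg (X : Type) (F : set_system X) (FF : Filter F) (a b : X -> R) a0 b0 :
  a @ F --> a0 -> b @ F --> b0 -> vec2 (a x) (b x) @[x --> F] --> vec2 a0 b0.
Proof.
have e (c d : R) : vec2 c d = c *: delta_mx ord0 ord0 + d *: delta_mx ord0 (lift ord0 ord0).
  apply/rowP => j; rewrite !mxE eqxx /=.
  by case: j => [[|[|//]] hi] /=; rewrite ?mulr1 ?mulr0 ?addr0 ?add0r.
move=> ha hb; rewrite e; under eq_fun do rewrite e.
have gen (V : normedModType R) (u v : V) : a x *: u + b x *: v @[x --> F] --> a0 *: u + b0 *: v.
  by apply: cvgD; apply: cvgZl.
exact: (gen V2).
Qed.

Lemma pair_continuous_at (X Y Z : topologicalType) (x : X) (a : X -> Y) (b : X -> Z) :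
  {for x, continuous a} -> {for x, continuous b} -> {for x, continuous (fun x => (a x, b x))}.
Proof. by move=> ha hb; apply: cvg_pair; [exact: ha|exact: hb]. Qed.

Lemma pair_continuous (X : topologicalType) (x : X) (a b c : X -> R) :
  {for x, continuous a} -> {for x, continuous b} -> {for x, continuous c} ->
  {for x, continuous (fun x => (a x, vec2 (b x) (c x)) : R * V2)}.
Proof.
move=> ha hb hc; have h2 : {for x, continuous (fun x => vec2 (b x) (c x))}.
  by apply: vec2_cvg; [exact: hb|exact: hc].
exact: (@pair_continuous_at X R V2 x a _ ha h2).
Qed.

Lemma fst_continuous : continuous (fun w : R * V2 => w.1).
Proof. by move=> w; exact: cvg_fst. Qed.

Lemma snd_continuous (i : 'I_2) : continuous (fun w : R * V2 => w.2 ord0 i).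
Proof.
move=> w; apply: (@cvg_comp _ _ _ (fun w : R * V2 => w.2) (fun y : V2 => y ord0 i)).
  exact: cvg_snd.
exact: coord_continuous.
Qed.

Lemma box_continuous w : continuous (box w).
Proof.
have c1 : continuous (fun a : R * V2 => w.1 + squeeze a.1).
  exact: (contD (@cont_cst R _ w.1) (cont_comp fst_continuous squeeze_continuous)).
have c2 i : continuous (fun a : R * V2 => w.2 ord0 i + squeeze (a.2 ord0 i)).
  exact: (contD (@cont_cst R _ (w.2 ord0 i)) (cont_comp (@snd_continuous i) squeeze_continuous)).
by move=> a; exact: (pair_continuous (c1 a) (c2 ord0 a) (c2 _ a)).
Qed.

Lemma boxed_near w b : boxed w b -> \forall b' \near b, boxed w b'.
Proof.
move=> [h1 h2 h3].
have c1 : {for b, continuous (fun b : R * V2 => b.1 - w.1)}.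
  exact: (contB fst_continuous (@cont_cst R _ w.1)).
have c2 i : {for b, continuous (fun b : R * V2 => b.2 ord0 i - w.2 ord0 i)}.
  exact: (contB (@snd_continuous i) (@cont_cst R _ (w.2 ord0 i))).
have n1 : nbhs b (fun b' : R * V2 => squeezed (b'.1 - w.1)) := c1 _ (squeezed_near h1).
have n2 i : squeezed (b.2 ord0 i - w.2 ord0 i) ->
    nbhs b (fun b' : R * V2 => squeezed (b'.2 ord0 i - w.2 ord0 i)).
  by move=> h; exact: c2 i _ (squeezed_near h).
apply: (near_and n1 (near_conj (n2 _ h2) (n2 _ h3))) => b' k1 [k2 k3].
by split.
Qed.

Lemma unbox_continuous w b : boxed w b -> {for b, continuous (unbox w)}.
Proof.
move=> [h1 h2 h3].
have c1 : {for b, continuous (fun b : R * V2 => b.1 - w.1)}.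
  exact: (contB fst_continuous (@cont_cst R _ w.1)).
have c2 i : {for b, continuous (fun b : R * V2 => b.2 ord0 i - w.2 ord0 i)}.
  exact: (contB (@snd_continuous i) (@cont_cst R _ (w.2 ord0 i))).
have d1 := @continuous_comp _ _ _ _ unsqueeze b c1 (unsqueeze_continuous h1).
have d2 := @continuous_comp _ _ _ _ unsqueeze b (c2 ord0) (unsqueeze_continuous h2).
have d3 := @continuous_comp _ _ _ _ unsqueeze b (c2 _) (unsqueeze_continuous h3).
exact: (pair_continuous d1 d2 d3).
Qed.

(** The inverse [unbox] is continuous on the box, which is open. *)
Lemma box_open w (A : set (R * V2)) : open A -> open (box w @` A).
Proof.
move=> oA; rewrite openE => _ [a Aa <-].
have hb := boxed_box w a.
have n1 := boxed_near hb.
have n2 : \forall b' \near box w a, A (unbox w b').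
  by apply: (unbox_continuous hb); rewrite boxK; exact: open_nbhs_nbhs.
apply: (near_and n1 n2) => b' k1 k2; exists (unbox w b') => //.
exact: unboxK.
Qed.

End LeafBoxes.

(** * The foliation by center leaves *)

Section CenterFoliation.
Variable R : realType.
Local Notation V3 := 'rV[R]_3.
Local Notation V2 := 'rV[R]_2.
Local Notation T3 := (torus R).
Local Notation tpi := (@tpi R).
Local Notation lam := (@lam R).
Implicit Types (p q n v : V3) (s t : R) (y z : V2) (a b : R * V2) (hu hs : V3 -> R).

(** The leaves lifted to the cover: [Psi (-, y)] is the leaf on which [lev] takes the
value [y], parametrized by [cS]. *)
Record leaf_family G hu hs (Psi : R * V2 -> V3) : Prop := LeafFamily {
  lf_coords : leaf_coords G hu hs;
  lf_cont : continuous Psi;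
  lf_S : forall a, cS (Psi a) = a.1;
  lf_lev : forall a, lev hu hs (Psi a) = a.2;
  lf_eta : forall p, Psi (cS p, lev hu hs p) = p
}.

Definition position hu hs p : R * V2 := (cS p, lev hu hs p).

Lemma position_continuous G hu hs : leaf_coords G hu hs -> continuous (position hu hs).
Proof.
move=> C p; apply: pair_continuous; first exact: cS_continuous.
- exact: (lc_huc C).
- exact: (lc_hsc C).
Qed.

Lemma PsiK G hu hs Psi a : leaf_family G hu hs Psi -> position hu hs (Psi a) = a.
Proof. by move=> L; rewrite /position (lf_S L) (lf_lev L); case: a. Qed.

(** How [lev] changes under a translation by an integer vector. *)
Definition shift_lev n : V2 := vec2 (cU n) (cS n - c2 R * cT n).

Lemma levD G hu hs p n : leaf_coords G hu hs -> intv n ->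
  lev hu hs (p + n) = lev hu hs p + shift_lev n.
Proof.
move=> C hn; rewrite /lev (lc_huP C)// (lc_hsP C)//.
by apply/rowP => -[[|[|//]] hi]; rewrite !mxE.
Qed.

(** The two linear forms of [shift_lev] do not depend on the third coordinate of [n], and their
difference is a multiple of the second one. *)
Lemma small_shift n : intv n -> `|cU n| < 1 / 4 -> `|cS n - c2 R * cT n| < 1 / 4 ->
  n ord0 j0 = 0 /\ n ord0 j1 = 0.
Proof.
move=> hn h2 h3.
have l1 := @lam_lt R; have l2 := @lam_gt R.
have small (m : R) : m \is a Num.int -> `|m| < 1 -> m = 0.
  move=> /intrP[k ->]; rewrite -intr_norm -[X in _ < X]/(1%:~R) ltr_int => hk.
  by apply/eqP; rewrite intr_eq0; lia.
have e1 : (4 - 2 * lam) * n ord0 j1 = cU n - (cS n - c2 R * cT n).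
  by rewrite /cU /cS /cT; ring.
have n1 : n ord0 j1 = 0.
  apply: small; first exact: hn.
  have : `|(4 - 2 * lam) * n ord0 j1| < 1 / 2.
    by rewrite e1; apply: le_lt_trans (ler_normB _ _) _; move: h2 h3; clear; lra.
  rewrite normrM (@gtr0_norm _ (4 - 2 * lam)); last by move: l1; clear; lra.
  have : 3 * `|n ord0 j1| <= (4 - 2 * lam) * `|n ord0 j1|.
    by apply: ler_wpM2r => //; move: l1; clear; lra.
  by clear; lra.
split=> //; apply: small; first exact: hn.
by move: h2; rewrite /cU n1 mulr0 addr0; clear; lra.
Qed.

Lemma small_lattice n : intv n -> `|cS n| < 1 / 4 -> `|cU n| < 1 / 4 ->
  `|cS n - c2 R * cT n| < 1 / 4 -> n = 0.
Proof.
move=> hn h1 h2 h3; have [n0 n1] := small_shift hn h2 h3.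
have k1 := @c2_lt R; have k2 := @c2_gt R.
have n2 : n ord0 j2 = 0.
  have : `|n ord0 j2| < 1.
    move: h1; rewrite /cS n0 n1 mulr0 !add0r normrM (@gtr0_norm _ (c2 R)); last by move: k2; clear; lra.
    have : 33 / 100 * `|n ord0 j2| <= c2 R * `|n ord0 j2|.
      by apply: ler_wpM2r => //; move: k2; clear; lra.
    by clear; lra.
  have /intrP[k ->] := hn j2; rewrite -intr_norm -[X in _ < X]/(1%:~R) ltr_int => hk.
  by apply/eqP; rewrite intr_eq0; lia.
by apply: row3_inj; rewrite ?n0 ?n1 ?n2 mxE.
Qed.

Definition leaf_chart (Psi : R * V2 -> V3) w a : T3 := tpi (Psi (box w a)).

(** The boxes are so small that no two of their points differ by an integer vector. *)
Lemma leaf_chart_inj G hu hs Psi w a b : leaf_family G hu hs Psi ->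
  leaf_chart Psi w a = leaf_chart Psi w b -> a = b.
Proof.
move=> L /tpiP hn; have C := lf_coords L.
set P := Psi (box w a) in hn; set Q := Psi (box w b) in hn.
have eP : P = Q + (P - Q) by rewrite addrC subrK.
have eL := levD Q C hn; rewrite -eP !(lf_lev L) in eL.
have cmp i : (box w a).2 ord0 i = (box w b).2 ord0 i + shift_lev (P - Q) ord0 i by rewrite eL mxE.
have close i : (box w a).2 ord0 i - (box w b).2 ord0 i = squeeze (a.2 ord0 i) - squeeze (b.2 ord0 i).
  rewrite /box /=; case: i => [[|[|//]] hi].
    by rewrite (_ : Ordinal hi = ord0) ?vec2E; [ring|exact: val_inj].
  by rewrite (_ : Ordinal hi = lift ord0 ord0) ?vec2E; [ring|exact: val_inj].
have sq (u v : R) : `|squeeze u - squeeze v| < 1 / 4.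
  have h1 := squeezed_lt (squeezed_squeeze u); have h2 := squeezed_lt (squeezed_squeeze v).
  by apply: le_lt_trans (ler_normB _ _) _; move: h1 h2; clear; lra.
have n0 : P - Q = 0.
  apply: small_lattice hn _ _ _.
  - by rewrite cSB !(lf_S L) /box /= opprD addrACA subrr add0r.
  - have -> : cU (P - Q) = (box w a).2 ord0 ord0 - (box w b).2 ord0 ord0.
      by have := cmp ord0; rewrite /shift_lev vec2E => ->; rewrite [RHS]addrAC subrr add0r.
    by rewrite close.
  - have -> : cS (P - Q) - c2 R * cT (P - Q) = (box w a).2 ord0 (lift ord0 ord0) - (box w b).2 ord0 (lift ord0 ord0).
      by have := cmp (lift ord0 ord0); rewrite /shift_lev vec2E => ->; rewrite [RHS]addrAC subrr add0r.
    by rewrite close.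
have PQ : P = Q by apply/eqP; rewrite -subr_eq0 n0.
by rewrite -(boxK w a) -(boxK w b) -(PsiK (box w a) L) -(PsiK (box w b) L) -/P PQ.
Qed.

Lemma leaf_chart_foliated G hu hs Psi w : leaf_family G hu hs Psi ->
  foliated_chart (leaf_chart Psi w).
Proof.
move=> L; have C := lf_coords L; split.
- by move=> a b; exact: (leaf_chart_inj L).
- exact: (cont_comp (cont_comp (@box_continuous R w) (lf_cont L)) (@tpi_continuous R)).
move=> A oA.
have -> : leaf_chart Psi w @` A = tpi @` (position hu hs @^-1` (box w @` A)).
  apply/seteqP; split=> [_ [a Aa <-]|_ [p [a Aa ap] <-]].
    by exists (Psi (box w a)) => //; exists a => //; rewrite (PsiK _ L).
  by exists a => //; rewrite /leaf_chart ap (lf_eta L).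
apply: tpi_open; apply: open_comp; last exact: box_open.
by move=> p _; exact: (position_continuous C).
Qed.

Definition center_charts (Psi : R * V2 -> V3) : set (R * V2 -> T3) :=
  [set phi | exists w, phi = leaf_chart Psi w].

(** Two charts overlap along an integer translation, which permutes the fibres of [lev]. *)
Lemma center_foliation G hu hs Psi : leaf_family G hu hs Psi -> foliation (center_charts Psi).
Proof.
move=> L; have C := lf_coords L; split.
- by move=> _ [w ->]; exact: leaf_chart_foliated L.
- move=> x; pose w := position hu hs (repr x).
  exists (leaf_chart Psi w); first by exists w.
  exists (unbox w w) => //.
  have z (s : R) : squeezed (s - s).
    by rewrite /squeezed subrr mul0r normr0 divr_gt0// pi_gt0.
  by rewrite /leaf_chart unboxK; [rewrite /w (lf_eta L) tpi_repr|split; exact: z].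
move=> _ _ a b [w ->] [w' ->] /tpiP hn; set n := _ - _ in hn.
pose pos a' := position hu hs (Psi (box w a') - n).
have posc : continuous pos.
  have c1 : continuous (fun a' => Psi (box w a') - n).
    exact: (cont_comp (cont_comp (@box_continuous R w) (lf_cont L)) (@V3_shift_continuous R (- n))).
  exact: (cont_comp c1 (position_continuous C)).
have pos_a : pos a = box w' b.
  by rewrite /pos /n subKr (PsiK _ L).
exists (fun a' => boxed w' (pos a')).
  have := boxed_box w' b; rewrite -pos_a => h.
  exact: (posc a _ (boxed_near h)).
move=> a1 a2 h1 h2 e12; exists (unbox w' (pos a1)), (unbox w' (pos a2)).
have back a' : boxed w' (pos a') -> leaf_chart Psi w' (unbox w' (pos a')) = leaf_chart Psi w a'.
  move=> h; rewrite /leaf_chart unboxK// (lf_eta L).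
  by apply: tpiD; exact: intvN.
split; [exact: back|exact: back|].
have lev_eq a' : (pos a').2 = (box w a').2 - shift_lev n.
  apply/eqP; rewrite eq_sym subr_eq; apply/eqP.
  have := levD (Psi (box w a') - n) C hn; rewrite subrK (lf_lev L) => ->.
  by [].
have e2 : (pos a1).2 = (pos a2).2 by rewrite !lev_eq /box /= e12.
by rewrite /unbox e2.
Qed.

(** A plaque lifts to a level of [lev]; along a chain of plaques the levels of the lifts differ
by integer translations, which can be chosen trivial one after the other. *)
Lemma leaf_level G hu hs Psi q x : leaf_family G hu hs Psi ->
  leaf (center_charts Psi) (tpi q) x -> exists2 q', tpi q' = x & lev hu hs q' = lev hu hs q.
Proof.
move=> L; have C := lf_coords L.
have step (y z : T3) : same_plaque (center_charts Psi) y z -> forall q1, tpi q1 = y ->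
    exists2 q2, tpi q2 = z & lev hu hs q2 = lev hu hs q1.
  move=> [_ [v [[w ->] [s _ <-] [t _ <-]]]] q1 /tpiP hn.
  exists (Psi (box w (t, v)) + (q1 - Psi (box w (s, v)))); first by rewrite tpiD.
  rewrite (levD _ C hn) (lf_lev L).
  have -> : lev hu hs q1 = lev hu hs (Psi (box w (s, v)) + (q1 - Psi (box w (s, v)))).
    by rewrite addrC subrK.
  by rewrite (levD _ C hn) (lf_lev L).
have main (y z : T3) : clos_refl_trans T3 (same_plaque (center_charts Psi)) y z ->
    forall q1, tpi q1 = y -> exists2 q2, tpi q2 = z & lev hu hs q2 = lev hu hs q1.
  elim=> {y z} [y z h q1 e1|y q1 e1|y y' z _ h1 _ h2 q1 e1].
  - exact: step h _ e1.
  - by exists q1.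
  - by have [q2 e2 l2] := h1 q1 e1; have [q3 e3 l3] := h2 q2 e2; exists q3 => //; rewrite l3.
by move=> h; exact: (main _ _ h).
Qed.

End CenterFoliation.

(** * Center arcs that leave their leaf *)

Section ArcsOutsideLeaves.
Variable R : realType.
Local Notation V3 := 'rV[R]_3.
Local Notation V2 := 'rV[R]_2.
Local Notation T3 := (torus R).
Local Notation tpi := (@tpi R).
Local Notation om := (@om R).
Implicit Types (p q n v : V3) (s t : R) (hu hs : V3 -> R).

Lemma scale_continuous (X : topologicalType) (k : X -> R) (v : X -> V3) :
  continuous k -> continuous v -> continuous (fun x => k x *: v x).
Proof.
have gen (V : normedModType R) (k' : X -> R) (v' : X -> V) : continuous k' -> continuous v' ->
    continuous (fun x => k' x *: v' x).
  by move=> hk hv x; apply: cvgZ; [exact: hk|exact: hv].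
exact: (gen V3).
Qed.

Lemma reparametrize (c : R -> V3) (b db : R -> R) (v : V3 -> V3) :
  (forall s, derivable c s 1 /\ derive1 c s = v (c s)) ->
  (forall t, is_derive t (1 : R) b (db t)) ->
  forall t, derivable (fun t => c (b t)) t 1 /\ derive1 (fun t => c (b t)) t = db t *: v (c (b t)).
Proof.
move=> hc hb t.
have dc : differentiable c (b t) by apply/derivable1_diffP; have [] := hc (b t).
have dbt : differentiable b t by apply/derivable1_diffP; exact: ex_derive.
have dd : differentiable (c \o b) t by exact: differentiable_comp.
split; first exact/derivable1_diffP.
have [_ <-] := hc (b t); rewrite (derive1E' dc).
apply: etrans (derive1E' dd) _.
apply: etrans (congr1 (fun k : R -> V3 => k 1) (diff_comp dbt dc)) _ => /=.
have -> : 'd b t 1 = db t *: (1 : R) by rewrite -derive1E'// derive1E /GRing.scale /= mulr1; have [_] := hb t.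
by rewrite linearZ.
Qed.

Lemma curve_C1 (c : R -> V3) (k : R -> R) (v : V3 -> V3) : continuous k -> continuous v ->
  (forall t, derivable c t 1 /\ derive1 c t = k t *: v (c t)) -> C1_curve c.
Proof.
move=> kc vc hc; split=> [t|]; first by have [] := hc t.
have cc : continuous c.
  move=> t; apply: differentiable_continuous; apply/derivable1_diffP.
  by have [] := hc t.
rewrite (_ : derive1 c = fun t => k t *: v (c t)); last by apply/funext => t; have [] := hc t.
exact: (scale_continuous kc (cont_comp cc vc)).
Qed.

(** A plaque is a piece of a curve [Psi (-, y)], reparametrized by [squeeze]. *)
Lemma center_tangent_foliation g h e G H es ec eu ks kc ku hu hs Psi :
  framed_diffeo g h e G H es ec eu ks kc ku -> leaf_family G hu hs Psi ->
  tangent_foliation (line_field ec) (center_charts Psi).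
Proof.
move=> D L; have F := fd_frame D; have M := fd_near D; have C := lf_coords L.
have pec p n : intv n -> ec (p + n) = ec p by move=> hn; have [] := fr_per F p hn.
split; first exact: center_foliation L.
move=> _ y [w ->].
pose y' := (box w (0, y)).2.
pose c s := Psi (s, y').
have cE : forall s, derivable c s 1 /\ derive1 c s = ec (c s).
  apply: (center_curve M F (differentiable_expansion (fd_G D).1.1) (center_rel_fibre M C)).
  - have cc : continuous (fun s : R => (s, y') : R * V2).
      move=> s; have id_c : {for s, continuous (fun s : R => s)} by exact: cvg_id.
      have cst_c : {for s, continuous (fun s : R => y')} by exact: cvg_cst.
      exact: (@pair_continuous_at R R V2 s _ _ id_c cst_c).
    exact: (cont_comp cc (lf_cont L)).
  - by move=> s; rewrite (lf_S L).
  - by move=> s t; apply/lev_same; rewrite !(lf_lev L).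
pose b t := w.1 + squeeze t.
have hb t : is_derive t (1 : R) b ((1 + t ^+ 2)^-1 / 16).
  have dbt := is_deriveD (is_derive_cst w.1 t (1 : R)) (is_derive_squeeze t).
  by rewrite add0r in dbt; exact: dbt.
have hcb := reparametrize cE hb.
have d0 t : 0 < 1 + t ^+ 2 by rewrite ltr_wpDr// sqr_ge0.
have k0 t : (1 + t ^+ 2)^-1 / 16 != 0 by rewrite gt_eqF// divr_gt0// invr_gt0.
have ec0 p : ec p != 0.
  have [_ h1 _] := fr_S F p; apply/eqP => e0; move: h1; rewrite e0 raddf0 => /eqP.
  by rewrite eq_sym oner_eq0.
have cphi t : tpi (c (b t)) = leaf_chart Psi w (t, y) by [].
exists (fun t => c (b t)); split.
- apply: (curve_C1 _ (fr_ecc F) hcb).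
  apply: contM; last exact: cont_cst.
  apply: contV; last by move=> t; rewrite gt_eqF.
  apply: contD; first exact: cont_cst.
  have id_c : continuous (fun t : R => t) by move=> t.
  exact: (contM id_c id_c).
- move=> s t /=; rewrite !cphi => /(leaf_chart_inj L)/(congr1 fst).
  by [].
- by apply/seteqP; split=> [_ [t _ <-]|_ [t _ <-]]; exists t.
- move=> t; have [_ ->] := hcb t; split; first by rewrite scaler_eq0 negb_or k0 ec0.
  rewrite line_field_tpi//; apply/eqP; rewrite eqEsubv; apply/andP; split; apply/subvP => v /vlineP[r ->].
    by rewrite scalerA memvZ// memv_line.
  by apply/vlineP; exists (r / ((1 + t ^+ 2)^-1 / 16)); rewrite scalerA divfK.
Qed.

(** The map contracts the distance to [T = 0] by 1/5 up to an error [e], and the backward orbit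
is bounded, so only the error remains. *)
Lemma torus_thin e G H p : near_model e G H -> torus_set H p -> `|cT p| <= 5 / 4 * e.
Proof.
move=> M tp; rewrite -subr_le0.
apply: (@le0_geometric R _ (1 / 20) (1 / 5)); rewrite ?divr_ge0//; first by clear; lra.
move=> k; elim: k p tp => [|k IHk] p tp.
  have /andP[/ltW e0 _] := nm_e M; have := tp 0%N; rewrite expr0 /=; move: e0; clear; lra.
have tq := torus_setH tp; have := IHk _ tq; have := nm_T0 M (H p); rewrite (nm_HG M).
have := @psi_trap R (cT (H p)) 0 (tq 0%N); rewrite psi0 !subr0 normr0 => /(_ (divr_ge0 _ _)).
move=> ht h1 h2; rewrite exprS.
have : `|cT p| <= `|cT p - psi (cT (H p))| + `|psi (cT (H p))|.
  by have := ler_normD (cT p - psi (cT (H p))) (psi (cT (H p))); rewrite subrK.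
have {}ht : `|psi (cT (H p))| <= 1 / 5 * `|cT (H p)| by apply: ht.
by move: ht h1 h2; move: ((1 / 5) ^+ k) => x; clear; lra.
Qed.

(** On the trapped set [T], and with it [al T], is almost constant. *)
Lemma torus_hs e G H hu hs p q : near_model e G H -> leaf_coords G hu hs ->
  torus_set H p -> torus_set H q -> `|(hs q - hs p) - (cS q - cS p)| <= 10 * om.
Proof.
move=> M C tp tq.
have /andP[e0 _] := nm_e M.
have al0 r : torus_set H r -> `|al (cT r) - al 0| <= 2 * om.
  move=> tr; have h := torus_thin M tr.
  have h1 : `|al (cT r) - al (cT r / 2)| <= om.
    apply: (nm_al M); have -> : cT r - cT r / 2 = cT r / 2 by field.
    by rewrite normrM (@gtr0_norm _ 2^-1)//; move: h e0; clear; lra.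
  have h2 : `|al (cT r / 2) - al 0| <= om.
    apply: (nm_al M); rewrite subr0 normrM (@gtr0_norm _ 2^-1)//.
    by move: h e0; clear; lra.
  have -> : al (cT r) - al 0 = (al (cT r) - al (cT r / 2)) + (al (cT r / 2) - al 0) by ring.
  by apply: le_trans (ler_normD _ _) _; move: h1 h2; clear; lra.
have := lc_hs C p; have := lc_hs C q; have := al0 _ tp; have := al0 _ tq.
by rewrite !ler_norml; move: om (al 0) (al (cT p)) (al (cT q)) => o a0 a1 a2; clear; lra.
Qed.

(** The intersection of the torus with the level 0 of [hu]. *)
Lemma trapped_curve e G H hu hs : near_model e G H -> leaf_coords G hu hs ->
  exists c : R -> V3, [/\ forall s, cS (c s) = s, forall s, hu (c s) = 0,
    forall s, torus_set H (c s) & forall s t, N (c t - c s) <= `|t - s|].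
Proof.
move=> M C.
have /choice[c hc] s : exists p, [/\ cS p = s, hu p = 0 & torus_set H p] := torus_set_meets s 0 M C.
exists c; split=> [s|s|s|s t]; try by have [] := hc s.
have [s1 s2 s3] := hc s; have [t1 t2 t3] := hc t.
have hST : cS (c t - c s) = t - s by rewrite cSB s1 t1.
have hT := torus_cone M C s3 t3 (etrans s2 (esym t2)).
have hU := hu_flat M C (etrans s2 (esym t2)).
rewrite hST in hT; have n0 := normr_ge0 (t - s).
apply: N_le; first by rewrite hST.
  by move: hT n0; clear; lra.
apply: le_trans hU _; have Ml := Mx_le_add (c t - c s); rewrite hST in Ml.
have c4 : (1 / 10) ^+ 4 <= 1 / 10 :> R by clear; lra.
apply: le_trans (_ : 1 / 10 * Mx (c t - c s) <= _); first by apply: ler_wpM2r => //; exact: Mx_ge0.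
by move: Ml hT n0; clear; lra.
Qed.

(** Both the leaves and the curves in the trapped set are tangent to the center; the latter
cross the former since [hs] is constant on the leaves. *)
Lemma arc_outside_leaf g h e G H es ec eu ks kc ku hu hs Psi :
  framed_diffeo g h e G H es ec eu ks kc ku -> leaf_family G hu hs Psi ->
  exists x c, [/\ embedded_arc c, tangent_arc (line_field ec) c, arc_image c x
    & ~ (arc_image c `<=` leaf (center_charts Psi) x)].
Proof.
move=> D L; have F := fd_frame D; have M := fd_near D; have C := lf_coords L.
have pec p n : intv n -> ec (p + n) = ec p by move=> hn; have [] := fr_per F p hn.
have [c [cS_c hu_c tor_c lip]] := trapped_curve M C.
have cc : continuous c.
  apply: V3_continuous => s eps eps0.
  have : \forall t \near s, `|s - t| < eps := near_norm_lt s eps0.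
  by apply: filterS => t ht; apply: le_lt_trans (lip s t) _; rewrite distrC.
have cE : forall s, derivable c s 1 /\ derive1 c s = ec (c s).
  apply: (center_curve M F (differentiable_expansion (fd_G D).1.1) (center_rel_torus M C)) => //.
  by move=> s t; split; rewrite ?hu_c.
have hb t : is_derive t (1 : R) (fun t : R => t / 100) (1 / 100).
  by apply: is_derive_eq; rewrite /GRing.scale /=; ring.
have hcb := reparametrize cE hb.
have h100 : 1 / 100 != 0 :> R by rewrite gt_eqF// divr_gt0.
have ec0 p : ec p != 0.
  have [_ h1 _] := fr_S F p; apply/eqP => e0; move: h1; rewrite e0 raddf0 => /eqP.
  by rewrite eq_sym oner_eq0.
have k1 := @c2_lt R; have k2 := @c2_gt R.
(* So short a piece of the curve contains no two points that differ by an integer vector. *)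
pose a t := c (t / 100).
have o10 : 10 * om < 1 / 200.
  have omR := om_le R; have h2 : (1 / 10) ^+ 6 <= 1 / 100 / 100 :> R by clear; lra.
  by move: omR h2; clear; lra.
exists (tpi (a 0)), a; split.
- split.
  + by apply: (curve_C1 _ (fr_ecc F) hcb); exact: cont_cst.
  + move=> s t; rewrite !in_itv /= => /andP[s0 s1] /andP[t0 t1] /tpiP hn.
    have nN : N (a s - a t) <= 1 / 100.
      apply: le_trans (lip _ _) _; rewrite -mulrBl normrM (@gtr0_norm _ 100^-1)//.
      have : `|s - t| <= 1 by rewrite ler_norml; move: s0 s1 t0 t1; clear; lra.
      by clear; lra.
    have nS := le_trans (cS_le_N _) nN; have nT := le_trans (cT_le_N _) nN.
    have nU := le_trans (cU_le_N _) nN.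
    have cT1 : `|c2 R * cT (a s - a t)| <= 1 * (1 / 100).
      by rewrite normrM; apply: ler_pM => //; rewrite ler_norml; move: k1 k2; clear; lra.
    have n0 : a s - a t = 0.
      apply: small_lattice hn _ _ _; [by move: nS; clear; lra|by move: nU; clear; lra|].
      by apply: le_lt_trans (ler_normB _ _) _; move: nS cT1; clear; lra.
    have : cS (a s - a t) = 0 by rewrite n0 raddf0.
    by rewrite cSB !cS_c; clear; lra.
  + by move=> t _; have [_ ->] := hcb t; rewrite scaler_eq0 negb_or h100 ec0.
- move=> t _; have [_ ->] := hcb t.
  by rewrite line_field_tpi// memvZ// memv_line.
- by exists 0 => //=; rewrite in_itv /= lexx ler01.
move=> /(_ (tpi (a 1))) in_leaf.
have {}in_leaf : leaf (center_charts Psi) (tpi (a 0)) (tpi (a 1)).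
  by apply: in_leaf; exists 1 => //=; rewrite in_itv /= lexx ler01.
have [q /tpiP hn lq] := leaf_level L in_leaf.
have := levD (a 1) C hn; rewrite addrC subrK lq => e2.
have eU := congr1 (fun y : V2 => y ord0 ord0) e2.
have eS := congr1 (fun y : V2 => y ord0 (lift ord0 ord0)) e2.
rewrite /= !mxE /= !hu_c add0r in eU.
rewrite /= !mxE /= in eS.
have th := torus_hs M C (tor_c (0 / 100)) (tor_c (1 / 100)).
rewrite !cS_c -/(a 0) -/(a 1) in th.
have eS' : cS (q - a 1) - c2 R * cT (q - a 1) = hs (a 0) - hs (a 1).
  by move: eS; clear; lra.
have [n0 n1] : (q - a 1) ord0 j0 = 0 /\ (q - a 1) ord0 j1 = 0.
  apply: (small_shift hn); first by rewrite -eU normr0.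
  by rewrite eS'; move: th o10; rewrite mul0r subr0 !ltr_norml !ler_norml; clear; lra.
have : cS (q - a 1) - c2 R * cT (q - a 1) = 0 by rewrite /cS /cT n0 n1; ring.
by rewrite eS'; move: th o10; rewrite mul0r subr0 !ler_norml; clear; lra.
Qed.

End ArcsOutsideLeaves.

Theorem theorem1p4 (R : realType) :
  exists U : set (torus R -> torus R),
    [/\ U !=set0, C1_open U
      & forall f, U f -> partially_hyperbolic f /\
          forall Ec, center_bundle f Ec -> not_locally_uniquely_integrable Ec].
Proof.
have [e0 e00 close] := close_to_model R.
exists [set g | Diff1 g /\ exists2 e, e < e0 & C1_close e (@torus_model R) g].
split=> [||g [gD [e ee0 /(C1_close_le (ltW ee0)) ge]]].
- exists (@torus_model R); split; first exact: torus_model_Diff1.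
  exists (e0 / 2); first by rewrite ltr_pdivrMr// mulr_natr mulr2n ltrDl.
  by apply: C1_close_refl; rewrite divr_gt0.
- exact: C1_ball_open.
have [e' [G [H [h [lG lH gh M J]]]]] := close g gD ge.
have [es [ec [eu [ks [kc [ku F]]]]]] := frame_exists M J.
have D : framed_diffeo g h e' G H es ec eu ks kc ku by split.
split=> [|Ec /(center_unique D) ->].
  by split => //; exists (line_field es), (line_field ec), (line_field eu); exact: fd_splitting D.
have [hu [hs C]] := leaf_coords_exist M.
have [Psi [Pc PS Pl Pe]] := leaf_chart_exists M C.
have L : leaf_family G hu hs Psi.
  by split=> // -[s y]; [exact: PS|exact: Pl].
exists (center_charts Psi); first exact: center_tangent_foliation D L.
exact: arc_outside_leaf D L.
Qed.
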